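(* Let $d=2$. Assume $W=\frac12w^2$ where $w\in\mathcal{C}^2(\mathbb{R}^2,\mathbb{R})$ solves either $\Delta w=\partial_{11}w+\partial_{22}w=0$ in $\mathbb{R}^2$, or $\partial_{11}w-\partial_{22}w=0$ in $\mathbb{R}^2$. Let $u^\pm=(a,u_2^\pm)\in\mathbb{R}^2$ satisfy $W(u^\pm)=0$ and suppose $w>0$ on the open segment $(u^-,u^+)$. Let $u$ be a global minimizer of problem $(\mathcal P)$ and assume that either $u\in L^\infty$ or there exist $C,\beta>0$ with $W(z)\le Ce^{\beta|z|^2}$ for all $z\in\mathbb{R}^2$. Then $u$ is one-dimensional: $u(x)=g(x_1)$, where $g$ is the minimizer (unique up to translation) of $$\inf\Big\{\int_\mathbb{R}\tfrac12|\dot\gamma|^2+W(\gamma)\,dt:\ \gamma\in\dot H^1(\mathbb{R},\mathbb{R}^2_a),\ \gamma(\pm\infty)=u^\pm\Big\}.$$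
   Context: $\mathbb{T}=\mathbb{R}/\mathbb{Z}$, $\Omega=\mathbb{R}\times\mathbb{T}$, $x=(x_1,x_2)$. $\dot H^1_{div}(\Omega,\mathbb{R}^2)=\{u\in H^1_{loc}(\Omega,\mathbb{R}^2):\nabla u\in L^2,\ \nabla\cdot u=0\}$, $E(u)=\int_\Omega\frac12|\nabla u|^2+W(u)\,dx$, $\overline{u}(x_1)=\int_{\mathbb{T}}u(x_1,x_2)dx_2$. Problem $(\mathcal P)$: minimize $E(u)$ over $u\in\dot H^1_{div}(\Omega,\mathbb{R}^2)$ with $\lim_{x_1\to\pm\infty}\overline{u}(x_1)=u^\pm$; a global minimizer is an admissible $u$ attaining this infimum. $\mathbb{R}^2_a=\{z\in\mathbb{R}^2:z_1=a\}$, and $\dot H^1(\mathbb{R},\mathbb{R}^2_a)$ denotes locally $H^1$ curves with values in $\mathbb{R}^2_a$ and square-integrable derivative. *)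

(* Defs.v *)
From HB Require Import structures.
From mathcomp Require Import all_boot all_order all_algebra.
From mathcomp Require Import all_classical all_reals all_analysis.
Set Implicit Arguments. Unset Strict Implicit. Unset Printing Implicit Defensive.
Import Order.TTheory GRing.Theory Num.Def Num.Theory.
Import numFieldNormedType.Exports.
Local Open Scope classical_set_scope.
Local Open Scope ring_scope.

Definition leb1 (R : realType) := (@lebesgue_measure R).
Definition leb2 (R : realType) := ((@lebesgue_measure R) \x (@lebesgue_measure R))%E.

Arguments leb1 R : clear implicits.
Arguments leb2 R : clear implicits.

Definition pd1 (R : realType) (f : R * R -> R) (x : R * R) : R :=
  derive1 (fun t => f (t, x.2)) x.1.
Definition pd2 (R : realType) (f : R * R -> R) (x : R * R) : R :=
  derive1 (fun t => f (x.1, t)) x.2.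
Definition has_pd (R : realType) (f : R * R -> R) : Prop :=
  (forall x : R * R, derivable (fun t => f (t, x.2)) x.1 1) /\
  (forall x : R * R, derivable (fun t => f (x.1, t)) x.2 1).

Definition C2 (R : realType) (w : R * R -> R) : Prop :=
  [/\ has_pd w, has_pd (pd1 w), has_pd (pd2 w),
      [/\ continuous w, continuous (pd1 w) & continuous (pd2 w)] &
      [/\ continuous (pd1 (pd1 w)), continuous (pd2 (pd1 w)),
          continuous (pd1 (pd2 w)) & continuous (pd2 (pd2 w))]].

(** Test functions: C^1 with compact support (sufficient for weak derivatives). *)
Definition test2 (R : realType) (phi : R * R -> R) : Prop :=
  [/\ has_pd phi, continuous phi, continuous (pd1 phi), continuous (pd2 phi) &
      exists M : R, forall x : R * R, M < `|x.1| \/ M < `|x.2| -> phi x = 0].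
Definition test1 (R : realType) (phi : R -> R) : Prop :=
  [/\ (forall t : R, derivable phi t 1), continuous phi, continuous (derive1 phi) &
      exists M : R, forall t : R, M < `|t| -> phi t = 0].

Definition box (R : realType) (M : R) : set (R * R) :=
  [set x | `|x.1| <= M /\ `|x.2| <= M].

Definition locL2_2 (R : realType) (f : R * R -> R) : Prop :=
  measurable_fun setT f /\
  forall M : R, (leb2 R).-integrable (box M) (fun x => (f x ^+ 2)%:E).
Definition locL2_1 (R : realType) (f : R -> R) : Prop :=
  measurable_fun setT f /\
  forall M : R, (leb1 R).-integrable [set t | `|t| <= M] (fun t => (f t ^+ 2)%:E).

Definition is_wpd1 (R : realType) (f g : R * R -> R) : Prop :=
  forall phi, test2 phi ->
  (\int[leb2 R]_x (f x * pd1 phi x)%:E = - \int[leb2 R]_x (g x * phi x)%:E)%E.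
Definition is_wpd2 (R : realType) (f g : R * R -> R) : Prop :=
  forall phi, test2 phi ->
  (\int[leb2 R]_x (f x * pd2 phi x)%:E = - \int[leb2 R]_x (g x * phi x)%:E)%E.
Definition is_wd (R : realType) (f g : R -> R) : Prop :=
  forall phi, test1 phi ->
  (\int[leb1 R]_t (f t * derive1 phi t)%:E = - \int[leb1 R]_t (g t * phi t)%:E)%E.

Definition H1loc (R : realType) (f g1 g2 : R * R -> R) : Prop :=
  [/\ locL2_2 f, locL2_2 g1, locL2_2 g2, is_wpd1 f g1 & is_wpd2 f g2].

Definition sqn (R : realType) (z : R * R) : R := z.1 ^+ 2 + z.2 ^+ 2.

(** the fundamental domain of Omega = R x T, T = R/Z *)
Definition Omega (R : realType) : set (R * R) := [set x | 0 <= x.2 /\ x.2 < 1].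

Arguments Omega R : clear implicits.

Definition periodic2 (R : realType) (u : R * R -> R * R) : Prop :=
  forall x : R * R, u (x.1, x.2 + 1) = u x.

Definition avg (R : realType) (f : R * R -> R) (t : R) : R :=
  fine (\int[leb1 R]_(s in [set s : R | 0 <= s /\ s < 1]) (f (t, s))%:E).

Definition elim_pinfty (R : realType) (f : R -> R) (l : R) : Prop :=
  forall e : R, 0 < e -> exists M : R, {ae leb1 R, forall t, M < t -> `|f t - l| < e}.
Definition elim_minfty (R : realType) (f : R -> R) (l : R) : Prop :=
  forall e : R, 0 < e -> exists M : R, {ae leb1 R, forall t, t < M -> `|f t - l| < e}.

(** admissible pairs for (P): u with weak Jacobian D, where
    D x = ((d1 u1, d2 u1), (d1 u2, d2 u2)); u^- = (a, m), u^+ = (a, p). *)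
Definition gradsq (R : realType) (D : R * R -> (R * R) * (R * R)) (x : R * R) : R :=
  sqn (D x).1 + sqn (D x).2.

Definition admissible2 (R : realType) (a m p : R)
    (u : R * R -> R * R) (D : R * R -> (R * R) * (R * R)) : Prop :=
  [/\ periodic2 u,
      H1loc (fun x => (u x).1) (fun x => (D x).1.1) (fun x => (D x).1.2) /\
      H1loc (fun x => (u x).2) (fun x => (D x).2.1) (fun x => (D x).2.2),
      (\int[leb2 R]_(x in Omega R) (gradsq D x)%:E < +oo)%E,
      {ae leb2 R, forall x, (D x).1.1 + (D x).2.2 = 0} &
      [/\ elim_minfty (avg (fun x => (u x).1)) a,
          elim_minfty (avg (fun x => (u x).2)) m,
          elim_pinfty (avg (fun x => (u x).1)) a &
          elim_pinfty (avg (fun x => (u x).2)) p]].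

Definition energy2 (R : realType) (W : R * R -> R)
    (u : R * R -> R * R) (D : R * R -> (R * R) * (R * R)) : \bar R :=
  \int[leb2 R]_(x in Omega R) (gradsq D x / 2 + W (u x))%:E.

Definition global_minimizer (R : realType) (W : R * R -> R) (a m p : R)
    (u : R * R -> R * R) : Prop :=
  exists D, admissible2 a m p u D /\
    forall v Dv, admissible2 a m p v Dv -> (energy2 W u D <= energy2 W v Dv)%E.

Definition admissible1 (R : realType) (a m p : R) (gam : R -> R * R) (h : R -> R) : Prop :=
  [/\ forall t, (gam t).1 = a,
      locL2_1 (fun t => (gam t).2) /\ locL2_1 h, is_wd (fun t => (gam t).2) h,
      (\int[leb1 R]_t (h t ^+ 2)%:E < +oo)%E &
      elim_minfty (fun t => (gam t).2) m /\ elim_pinfty (fun t => (gam t).2) p].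

Definition energy1 (R : realType) (W : R * R -> R) (gam : R -> R * R) (h : R -> R) : \bar R :=
  \int[leb1 R]_t (h t ^+ 2 / 2 + W (gam t))%:E.

Definition minimizer1 (R : realType) (W : R * R -> R) (a m p : R) (gam : R -> R * R) : Prop :=
  exists h, admissible1 a m p gam h /\
    forall gam' h', admissible1 a m p gam' h' -> (energy1 W gam h <= energy1 W gam' h')%E.

Definition Wof (R : realType) (w : R * R -> R) (z : R * R) : R := w z ^+ 2 / 2.

(* Main.v *)
(** Put [sg = 1] in the harmonic case and [sg = -1] in the wave case.  The
    equation for [w] provides [psi] with [grad psi = (- sg w_2, w_1)], then [Phi1]
    with [grad Phi1 = (psi, w)] and [Phi2] with [grad Phi2 = (- sg w, psi)].  For
    divergence-free [u] with Jacobian [D],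
      [d_1 Phi1(u) + d_2 Phi2(u) = w(u) (D21 - sg D12)],
    so the integral of the right-hand side over the cylinder is the constant
    [c = Phi1(u^+) - Phi1(u^-)], while [det D] integrates to 0.  Completing squares
    gives [E(u) >= c], with equality only if [D21 - sg D12 = w(u)] and
    [(1 - sg) D11 = 0].  The heteroclinic orbit [y' = w(a, y)], seen as a function
    of [x_1] alone, has energy [c], so every minimizer is in the equality case.

    If [sg = -1] then [u_1] does not depend on [x_1] and hence equals [a].  If
    [sg = 1], testing [det D] against a truncation of [u_1] above a level [k > a]
    that [u_1] exceeds bounds the integral of [|grad w|^4(u)] over the set where
    [u_1 > k] and [grad u_1 <> 0] below by a constant (Gagliardo-Nirenberg), while
    this integral tends to 0 as [k] approaches the essential supremum of [u_1];
    so [u_1 <= a], and [u_1 = a] since [u_1] has mean [a] on every slice.  These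
    integrals are finite because [u] is bounded, or because the level sets of [u]
    decay faster than any Gaussian and the exponential growth of [w] is inherited
    by its gradient and its conjugate.  Then [D12 = D22 = 0], and [u_2] is a
    function of [x_1] solving [y' = w(a, y)]. *)
Require Import Defs.
From HB Require Import structures.
From mathcomp Require Import all_boot all_order all_algebra.
From mathcomp Require Import all_classical all_reals all_analysis.
From mathcomp Require Import measurable_realfun ring lra.
Import Order.TTheory GRing.Theory Num.Def Num.Theory.
Import numFieldNormedType.Exports.
Local Open Scope classical_set_scope.
Local Open Scope ring_scope.
Set Implicit Arguments.
Unset Strict Implicit.
Unset Printing Implicit Defensive.

(** * Square-integrable functions *)

(** A minimizer is known only weakly, so nothing is differentiated on the plane. Each component has
    two representatives, absolutely continuous on almost every horizontal, respectively vertical,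
    line; integral identities are the fundamental theorem of calculus on lines combined with Fubini.
    This suffices for [d_1 Phi1(u) + d_2 Phi2(u)], whose terms contain first derivatives only. It
    does not suffice for [det D], whose divergence form contains second derivatives: there one
    derivative is replaced by a difference quotient in [x_2], which periodicity moves from one
    factor to the other. The ends of the cylinder are reached through slices where the means are
    near their limits and the energy is small; they exist in every half-line, because its measure is
    infinite. In the harmonic case the essential supremum of [u_1] may be attained on a set of
    positive measure, so that integrals over [u_1 > k] alone need not tend to 0. The condition
    [grad u_1 <> 0] removes that set, since the gradient vanishes almost everywhere on a level set.
    The two end points come in either order; the sign condition is carried as [0 < (p - m) * w], and
    [W] is even in [w]. *)

Section general_measure.
Context d (T : measurableType d) (R : realType).
Variable mu : {measure set T -> \bar R}.
Implicit Types (A : set T) (f g : T -> R).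

Definition sqint A f :=
  measurable_fun A f /\ mu.-integrable A (fun x => (f x ^+ 2)%:E).

Lemma sqint_lty A f : measurable A -> measurable_fun A f ->
  (\int[mu]_(x in A) (f x ^+ 2)%:E < +oo)%E -> sqint A f.
Proof.
move=> mA mf h; split => //; apply/integrableP; split.
  by apply/measurable_EFinP; apply: measurable_funX.
apply: le_lt_trans h; rewrite le_eqVlt; apply/orP; left; apply/eqP.
by apply: eq_integral => x _; rewrite /= ger0_norm// sqr_ge0.
Qed.

Lemma integrable_le A f g : measurable A -> measurable_fun A f ->
  (forall x, A x -> `|f x| <= g x) -> mu.-integrable A (EFin \o g) ->
  mu.-integrable A (EFin \o f).
Proof.
move=> mA mf fg; apply: le_integrable => //; first exact/measurable_EFinP.
move=> x Ax /=; rewrite lee_fin (le_trans (fg _ Ax))//; exact: ler_norm.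
Qed.

Lemma integrable_lty_ge0 A f : measurable A -> measurable_fun A f ->
  (forall x, A x -> 0 <= f x) ->
  (\int[mu]_(x in A) (f x)%:E < +oo)%E -> mu.-integrable A (EFin \o f).
Proof.
move=> mA mf f0 h; apply/integrableP; split; first exact/measurable_EFinP.
apply: le_lt_trans h; rewrite le_eqVlt; apply/orP; left; apply/eqP.
by apply: eq_integral => x xA; rewrite /= ger0_norm// f0//; exact: set_mem.
Qed.

Lemma integral_EFin_Rintegral A f : measurable A -> mu.-integrable A (EFin \o f) ->
  (\int[mu]_(x in A) (f x)%:E = (\int[mu]_(x in A) f x)%:E)%E.
Proof.
by move=> mA intf; rewrite fineK//; exact: (integrable_fin_num mA).
Qed.

Lemma sqintM A f g : measurable A -> sqint A f -> sqint A g ->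
  mu.-integrable A (EFin \o (fun x => f x * g x)).
Proof.
move=> mA [mf f2] [mg g2].
apply: (@integrable_le _ _ (fun x => f x ^+ 2 + g x ^+ 2)) => //.
- exact: measurable_funM.
- move=> x _; rewrite ler_norml; apply/andP; split.
    by have := sqr_ge0 (f x + g x); have := sqr_ge0 (f x); have := sqr_ge0 (g x); nra.
  by have := sqr_ge0 (f x - g x); have := sqr_ge0 (f x); have := sqr_ge0 (g x); nra.
- by rewrite [X in mu.-integrable _ X](_ : _ = (fun x => (f x ^+ 2)%:E) \+ (fun x => (g x ^+ 2)%:E))%E;
    [exact: integrableD|apply/funext => x /=; rewrite EFinD].
Qed.

(** The integral of [(f + t g)^2] is a nonnegative quadratic polynomial in [t], and its discriminant
    gives the bound. *)
Lemma cauchy_schwarz_Rintegral A f g : measurable A -> sqint A f -> sqint A g ->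
  (\int[mu]_(x in A) (f x * g x)) ^+ 2 <=
  (\int[mu]_(x in A) (f x ^+ 2)) * (\int[mu]_(x in A) (g x ^+ 2)).
Proof.
move=> mA sf sg; have [mf f2] := sf; have [mg g2] := sg.
have fg := sqintM mA sf sg.
set a := \int[mu]_(x in A) (f x ^+ 2); set b := \int[mu]_(x in A) (g x ^+ 2).
set c := \int[mu]_(x in A) (f x * g x).
have key t : 0 <= a + 2 * t * c + t ^+ 2 * b.
  have -> : a + 2 * t * c + t ^+ 2 * b = \int[mu]_(x in A) ((f x + t * g x) ^+ 2).
    rewrite /a /c /b -[_ * \int[mu]_(x in A) (f x * g x)]RintegralZl//.
    rewrite -[_ * \int[mu]_(x in A) (g x ^+ 2)]RintegralZl//.
    rewrite -RintegralD//; last first.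
      have := integrableZl mA (2 * t) fg.
      by apply: eq_integrable => // x _ /=; rewrite -EFinM.
    rewrite -RintegralD//.
    - by apply: eq_Rintegral => x _ /=; ring.
    - have := integrableD mA f2 (integrableZl mA (2 * t) fg).
      by apply: eq_integrable => // x _ /=; rewrite EFinD EFinM.
    - have := integrableZl mA (t ^+ 2) g2.
      by apply: eq_integrable => // x _ /=; rewrite EFinM.
  by apply: Rintegral_ge0 => x _; exact: sqr_ge0.
have b0 : 0 <= b by apply: Rintegral_ge0 => x _; exact: sqr_ge0.
have a0 : 0 <= a by apply: Rintegral_ge0 => x _; exact: sqr_ge0.
have [bz|bn0] := eqVneq b 0; last first.
  have bp : 0 < b by rewrite lt_neqAle eq_sym bn0.
  have := key (- c / b).
  rewrite -(pmulr_lge0 _ bp).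
  have -> : (a + 2 * (- c / b) * c + (- c / b) ^+ 2 * b) * b = a * b - c ^+ 2 by field.
  by rewrite subr_ge0.
rewrite bz mulr0.
have [->|cn0] := eqVneq c 0; first by rewrite expr0n.
(* When [b = 0] the polynomial is affine in [t], and this [t] would give it the value [-1]. *)
have := key (- (a + 1) / (2 * c)).
rewrite bz mulr0 addr0.
have -> : a + 2 * (- (a + 1) / (2 * c)) * c = -1 by field.
by rewrite ler0N1.
Qed.

End general_measure.

(** * Weak limits and Fubini on rectangles *)

Section limits_of_integrals.
Context d (T : measurableType d) (R : realType).
Variable mu : {measure set T -> \bar R}.
Implicit Types (A : set T) (f g : T -> R).

Lemma Rintegral_dominated A (f_ : nat -> T -> R) f g : measurable A ->
  (forall n, measurable_fun A (f_ n)) -> measurable_fun A f ->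
  {ae mu, forall x, A x -> f_ n x @[n --> \oo] --> f x} ->
  mu.-integrable A (EFin \o g) ->
  {ae mu, forall x n, A x -> `|f_ n x| <= g x} ->
  \int[mu]_(x in A) f_ n x @[n --> \oo] --> \int[mu]_(x in A) f x.
Proof.
move=> mA mf_ mf ff ig fg.
have fE : {ae mu, forall x, A x -> (f_ n x)%:E @[n --> \oo] --> (f x)%:E}.
  by apply: filterS ff => x /= + Ax => /(_ Ax) h; apply: cvg_EFin => //; exact: nearW.
have gE : {ae mu, forall x n, A x -> (`|(f_ n x)%:E| <= (g x)%:E)%E}.
  by apply: filterS fg => x /= + n Ax => /(_ n Ax); rewrite lee_fin.
have [i1 _ h] := @dominated_convergence _ _ _ mu A mA (fun n x => (f_ n x)%:E)
  (EFin \o f) (EFin \o g) (fun n => (measurable_EFinP _ _).2 (mf_ n))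
  ((measurable_EFinP _ _).2 mf) fE ig gE.
apply: fine_cvg; move: h.
by rewrite [X in _ -> _ --> X]fineK//; exact: integrable_fin_num.
Qed.

(** A sequence bounded in L2 that tends to 0 almost everywhere tends to 0 weakly. The products
    [k * q n] have no common bound, hence the truncation [h l n], the minimum of [|k| |q n|] and
    [l k^2]: it is dominated by [l k^2], and the part cut off is at most [q n ^ 2 / l], small
    uniformly in [n] for large [l]. *)
Lemma weak_cvg0 A (k : T -> R) (q : nat -> T -> R) (C : R) : measurable A ->
  sqint mu A k -> (forall n, sqint mu A (q n)) ->
  (forall n, \int[mu]_(x in A) (q n x ^+ 2) <= C) ->
  {ae mu, forall x, A x -> q n x @[n --> \oo] --> 0} ->
  \int[mu]_(x in A) (k x * q n x) @[n --> \oo] --> 0.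
Proof.
move=> mA sk sq qC q0.
have [mk ik] := sk.
have mq n : measurable_fun A (q n) by have [] := sq n.
have C0 : 0 <= C.
  by apply: le_trans (qC 0%N); apply: Rintegral_ge0 => x _; exact: sqr_ge0.
pose h l n x := Num.min (`|k x| * `|q n x|) (l * k x ^+ 2).
have mh l n : measurable_fun A (h l n).
  apply: measurable_minr.
    by apply: measurable_funM; apply: measurableT_comp.
  by apply: measurable_funM => //; exact: measurable_funX.
have ilk l : mu.-integrable A (EFin \o (fun x => l * k x ^+ 2)).
  have := integrableZl mA l ik.
  by apply: eq_integrable => // x _ /=; rewrite -EFinM.
have h0 l n x : 0 <= l -> 0 <= h l n x.
  by move=> l0; rewrite /h le_min; apply/andP; split; apply: mulr_ge0 => //; exact: sqr_ge0.
have hl l n x : 0 <= l -> `|h l n x| <= l * k x ^+ 2.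
  by move=> l0; rewrite ger0_norm ?h0// /h ge_min lexx orbT.
have ih l n : 0 <= l -> mu.-integrable A (EFin \o h l n).
  by move=> l0; apply: integrable_le (ilk l) => // x _; exact: hl.
have hcv l : 0 <= l -> \int[mu]_(x in A) h l n x @[n --> \oo] --> 0.
  move=> l0.
  have -> : (0 : R) = \int[mu]_(x in A) (cst 0 x) by rewrite Rintegral_cst// mul0r.
  apply: (@Rintegral_dominated A (h l) (cst 0) (fun x => l * k x ^+ 2)) => //.
  - apply: filterS q0 => x + Ax => /(_ Ax) qx.
    apply: (@squeeze_cvgr _ _ _ _ (cst 0) (fun n => `|k x| * `|q n x|)).
    + by apply: nearW => n; rewrite h0//= /h ge_min lexx.
    + exact: cvg_cst.
    + rewrite -[X in _ --> X](mulr0 `|k x|); apply: cvgM; first exact: cvg_cst.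
      by rewrite -(normr0 R); exact: cvg_norm.
  - by apply: aeW => x n _; exact: hl.
apply/cvgrPdist_lt => e e0.
(* With this [l] the part cut off, at most [C / l], stays below [e / 2]. *)
pose l := (2 * (C + 1)) / e.
have l0 : 0 < l by rewrite divr_gt0// mulr_gt0// ltr_wpDl.
have /cvgrPdist_lt/(_ (e / 2)) := hcv l (ltW l0).
rewrite divr_gt0// => /(_ isT).
apply: filterS => n; rewrite sub0r normrN => hn.
rewrite sub0r normrN.
have ikq := sqintM mA sk (sq n).
apply: (le_lt_trans (le_normr_Rintegral _ _)) => //.
have iq2 : mu.-integrable A (EFin \o (fun x => l^-1 * q n x ^+ 2)).
  have [_ iq] := sq n; have := integrableZl mA l^-1 iq.
  by apply: eq_integrable => // x _ /=; rewrite -EFinM.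
have ihl := ih l n (ltW l0).
apply: (@le_lt_trans _ _ (\int[mu]_(x in A) (h l n x + l^-1 * q n x ^+ 2))).
  apply: le_Rintegral => //.
  - exact: (integrable_norm ikq).
  - have := integrableD mA ihl iq2.
    by apply: eq_integrable => // x _ /=; rewrite -EFinD.
  - move=> x _; rewrite normrM /h /Num.min; case: ifPn => _.
      by rewrite lerDl mulr_ge0 ?invr_ge0 ?(ltW l0)// sqr_ge0.
    rewrite -(real_normK (num_real (k x))) -(real_normK (num_real (q n x))).
    have := sqr_ge0 (l * `|k x| - `|q n x|).
    have : 0 <= `|k x| * `|q n x| by rewrite mulr_ge0.
    move: (`|k x|) (`|q n x|) => y z yz sq0.
    rewrite -(ler_pM2l l0) mulrDr [l * (l^-1 * _)]mulrA divff ?gt_eqF// mul1r.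
    have -> : l * (l * y ^+ 2) + z ^+ 2 = (l * y - z) ^+ 2 + 2 * (l * (y * z)) by ring.
    have : 0 <= l * (y * z) by rewrite mulr_ge0// ltW.
    lra.
rewrite RintegralD// RintegralZl//; last by have [] := sq n.
have q2 : l^-1 * \int[mu]_(x in A) (q n x ^+ 2) <= e / 2.
  apply: (@le_trans _ _ (l^-1 * C)); first by rewrite ler_pM2l ?invr_gt0.
  rewrite /l invf_div -mulrA ler_pM2l// invfM -mulrA.
  rewrite -[leRHS]mulr1 ler_pM2l ?invr_gt0// ler_pdivrMl ?ltr_wpDl// mulr1.
  by rewrite lerDl.
rewrite [ltRHS](splitr e); apply: ltr_leD => //.
exact: le_lt_trans (ler_norm _) hn.
Qed.

End limits_of_integrals.

Section product_measures.
Context d1 d2 (T1 : measurableType d1) (T2 : measurableType d2) (R : realType).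
Variable m1 : {sigma_finite_measure set T1 -> \bar R}.
Variable m2 : {sigma_finite_measure set T2 -> \bar R}.
Local Notation m12 := (m1 \x m2)%E.

Lemma ae_prod1 (P : T1 * T2 -> Prop) : {ae m12, forall z, P z} ->
  {ae m1, forall x, {ae m2, forall y, P (x, y)}}.
Proof.
move=> [N [mN N0 PN]].
have : (\int[m1]_x (m2 (xsection N x)) = 0)%E by exact: N0.
under eq_integral do rewrite -[m2 _]gee0_abs//.
move/(ae_eq_integral_abs m1 measurableT) => /(_ (measurable_fun_xsection m2 mN)).
apply: filterS => x /(_ I) /= Nx.
exists (xsection N x); split => //; first exact: measurable_xsection.
by move=> y /= Pxy; rewrite /xsection /= inE; exact: PN.
Qed.

(** [m12] is built by integrating sections over the first variable; uniqueness of the product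
    measure identifies it with the measure built in the other order. *)
Lemma ae_prod2 (P : T1 * T2 -> Prop) : {ae m12, forall z, P z} ->
  {ae m2, forall y, {ae m1, forall x, P (x, y)}}.
Proof.
move=> [N [mN N0 PN]].
have : (\int[m2]_y (m1 (ysection N y)) = 0)%E.
  transitivity ((m1 \x^ m2)%E N) => //; rewrite -N0.
  apply/esym; apply: (@product_measure_unique _ _ _ _ _ m1 m2 (m1 \x^ m2)%E) => //.
  by move=> A B mA mB /=; rewrite product_measure2E.
under eq_integral do rewrite -[m1 _]gee0_abs//.
move/(ae_eq_integral_abs m2 measurableT) => /(_ (measurable_fun_ysection m1 mN)).
apply: filterS => x /(_ I) /= Nx.
exists (ysection N x); split => //; first exact: measurable_ysection.
by move=> y /= Pxy; rewrite /ysection /= inE; exact: PN.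
Qed.

Lemma ae_prod1_conv (P : set (T1 * T2)) : measurable P ->
  {ae m1, forall x, {ae m2, forall y, P (x, y)}} -> {ae m12, forall z, P z}.
Proof.
move=> mP h; have mN : measurable (~` P) by exact: measurableC.
exists (~` P); split => //.
suff : (\int[m1]_x (m2 (xsection (~` P) x)) = 0)%E by [].
rewrite (@ae_eq_integral _ _ _ m1 setT (cst 0%E)) ?integral0//.
- exact: measurable_fun_xsection.
- apply: filterS h => x hx _ /=; apply/negligibleP.
    exact: measurable_xsection.
  apply: negligibleS hx => y /=; rewrite /xsection /= inE; exact.
Qed.

Lemma ae_prod2_conv (P : set (T1 * T2)) : measurable P ->
  {ae m2, forall y, {ae m1, forall x, P (x, y)}} -> {ae m12, forall z, P z}.
Proof.
move=> mP h; have mN : measurable (~` P) by exact: measurableC.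
exists (~` P); split => //.
have -> : (m12 (~` P) = (m1 \x^ m2)%E (~` P)).
  apply: (@product_measure_unique _ _ _ _ _ m1 m2 (m1 \x^ m2)%E) => //.
  by move=> A B mA mB /=; rewrite product_measure2E.
suff : (\int[m2]_x (m1 (ysection (~` P) x)) = 0)%E by [].
rewrite (@ae_eq_integral _ _ _ m2 setT (cst 0%E)) ?integral0//.
- exact: measurable_fun_ysection.
- apply: filterS h => x hx _ /=; apply/negligibleP.
    exact: measurable_ysection.
  apply: negligibleS hx => y /=; rewrite /ysection /= inE; exact.
Qed.

Lemma tonelli_rect1 A B (f : T1 * T2 -> \bar R) : measurable A -> measurable B ->
  measurable_fun setT f -> (forall z, 0 <= f z)%E ->
  (\int[m12]_(z in A `*` B) f z = \int[m1]_(x in A) \int[m2]_(y in B) f (x, y))%E.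
Proof.
move=> mA mB mf f0; rewrite integral_mkcond fubini_tonelli1; last 2 first.
- apply/(measurable_restrictT _ _).1; first exact: measurableX.
  exact: measurable_funTS.
- by move=> z; rewrite patchE; case: ifP.
rewrite [RHS]integral_mkcond; apply: eq_integral => x _.
rewrite /fubini_F patchE; case: ifPn => xA.
  rewrite [RHS]integral_mkcond; apply: eq_integral => y _.
  rewrite !patchE; congr (if _ then _ else _).
  by rewrite in_setX/= xA.
rewrite integral0_eq// => y _; by rewrite patchE in_setX/= (negbTE xA).
Qed.

Lemma tonelli_rect2 A B (f : T1 * T2 -> \bar R) : measurable A -> measurable B ->
  measurable_fun setT f -> (forall z, 0 <= f z)%E ->
  (\int[m12]_(z in A `*` B) f z = \int[m2]_(y in B) \int[m1]_(x in A) f (x, y))%E.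
Proof.
move=> mA mB mf f0; rewrite integral_mkcond fubini_tonelli2; last 2 first.
- apply/(measurable_restrictT _ _).1; first exact: measurableX.
  exact: measurable_funTS.
- by move=> z; rewrite patchE; case: ifP.
rewrite [RHS]integral_mkcond; apply: eq_integral => y _.
rewrite /fubini_G patchE; case: ifPn => yB.
  rewrite [RHS]integral_mkcond; apply: eq_integral => x _.
  rewrite !patchE; congr (if _ then _ else _).
  by rewrite in_setX/= yB andbT.
rewrite integral0_eq// => x _; by rewrite patchE in_setX/= (negbTE yB) andbF.
Qed.

Section fubini_rect.
Variables (A : set T1) (B : set T2) (f : T1 * T2 -> R).
Hypotheses (mA : measurable A) (mB : measurable B).
Hypothesis intf : m12.-integrable (A `*` B) (EFin \o f).

Let g := (EFin \o f) \_ (A `*` B).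

Let intg : m12.-integrable setT g.
Proof. by apply/(integrable_mkcond _ (measurableX mA mB)). Qed.

Let gE1 x : A x -> (fun y => g (x, y)) = (fun y => (f (x, y))%:E) \_ B.
Proof.
move=> Ax; apply/funext => y; rewrite /g !patchE.
by congr (if _ then _ else _); rewrite in_setX/= mem_set.
Qed.

Let gE2 y : B y -> (fun x => g (x, y)) = (fun x => (f (x, y))%:E) \_ A.
Proof.
move=> By; apply/funext => x; rewrite /g !patchE.
by congr (if _ then _ else _); rewrite in_setX/= (mem_set By) andbT.
Qed.

Lemma fubini_rect_ae1 :
  {ae m1, forall x, A x -> m2.-integrable B (fun y => (f (x, y))%:E)}.
Proof.
apply: filterS (ae_integrable1 intg) => x h Ax.
by apply/(integrable_mkcond _ mB); rewrite -gE1.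
Qed.

Lemma fubini_rect_ae2 :
  {ae m2, forall y, B y -> m1.-integrable A (fun x => (f (x, y))%:E)}.
Proof.
apply: filterS (ae_integrable2 intg) => y h By.
by apply/(integrable_mkcond _ mA); rewrite -gE2.
Qed.

Let F1 : {ae m1, forall x, A x ->
  fubini_F m2 g x = (\int[m2]_(y in B) f (x, y))%:E}.
Proof.
apply: filterS fubini_rect_ae1 => x h Ax.
by rewrite /fubini_F gE1// -integral_mkcond -integral_EFin_Rintegral//; exact: h.
Qed.

Let F2 : {ae m2, forall y, B y ->
  fubini_G m1 g y = (\int[m1]_(x in A) f (x, y))%:E}.
Proof.
apply: filterS fubini_rect_ae2 => y h By.
by rewrite /fubini_G gE2// -integral_mkcond -integral_EFin_Rintegral//; exact: h.
Qed.

Lemma measurable_fine_fubini1 :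
  measurable_fun A (fun x => \int[m2]_(y in B) f (x, y)).
Proof.
have := measurable_funTS (D := A) (measurable_fubini_F intg).
move=> /(measurableT_comp (fine_measurable measurableT)).
apply: eq_measurable_fun => x; rewrite inE => Ax.
by rewrite /= /fubini_F gE1// -integral_mkcond.
Qed.

Lemma measurable_fine_fubini2 :
  measurable_fun B (fun y => \int[m1]_(x in A) f (x, y)).
Proof.
have := measurable_funTS (D := B) (measurable_fubini_G intg).
move=> /(measurableT_comp (fine_measurable measurableT)).
apply: eq_measurable_fun => x; rewrite inE => Ax.
by rewrite /= /fubini_G gE2// -integral_mkcond.
Qed.

Lemma fubini_rect_int1 :
  m1.-integrable A (EFin \o (fun x => \int[m2]_(y in B) f (x, y))).
Proof.
apply/integrableP; split; first exact/measurable_EFinP/measurable_fine_fubini1.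
have /integrableP[mF] := integrableS measurableT mA (@subsetT _ _) (integrable_fubini_F intg).
apply: le_lt_trans; rewrite le_eqVlt; apply/orP; left; apply/eqP.
apply: ae_eq_integral => //.
- by apply/measurable_EFinP; apply: measurableT_comp => //; exact: measurable_fine_fubini1.
- exact: measurableT_comp.
- by apply: filterS F1 => x h Ax; rewrite h.
Qed.

Lemma fubini_rect_int2 :
  m2.-integrable B (EFin \o (fun y => \int[m1]_(x in A) f (x, y))).
Proof.
apply/integrableP; split; first exact/measurable_EFinP/measurable_fine_fubini2.
have iG : m2.-integrable setT (fubini_G m1 g).
  apply/integrableP; split; first exact: measurable_fubini_G intg.
  have mg : measurable_fun setT g by exact: measurable_int intg.
  apply: le_lt_trans ((integrable21ltyP m1 m2 mg).1 intg).
  apply: ge0_le_integral => //.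
  - by apply: measurableT_comp => //; exact: measurable_fubini_G intg.
  - apply: (measurable_fun_fubini_tonelli_G (abse \o g)) => //.
    exact: measurableT_comp.
    by move=> z; exact: abse_ge0.
  - move=> y _; apply: le_abse_integral => //.
    exact: measurableT_comp.
have /integrableP[mF] := integrableS measurableT mB (@subsetT _ _) iG.
apply: le_lt_trans; rewrite le_eqVlt; apply/orP; left; apply/eqP.
apply: ae_eq_integral => //.
- by apply/measurable_EFinP; apply: measurableT_comp => //; exact: measurable_fine_fubini2.
- exact: measurableT_comp.
- by apply: filterS F2 => x h Ax; rewrite h.
Qed.

Lemma fubini_rect1 : \int[m12]_(z in A `*` B) f z =
  \int[m1]_(x in A) (\int[m2]_(y in B) f (x, y)).
Proof.
rewrite /Rintegral integral_mkcond -(integral12_prod_meas1 intg); congr fine.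
transitivity (\int[m1]_(x in A) fubini_F m2 g x)%E.
  rewrite [RHS]integral_mkcond; apply: eq_integral => x _; rewrite patchE.
  case: ifPn => // xA; rewrite /fubini_F integral0_eq// => y _.
  by rewrite /g patchE in_setX/= (negbTE xA).
apply: ae_eq_integral => //.
- exact: measurable_funTS (measurable_fubini_F intg).
- exact/measurable_EFinP/measurable_fine_fubini1.
Qed.

Lemma fubini_rect2 : \int[m12]_(z in A `*` B) f z =
  \int[m2]_(y in B) (\int[m1]_(x in A) f (x, y)).
Proof.
rewrite /Rintegral integral_mkcond -(integral21_prod_meas1 intg); congr fine.
transitivity (\int[m2]_(y in B) fubini_G m1 g y)%E.
  rewrite [RHS]integral_mkcond; apply: eq_integral => y _; rewrite patchE.
  case: ifPn => // yB; rewrite /fubini_G integral0_eq// => x _.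
  by rewrite /g patchE in_setX/= (negbTE yB) andbF.
apply: ae_eq_integral => //.
- exact: measurable_funTS (measurable_fubini_G intg).
- exact/measurable_EFinP/measurable_fine_fubini2.
Qed.

End fubini_rect.

End product_measures.

(** * Absolutely continuous functions *)

Section real_line.
Context {R : realType}.
Local Notation mu := (@lebesgue_measure R).
Implicit Types (h y : R -> R).

Lemma lebesgue_measure_shift (c : R) (A : set R) : measurable A ->
  mu ((fun x : R => x + c) @^-1` A) = mu A.
Proof.
move=> mA.
have ms : measurable_fun [set: measurableTypeR R]
    ((fun x : R => x + c) : measurableTypeR R -> measurableTypeR R).
  exact: measurable_funD.
suff : mu A = pushforward mu ((fun x : R => x + c) : _ -> measurableTypeR R) A.
  by move=> ->.
apply: lebesgue_measure_unique => //= X [[a b]] _ <-; rewrite /pushforward /=.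
rewrite [X in _ = lebesgue_measure X](_ : _ = `]a - c, b - c]%classic); last first.
  by apply/seteqP; split=> x /=; rewrite !in_itv/= ltrBlDr lerBrDr.
rewrite !lebesgue_measure_itv/= !lte_fin ltrD2r.
by case: ifPn => // _; rewrite -!EFinB; congr EFin; ring.
Qed.

Lemma ae_shift (c : R) (P : R -> Prop) : {ae mu, forall x, P x} ->
  {ae mu, forall x, P (x + c)}.
Proof.
move=> [N [mN N0 PN]]; exists ((fun x : R => x + c) @^-1` N); split.
- by rewrite -[X in measurable X]setTI; apply: measurable_funD.
- by rewrite lebesgue_measure_shift.
- by move=> x /= Px; exact: PN.
Qed.

Lemma ge0_integral_shift (c : R) D (f : R -> \bar R) : measurable D ->
  measurable_fun D f -> (forall x, D x -> 0 <= f x)%E ->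
  (\int[mu]_(x in (fun x : R => x + c)%R @^-1` D) f (x + c)%R = \int[mu]_(x in D) f x)%E.
Proof.
move=> mD mf f0.
have ms : measurable_fun [set: measurableTypeR R]
    ((fun x : R => x + c) : measurableTypeR R -> measurableTypeR R).
  exact: measurable_funD.
rewrite -(ge0_integral_pushforward ms)//.
  by apply: eq_measure_integral => //= A mA AD; rewrite /pushforward lebesgue_measure_shift.
by move=> x /set_mem; exact: f0.
Qed.

Definition locint h := forall a b : R, mu.-integrable `[a, b] (EFin \o h).

Lemma locintP h : measurable_fun setT h ->
  (forall a b : R, (\int[mu]_(x in `[a, b]) `|h x|%:E < +oo)%E) -> locint h.
Proof.
move=> mh hoo a b; apply/integrableP; split; last exact: hoo.
by apply/measurable_EFinP; exact: measurable_funTS.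
Qed.

Lemma locint_measurable h : locint h -> measurable_fun setT h.
Proof.
move=> lh.
have -> : [set: R] = \bigcup_(n : nat) `[- n%:R, n%:R]%classic.
  apply/esym/seteqP; split=> // x _.
  exists (Num.bound `|x|) => //=; rewrite in_itv/= -ler_norml.
  exact/ltW/archi_boundP/normr_ge0.
apply/measurable_fun_bigcup => // n.
by have /integrableP[/measurable_EFinP] := lh (- n%:R) n%:R.
Qed.

Lemma locint_shift h c : locint h -> locint (fun x : R => h (x + c)).
Proof.
move=> lh; have mh := locint_measurable lh.
have mhc : measurable_fun setT (fun x : R => h (x + c)).
  by apply: (measurableT_comp mh); exact: measurable_funD.
apply: locintP => // a b.
have /integrableP[_] := lh (a + c) (b + c).
apply: le_lt_trans; rewrite le_eqVlt; apply/orP; left; apply/eqP.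
rewrite -[RHS](ge0_integral_shift c)//; first last.
- by apply: measurableT_comp => //; apply/measurable_EFinP; exact: measurable_funTS.
congr (integral _ _ _); apply/seteqP; split=> x /=; rewrite !in_itv/=;
  by rewrite !lerD2r.
Qed.

Lemma Rintegral_shift h c a b : locint h ->
  \int[mu]_(x in `[a, b]) h (x + c) = \int[mu]_(x in `[a + c, b + c]) h x.
Proof.
move=> lh; have mh := locint_measurable lh.
rewrite /Rintegral; congr fine.
have pre : `[a, b]%classic = (fun x : R => x + c) @^-1` `[a + c, b + c]%classic.
  by apply/seteqP; split=> x /=; rewrite !in_itv/= !lerD2r.
rewrite pre integralE [RHS]integralE; congr (_ - _)%E.
- rewrite -[RHS](ge0_integral_shift c)//; first by apply: eq_integral => x _; rewrite !funeposE.
  by apply: measurable_funepos; apply/measurable_EFinP; exact: measurable_funTS.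
- rewrite -[RHS](ge0_integral_shift c)//; first by apply: eq_integral => x _; rewrite !funenegE.
  by apply: measurable_funeneg; apply/measurable_EFinP; exact: measurable_funTS.
Qed.

Lemma continuous_locint h : continuous h -> locint h.
Proof.
move=> ch a b; apply: continuous_compact_integrable; first exact: segment_compact.
exact: continuous_subspaceT.
Qed.

Lemma locintD h k : locint h -> locint k -> locint (fun x => h x + k x).
Proof.
move=> lh lk a b; have := @integrableD _ _ _ mu _ (measurable_itv `[a, b]) _ _ (lh a b) (lk a b).
by apply: eq_integrable => // x _ /=; rewrite EFinD.
Qed.

Lemma locintZ h (k : R) : locint h -> locint (fun x => k * h x).
Proof.
move=> lh a b; have := @integrableZl _ _ _ mu _ (measurable_itv `[a, b]) k _ (lh a b).
by apply: eq_integrable => // x _ /=; rewrite EFinM.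
Qed.

Lemma locint_norm h : locint h -> locint (fun x => `|h x|).
Proof. by move=> lh a b; exact: integrable_norm. Qed.

Lemma continuous_bounded_itv (g : R -> R) a b : continuous g ->
  exists M, 0 <= M /\ forall x, a <= x <= b -> `|g x| <= M.
Proof.
move=> cg.
have /compact_bounded[M [Mr MP]] : compact (g @` `[a, b]).
  apply: continuous_compact; last exact: segment_compact.
  exact: continuous_subspaceT.
exists (Num.max 0 (M + 1)); split; first by rewrite le_max lexx.
move=> x xab; apply: (MP (Num.max 0 (M + 1))).
  by rewrite lt_max ltrDl ltr01 orbT.
by exists x => //=; rewrite in_itv.
Qed.

Lemma locint_cM (g : R -> R) h : continuous g -> locint h -> locint (fun x => g x * h x).
Proof.
move=> cg lh a b; have mh := locint_measurable lh.
have [M [M0 gM]] := continuous_bounded_itv a b cg.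
have iM := @integrableZl _ _ _ mu _ (measurable_itv `[a, b]) M _ (integrable_norm (lh a b)).
apply: (@integrable_le _ _ _ mu _ _ (fun x : R => M * `|h x|)) => //.
- apply: measurable_funM; last exact: measurable_funTS.
  by apply: measurable_funTS; exact: continuous_measurable_fun.
- by move=> x /=; rewrite in_itv/= => xab; rewrite normrM ler_wpM2r// gM.
Qed.

Lemma Rintegral_itv_split h a b c : locint h -> a <= b -> b <= c ->
  \int[mu]_(x in `[a, c]) h x =
  \int[mu]_(x in `[a, b]) h x + \int[mu]_(x in `[b, c]) h x.
Proof.
move=> lh ab bc; have := @Rintegral_itvB R h (BLeft a) (BRight c) b (lh a c).
rewrite !bnd_simp => /(_ ab bc).
rewrite (@Rintegral_itv_obnd_cbnd _ b (BRight c)); last first.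
  by apply: integrableS (lh a c) => //; apply: subset_itvScc; rewrite bnd_simp.
by move=> <-; rewrite addrC subrK.
Qed.

Lemma Rintegral_itv11 h a : \int[mu]_(x in `[a, a]) h x = 0.
Proof. by rewrite set_itv1 Rintegral_set1. Qed.

Lemma Rintegral_itv_cst a b (c : R) : a <= b ->
  \int[mu]_(x in `[a, b]) c = c * (b - a).
Proof.
move=> ab; rewrite Rintegral_cst//= lebesgue_measure_itv/= lte_fin.
case: ltP => [//|ba]; have -> : a = b by apply/eqP; rewrite eq_le ab.
by rewrite subrr.
Qed.

Lemma Rintegral_itv_le h a b M : locint h -> a <= b ->
  (forall x, a <= x <= b -> `|h x| <= M) ->
  `|\int[mu]_(x in `[a, b]) h x| <= M * (b - a).
Proof.
move=> lh ab hM; apply: (le_trans (le_normr_Rintegral _ _)) => //.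
rewrite -Rintegral_itv_cst//; apply: le_Rintegral => //.
- exact: (locint_norm lh).
- by apply: continuous_locint => x; exact: cvg_cst.
Qed.

(** Absolute continuity in integral form. The derivative [h] is part of the data and matters only up
    to null sets, while [y] is a genuine function, automatically continuous. *)
Definition AC y h := locint h /\
  forall a b, a <= b -> y b - y a = \int[mu]_(x in `[a, b]) h x.

Lemma AC_continuous y h : AC y h -> continuous y.
Proof.
move=> [lh yh] x.
have cI a b : {within `[a, b], continuous (fun x => \int[mu]_(t in `[a, x]) h t)}.
  have [ab|ba] := leP a b.
    exact: (@parameterized_integral_continuous R a b h ab (lh a b)).
  by rewrite set_itv_ge ?bnd_simp -?ltNge//; exact: continuous_subspace0.
have := cI (x - 1) (x + 1).
move/(continuous_within_itvP _ _) => /(_ _)[|+ _ _].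
  by rewrite ltrD2l gtrN.
move=> /(_ x); have xx : x \in `]x - 1, x + 1[ by rewrite in_itv/= gtrBl ltrDl ltr01.
move=> /(_ xx) cx.
have cy : {for x, continuous (fun t => y (x - 1) + \int[mu]_(s in `[x - 1, t]) h s)}.
  by apply: cvgD => //; exact: cvg_cst.
have E : \forall t \near x,
    y (x - 1) + \int[mu]_(s in `[x - 1, t]) h s = y t.
  near=> t; rewrite -yh; first by rewrite addrC subrK.
  by apply: ltW; near: t; apply: lt_nbhsr; rewrite ltrBlDr ltrDl.
rewrite /continuous_at -(nbhs_singleton E).
by apply: cvg_trans cy; apply: near_eq_cvg.
Unshelve. all: by end_near. Qed.

(** Continuous induction. Let [c] be the supremum of the points where [K] is at most its value at
    the left end. An interval that straddles [c], from such a point just below it to a point just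
    beyond, would pass the supremum; so the right end itself is within reach. *)
Lemma straddle_le (K : R -> R) :
  (forall x, exists2 d, 0 < d & forall a b, x - d < a -> a <= x -> x <= b ->
     b < x + d -> K b <= K a) ->
  forall a b, a <= b -> K b <= K a.
Proof.
move=> Kloc A B AB.
pose S := [set x | A <= x <= B /\ K x <= K A].
have SA : S A by rewrite /S /= lexx AB.
have hS : has_sup S.
  by split; [exists A|exists B => x [/andP[]]].
set c := sup S.
have Ac : A <= c by apply: ub_le_sup => //; case: hS.
have cB : c <= B by apply: sup_le_ub; [exists A|move=> x [/andP[]]].
have [d d0 hd] := Kloc c.
have [a Sa ca] := sup_adherent d0 hS.
have [/andP[Aa aB] KaA] := Sa.
have ac : a <= c by apply: ub_le_sup => //; case: hS.
have [cdB|Bcd] := leP (c + d) B; last first.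
  by apply: le_trans KaA; apply: hd => //.
have : S (c + d / 2).
  split.
    rewrite (le_trans Ac) ?lerDl ?divr_ge0 ?ltW//=.
    by rewrite (lt_le_trans _ cdB)// ltrD2l ltr_pdivrMr// ltr_pMr// ltr1n.
  apply: le_trans KaA; apply: hd => //; first by rewrite lerDl divr_ge0// ltW.
  by rewrite ltrD2l ltr_pdivrMr// ltr_pMr// ltr1n.
move=> /(ub_le_sup (proj2 hS)); rewrite -/c gerDl leNgt divr_gt0//.
Qed.

End real_line.

(** * The chain rule for absolutely continuous functions *)

Section AC_calculus.
Context {R : realType}.
Local Notation mu := (@lebesgue_measure R).
Implicit Types (h y : R -> R).

(** The end points come in any order and may coincide; membership of [c] in every open interval that
    contains both of them replaces [a < c < b]. *)
Lemma mean_value (f f' : R -> R) a b : (forall t : R, is_derive t 1 f (f' t)) ->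
  exists c, (forall lo hi, lo < a < hi -> lo < b < hi -> lo < c < hi) /\
    f b - f a = f' c * (b - a).
Proof.
move=> df.
have cf : continuous f.
  by move=> t; apply: differentiable_continuous; apply/derivable1_diffP; case: (df t).
have [ab|ba|->] := ltgtP a b.
- have [c /[!in_itv]/= /andP[ac cb] e] := @MVT R f f' a b ab (fun t _ => df t)
    (continuous_subspaceT cf).
  exists c; split => // lo hi /andP[la _] /andP[_ bh].
  by rewrite (lt_trans la ac) (lt_trans cb bh).
- have [c /[!in_itv]/= /andP[ac cb] e] := @MVT R f f' b a ba (fun t _ => df t)
    (continuous_subspaceT cf).
  exists c; split => [lo hi /andP[_ ah] /andP[lb _]|].
    by rewrite (lt_trans lb ac) (lt_trans cb ah).
  by rewrite -opprB e -mulrN opprB.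
- by exists b; split => //; rewrite !subrr mulr0.
Qed.

(** A [C^1] function whose gradient [(P, Q)] is carried as data, so that potentials with a
    prescribed gradient can be handled directly. *)
Definition C1with (F P Q : R * R -> R) :=
  [/\ (forall x : R * R, is_derive x.1 1 (fun t : R => F (t, x.2)) (P x)),
      (forall x : R * R, is_derive x.2 1 (fun t : R => F (x.1, t)) (Q x)),
      continuous P & continuous Q].

Lemma continuous_ball2 (P : R * R -> R) (z : R * R) e : continuous P -> 0 < e ->
  exists2 r, 0 < r & forall x1 x2, z.1 - r < x1 < z.1 + r -> z.2 - r < x2 < z.2 + r ->
    `|P z - P (x1, x2)| < e.
Proof.
move=> cP e0; have /cvgrPdist_lt/(_ e e0) := cP z.
move=> /nbhs_ballP[r /= r0 hr]; exists r => // x1 x2 h1 h2.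
apply: hr; split => /=; rewrite /ball /= distrC ltr_distl; lra.
Qed.

(** The increment is split at the corner [(x1, z2)], with one mean value on each side. *)
Lemma C1with_incr F P Q x1 x2 z1 z2 lo1 hi1 lo2 hi2 : C1with F P Q ->
  lo1 < x1 < hi1 -> lo1 < z1 < hi1 -> lo2 < x2 < hi2 -> lo2 < z2 < hi2 ->
  exists c1 c2, [/\ lo1 < c1 < hi1, lo2 < c2 < hi2 &
    F (z1, z2) - F (x1, x2) = P (c1, z2) * (z1 - x1) + Q (x1, c2) * (z2 - x2)].
Proof.
move=> [dP dQ _ _] hx1 hz1 hx2 hz2.
have [c1 [c1P e1]] := @mean_value (fun t => F (t, z2)) (fun t => P (t, z2)) x1 z1
  (fun t => dP (t, z2)).
have [c2 [c2P e2]] := @mean_value (fun t => F (x1, t)) (fun t => Q (x1, t)) x2 z2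
  (fun t => dQ (x1, t)).
exists c1, c2; split; [exact: c1P|exact: c2P|rewrite -e1 -e2; ring].
Qed.

Lemma C1with_continuous F P Q : C1with F P Q -> continuous F.
Proof.
move=> C1 [z1 z2]; have [_ _ cP cQ] := C1.
have [r1 r10 h1] := continuous_ball2 (z1, z2) cP ltr01.
have [r2 r20 h2] := continuous_ball2 (z1, z2) cQ ltr01.
apply/cvgrPdist_lt => e e0.
rewrite /= in h1 h2.
pose M := `|P (z1, z2)| + `|Q (z1, z2)| + 2.
have M0 : 0 < M by rewrite /M; have := normr_ge0 (P (z1, z2)); have := normr_ge0 (Q (z1, z2)); lra.
pose r := Num.min (Num.min r1 r2) (e / (2 * M)).
have r0 : 0 < r by rewrite !lt_min r10 r20 divr_gt0// mulr_gt0.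
exists (ball z1 r, ball z2 r); first by split; exact: nbhsx_ballx.
move=> [x1 x2] [/= b1 b2].
move: b1 b2; rewrite /ball /= ![`|_ - _| < r]ltr_distl => b1 b2.
have rr1 : r <= r1 by rewrite /r !ge_min lexx.
have rr2 : r <= r2 by rewrite /r !ge_min lexx !orbT.
have re : r <= e / (2 * M) by rewrite /r ge_min lexx orbT.
have [||||c1 [c2 [k1 k2 ->]]] :=
  @C1with_incr F P Q x1 x2 z1 z2 (z1 - r) (z1 + r) (z2 - r) (z2 + r) C1; try lra.
have hP : `|P (c1, z2)| <= M.
  have := h1 c1 z2; rewrite distrC => h.
  have : `|P (c1, z2) - P (z1, z2)| < 1 by apply: h; lra.
  rewrite /M; have := ler_normD (P (c1, z2) - P (z1, z2)) (P (z1, z2)).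
  by rewrite subrK; have := normr_ge0 (Q (z1, z2)); lra.
have hQ : `|Q (x1, c2)| <= M.
  have := h2 x1 c2; rewrite distrC => h.
  have : `|Q (x1, c2) - Q (z1, z2)| < 1 by apply: h; lra.
  rewrite /M; have := ler_normD (Q (x1, c2) - Q (z1, z2)) (Q (z1, z2)).
  by rewrite subrK; have := normr_ge0 (P (z1, z2)); lra.
have n1 : `|z1 - x1| < r by rewrite ltr_distl; lra.
have n2 : `|z2 - x2| < r by rewrite ltr_distl; lra.
apply: (le_lt_trans (ler_normD _ _)); rewrite !normrM.
have : `|P (c1, z2)| * `|z1 - x1| + `|Q (x1, c2)| * `|z2 - x2| < M * r + M * r.
  apply: ltrD; (apply: (le_lt_trans (y := M * _)); first exact: ler_wpM2r);
    by rewrite ltr_pM2l.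
move/lt_le_trans; apply.
have : M * r <= M * (e / (2 * M)) by rewrite ler_pM2l.
have -> : M * (e / (2 * M)) = e / 2 by field; rewrite gt_eqF.
lra.
Qed.

Definition prim h t := if 0 <= t then \int[mu]_(x in `[0, t]) h x
  else - \int[mu]_(x in `[t, 0]) h x.

Lemma prim_AC h : locint h -> AC (prim h) h.
Proof.
move=> lh; split => // a b ab; rewrite /prim.
have [a0|a0] := leP 0 a.
  by rewrite (le_trans a0 ab) (Rintegral_itv_split lh a0 ab) addrC addKr.
have [b0|b0] := leP 0 b.
  by rewrite opprK addrC -Rintegral_itv_split// ltW.
by rewrite (Rintegral_itv_split lh ab (ltW b0)); ring.
Qed.

Lemma AC_prim h : locint h -> exists y, AC y h.
Proof. by move=> lh; exists (prim h); exact: prim_AC. Qed.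

(** Pointwise derivatives of [y1] and [y2] are avoided. On a short interval around [x] the mean
    value form of the increment of [F] differs from the integral of [H] by at most [e] times the
    integral of [|h1| + |h2|], because [P] and [Q] vary little there. [straddle_le] spreads this
    estimate to [[a, b]], and [e] tends to 0. *)
Lemma AC_chain2 F P Q y1 h1 y2 h2 : C1with F P Q -> AC y1 h1 -> AC y2 h2 ->
  AC (fun t => F (y1 t, y2 t))
     (fun t => P (y1 t, y2 t) * h1 t + Q (y1 t, y2 t) * h2 t).
Proof.
move=> C1 A1 A2; have [_ _ cP cQ] := C1.
have c1 := AC_continuous A1; have c2 := AC_continuous A2.
have [l1 e1] := A1; have [l2 e2] := A2.
have cy : continuous (fun t => (y1 t, y2 t)).
  by move=> t; exact: (cvg_pair (c1 t) (c2 t)).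
have cPy : continuous (fun t => P (y1 t, y2 t)).
  by move=> t; apply: continuous_comp; [exact: cy|exact: cP].
have cQy : continuous (fun t => Q (y1 t, y2 t)).
  by move=> t; apply: continuous_comp; [exact: cy|exact: cQ].
set G := fun t => F (y1 t, y2 t).
set H := fun t => _ + _.
have lP := locint_cM cPy l1; have lQ := locint_cM cQy l2.
have lH : locint H by exact: locintD.
split => // a b ab.
pose V t := `|h1 t| + `|h2 t|.
have lV : locint V by apply: locintD; exact: locint_norm.
have [pH [_ pHE]] := AC_prim lH; have [pV [_ pVE]] := AC_prim lV.
have main e x : 0 < e -> exists2 d, 0 < d & forall a b, x - d < a -> a <= x -> x <= b ->
    b < x + d -> `|(G b - G a) - (pH b - pH a)| <= e * (pV b - pV a).
  move=> e0; have e20 : 0 < e / 2 by rewrite divr_gt0.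
  have [r1 r10 k1] := continuous_ball2 (y1 x, y2 x) cP e20.
  have [r2 r20 k2] := continuous_ball2 (y1 x, y2 x) cQ e20.
  pose r := Num.min r1 r2.
  have r0 : 0 < r by rewrite lt_min r10.
  have rr1 : r <= r1 by rewrite ge_min lexx.
  have rr2 : r <= r2 by rewrite ge_min lexx orbT.
  have /cvgrPdist_lt/(_ r r0)/nbhs_ballP[d1 /= d10 g1] := c1 x.
  have /cvgrPdist_lt/(_ r r0)/nbhs_ballP[d2 /= d20 g2] := c2 x.
  pose d := Num.min d1 d2.
  have d0 : 0 < d by rewrite lt_min d10.
  have dd1 : d <= d1 by rewrite ge_min lexx.
  have dd2 : d <= d2 by rewrite ge_min lexx orbT.
  have near1 t : x - d < t < x + d -> y1 x - r < y1 t < y1 x + r.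
    move=> td; rewrite -ltr_distl distrC; apply: g1; rewrite /ball /= distrC ltr_distl.
    lra.
  have near2 t : x - d < t < x + d -> y2 x - r < y2 t < y2 x + r.
    move=> td; rewrite -ltr_distl distrC; apply: g2; rewrite /ball /= distrC ltr_distl.
    lra.
  exists d => // s t xs sx xt tx.
  have st : s <= t by rewrite (le_trans sx).
  have [||||z1 [z2 [q1 q2 GE]]] := @C1with_incr F P Q (y1 s) (y2 s) (y1 t) (y2 t)
    (y1 x - r) (y1 x + r) (y2 x - r) (y2 x + r) C1.
  - by apply: near1; lra.
  - by apply: near1; lra.
  - by apply: near2; lra.
  - by apply: near2; lra.
  have ns2 : y2 x - r < y2 t < y2 x + r by apply: near2; lra.
  have ns1 : y1 x - r < y1 s < y1 x + r by apply: near1; lra.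
  pose D t' := (P (z1, y2 t) - P (y1 t', y2 t')) * h1 t' +
               (Q (y1 s, z2) - Q (y1 t', y2 t')) * h2 t'.
  have lD1 : locint (fun t' => (P (z1, y2 t) - P (y1 t', y2 t')) * h1 t').
    by apply: locint_cM => // t'; apply: cvgB; [exact: cvg_cst|exact: cPy].
  have lD2 : locint (fun t' => (Q (y1 s, z2) - Q (y1 t', y2 t')) * h2 t').
    by apply: locint_cM => // t'; apply: cvgB; [exact: cvg_cst|exact: cQy].
  have lD : locint D by exact: locintD.
  have -> : (G t - G s) - (pH t - pH s) = \int[mu]_(t' in `[s, t]) D t'.
    rewrite /G GE (e1 _ _ st) (e2 _ _ st) (pHE _ _ st).
    rewrite -RintegralZl// -RintegralZl//.
    rewrite -RintegralD//; [|exact: (locintZ _ l1)|exact: (locintZ _ l2)].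
    rewrite -RintegralB//; [|exact: (locintD (locintZ _ l1) (locintZ _ l2))].
    by apply: eq_Rintegral => t' _; rewrite /D /H; ring.
  rewrite (pVE _ _ st) -RintegralZl//.
  apply: (le_trans (le_normr_Rintegral _ _)) => //.
  apply: le_Rintegral => //; [exact: (locint_norm lD)|exact: (locintZ _ lV)|].
  move=> t' /=; rewrite in_itv/= => st'.
  rewrite /D /V mulrDr; apply: (le_trans (ler_normD _ _)); rewrite !normrM.
  have m1 : y1 x - r < y1 t' < y1 x + r by apply: near1; lra.
  have m2 : y2 x - r < y2 t' < y2 x + r by apply: near2; lra.
  apply: lerD; apply: ler_wpM2r => //.
    have a1 : `|P (y1 x, y2 x) - P (y1 t', y2 t')| < e / 2 by apply: k1 => /=; lra.
    have a2 : `|P (y1 x, y2 x) - P (z1, y2 t)| < e / 2 by apply: k1 => /=; lra.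
    rewrite -(subrKA (P (y1 x, y2 x))).
    by apply: (le_trans (ler_normD _ _)); rewrite [`|P (z1, _) - _|]distrC; lra.
  have a1 : `|Q (y1 x, y2 x) - Q (y1 t', y2 t')| < e / 2 by apply: k2 => /=; lra.
  have a2 : `|Q (y1 x, y2 x) - Q (y1 s, z2)| < e / 2 by apply: k2 => /=; lra.
  rewrite -(subrKA (Q (y1 x, y2 x))).
  by apply: (le_trans (ler_normD _ _)); rewrite [`|Q (y1 s, _) - _|]distrC; lra.
have step e : 0 < e -> `|(G b - G a) - (pH b - pH a)| <= e * (pV b - pV a).
  move=> e0; rewrite ler_norml; apply/andP; split.
  - have := @straddle_le R (fun t => - (G t - pH t) - e * pV t) _ a b ab.
    suff h : forall x, exists2 d, 0 < d & forall a b : R, x - d < a -> a <= x -> x <= b ->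
     b < x + d -> - (G b - pH b) - e * pV b <= - (G a - pH a) - e * pV a.
      by move=> /(_ h); lra.
    move=> x; have [d d0 hd] := main e x e0; exists d => // s t q1 q2 q3 q4.
    by have := hd s t q1 q2 q3 q4; rewrite ler_norml => /andP[]; lra.
  - have := @straddle_le R (fun t => (G t - pH t) - e * pV t) _ a b ab.
    suff h : forall x, exists2 d, 0 < d & forall a b : R, x - d < a -> a <= x -> x <= b ->
     b < x + d -> (G b - pH b) - e * pV b <= (G a - pH a) - e * pV a.
      by move=> /(_ h); lra.
    move=> x; have [d d0 hd] := main e x e0; exists d => // s t q1 q2 q3 q4.
    by have := hd s t q1 q2 q3 q4; rewrite ler_norml => /andP[]; lra.
rewrite -pHE//; apply/eqP; rewrite -subr_eq0 -normr_le0.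
apply/ler_addgt0Pl => e e0; rewrite addr0.
have W0 : 0 <= pV b - pV a.
  by rewrite pVE//; apply: Rintegral_ge0 => t _; rewrite addr_ge0.
(* The added 1 keeps the quotient well defined when the integral of [|h1| + |h2|] is 0. *)
have := step (e / (pV b - pV a + 1)); rewrite divr_gt0// ?ltr_wpDl// => /(_ isT).
move/le_trans; apply; rewrite mulrAC ler_pdivrMr ?ltr_wpDl//.
by rewrite ler_pM2l//; lra.
Qed.

End AC_calculus.

Section ae_combinators.
Context d (T : measurableType d) (R : realType).
Variable mu : {measure set T -> \bar R}.

Lemma ae_imp (P Q : T -> Prop) : {ae mu, forall x, P x} ->
  (forall x, P x -> Q x) -> {ae mu, forall x, Q x}.
Proof. by move=> hP PQ; exact: (filterS PQ hP). Qed.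

Lemma ae_imp2 (P Q S : T -> Prop) : {ae mu, forall x, P x} ->
  {ae mu, forall x, Q x} -> (forall x, P x -> Q x -> S x) -> {ae mu, forall x, S x}.
Proof. by move=> hP hQ PQ; near=> x; apply: PQ; near: x.
Unshelve. all: by end_near. Qed.

Lemma ae_imp3 (P Q S V : T -> Prop) : {ae mu, forall x, P x} ->
  {ae mu, forall x, Q x} -> {ae mu, forall x, S x} ->
  (forall x, P x -> Q x -> S x -> V x) -> {ae mu, forall x, V x}.
Proof. by move=> hP hQ hS PQ; near=> x; apply: PQ; near: x.
Unshelve. all: by end_near. Qed.

End ae_combinators.

(** * Differentiation almost everywhere, products and level sets *)

Section AC_tools.
Context {R : realType}.
Local Notation mu := (@lebesgue_measure R).
Implicit Types (h y : R -> R).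

Lemma AC_cst (c : R) : AC (fun=> c) (fun=> 0).
Proof.
split; first by apply: continuous_locint => x; exact: cvg_cst.
by move=> a b ab; rewrite Rintegral_itv_cst// mul0r subrr.
Qed.

Lemma AC_ext y1 h1 y2 h2 : AC y1 h1 -> y1 =1 y2 -> measurable_fun setT h2 ->
  {ae mu, forall t, h1 t = h2 t} -> AC y2 h2.
Proof.
move=> [l1 e1] yy mh hh.
have intE a b : (\int[mu]_(x in `[a, b]) `|h2 x|%:E = \int[mu]_(x in `[a, b]) `|h1 x|%:E)%E.
  apply: ae_eq_integral => //.
  - by apply/measurable_EFinP/measurableT_comp => //; exact: measurable_funTS.
  - apply/measurable_EFinP/measurableT_comp => //; apply: measurable_funTS.
    exact: locint_measurable.
  - by apply: (ae_imp hh) => t -> _.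
split.
  apply: locintP => // a b; rewrite intE.
  by have /integrableP[] := l1 a b.
move=> a b ab; rewrite -!yy e1// /Rintegral; congr fine.
apply: ae_eq_integral => //.
- by apply/measurable_EFinP; apply: measurable_funTS; exact: locint_measurable.
- by apply/measurable_EFinP; apply: measurable_funTS.
- by apply: (ae_imp hh) => t -> _.
Qed.

Lemma AC_eq y1 h1 y2 h2 : AC y1 h1 -> y1 =1 y2 -> h1 =1 h2 -> AC y2 h2.
Proof.
by move=> A /funext <- /funext <-.
Qed.

Lemma AC_chain1 (f f' : R -> R) y h : (forall t : R, is_derive t 1 f (f' t)) ->
  continuous f' -> AC y h -> AC (fun t => f (y t)) (fun t => f' (y t) * h t).
Proof.
move=> df cf' A.
have C1 : C1with (fun z => f z.1) (fun z => f' z.1) (fun=> 0).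
  split=> [x|x|x|x].
  - exact: df.
  - exact: (is_derive_cst (f x.1)).
  - by apply: (continuous_comp (f := fst)); [exact: cvg_fst|exact: cf'].
  - exact: cvg_cst.
by apply: AC_eq (AC_chain2 C1 A (AC_cst 0)) _ _ => t //=; rewrite mul0r addr0.
Qed.

Lemma AC_id : AC (fun t : R => t) (fun=> 1).
Proof.
split; first by apply: continuous_locint => x; exact: cvg_cst.
by move=> a b ab; rewrite Rintegral_itv_cst// mul1r.
Qed.

Lemma AC_C1 (y y' : R -> R) : (forall t, is_derive t (1 : R) y (y' t)) -> continuous y' -> AC y y'.
Proof.
by move=> dy cy'; apply: AC_eq (AC_chain1 dy cy' AC_id) _ _ => t //; rewrite mulr1.
Qed.

Lemma AC_mul y1 h1 y2 h2 : AC y1 h1 -> AC y2 h2 ->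
  AC (fun t => y1 t * y2 t) (fun t => h1 t * y2 t + y1 t * h2 t).
Proof.
move=> A1 A2.
have C1 : C1with (fun z : R * R => z.1 * z.2) (fun z => z.2) (fun z => z.1).
  split=> [x|x|x|x] /=.
  - by apply: is_derive_eq; rewrite scaler0 add0r /GRing.scale/= mulr1.
  - have := is_deriveZ x.1 (is_derive_id x.2 (1 : R)).
    by rewrite /GRing.scale/= mulr1.
  - exact: cvg_snd.
  - exact: cvg_fst.
by apply: AC_eq (AC_chain2 C1 A1 A2) _ _ => t //=; rewrite mulrC.
Qed.

Lemma AC_lin y1 h1 y2 h2 (k : R) : AC y1 h1 -> AC y2 h2 ->
  AC (fun t => y1 t + k * y2 t) (fun t => h1 t + k * h2 t).
Proof.
move=> [l1 e1] [l2 e2]; have l2' := locintZ k l2.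
split; first exact: locintD.
move=> a b ab; rewrite RintegralD// RintegralZl// -e1// -e2//; ring.
Qed.

Lemma AC_shift y h c : AC y h -> AC (fun t => y (t + c)) (fun t => h (t + c)).
Proof.
move=> [lh yh]; split; first exact: locint_shift.
by move=> a b ab; rewrite Rintegral_shift// -yh// lerD2r.
Qed.

Lemma locint_locally_integrable h : locint h -> locally_integrable setT h.
Proof.
move=> lh; split; [exact: locint_measurable|exact: openT|].
move=> K _ cK; have [M [_ KM]] := compact_bounded cK.
have /integrableP[mh] := lh (- (M + 1)) (M + 1).
apply: le_lt_trans; apply: ge0_subset_integral => //.
- exact: compact_measurable.
- by apply/measurable_EFinP; apply: measurableT_comp => //; apply/measurable_EFinP.
- move=> x Kx; rewrite /= in_itv/= -ler_norml; apply: KM => //.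
  by rewrite ltrDl.
Qed.

(** Lebesgue differentiation is applied to the right of each [- n], and the countably many null sets
    are joined. *)
Lemma AC_is_derive y h : AC y h -> {ae mu, forall t, is_derive t (1 : R) y (h t)}.
Proof.
move=> [lh yh].
have lih := locint_locally_integrable lh.
have : forall n : nat, {ae mu, forall x : R, - n%:R < x ->
    is_derive x (1 : R) y (h x)}.
  move=> n.
  have := @FTC1 R h (BLeft (- n%:R)) (lh (- n%:R)) lih.
  move/ae_imp; apply => x /= hx nx; have [|dF F'] := hx; first by rewrite lte_fin.
  set F := fun x => _ in dF F'.
  have yF : \forall t \near x, y (- n%:R) + F t = y t.
    near=> t; rewrite /F /= -yh; first by rewrite addrC subrK.
    by apply: ltW; near: t; apply: lt_nbhsr.
  have dF1 : is_derive x 1 (fun t => y (- n%:R) + F t) (h x).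
    have : is_derive x 1 F (h x) by rewrite -F' derive1E; exact: DeriveDef.
    by move=> dF1; have := is_deriveD (is_derive_cst (y (- n%:R)) x (1 : R)) dF1; rewrite add0r.
  by apply: near_eq_is_derive yF _.
move/ae_foralln/ae_imp; apply => x hx.
apply: (hx (Num.bound `|x|)).
rewrite ltrNl; apply: le_lt_trans (archi_boundP (normr_ge0 x)).
by rewrite -normrN ler_norm.
Unshelve. all: by end_near. Qed.

Lemma is_derive_seq y (t l : R) : is_derive t 1 y l ->
  (y (t + n.+1%:R^-1) - y t) * n.+1%:R @[n --> \oo] --> l.
Proof.
move=> [dy yl].
have : (y (h + t) - y t) * h^-1 @[h --> 0^'] --> l.
  move/cvg_ex: dy => [k hk].
  rewrite -yl /derive; move: hk; rewrite /= => hk.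
  have -> : lim (h^-1 *: (((fun u : R => y (u + t)) \o *:%R^~ 1) h - y t) @[h --> 0^']) = k.
    exact: cvg_lim hk.
  apply: cvg_trans hk; apply: near_eq_cvg; near=> h => /=.
  by rewrite /GRing.scale/= mulr1 mulrC.
move/cvgr_dnbhsP => /(_ (fun n => n.+1%:R^-1)).
have h0 : (forall n : nat, (n.+1%:R^-1 : R) != 0) /\ n.+1%:R^-1 @[n --> \oo] --> (0 : R).
  by split=> [n|]; [rewrite invr_eq0 pnatr_eq0|exact: cvg_harmonic].
move=> /(_ h0); apply: cvg_trans; apply: near_eq_cvg; near=> n.
by rewrite invrK [n.+1%:R^-1 + t]addrC.
Unshelve. all: by end_near. Qed.

(** The primitive is constant on the rationals, hence everywhere by continuity, and its derivative
    is [h] almost everywhere. Rational end points make the hypothesis a countable one, so that it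
    can be secured on almost every line at once. *)
Lemma locint_ae0 h : locint h ->
  (forall a b : rat, a <= b -> \int[mu]_(x in `[ratr a, ratr b]) h x = 0) ->
  {ae mu, forall t, h t = 0}.
Proof.
move=> lh h0; have [y A] := AC_prim lh.
have cy := AC_continuous A.
have yq (a b : rat) : a <= b -> y (ratr b) = y (ratr a).
  by move=> ab; apply/eqP; rewrite -subr_eq0 (A.2 _ _) ?ler_rat// h0.
have yq0 (a : rat) : y (ratr a) = y 0.
  rewrite -(rmorph0 (@ratr R)).
  by have [/yq ->|/ltW/yq ->] := leP a 0.
have yc t : y t = y 0.
  apply/eqP; rewrite -subr_eq0 -normr_le0; apply/ler_addgt0Pl => e e0; rewrite addr0.
  have /cvgrPdist_lt/(_ e e0)/nbhs_ballP[d /= d0 hd] := cy t.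
  have [q /[!in_itv]/= /andP[tq qt]] := @rat_in_itvoo R (t - d) (t + d) ltac:(lra).
  by rewrite -(yq0 q) ltW//; apply: hd; rewrite /ball /= distrC ltr_distl tq.
apply: (ae_imp (AC_is_derive A)) => t /is_derive_seq.
under eq_fun do rewrite yc [y t]yc subrr mul0r.
by move=> /(cvg_unique _ (cvg_cst _)) => ->.
Qed.

(** [g n] tends to 0 pointwise, while [g' n] is bounded by 1 and tends to the indicator of [M]. In
    the limit the chain rule for [g n (y)] says that [h], restricted to the level set, has zero
    integral over every segment. *)
Lemma AC_level_set y h (M : R) : AC y h -> {ae mu, forall t, y t = M -> h t = 0}.
Proof.
move=> A; have [lh _] := A.
have mh := locint_measurable lh.
have cy := AC_continuous A.
pose g n (x : R) := (x - M) / (1 + n%:R * (x - M) ^+ 2).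
pose g' n (x : R) := (1 - n%:R * (x - M) ^+ 2) / (1 + n%:R * (x - M) ^+ 2) ^+ 2.
have den n (x : R) : 0 < 1 + n%:R * (x - M) ^+ 2 :> R.
  by rewrite ltr_pwDl// mulr_ge0// sqr_ge0.
have dg n (x : R) : is_derive x 1 (g n) (g' n x).
  rewrite /g /g'; have dn := den n x.
  have : is_derive x 1 (fun x => 1 + n%:R * (x - M) ^+ 2 : R) (2 * n%:R * (x - M)).
    by apply: is_derive_eq; rewrite /GRing.scale/=; ring.
  move=> d1; have d2 := is_deriveV (lt0r_neq0 dn : (fun x => 1 + n%:R * (x - M) ^+ 2 : R) x != 0).
  apply: is_derive_eq; rewrite /GRing.scale/=.
  by field; rewrite gt_eqF.
have cg' n : continuous (g' n).
  move=> x; rewrite /g'; apply: cvgM; first by apply: cvgB; [exact: cvg_cst|apply: cvgM; [exact: cvg_cst|apply: cvgM; apply: cvgB => //; exact: cvg_cst]].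
  apply: cvgV; first by rewrite gt_eqF// exprn_gt0.
  apply: cvgM; apply: cvgD; try exact: cvg_cst; apply: cvgM; try exact: cvg_cst;
  apply: cvgM; apply: cvgB => //; exact: cvg_cst.
have g'1 n x : `|g' n x| <= 1.
  have dn := den n x; rewrite /g' normrM normfV (gtr0_norm (exprn_gt0 _ dn)).
  rewrite ler_pdivrMr ?exprn_gt0// mul1r.
  have : 0 <= n%:R * (x - M) ^+ 2 :> R by rewrite mulr_ge0// sqr_ge0.
  by move: (_ * _) => z z0; rewrite ler_norml; nra.
pose k t := (y t == M)%:R * h t.
have mI : measurable_fun setT (fun t => (y t == M)%:R : R).
  rewrite (_ : (fun t => _) = \1_(y @^-1` [set M])).
    apply: measurable_indic; rewrite -[X in measurable X]setTI.
    exact: (continuous_measurable_fun cy).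
  by apply/funext => t; rewrite indicE; congr (_%:R); congr nat_of_bool; apply/eqP/idP; rewrite inE.
have mk : measurable_fun setT k by exact: measurable_funM.
have hk t : `|k t| <= `|h t|.
  by rewrite /k normrM; case: eqP => _; rewrite ?normr1 ?mul1r// normr0 mul0r.
have lk : locint k.
  move=> a b; apply: (@integrable_le _ _ _ mu _ _ (fun t => `|h t|)) => //.
  - exact: measurable_funTS.
  - exact: (locint_norm lh).
suff : {ae mu, forall t, k t = 0}.
  by move/ae_imp; apply => t; rewrite /k => + yM; rewrite yM eqxx mul1r.
apply: locint_ae0 => // a b; rewrite -(ler_rat R); move: (ratr a) (ratr b) => {}a {}b ab.
have Ag n := AC_chain1 (dg n) (cg' n) A.
have cv1 : \int[mu]_(x in `[a, b]) (g' n (y x) * h x) @[n --> \oo] -->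
    \int[mu]_(x in `[a, b]) k x.
  apply: (@Rintegral_dominated _ _ _ mu _ _ _ (fun x => `|h x|)) => //.
  - by move=> n; apply: measurable_funTS; apply: locint_measurable; have [] := Ag n.
  - exact: measurable_funTS.
  - apply: aeW => x _; apply: cvgMl; rewrite /g'.
    have [->|yM] := eqVneq (y x) M.
      rewrite (_ : (fun n : nat => _) = cst (1 : R)); first exact: cvg_cst.
      by apply/funext => n; rewrite subrr expr0n mulr0 subr0 addr0 expr1n divr1.
    have s0 : 0 < (y x - M) ^+ 2 by rewrite exprn_even_gt0//= subr_eq0.
    move: (_ ^+ 2) s0 => s s0.
    rewrite [X in _ --> X](_ : _ = 0 :> R)//.
    (* Away from the level, [|g' n|] is at most [1 / (1 + n s)]; the factor 2 pays for [n.+1] in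
       place of [n]. *)
    apply: (@squeeze_cvgr _ _ _ _ (fun n => - (s^-1 * n.+1%:R^-1 * 2)) (fun n => s^-1 * n.+1%:R^-1 * 2)).
    + near=> n; rewrite -ler_norml normrM normfV.
      have n1 : (1 <= n%:R :> R) by rewrite ler1n; near: n; exists 1%N.
      have d0 : 0 < 1 + n%:R * s by rewrite ltr_pwDl// mulr_ge0// ltW.
      rewrite (gtr0_norm (exprn_gt0 _ d0)).
      rewrite ler_pdivrMr ?exprn_gt0//.
      apply: (@le_trans _ _ (1 + n%:R * s)).
        have : 0 <= n%:R * s by rewrite mulr_ge0// ltW.
        by move: (_ * s) => z z0; rewrite ler_norml; lra.
      rewrite expr2 mulrA ler_peMl ?ltW//.
      have -> : s^-1 / n.+1%:R * 2 * (1 + n%:R * s) = 2 * (1 + n%:R * s) / (s * n.+1%:R).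
        by rewrite invfM; move: (s^-1) (n.+1%:R^-1) => c1 c2; ring.
      by rewrite ltr_pdivlMr ?mulr_gt0// -natr1; nra.
    + rewrite -oppr0; apply: cvgN; rewrite -[X in _ --> X](mul0r 2); apply: cvgM; last exact: cvg_cst.
      by rewrite -[X in _ --> X](mulr0 s^-1); apply: cvgM; [exact: cvg_cst|exact: cvg_harmonic].
    + rewrite -[X in _ --> X](mul0r 2); apply: cvgM; last exact: cvg_cst.
      by rewrite -[X in _ --> X](mulr0 s^-1); apply: cvgM; [exact: cvg_cst|exact: cvg_harmonic].
  - exact: (locint_norm lh).
  - apply: aeW => x n _; rewrite normrM -[leRHS]mul1r; exact: ler_wpM2r.
have gto0 s : g n s @[n --> \oo] --> 0.
  have [->|sM] := eqVneq s M.
    by rewrite /g; under eq_fun do rewrite subrr mul0r; exact: cvg_cst.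
  have s0 : 0 < (s - M) ^+ 2 by rewrite exprn_even_gt0//= subr_eq0.
  have : `|g n s| @[n --> \oo] --> 0.
    apply: (@squeeze_cvgr _ _ _ _ (cst 0) (fun n => `|s - M| / (s - M) ^+ 2 * 2 * n.+1%:R^-1)).
    + near=> n; rewrite normr_ge0/= /g normrM normfV -!mulrA ler_wpM2l//.
      have n1 : (1 <= n%:R :> R) by rewrite ler1n; near: n; exists 1%N.
      rewrite (gtr0_norm (den n s)) -invf_div -invfM lef_pV2 ?posrE ?den//; last first.
        by rewrite mulr_gt0// divr_gt0.
      rewrite -natr1; move: (_ ^+ 2) s0 => z z0.
      by move: (n%:R : R) n1 => N N1; nra.
    + exact: cvg_cst.
    + by rewrite -[X in _ --> X](mulr0 (`|s - M| / (s - M) ^+ 2 * 2)); apply: cvgM; [exact: cvg_cst|exact: cvg_harmonic].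
  exact: norm_cvg0.
have cv2 : \int[mu]_(x in `[a, b]) (g' n (y x) * h x) @[n --> \oo] --> 0.
  under eq_fun do rewrite -(proj2 (Ag _))//.
  have cB := cvgB (gto0 (y b)) (gto0 (y a)); rewrite subr0 in cB; exact: cB.
exact: (cvg_unique _ cv1 cv2).
Unshelve. all: by end_near. Qed.

End AC_tools.

(** * The fundamental lemma of the calculus of variations *)

Section test_functions.
Context {R : realType}.
Local Notation mu := (@lebesgue_measure R).

Lemma is_derive_quad (f : R -> R) (t l C : R) :
  (forall h, `|f (t + h) - f t - l * h| <= C * h ^+ 2) -> is_derive t (1 : R) f l.
Proof.
move=> fh.
have C0 : 0 <= C.
  by have h1 := fh 1; rewrite expr1n !mulr1 in h1; exact: le_trans (normr_ge0 _) h1.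
have H : h^-1 *: (f (h *: 1 + t) - f t) @[h --> 0^'] --> l.
  apply/cvgrPdist_le => e e0; near=> h.
  have h0 : h != 0 by near: h; exact: nbhs_dnbhs_neq.
  rewrite /GRing.scale/= mulr1.
  have -> : l - h^-1 * (f (h + t) - f t) = - (h^-1 * (f (t + h) - f t - l * h)).
    by rewrite [h + t]addrC; field.
  rewrite normrN normrM normfV ler_pdivrMl ?normr_gt0//.
  apply: (le_trans (fh h)); rewrite -real_normK ?num_real// expr2 mulrA mulrC.
  apply: ler_wpM2l => //.
  have : `|h| <= e / (C + 1).
    near: h; apply: (@dnbhs0_le R); by rewrite divr_gt0// ltr_wpDl.
  rewrite ler_pdivlMr ?ltr_wpDl// => /(le_trans _); apply.
  by rewrite [`|h| * _]mulrC ler_wpM2r// lerDl.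
have dd : derivable f t 1 by apply/cvg_ex; exists l.
by apply: DeriveDef => //; exact: cvg_lim H.
Unshelve. all: by end_near. Qed.

(** A [C^1] function that vanishes on a half-line; the bumps, steps and truncations are assembled
    from it. *)
Definition pos2 (t : R) := Num.max t 0 ^+ 2.

Lemma is_derive_pos2 t : is_derive t (1 : R) pos2 (2 * Num.max t 0).
Proof.
apply: (@is_derive_quad _ _ _ 1) => h; rewrite /pos2 mul1r.
have [t0|t0] := leP t 0; have [h0|h0] := leP (t + h) 0; rewrite ler_norml; nra.
Qed.

Lemma continuous_pos : continuous (fun t : R => Num.max t 0).
Proof. by move=> t; apply: continuous_max; [exact: cvg_id|exact: cvg_cst]. Qed.

Lemma is_derive_continuous (f f' : R -> R) :
  (forall t, is_derive t (1 : R) f (f' t)) -> continuous f.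
Proof.
move=> df t; apply: differentiable_continuous; apply/derivable1_diffP.
by case: (df t).
Qed.

Lemma test1P (f f' : R -> R) : (forall t, is_derive t (1 : R) f (f' t)) ->
  continuous f' -> (exists M, forall t, M < `|t| -> f t = 0) -> test1 f.
Proof.
move=> df cf' supp; split => //.
- exact: (is_derive_continuous df).
- rewrite (_ : derive1 f = f')//; apply/funext => t.
  by rewrite derive1E; case: (df t).
Qed.

Lemma derive1_is_derive (f f' : R -> R) t : is_derive t (1 : R) f (f' t) ->
  derive1 f t = f' t.
Proof. by rewrite derive1E => -[]. Qed.

Variables (r s : R).
Hypothesis rs : r < s.

Let c := (s - r) / 2.
Let c4 : 0 < c ^+ 4. Proof. by rewrite exprn_gt0// divr_gt0// subr_gt0. Qed.

(** The parabola with zeros [r] and [s] has maximum [((s - r) / 2)^2], at the midpoint; its positive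
    part is squared to be [C^1], whence the fourth power in the denominator. *)
Definition bump t := pos2 ((t - r) * (s - t)) / ((s - r) / 2) ^+ 4.

(** As [n] grows it tends to 1 inside []r, s[] while keeping its support and its range [[0, 1]]: a
    sequence of test functions that converges to the indicator of an interval. *)
Definition plateau (n : nat) t := 1 - (1 - bump t) ^+ n.

Definition plateau' (n : nat) t := n%:R * (1 - bump t) ^+ n.-1 *
  (2 * Num.max ((t - r) * (s - t)) 0 * (s + r - 2 * t) / ((s - r) / 2) ^+ 4).

Lemma is_derive_bump t : is_derive t (1 : R) bump
  (2 * Num.max ((t - r) * (s - t)) 0 * (s + r - 2 * t) / ((s - r) / 2) ^+ 4).
Proof.
have d1 : is_derive t (1 : R) (fun t => (t - r) * (s - t)) (s + r - 2 * t).
  by apply: is_derive_eq; rewrite /GRing.scale/=; ring.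
have d2 := is_derive1_comp (g := fun t => (t - r) * (s - t)) (is_derive_pos2 ((t - r) * (s - t))) d1.
have d3 : is_derive t (1 : R) (fun t => (((s - r) / 2) ^+ 4)^-1 *: (pos2 \o (fun t => (t - r) * (s - t))) t)
   ((((s - r) / 2) ^+ 4)^-1 *: (2 * Num.max ((t - r) * (s - t)) 0 * (s + r - 2 * t))).
  exact: is_deriveZ.
have -> : bump = (fun t => (((s - r) / 2) ^+ 4)^-1 *: (pos2 \o (fun t => (t - r) * (s - t))) t).
  by apply/funext => x; rewrite /bump /GRing.scale/= mulrC.
by move: d3; rewrite /GRing.scale/= [_^-1 * _]mulrC.
Qed.

Lemma is_derive_plateau n t : is_derive t (1 : R) (plateau n) (plateau' n t).
Proof.
have d := is_derive_bump t; rewrite /plateau /plateau'; move: d; set e := _ / _ => d.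
have d1 : is_derive t (1 : R) (fun t => 1 - bump t) (- e).
  have := is_deriveB (is_derive_cst (1 : R) t (1 : R)) d; by rewrite sub0r.
have d3 := is_deriveB (is_derive_cst (1 : R) t (1 : R)) (is_deriveX n d1).
rewrite sub0r scalerN opprK in d3.
rewrite (_ : (fun t => 1 - _) = cst 1 - (fun t => 1 - bump t) ^+ n)//.
by apply/funext => x; rewrite fctE exprfctE.
Qed.

Lemma bump_ge0 t : 0 <= bump t.
Proof. by rewrite mulr_ge0 ?sqr_ge0 ?invr_ge0 ?ltW. Qed.

Lemma bump_le1 t : bump t <= 1.
Proof.
rewrite ler_pdivrMr// mul1r /pos2.
have : Num.max ((t - r) * (s - t)) 0 <= ((s - r) / 2) ^+ 2.
  rewrite ge_max sqr_ge0 andbT.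
  by have := sqr_ge0 ((s + r) / 2 - t); nra.
have : 0 <= Num.max ((t - r) * (s - t)) 0 by rewrite le_max lexx orbT.
move: (Num.max _ _) => x x0 xc.
rewrite (exprM _ 2 2); apply: lerXn2r => //; rewrite nnegrE; exact: sqr_ge0.
Qed.

Lemma bump_out t : t <= r \/ s <= t -> bump t = 0.
Proof.
move=> h; rewrite /bump /pos2 max_r ?expr0n ?mul0r//.
case: h => h; [apply: mulr_le0_ge0|apply: mulr_ge0_le0]; rewrite ?subr_le0 ?subr_ge0//.
  by rewrite (le_trans h)// ltW.
by rewrite (le_trans _ h)// ltW.
Qed.

Lemma bump_in t : r < t < s -> 0 < bump t.
Proof.
move=> /andP[rt ts]; rewrite /bump /pos2 divr_gt0// exprn_gt0// lt_max.
by rewrite mulr_gt0// subr_gt0.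
Qed.

Lemma plateau_range n t : 0 <= plateau n t <= 1.
Proof.
have b0 := bump_ge0 t; have b1 := bump_le1 t; rewrite /plateau.
have e1 : (1 - bump t) ^+ n <= 1 by rewrite exprn_ile1 ?subr_ge0// gerBl.
have e0 : 0 <= (1 - bump t) ^+ n by rewrite exprn_ge0// subr_ge0.
by lra.
Qed.

Lemma plateau_out n t : t <= r \/ s <= t -> plateau n t = 0.
Proof. by move=> /bump_out; rewrite /plateau => ->; rewrite subr0 expr1n subrr. Qed.

Lemma plateau_cvg t : r < t < s -> plateau n t @[n --> \oo] --> (1 : R).
Proof.
move=> /bump_in b0; rewrite -[X in _ --> X]subr0; apply: cvgB; first exact: cvg_cst.
apply: cvg_expr; rewrite ger0_norm ?subr_ge0 ?bump_le1// ltrBlDr ltrDl//.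
Qed.

Lemma continuous_plateau' n : continuous (plateau' n).
Proof.
have cb : continuous bump by exact: is_derive_continuous is_derive_bump.
move=> t; apply: cvgM.
  apply: cvgM; first exact: cvg_cst.
  apply: (@continuous_comp _ _ _ (fun t => 1 - bump t) (fun x => x ^+ n.-1)).
    by apply: cvgB; [exact: cvg_cst|exact: cb].
  exact: exprn_continuous.
apply: cvgM; last exact: cvg_cst.
apply: cvgM; last first.
  by apply: cvgB; [exact: cvg_cst|apply: cvgM; [exact: cvg_cst|exact: cvg_id]].
apply: cvgM; first exact: cvg_cst.
apply: (@continuous_comp _ _ _ (fun t => (t - r) * (s - t)) (fun x => Num.max x 0)).
  by apply: cvgM; apply: cvgB; try exact: cvg_cst; exact: cvg_id.
exact: continuous_pos.
Qed.

Lemma continuous_plateau n : continuous (plateau n).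
Proof. exact: is_derive_continuous (is_derive_plateau n). Qed.

Lemma test1_plateau n : test1 (plateau n).
Proof.
apply: (test1P (is_derive_plateau n) (@continuous_plateau' n)).
exists (`|r| + `|s|) => t h; apply: plateau_out.
have [tr|rt] := leP t r; first by left.
right; have := ler_norm s; have := ler_norm (- r); rewrite normrN.
have := ler_norm r; have := normr_ge0 s; move: h; case: (ger0P t); lra.
Qed.

Lemma plateau_integral_cvg (Q : R -> R) : locint Q ->
  \int[mu]_(t in `[r, s]) (Q t * plateau n t) @[n --> \oo] --> \int[mu]_(t in `[r, s]) Q t.
Proof.
move=> lQ; have mQ := locint_measurable lQ.
apply: (@Rintegral_dominated _ _ _ mu _ _ _ (fun t => `|Q t|)) => //.
- move=> n; apply: measurable_funTS; apply: measurable_funM => //.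
  exact: (continuous_measurable_fun (@continuous_plateau n)).
- exact: measurable_funTS.
(* Plateaus stay at 0 at the two end points, which form the null set left out. *)
- exists [set r; s]; split => //; first exact: measurableU.
      rewrite measureU0 ?lebesgue_measure_set1//; exact: lebesgue_measure_set1.
    move=> t /= /not_implyP[]; rewrite in_itv/= => /andP[rt ts] h.
    apply: contrapT => /not_orP[/eqP tr /eqP t's]; apply: h.
    rewrite -[X in _ --> X]mulr1; apply: cvgM; first exact: cvg_cst.
    by apply: plateau_cvg; rewrite !lt_neqAle rt ts eq_sym tr t's.
- exact: (locint_norm lQ).
- apply: aeW => t n _; rewrite normrM -[leRHS]mulr1 ler_wpM2l//.
  by have /andP[p0 p1] := plateau_range n t; rewrite ger0_norm.
Qed.

End test_functions.

Section fundamental_lemma.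
Context {R : realType}.
Local Notation mu := (@lebesgue_measure R).

Lemma Rintegral_setT_itv (f : R -> R) r s : (forall t, t <= r \/ s <= t -> f t = 0) ->
  \int[mu]_t f t = \int[mu]_(t in `[r, s]) f t.
Proof.
move=> f0; rewrite [RHS]Rintegral_mkcond; apply: eq_Rintegral => t _.
rewrite patchE; case: ifPn => // /negP; rewrite inE /= in_itv/= => h.
apply: f0; have [tr|rt] := leP t r; [by left|right].
by rewrite leNgt; apply/negP => /ltW ts; apply: h; rewrite (ltW rt).
Qed.

Lemma fundamental_lemma (Q : R -> R) : locint Q ->
  (forall b, test1 b -> \int[mu]_t (Q t * b t) = 0) -> {ae mu, forall t, Q t = 0}.
Proof.
move=> lQ hQ; apply: locint_ae0 => // a b; rewrite -(ler_rat R).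
move: (ratr a) (ratr b) => {}a {}b; rewrite le_eqVlt => /predU1P[->|ab].
  exact: Rintegral_itv11.
have := plateau_integral_cvg ab lQ.
have z n : \int[mu]_(t in `[a, b]) (Q t * plateau a b n t) = 0.
  rewrite -(@Rintegral_setT_itv (fun t => Q t * plateau a b n t)).
    by apply: hQ; exact: test1_plateau.
  by move=> t /(plateau_out ab) ->; rewrite mulr0.
under eq_fun do rewrite z.
by move=> /(cvg_unique _ (cvg_cst _)) <-.
Qed.

End fundamental_lemma.

(** * Absolute continuity on lines *)

Lemma measurable_itvR (R : realType) (i : interval R) :
  measurable ([set` i] : set (measurableTypeR R)).
Proof. exact: measurable_itv. Qed.

Lemma locint_eq (R : realType) (h k : R -> R) : locint h -> h =1 k -> locint k.
Proof. by move=> lh /funext <-. Qed.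

Lemma locintB (R : realType) (h k : R -> R) : locint h -> locint k ->
  locint (fun x => h x - k x).
Proof.
move=> lh lk; apply: locint_eq (locintD lh (locintZ (-1) lk)) _ => x.
by rewrite mulN1r.
Qed.

Section integrals_with_parameters.
Context {R : realType}.
Local Notation mu := (@lebesgue_measure R).
Local Notation mu2 := (@lebesgue_measure R \x @lebesgue_measure R)%E.

Lemma measurable_Rintegral_param d (X : measurableType d) (K : X * R -> R) :
  measurable_fun setT K -> measurable_fun setT (fun x => \int[mu]_t K (x, t)).
Proof.
move=> mK; apply: (measurableT_comp (fine_measurable measurableT)).
rewrite (_ : (fun x => _) = (fun x => \int[mu]_t ((EFin \o K)^\+ (x, t)) -
   \int[mu]_t ((EFin \o K)^\- (x, t)))%E); last first.
  apply/funext => x; rewrite integralE; congr (_ - _)%E; apply: eq_integral => t _.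
    by rewrite !funeposE.
  by rewrite !funenegE.
have mEK : measurable_fun setT (EFin \o K) by exact/measurable_EFinP.
apply: emeasurable_funB.
- apply: (measurable_fun_fubini_tonelli_F (m2 := mu) ((EFin \o K)^\+)%E) => //.
  exact: measurable_funepos.
- apply: (measurable_fun_fubini_tonelli_F (m2 := mu) ((EFin \o K)^\-)%E) => //.
  exact: measurable_funeneg.
Qed.

(** The moving bound of integration is encoded in the indicators of [A1] and [A2], which turns the
    primitive into partial integrals over the whole line of jointly measurable functions. *)
Lemma measurable_prim (g : R * R -> R) : measurable_fun setT g ->
  measurable_fun setT (fun x : R * R => prim (fun t => g (t, x.2)) x.1).
Proof.
move=> mg.
pose A1 := [set x : (R * R) * R | 0 <= x.2] `&` [set x | x.2 <= x.1.1].
pose A2 := [set x : (R * R) * R | x.2 <= 0] `&` [set x | x.1.1 <= x.2].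
pose A3 := [set x : R * R | 0 <= x.1].
pose K1 (x : (R * R) * R) : R := g (x.2, x.1.2) * \1_A1 x.
pose K2 (x : (R * R) * R) : R := g (x.2, x.1.2) * \1_A2 x.
have m11 : measurable_fun setT (fun x : (R * R) * R => x.1.1).
  by apply: (measurableT_comp (f := fst)).
have m12 : measurable_fun setT (fun x : (R * R) * R => x.1.2).
  by apply: (measurableT_comp (f := snd)).
have mle (f h : (R * R) * R -> R) : measurable_fun setT f -> measurable_fun setT h ->
    measurable [set x | f x <= h x].
  by move=> mf mh; rewrite -[X in measurable X]setTI; exact: measurable_fun_le.
have mA1 : measurable A1 by apply: measurableI; apply: mle.
have mA2 : measurable A2 by apply: measurableI; apply: mle.
have mA3 : measurable A3.
  by rewrite -[X in measurable X]setTI; apply: measurable_fun_le.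
have mgp : measurable_fun setT (fun x : (R * R) * R => g (x.2, x.1.2)).
  by apply: (measurableT_comp mg); exact: measurable_fun_pair.
have mK1 : measurable_fun setT K1 by apply: measurable_funM => //; exact: measurable_indic.
have mK2 : measurable_fun setT K2 by apply: measurable_funM => //; exact: measurable_indic.
rewrite (_ : (fun x => _) = (fun x => \1_A3 x * \int[mu]_t K1 (x, t) -
    \1_(~` A3) x * \int[mu]_t K2 (x, t))).
  apply: measurable_funB; (apply: measurable_funM; last exact: measurable_Rintegral_param);
    apply: measurable_indic => //; exact: measurableC.
apply/funext => -[t s]; rewrite /prim /=.
have E1 x : \1_A1 (t, s, x) = (x \in `[0, t])%:R :> R.
  rewrite indicE; congr (_%:R); congr nat_of_bool.
  by rewrite in_itv/=; apply/idP/andP; rewrite inE.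
have E2 x : \1_A2 (t, s, x) = (x \in `[t, 0])%:R :> R.
  rewrite indicE; congr (_%:R); congr nat_of_bool.
  by rewrite in_itv/=; apply/idP/andP; rewrite inE /A2 /= => -[].
have E3 : (t, s) \in A3 = (0 <= t) by apply/idP/idP; rewrite inE.
have E4 : (t, s) \in ~` A3 = ~~ (0 <= t) by rewrite in_setC E3.
rewrite !indicE E3 E4; have [t0|t0] := leP 0 t.
  rewrite mul1r mul0r subr0 [LHS]Rintegral_mkcond; apply: eq_Rintegral => x _.
  by rewrite /K1 /= E1 patchE mem_setE; case: (x \in _); rewrite ?mulr1 ?mulr0.
rewrite mul1r mul0r sub0r [X in - X = _]Rintegral_mkcond; congr (- _).
apply: eq_Rintegral => x _.
by rewrite /K2 /= E2 patchE mem_setE; case: (x \in _); rewrite ?mulr1 ?mulr0.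
Qed.

End integrals_with_parameters.

Section absolutely_continuous_on_lines.
Context {R : realType}.
Local Notation mu := (@lebesgue_measure R).
Local Notation mu2 := (@lebesgue_measure R \x @lebesgue_measure R)%E.

Lemma integrable_boundedM d (T : measurableType d) (m : {measure set T -> \bar R})
    (A : set T) (k h : T -> R) (C : R) : measurable A -> measurable_fun A k ->
  (forall x, A x -> `|k x| <= C) -> m.-integrable A (EFin \o h) ->
  m.-integrable A (EFin \o (fun x => k x * h x)).
Proof.
move=> mA mk kC ih.
have mh : measurable_fun A h by have /integrableP[/measurable_EFinP] := ih.
have iC := @integrableZl _ _ _ m _ mA C _ (integrable_norm ih).
apply: (@integrable_le _ _ _ m _ _ (fun x => C * `|h x|)) => //.
- exact: measurable_funM.
- by move=> x Ax; rewrite normrM ler_wpM2r// kC.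
Qed.

Lemma test1_is_derive (b : R -> R) : test1 b -> forall t, is_derive t (1 : R) b (derive1 b t).
Proof. by move=> [db _ _ _] t; rewrite derive1E; apply: DeriveDef. Qed.

Lemma test1_bound (a : R -> R) : test1 a ->
  exists N : nat, exists C, forall t,
    [/\ `|a t| <= C, `|derive1 a t| <= C & (N%:R < `|t| -> a t = 0 /\ derive1 a t = 0)].
Proof.
move=> [da ca ca' [M hM]].
pose N := (Num.bound `|M|).+1.
have MN : M < N%:R.
  apply: le_lt_trans (ler_norm _) _; apply: lt_trans (archi_boundP (normr_ge0 M)) _.
  by rewrite ltr_nat.
have a0 t : N%:R < `|t| -> a t = 0 /\ derive1 a t = 0.
  move=> Nt; split; first by apply: hM; exact: lt_trans Nt.
  rewrite derive1E.
  have -> : 'D_1 a t = 'D_1 (cst 0 : R -> R) t.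
    apply: near_eq_derive; near=> x; apply: hM; apply: lt_trans MN _.
    near: x; apply: (@cvgr_norm_gt _ _ _ _ _ id t) => //; exact: cvg_id.
  exact: derive_cst.
have [C1 [C10 h1]] := continuous_bounded_itv (- N%:R) N%:R ca.
have [C2 [C20 h2]] := continuous_bounded_itv (- N%:R) N%:R ca'.
exists N, (Num.max C1 C2) => t; split => //.
- have [/a0[-> _]|tN] := ltP N%:R `|t|; first by rewrite normr0 le_max C10.
  by rewrite le_max h1// -ler_norml.
- have [/a0[_ ->]|tN] := ltP N%:R `|t|; first by rewrite normr0 le_max C10.
  by rewrite le_max h2 ?orbT// -ler_norml.
- exact: a0.
Unshelve. all: by end_near. Qed.

Lemma Rintegral_setT_support d (T : measurableType d) (m : {measure set T -> \bar R})
    (A : set T) (f : T -> R) : (forall x, ~ A x -> f x = 0) ->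
  \int[m]_x f x = \int[m]_(x in A) f x.
Proof.
move=> f0; rewrite [RHS]Rintegral_mkcond; apply: eq_Rintegral => x _.
by rewrite patchE; case: ifPn => // /negP; rewrite inE; exact: f0.
Qed.

Lemma ae_eq_Rintegral d (T : measurableType d) (m : {measure set T -> \bar R})
    (A : set T) (f1 f2 : T -> R) : measurable A -> measurable_fun A f1 ->
  measurable_fun A f2 -> {ae m, forall x, A x -> f1 x = f2 x} ->
  \int[m]_(x in A) f1 x = \int[m]_(x in A) f2 x.
Proof.
move=> mA m1 m2 e; rewrite /Rintegral; congr fine; apply: ae_eq_integral => //.
- exact/measurable_EFinP.
- exact/measurable_EFinP.
- by apply: (ae_imp e) => x h Ax; rewrite /= h.
Qed.

(** Zero mean is exactly what makes the primitive that vanishes on the left of the support vanish on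
    the right of it too. *)
Lemma test1_prim (k : R -> R) (M : R) : continuous k -> 0 <= M ->
  (forall t, t <= - M \/ M <= t -> k t = 0) -> \int[mu]_(t in `[- M, M]) k t = 0 ->
  exists2 a, test1 a & derive1 a = k.
Proof.
move=> ck M0 k0 ik; have lk := continuous_locint ck.
have A := prim_AC lk; set y := prim k in A.
have dy t : is_derive t (1 : R) y (k t).
  have ti : t - 1 < t by rewrite ltrBlDr ltrDl.
  have := @continuous_FTC1_closed R k (t - 1) t (t + 1) _ (lk _ _).
  move=> /(_ _)/(_ ti (ck t))[|dF F']; first by rewrite ltrDl.
  set F := fun x => _ in dF F'.
  have yF : \forall x \near t, y (t - 1) + F x = y x.
    near=> x; rewrite /F /= -(proj2 A); first by rewrite addrC subrK.
    by apply: ltW; near: x; apply: lt_nbhsr.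
  have dF1 : is_derive t (1 : R) (fun x => y (t - 1) + F x) (k t).
    have : is_derive t (1 : R) F (k t) by rewrite -F' derive1E; exact: DeriveDef.
    by move=> dF1; have := is_deriveD (is_derive_cst (y (t - 1)) t (1 : R)) dF1; rewrite add0r.
  by apply: near_eq_is_derive yF _.
exists (fun t => y t - y (- M)).
  apply: (@test1P R _ k) => //.
    move=> t; have := is_deriveB (dy t) (is_derive_cst (y (- M)) t (1 : R)).
    by rewrite subr0.
  have z r s : r <= s -> (forall t, r <= t <= s -> k t = 0) -> y s - y r = 0.
    move=> rs kz; rewrite (proj2 A)//.
    rewrite (@eq_Rintegral _ _ _ mu _ (cst 0)).
      by rewrite Rintegral_itv_cst// mul0r.
    by move=> t; rewrite inE /= in_itv/=; exact: kz.
  exists M => t Mt; have [t0|t0] := leP 0 t.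
    rewrite ger0_norm// in Mt.
    rewrite -(subrKA (y M)) (z M t (ltW Mt)) ?add0r.
      by rewrite (proj2 A) ?ik// -subr_ge0 opprK addr_ge0.
    by move=> x /andP[Mx _]; apply: k0; right.
  rewrite ltr0_norm// in Mt.
  apply/eqP; rewrite subr_eq0 eq_sym -subr_eq0; apply/eqP; apply: z.
    by rewrite -lerN2 opprK ltW.
  by move=> x /andP[_ xM]; apply: k0; left.
apply/funext => t; rewrite derive1E.
have := is_deriveB (dy t) (is_derive_cst (y (- M)) t (1 : R)).
by rewrite subr0 => -[].
Unshelve. all: by end_near. Qed.

Section ACL.
Variables f g : R * R -> R.
Hypotheses (mf : measurable_fun setT f) (mg : measurable_fun setT g).
Let sq (n : nat) := (`[- n%:R, n%:R] `*` `[- n%:R, n%:R] : set (R * R)).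
Hypotheses (lf : forall n, mu2.-integrable (sq n) (EFin \o f))
           (lg : forall n, mu2.-integrable (sq n) (EFin \o g)).
Hypothesis fg : forall a b, test1 a -> test1 b ->
  \int[mu2]_z ((f z * derive1 a z.1 + g z * a z.1) * b z.2) = 0.

Let itv_nat (x : R) : exists N : nat, `|x| <= N%:R.
Proof. by exists (Num.bound `|x|); exact/ltW/archi_boundP/normr_ge0. Qed.

Let slice_locint (h : R * R -> R) : measurable_fun setT h ->
  (forall n, mu2.-integrable (sq n) (EFin \o h)) ->
  {ae mu, forall s, locint (fun t => h (t, s))}.
Proof.
move=> mh lh.
have H : {ae mu, forall s (n : nat), `[- n%:R, n%:R]%classic s ->
  mu.-integrable `[- n%:R, n%:R] (fun t => (h (t, s))%:E)}.
  by apply: ae_foralln => n; exact: (fubini_rect_ae2 (measurable_itvR _) (measurable_itvR _) (lh n)).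
apply: (ae_imp H) => s hs c d.
have [N1 s1] := itv_nat s; have [N2 c2] := itv_nat c; have [N3 d3] := itv_nat d.
pose N := (N1 + N2 + N3)%N.
have hN : `[- N%:R, N%:R]%classic s.
  rewrite /= in_itv/= -ler_norml (le_trans s1)// ler_nat /N -addnA leq_addr//.
apply: integrableS (hs N hN) => //; apply: subset_itvScc; rewrite bnd_simp.
  rewrite lerNl; apply: (@le_trans _ _ `|c|); first by rewrite -normrN ler_norm.
  by rewrite (le_trans c2)// ler_nat /N addnAC leq_addl.
by rewrite (le_trans (ler_norm _))// (le_trans d3)// ler_nat /N leq_addl.
Qed.

(** The defect of the weak derivative relation on the row [s], for the test function [a]. *)
Let Q a s := \int[mu]_t (f (t, s) * derive1 a t + g (t, s) * a t).

(** Testing with [a(x_1) b(x_2)] and integrating in [x_1] first leaves a zero integral of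
    [Q a s * b s] for every [b]. The null set of rows obtained in this way depends on [a]. *)
Let Q0 a : test1 a -> {ae mu, forall s, Q a s = 0}.
Proof.
move=> ta; have [Na [Ca ha]] := test1_bound ta.
have [_ ca ca' _] := ta.
pose F z := f z * derive1 a z.1 + g z * a z.1.
have mf1 (k : R -> R) : continuous k -> measurable_fun setT (fun z : R * R => k z.1).
  by move=> ck; apply: (measurableT_comp (continuous_measurable_fun ck)).
have mf2 (k : R -> R) : continuous k -> measurable_fun setT (fun z : R * R => k z.2).
  by move=> ck; apply: (measurableT_comp (continuous_measurable_fun ck)).
have msq n : measurable (sq n : set (measurableTypeR R * measurableTypeR R)%type).
  by apply: measurableX; exact: measurable_itvR.
have iF n : mu2.-integrable (sq n) (EFin \o F).
  have i1 : mu2.-integrable (sq n) (EFin \o (fun z => derive1 a z.1 * f z)).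
    apply: (@integrable_boundedM _ _ mu2 _ _ _ Ca) => //.
      by apply: measurable_funTS; exact: mf1.
    by move=> z _; have [] := ha z.1.
  have i2 : mu2.-integrable (sq n) (EFin \o (fun z => a z.1 * g z)).
    apply: (@integrable_boundedM _ _ mu2 _ _ _ Ca) => //.
      by apply: measurable_funTS; exact: mf1.
    by move=> z _; have [] := ha z.1.
  have := integrableD (msq n) i1 i2.
  by apply: eq_integrable => // z _ /=; rewrite /F EFinD mulrC [g z * _]mulrC.
have F0 z : Na%:R < `|z.1| -> F z = 0.
  by move=> h; have [_ _ /(_ h)[a0 a'0]] := ha z.1; rewrite /F a0 a'0 !mulr0 addr0.
have QE n s : (Na <= n)%N -> Q a s = \int[mu]_(t in `[- n%:R, n%:R]) F (t, s).
  move=> Nan; apply: Rintegral_setT_support => t; rewrite /= in_itv/= -ler_norml => /negP.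
  by rewrite -ltNge => h; apply: (F0 (t, s)); apply: le_lt_trans h; rewrite ler_nat.
have lQ : locint (Q a).
  move=> c d; have [N2 c2] := itv_nat c; have [N3 d3] := itv_nat d.
  pose N := (Na + N2 + N3)%N.
  have := fubini_rect_int2 (measurable_itvR _) (measurable_itvR _) (iF N).
  move=> h.
  rewrite (_ : Q a = fun s => \int[mu]_(t in `[- N%:R, N%:R]) F (t, s)); last first.
    by apply/funext => s; apply: QE; rewrite /N -addnA leq_addr.
  apply: integrableS h => //; apply: subset_itvScc; rewrite bnd_simp.
    rewrite lerNl; apply: (@le_trans _ _ `|c|); first by rewrite -normrN ler_norm.
    by rewrite (le_trans c2)// ler_nat /N addnAC leq_addl.
  by rewrite (le_trans (ler_norm _))// (le_trans d3)// ler_nat /N leq_addl.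
apply: fundamental_lemma => // b tb; have [Nb [Cb hb]] := test1_bound tb; have [_ cb _ _] := tb.
pose N := (Na + Nb)%N.
rewrite -[RHS](fg ta tb).
have iFb : mu2.-integrable (sq N) (EFin \o (fun z => b z.2 * F z)).
  apply: (@integrable_boundedM _ _ mu2 _ _ _ Cb) => //.
    by apply: measurable_funTS; exact: mf2.
  by move=> z _; have [] := hb z.2.
rewrite [RHS](@Rintegral_setT_support _ _ mu2 (sq N)); last first.
  move=> z /not_andP[] /negP; rewrite /= in_itv/= -ler_norml -ltNge => h.
    rewrite -/(F z) F0 ?mul0r//; apply: le_lt_trans h; rewrite ler_nat leq_addr//.
  have [_ _ /(_ _)[|-> _]] := hb z.2; rewrite ?mulr0//.
  by apply: le_lt_trans h; rewrite ler_nat leq_addl.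
transitivity (\int[mu2]_(z in sq N) (b z.2 * F z)); last first.
  by apply: eq_Rintegral => z _; rewrite mulrC.
rewrite (fubini_rect2 (measurable_itvR _) (measurable_itvR _) iFb).
rewrite (@Rintegral_setT_support _ _ mu `[- N%:R, N%:R]); last first.
  move=> s; rewrite /= in_itv/= -ler_norml => /negP; rewrite -ltNge => h.
  have [_ _ /(_ _)[|-> _]] := hb s; rewrite ?mulr0//.
  by apply: le_lt_trans h; rewrite ler_nat leq_addl.
apply: ae_eq_Rintegral => //.
- apply: measurable_funTS; apply: measurable_funM; first exact: locint_measurable.
  exact: continuous_measurable_fun.
- exact: (measurable_fine_fubini2 (measurable_itvR _) (measurable_itvR _) iFb).
- apply: (ae_imp (fubini_rect_ae2 (measurable_itvR _) (measurable_itvR _) (iF N))) => s hs sN.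
  rewrite /= RintegralZl//; last exact: hs.
  by rewrite mulrC (QE N)// leq_addr.
Qed.

(** The integrals of the plateaus on [[0, 1]] tend to 1, so one of them is not 0. *)
Let rho_ex : exists n0, \int[mu]_(t in `[0, 1]) plateau (0 : R) 1 n0 t != 0.
Proof.
have l1 : locint (fun=> 1 : R) by apply: continuous_locint => x; exact: cvg_cst.
have := plateau_integral_cvg ltr01 l1.
rewrite Rintegral_itv_cst// subr0 mulr1 => /cvgrPdist_lt/(_ 1 ltr01)[n0 _ /(_ n0 (leqnn _))].
move=> h; exists n0; apply/eqP => e; move: h.
under eq_Rintegral do rewrite mul1r.
by rewrite e subr0 normr1 ltxx.
Qed.

Let n0 := projT1 (cid rho_ex).
Let rho := plateau (0 : R) 1 n0.
Let I0 := \int[mu]_(t in `[0, 1]) rho t.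
Let I0_neq0 : I0 != 0. Proof. exact: (projT2 (cid rho_ex)). Qed.

Let kap (r s : R) n := (\int[mu]_(t in `[r, s]) plateau r s n t) / I0.

Let plateau_integral (r s : R) n N (h : R -> R) : r < s -> - N <= r -> s <= N ->
  \int[mu]_(t in `[- N, N]) (h t * plateau r s n t) =
  \int[mu]_(t in `[r, s]) (h t * plateau r s n t).
Proof.
move=> rs Nr sN; rewrite -(@Rintegral_setT_itv R (fun t => h t * plateau r s n t) (- N) N).
  by rewrite (@Rintegral_setT_itv R _ r s)// => t /(plateau_out rs) ->; rewrite mulr0.
move=> t tN; rewrite plateau_out ?mulr0//.
by case: tN => tN; [left; exact: le_trans tN Nr|right; exact: le_trans sN tN].
Qed.

(* With [phi] a plateau approximating an indicator, [phi - k * rho] has zero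
   mean for a suitable [k], hence is the derivative of a test function. *)
Let test_ex (r s : R) n : r < s -> exists2 a, test1 a &
  derive1 a = fun t => plateau r s n t - kap r s n * rho t.
Proof.
move=> rs; pose N := `|r| + `|s| + 1.
have N0 : 0 <= N by rewrite /N !addr_ge0.
have Nr : - N <= r.
  by rewrite lerNl (le_trans (ler_norm _))// normrN /N -addrA lerDl addr_ge0.
have sN : s <= N by rewrite (le_trans (ler_norm _))// /N addrAC lerDr addr_ge0.
have N1 : 1 <= N by rewrite /N lerDr addr_ge0.
have cr := continuous_locint (@continuous_plateau R r s n).
have cp := continuous_locint (@continuous_plateau R 0 1 n0).
apply: (@test1_prim _ N) => //.
- move=> t; apply: cvgB; first exact: (@continuous_plateau R r s n).
  by apply: cvgM; [exact: cvg_cst|exact: (@continuous_plateau R 0 1 n0)].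
- move=> t tN; rewrite plateau_out//; last by case: tN => tN; [left; exact: le_trans tN Nr|right; exact: le_trans sN tN].
  rewrite /rho plateau_out ?mulr0 ?subr0//.
  by case: tN => tN; [left; apply: (le_trans tN); rewrite oppr_le0|right; exact: le_trans N1 tN].
- rewrite RintegralB; [|by []|exact: cr|exact: (locintZ _ cp)].
  rewrite RintegralZl; [|by []|exact: cp].
  have := @plateau_integral r s n N (fun=> 1) rs Nr sN.
  have := @plateau_integral 0 1 n0 N (fun=> 1) ltr01 _ N1.
  rewrite oppr_le0 => /(_ N0).
  have m1 A (h : R -> R) : \int[mu]_(t in A) (1 * h t) = \int[mu]_(t in A) h t.
    by apply: eq_Rintegral => t _; rewrite mul1r.
  rewrite !m1.
  by rewrite -/rho -/I0 => -> ->; rewrite /kap divfK// subrr.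
Qed.

Let P (x : R * R) := prim (fun t => g (t, x.2)) x.1.
(** The constant expected on the row [s], written as a weighted mean of [f - P] so that it is
    measurable in [s]. *)
Let cc s := (\int[mu]_t ((f (t, s) - P (t, s)) * rho t)) / I0.

(** With [P] the primitive of [g] along rows, [f - P] should be constant on almost every row. All
    test functions together would leave uncountably many null sets; those whose derivative is a
    plateau on a rational interval minus a multiple of [rho] form a countable family. They suffice,
    because they force [f - P - cc] to have zero integral over every rational interval. *)
Lemma ACL : exists ft, [/\ measurable_fun setT ft, {ae mu2, forall z, f z = ft z} &
  {ae mu, forall s, AC (fun t => ft (t, s)) (fun t => g (t, s))}].
Proof.
have mP : measurable_fun setT P by exact: measurable_prim.
have mcc : measurable_fun setT cc.
  apply: measurable_funM; last exact: measurable_cst.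
  apply: (measurable_Rintegral_param (K := fun x => (f (x.2, x.1) - P (x.2, x.1)) * rho x.2)).
  have ms : measurable_fun setT (fun x : R * R => (x.2, x.1)) by exact: measurable_fun_pair.
  apply: measurable_funM.
    by apply: measurable_funB; [exact: (measurableT_comp mf ms)|exact: (measurableT_comp mP ms)].
  apply: (measurableT_comp (f := rho)) => //.
  exact: (continuous_measurable_fun (@continuous_plateau R 0 1 n0)).
pose ft x := cc x.2 + P x.
have mft : measurable_fun setT ft.
  have m1 : measurable_fun setT (fun x : R * R => cc x.2) by exact: (measurableT_comp mcc measurable_snd).
  exact: measurable_funD.
(* Rational intervals and indices are enumerated by [unpickle], so that one null set serves for all
   of them. *)
have H : {ae mu, forall s (k : nat) (q : rat * rat) n, unpickle k = Some (q, n) ->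
    ratr q.1 < ratr q.2 :> R -> exists a, [/\ test1 a,
      derive1 a = (fun t => plateau (ratr q.1) (ratr q.2) n t - kap (ratr q.1) (ratr q.2) n * rho t)
      & Q a s = 0]}.
  apply: ae_foralln => k.
  case e : (unpickle k : option ((rat * rat) * nat)) => [[q n]|]; last by apply: aeW => s q n.
  have [q12|q12] := boolP (ratr q.1 < ratr q.2 :> R); last first.
    by apply: aeW => s q' n' [<- _]; rewrite (negbTE q12).
  have [a ta a'] := test_ex n q12.
  by apply: (ae_imp (Q0 ta)) => s qs q' n' [<- <-] _; exists a.
have good : {ae mu, forall s, AC (fun t => ft (t, s)) (fun t => g (t, s)) /\
    {ae mu, forall t, f (t, s) = ft (t, s)}}.
  apply: (ae_imp3 (slice_locint mf lf) (slice_locint mg lg) H) => s lfs lgs hs.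
  have Ay := prim_AC lgs; set y := prim (fun t => g (t, s)) in Ay.
  split.
    apply: AC_eq (AC_lin 1 (AC_cst (cc s)) Ay) _ _ => t; first by rewrite mul1r.
    by rewrite mul1r add0r.
  have ly : locint y by apply: continuous_locint; exact: AC_continuous Ay.
  pose F t := f (t, s) - y t.
  have lF : locint F.
    exact: locintB.
  have ccE : cc s = (\int[mu]_(t in `[0, 1]) (F t * rho t)) / I0.
    congr (_ / _); apply: Rintegral_setT_itv => t /(plateau_out ltr01).
    by rewrite /rho => ->; rewrite mulr0.
  suff : {ae mu, forall t, F t - cc s = 0}.
    by move/ae_imp; apply => t; rewrite /F /ft /P /= -/y => /eqP; rewrite subr_eq0 => /eqP <-; rewrite subrK.
  have lFc : locint (fun t => F t - cc s).
    by apply: locintB => //; apply: continuous_locint => x; exact: cvg_cst.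
  apply: locint_ae0 => // qa qb; rewrite le_eqVlt => /predU1P[->|qab]; first exact: Rintegral_itv11.
  have rab : ratr qa < ratr qb :> R by rewrite ltr_rat.
  move: (hs) => {}hs.
  have key n : \int[mu]_(t in `[ratr qa, ratr qb]) ((F t - cc s) * plateau (ratr qa) (ratr qb) n t) = 0.
    have [a [ta a' Qas]] := hs (pickle ((qa, qb), n)) (qa, qb) n (pickleK _) rab.
    rewrite /= in a'; move: (ratr qa) (ratr qb) rab a' => r r' rr' a'.
    have [N1 [C1 ha]] := test1_bound ta; have [da ca ca' _] := ta.
    pose N := N1%:R + `|r| + `|r'| + 1.
    have N0 : 0 <= N by rewrite /N !addr_ge0.
    have Nr : - N <= r.
      by rewrite lerNl (le_trans (ler_norm _))// normrN /N addrAC -!addrA addrCA lerDl !addr_ge0.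
    have sN : r' <= N by rewrite (le_trans (ler_norm _))// /N addrAC lerDr !addr_ge0.
    have N11 : 1 <= N by rewrite /N lerDr !addr_ge0.
    have NN1 : N1%:R < N by rewrite /N -!addrA ltrDl ltr_wpDl// ltr_wpDl.
    have aN t : N <= `|t| -> a t = 0 /\ derive1 a t = 0.
      by move=> h; have [_ _] := ha t; apply; exact: lt_le_trans h.
    have e1 : \int[mu]_(t in `[- N, N]) (f (t, s) * derive1 a t + g (t, s) * a t) = 0.
      rewrite -Qas /Q; apply/esym; apply: Rintegral_setT_itv => t tN.
      have /aN[-> ->] : N <= `|t|; last by rewrite !mulr0 addr0.
      case: tN => tN; first by rewrite -normrN (le_trans _ (ler_norm _))// lerNr.
      by rewrite (le_trans tN) ?ler_norm.
    have Aa : AC a (derive1 a) by apply: AC_C1 => //; exact: test1_is_derive.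
    have [lya yaE] := AC_mul Ay Aa.
    (* Integration by parts of the primitive [y] against [a]; subtracting it from the relation for
       [f] eliminates [g]. *)
    have e2 : \int[mu]_(t in `[- N, N]) (g (t, s) * a t + y t * derive1 a t) = 0.
      rewrite -yaE; last by rewrite ge0_cp.
      have [-> _] := aN N (ler_norm _); have [-> _] := aN (- N) (ltac:(by rewrite normrN ler_norm)).
      by rewrite !mulr0 subrr.
    have i1 : locint (fun t => f (t, s) * derive1 a t + g (t, s) * a t).
      apply: locint_eq (locintD (locint_cM ca' lfs) (locint_cM ca lgs)) _ => t.
      by rewrite mulrC [a t * _]mulrC.
    have e3 : \int[mu]_(t in `[- N, N]) (F t * derive1 a t) = 0.
      rewrite -[RHS](subrr 0) -{1}e1 -{1}e2 -RintegralB; [|by []|exact: i1|exact: lya].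
      by apply: eq_Rintegral => t _; rewrite /F; ring.
    have cr := @continuous_plateau R r r' n.
    have cp := @continuous_plateau R 0 1 n0.
    have e4 : \int[mu]_(t in `[- N, N]) (F t * plateau r r' n t) =
              kap r r' n * \int[mu]_(t in `[- N, N]) (F t * rho t).
      have lFr : locint (fun t => F t * rho t).
        by apply: locint_eq (locint_cM cp lF) _ => t; rewrite mulrC.
      have lFp : locint (fun t => F t * plateau r r' n t).
        by apply: locint_eq (locint_cM cr lF) _ => t; rewrite mulrC.
      apply/eqP; rewrite -subr_eq0 -RintegralZl; [|by []|exact: lFr].
      rewrite -RintegralB; [|by []|exact: lFp|exact: (locintZ _ lFr)].
      rewrite -[X in _ == X]e3; apply/eqP; apply: eq_Rintegral => t _.
      by rewrite a'; ring.
    rewrite (plateau_integral _ _ rr' Nr sN) in e4.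
    rewrite (plateau_integral _ _ ltr01 _ N11) ?oppr_le0// -/rho in e4.
    have lFp : locint (fun t => F t * plateau r r' n t).
      by apply: locint_eq (locint_cM cr lF) _ => t; rewrite mulrC.
    transitivity (\int[mu]_(t in `[r, r']) (F t * plateau r r' n t) - cc s * \int[mu]_(t in `[r, r']) plateau r r' n t).
      rewrite -RintegralZl; [|by []|exact: (continuous_locint cr)].
      rewrite -RintegralB; [|by []|exact: lFp|exact: (locintZ _ (continuous_locint cr))].
      by apply: eq_Rintegral => t _; ring.
    by rewrite e4 ccE /kap; field.
  have := plateau_integral_cvg rab lFc.
  under eq_fun do rewrite key.
  by move=> /(cvg_unique _ (cvg_cst _)) <-.
exists ft; split => //; last by apply: (ae_imp good) => s [].
apply: ae_prod2_conv; last by apply: (ae_imp good) => s [].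
rewrite (_ : (fun z => f z = ft z) = (fun z => f z - ft z) @^-1` [set 0]).
  by rewrite -[X in measurable X]setTI; apply: (measurable_funB mf mft).
by apply/seteqP; split=> z /= h; [rewrite h subrr|apply/eqP; rewrite -subr_eq0 h].
Qed.

End ACL.
End absolutely_continuous_on_lines.

(** * Periodic functions of one variable and their difference quotients *)

Section periodic_functions.
Context {R : realType}.
Local Notation mu := (@lebesgue_measure R).
Implicit Types (y k : R -> R).

Lemma continuous_sqr (f : R -> R) : continuous f -> continuous (fun x => f x ^+ 2).
Proof.
move=> cf x; apply: (@continuous_comp _ _ _ f (fun z => z ^+ 2)); first exact: cf.
exact: exprn_continuous.
Qed.

Lemma AC_sub y1 h1 y2 h2 : AC y1 h1 -> AC y2 h2 ->
  AC (fun t => y1 t - y2 t) (fun t => h1 t - h2 t).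
Proof.
by move=> A1 A2; apply: AC_eq (AC_lin (-1) A1 A2) _ _ => t; rewrite mulN1r.
Qed.

Lemma AC_der0_cst y k : AC y k -> {ae mu, forall t, k t = 0} -> forall s t, y s = y t.
Proof.
move=> A k0.
have h a b : a <= b -> y b - y a = 0.
  move=> ab; rewrite (proj2 A)// (@ae_eq_Rintegral _ _ _ mu _ _ (fun=> 0))//.
  - by rewrite Rintegral_itv_cst// mul0r.
  - by apply: measurable_funTS; apply: locint_measurable; case: A.
  - by apply: (ae_imp k0).
move=> s t; apply/eqP; rewrite -subr_eq0; apply/eqP.
by have [/h/eqP|/ltW/h//] := leP s t; rewrite subr_eq0 eq_sym -subr_eq0 => /eqP.
Qed.

Lemma AC_cst_der0 y k : AC y k -> (forall s t, y s = y t) -> {ae mu, forall t, k t = 0}.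
Proof.
move=> [lk yk] yc; apply: locint_ae0 => // a b ab.
by rewrite -yk ?ler_rat// (yc _ (ratr a)) subrr.
Qed.

Lemma ae_eq_continuous (y1 y2 : R -> R) : continuous y1 -> continuous y2 ->
  {ae mu, forall t, y1 t = y2 t} -> y1 =1 y2.
Proof.
move=> c1 c2 h t; apply/eqP; rewrite -subr_eq0; apply/negPn/negP => n0.
have cd : continuous (fun s => y1 s - y2 s) by move=> s; apply: cvgB; [exact: c1|exact: c2].
have : 0 < `|y1 t - y2 t| by rewrite normr_gt0.
move=> e0; have /cvgrPdist_lt/(_ _ e0)/nbhs_ballP[d /= d0 hd] := cd t.
have : ~ mu.-negligible (ball t d).
  move=> /(negligibleP mu (measurable_ball _ _)).1 /eqP.
  move=> /eqP e2; have := etrans (esym (lebesgue_measure_ball t (ltW d0))) e2 => /eqP.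
  by rewrite eqe mulrn_eq0 /= gt_eqF.
apply; apply: negligibleS h => s ts /= e.
by have := hd s ts; rewrite /= e subrr subr0 ltxx.
Qed.

Lemma AC_periodic_der y k : AC y k -> (forall s, y (s + 1) = y s) ->
  {ae mu, forall s, k (s + 1) = k s}.
Proof.
move=> A py; have := AC_cst_der0 (AC_sub (AC_shift 1 A) A).
move=> /(_ _)/ae_imp; apply; first by move=> s t; rewrite !py !subrr.
by move=> s /eqP; rewrite subr_eq0 => /eqP.
Qed.

(** The integral over [[c, c + 1]] is absolutely continuous in [c], with zero derivative almost
    everywhere. *)
Lemma periodic_integral k c : locint k -> {ae mu, forall s, k (s + 1) = k s} ->
  \int[mu]_(x in `[c, c + 1]) k x = \int[mu]_(x in `[0, 1]) k x.
Proof.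
move=> lk pk; have A := prim_AC lk.
have Ad := AC_sub (AC_shift 1 A) A.
have := AC_der0_cst Ad _ c 0; rewrite !(proj2 A) ?lerDl// add0r; apply.
by apply: (ae_imp pk) => s ->; rewrite subrr.
Qed.

Lemma periodic_integral_shift k c : locint k -> {ae mu, forall s, k (s + 1) = k s} ->
  \int[mu]_(x in `[0, 1]) k (x + c) = \int[mu]_(x in `[0, 1]) k x.
Proof.
by move=> lk pk; rewrite Rintegral_shift// add0r addrC periodic_integral.
Qed.

Definition diffq (h : R) y s := (y (s + h) - y s) / h.

Lemma Rintegral_sqr_itv k a b : a <= b -> locint k -> locint (fun s => k s ^+ 2) ->
  (\int[mu]_(x in `[a, b]) k x) ^+ 2 <= (b - a) * \int[mu]_(x in `[a, b]) (k x ^+ 2).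
Proof.
move=> ab lk lk2.
have s1 : sqint mu `[a, b] (fun=> 1 : R).
  split => //; have l1 : locint (fun=> 1 ^+ 2 : R) by apply: continuous_locint => x; exact: cvg_cst.
  exact: (l1 a b).
have s2 : sqint mu `[a, b] k.
  by split; [apply: measurable_funTS; exact: locint_measurable|exact: lk2].
have := cauchy_schwarz_Rintegral (measurable_itvR _) s1 s2.
rewrite (_ : \int[mu]_(x in `[a, b]) (1 * k x) = \int[mu]_(x in `[a, b]) k x); last first.
  by apply: eq_Rintegral => x _; rewrite mul1r.
by rewrite Rintegral_itv_cst// expr1n mul1r.
Qed.

(** By Cauchy-Schwarz on [[s, s + h]] the squared difference quotient is at most
    [(K (s + h) - K s) / h], with [K] a primitive of [k ^+ 2]. Its integral over a period is that of
    [k ^+ 2], because [K (s + 1) - K s] does not depend on [s]. *)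
Lemma diffq_L2_pos y k h : AC y k -> (forall s, y (s + 1) = y s) ->
  locint (fun s => k s ^+ 2) -> 0 < h ->
  \int[mu]_(s in `[0, 1]) (diffq h y s ^+ 2) <= \int[mu]_(s in `[0, 1]) (k s ^+ 2).
Proof.
move=> A py lk2 h0; have cy := AC_continuous A; have [lk yk] := A.
have AK := prim_AC lk2; set K := prim _ in AK.
have cK := AC_continuous AK.
have lK := continuous_locint cK.
have pk := AC_periodic_der A py.
have kap s : K (s + 1) - K s = \int[mu]_(x in `[0, 1]) (k x ^+ 2).
  rewrite (proj2 AK) ?lerDl// periodic_integral//.
  by apply: (ae_imp pk) => x ->.
set kp := \int[mu]_(x in _) _ in kap *.
have cd : continuous (fun s => diffq h y s ^+ 2).
  have c1 : continuous (diffq h y).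
    move=> s; apply: cvgM; last exact: cvg_cst.
    apply: cvgB; last exact: cy.
    by apply: (continuous_comp (f := fun s : R => s + h)); [apply: cvgD; [exact: cvg_id|exact: cvg_cst]|exact: cy].
  exact: continuous_sqr.
have lKh : locint (fun s => K (s + h)) by exact: locint_shift.
have lD : locint (fun s => h^-1 * (K (s + h) - K s)) by apply: locintZ; exact: locintB.
apply: (@le_trans _ _ (\int[mu]_(s in `[0, 1]) (h^-1 * (K (s + h) - K s)))).
  apply: le_Rintegral; [by []|exact: (continuous_locint cd)|exact: lD|].
  move=> s _; have sh : s <= s + h by rewrite lerDl ltW.
  rewrite /diffq (proj2 AK)// yk// exprMn.
  have := Rintegral_sqr_itv sh lk lk2; rewrite [s + h - s]addrC addKr => hh.
  rewrite exprVn mulrC expr2 invfM -mulrA ler_pM2l ?invr_gt0//.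
  by rewrite ler_pdivrMl.
rewrite RintegralZl; [|by []|exact: (locintB lKh lK)].
rewrite RintegralB; [|by []|exact: lKh|exact: lK].
rewrite (Rintegral_shift h 0 1 lK) add0r.
(* A primitive [J] of [K] turns the difference of the two integrals over unit windows into the
   integral of [K (x + 1) - K x] over [[0, h]]. *)
have AJ := prim_AC lK; set J := prim K in AJ.
have AJd := AC_sub (AC_shift 1 AJ) AJ.
have -> : \int[mu]_(x in `[h, 1 + h]) K x - \int[mu]_(x in `[0, 1]) K x = kp * h.
  have := proj2 AJd 0 h (ltW h0); rewrite add0r.
  have -> : \int[mu]_(x in `[0, h]) (K (x + 1) - K x) = kp * h.
    rewrite (@eq_Rintegral _ _ _ mu _ (fun=> kp)); last by move=> x _; exact: kap.
    by rewrite Rintegral_itv_cst ?ltW// subr0.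
  move=> <-.
  have -> : J (h + 1) - J h - (J 1 - J 0) = (J (h + 1) - J h) - (J 1 - J 0) by [].
  by rewrite [1 + h]addrC !(proj2 AJ) ?lerDl.
by rewrite mulrCA mulVf ?mulr1// gt_eqF.
Qed.

(** A negative step is a positive one seen from the other end point, and the translation by [h]
    keeps integrals over a period. *)
Lemma diffq_L2 y k h : AC y k -> (forall s, y (s + 1) = y s) ->
  locint (fun s => k s ^+ 2) -> h != 0 ->
  \int[mu]_(s in `[0, 1]) (diffq h y s ^+ 2) <= \int[mu]_(s in `[0, 1]) (k s ^+ 2).
Proof.
move=> A py lk2; rewrite neq_lt => /orP[h0|]; last exact: diffq_L2_pos.
have cy := AC_continuous A.
have cd : continuous (fun s => diffq (- h) y s ^+ 2).
  have c1 : continuous (diffq (- h) y).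
    move=> s; apply: cvgM; last exact: cvg_cst.
    apply: cvgB; last exact: cy.
    by apply: (continuous_comp (f := fun s : R => s - h)); [apply: cvgB; [exact: cvg_id|exact: cvg_cst]|exact: cy].
  exact: continuous_sqr.
rewrite (_ : \int[mu]_(s in `[0, 1]) _ = \int[mu]_(s in `[0, 1]) (diffq (- h) y (s + h) ^+ 2)); last first.
  apply: eq_Rintegral => s _; congr (_ ^+ 2); rewrite /diffq addrK.
  by rewrite invrN mulrN -mulNr opprB.
rewrite (@periodic_integral_shift (fun s => diffq (- h) y s ^+ 2) h); first by apply: diffq_L2_pos => //; rewrite oppr_gt0.
- exact: continuous_locint.
- by apply: aeW => s; rewrite /diffq addrAC !py.
Qed.

Lemma diffq_cvg y (l s : R) (h_ : nat -> R) : is_derive s (1 : R) y l ->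
  (forall n, h_ n != 0) -> h_ n @[n --> \oo] --> 0 ->
  diffq (h_ n) y s @[n --> \oo] --> l.
Proof.
move=> [dy yl] hn0 h0.
have : (y (h + s) - y s) * h^-1 @[h --> 0^'] --> l.
  move/cvg_ex: dy => [k hk]; rewrite -yl /derive; move: hk; rewrite /= => hk.
  have -> : lim (h^-1 *: (((fun u : R => y (u + s)) \o *:%R^~ 1) h - y s) @[h --> 0^']) = k.
    exact: cvg_lim hk.
  apply: cvg_trans hk; apply: near_eq_cvg; near=> h => /=.
  by rewrite /GRing.scale/= mulr1 mulrC.
move/cvgr_dnbhsP => /(_ h_ (conj hn0 h0)); apply: cvg_trans; apply: near_eq_cvg; near=> n.
by rewrite /diffq [h_ n + s]addrC.
Unshelve. all: by end_near. Qed.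

Lemma diffq_ae_cvg y k (h_ : nat -> R) : AC y k ->
  (forall n, h_ n != 0) -> h_ n @[n --> \oo] --> 0 ->
  {ae mu, forall s, diffq (h_ n) y s - k s @[n --> \oo] --> 0}.
Proof.
move=> A hn0 h0; apply: (ae_imp (AC_is_derive A)) => s ds.
by rewrite -(subrr (k s)); apply: cvgB; [exact: diffq_cvg|exact: cvg_cst].
Qed.

Lemma AC_continuous_diffq y h : continuous y -> continuous (diffq h y).
Proof.
move=> cy s; apply: cvgM; last exact: cvg_cst.
apply: cvgB; last exact: cy.
by apply: (continuous_comp (f := fun s : R => s + h)); [apply: cvgD; [exact: cvg_id|exact: cvg_cst]|exact: cy].
Qed.

Lemma AC_osc_sqr y k : AC y k -> locint (fun s => k s ^+ 2) -> forall s s',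
  0 <= s <= 1 -> 0 <= s' <= 1 -> (y s - y s') ^+ 2 <= \int[mu]_(x in `[0, 1]) (k x ^+ 2).
Proof.
move=> [lk yk] lk2.
have main s s' : 0 <= s <= 1 -> 0 <= s' <= 1 -> s <= s' ->
    (y s - y s') ^+ 2 <= \int[mu]_(x in `[0, 1]) (k x ^+ 2).
  move=> /andP[s0 s1] /andP[s'0 s'1] ss'.
  rewrite -sqrrN opprB yk//; apply: (le_trans (Rintegral_sqr_itv ss' lk lk2)).
  have i0 a b : 0 <= \int[mu]_(x in `[a, b]) (k x ^+ 2).
    by apply: Rintegral_ge0 => x _; exact: sqr_ge0.
  rewrite (Rintegral_itv_split lk2 s0 s1) (Rintegral_itv_split lk2 ss' s'1).
  apply: (@le_trans _ _ (1 * \int[mu]_(x in `[s, s']) (k x ^+ 2))).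
    by apply: ler_wpM2r => //; lra.
  by rewrite mul1r; have := i0 0 s; have := i0 s' 1; lra.
move=> s s' hs hs'; have [ss'|/ltW ss'] := leP s s'; first exact: main.
by rewrite -sqrrN opprB; exact: main.
Qed.

Lemma AC_mean_sqr y k : AC y k -> locint (fun s => k s ^+ 2) -> forall s,
  0 <= s <= 1 -> (y s - \int[mu]_(x in `[0, 1]) y x) ^+ 2 <= \int[mu]_(x in `[0, 1]) (k x ^+ 2).
Proof.
move=> A lk2 s hs; have cy := AC_continuous A.
have ly := continuous_locint cy.
have cys : continuous (fun x => y s - y x) by move=> x; apply: cvgB; [exact: cvg_cst|exact: cy].
have cys2 : continuous (fun x => (y s - y x) ^+ 2).
  exact: continuous_sqr.
have -> : y s - \int[mu]_(x in `[0, 1]) y x = \int[mu]_(x in `[0, 1]) (y s - y x).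
  rewrite RintegralB; [|by []| |exact: ly].
    by rewrite Rintegral_itv_cst// subr0 mulr1.
  by apply: continuous_locint => x; exact: cvg_cst.
apply: (le_trans (Rintegral_sqr_itv ler01 (continuous_locint cys) (continuous_locint cys2))).
rewrite subr0 mul1r.
rewrite -[leRHS]mulr1 -[X in _ <= _ * X](subr0 1) -Rintegral_itv_cst//.
apply: le_Rintegral; [by []|exact: (continuous_locint cys2)| |].
  by apply: continuous_locint => x; exact: cvg_cst.
by move=> x /=; rewrite in_itv/= => hx; exact: AC_osc_sqr A lk2 _ _ hs hx.
Qed.

End periodic_functions.

(** * Measurability of continuous functions of two variables *)

Section continuous_measurable2.
Context {R : realType}.

(** The sigma-algebra of [R * R] is the product one, so an open set is written as the countable
    union of the rectangles with rational corners that it contains. *)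
Lemma continuous_measurable2 (F : R * R -> R) : continuous F -> measurable_fun setT F.
Proof.
move=> cF; apply: (measurability _ (RGenOpens.measurableE R)) => //.
move=> _ [_ [oa [ob ->] <-]]; rewrite setTI.
set O := (X in F @^-1` X); have oO : open O by exact: interval_open.
have oU : open (F @^-1` O) by move/continuousP : cF; apply.
set U := F @^-1` O in oU *.
pose rc (q : (rat * rat) * (rat * rat)) : set (R * R) :=
  `]ratr q.1.1, ratr q.1.2[%classic `*` `]ratr q.2.1, ratr q.2.2[%classic.
have -> : U = \bigcup_(k : nat) (if unpickle k is Some q then
    (if `[< rc q `<=` U >] then rc q else set0) else set0).
  apply/seteqP; split=> [z Uz|z [k _]]; last first.
    by case: (unpickle k) => // q; case: asboolP => // h; exact: h.
  have [[A B] /= [zA zB] AB] := oU z Uz.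
  have /nbhs_ballP[e1 /= e10 h1] := zA; have /nbhs_ballP[e2 /= e20 h2] := zB.
  have [a /[!in_itv]/= /andP[a1 a2]] := @rat_in_itvoo R (z.1 - e1) z.1 ltac:(lra).
  have [b /[!in_itv]/= /andP[b1 b2]] := @rat_in_itvoo R z.1 (z.1 + e1) ltac:(lra).
  have [c /[!in_itv]/= /andP[d1 d2]] := @rat_in_itvoo R (z.2 - e2) z.2 ltac:(lra).
  have [d /[!in_itv]/= /andP[f1 f2]] := @rat_in_itvoo R z.2 (z.2 + e2) ltac:(lra).
  exists (pickle ((a, b), (c, d))); [exact: I|rewrite pickleK].
  have -> : `[< rc ((a, b), (c, d)) `<=` U >] = true.
    apply/asboolP => -[x y] [/= /[!in_itv]/= /andP[x1 x2] /andP[y1 y2]].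
    apply: AB; split => /=.
      by apply: h1; rewrite /ball /= ltr_distl; lra.
    by apply: h2; rewrite /ball /= ltr_distl; lra.
  by split; rewrite /= in_itv/= ?a2 ?d2.
apply: bigcup_measurable => k _; case: (unpickle k) => // q; case: ifP => // _.
by apply: measurableX; exact: measurable_itv.
Qed.

End continuous_measurable2.

(** * The flux identity *)

Lemma continuous_pair (R : realType) (f g : R -> R) : continuous f -> continuous g ->
  continuous (fun x => (f x, g x)).
Proof. by move=> cf cg x; exact: (cvg_pair (cf x) (cg x)). Qed.

Section slice_lemmas.
Context {R : realType}.
Local Notation mu := (@lebesgue_measure R).
Implicit Types (y k : R -> R).

Lemma sqint_continuous y a b : continuous y -> sqint mu `[a, b] y.
Proof.
move=> cy; split; first by apply: measurable_funTS; exact: continuous_measurable_fun.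
exact: (continuous_locint (continuous_sqr cy)).
Qed.

Lemma sqintB d (T : measurableType d) (m : {measure set T -> \bar R}) A (f g : T -> R) :
  measurable A -> sqint m A f -> sqint m A g -> sqint m A (fun x => f x - g x).
Proof.
move=> mA [mf f2] [mg g2]; split; first exact: measurable_funB.
have := integrableD mA (integrableZl mA 2 f2) (integrableZl mA 2 g2) => i2.
apply: (@integrable_le _ _ _ m _ (fun x => (f x - g x) ^+ 2) (fun x => 2 * f x ^+ 2 + 2 * g x ^+ 2)) => //.
- by apply: measurable_funX; exact: measurable_funB.
- move=> x _; rewrite ger0_norm ?sqr_ge0//.
  by have := sqr_ge0 (f x + g x); nra.
Qed.

Lemma sqintZ d (T : measurableType d) (m : {measure set T -> \bar R}) A (f : T -> R) (c : R) :
  measurable A -> sqint m A f -> sqint m A (fun x => c * f x).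
Proof.
move=> mA [mf f2]; split; first exact: measurable_funM.
have := integrableZl mA (c ^+ 2) f2.
by apply: eq_integrable => // x _; rewrite exprMn EFinM.
Qed.

Lemma sqint_boundedM d (T : measurableType d) (m : {measure set T -> \bar R}) A (k f : T -> R) (C : R) :
  measurable A -> measurable_fun A k -> (forall x, A x -> `|k x| <= C) ->
  sqint m A f -> sqint m A (fun x => k x * f x).
Proof.
move=> mA mk kC [mf f2]; split; first exact: measurable_funM.
have h := @integrable_boundedM R _ _ m A (fun x => k x ^+ 2) (fun x => f x ^+ 2) (C ^+ 2) mA
  (measurable_funX 2 mk) _ f2.
have hk x : A x -> `|k x ^+ 2| <= C ^+ 2.
  by move=> Ax; rewrite normrX lerXn2r ?nnegrE// ?kC// (le_trans _ (kC x Ax)).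
have := h hk; apply: eq_integrable => // x _; by rewrite /= exprMn.
Qed.

Lemma sqint_Rle d (T : measurableType d) (m : {measure set T -> \bar R}) A (f g : T -> R) :
  measurable A -> sqint m A f -> sqint m A g ->
  `|\int[m]_(x in A) (f x * g x)| <=
  \int[m]_(x in A) (f x ^+ 2) + \int[m]_(x in A) (g x ^+ 2).
Proof.
move=> mA sf sg; have ifg := sqintM mA sf sg; have [_ f2] := sf; have [_ g2] := sg.
apply: (le_trans (le_normr_Rintegral mA ifg)).
rewrite -RintegralD//; apply: le_Rintegral => //.
- exact: (integrable_norm ifg).
- by have := integrableD mA f2 g2; apply: eq_integrable => // x _; rewrite EFinD.
- move=> x _; rewrite ler_norml; apply/andP; split.
    by have := sqr_ge0 (f x + g x); have := sqr_ge0 (f x); have := sqr_ge0 (g x); nra.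
  by have := sqr_ge0 (f x - g x); have := sqr_ge0 (f x); have := sqr_ge0 (g x); nra.
Qed.

(** Difference quotients converge to the derivative almost everywhere and are bounded in L2 by
    [diffq_L2], hence converge weakly. The factor 4 comes from [(x - y)^2 <= 2 x^2 + 2 y^2]. *)
Lemma slice_limit k y y' (h_ : nat -> R) : sqint mu `[0, 1] k -> AC y y' ->
  (forall s, y (s + 1) = y s) -> locint (fun s => y' s ^+ 2) ->
  (forall n, h_ n != 0) -> h_ n @[n --> \oo] --> 0 ->
  \int[mu]_(s in `[0, 1]) (k s * diffq (h_ n) y s) @[n --> \oo] -->
  \int[mu]_(s in `[0, 1]) (k s * y' s).
Proof.
move=> sk A py l2 hn0 h0.
have m01 := measurable_itvR (Interval (BLeft (0 : R)) (BRight 1)).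
have sd n : sqint mu `[0, 1] (diffq (h_ n) y).
  by apply: sqint_continuous; apply: AC_continuous_diffq; exact: AC_continuous A.
have sy' : sqint mu `[0, 1] y'.
  by split; [apply: measurable_funTS; apply: locint_measurable; case: A|exact: l2].
have sq n := sqintB m01 (sd n) sy'.
have := @weak_cvg0 _ _ _ mu `[0, 1] k (fun n s => diffq (h_ n) y s - y' s)
  (4 * \int[mu]_(s in `[0, 1]) (y' s ^+ 2)) m01 sk sq.
move=> /(_ _ _) H.
have : \int[mu]_(x in `[0, 1]) (k x * (diffq (h_ n) y x - y' x)) @[n --> \oo] --> 0.
  apply: H => [n|].
    have i1 := (sd n).2; have i2 := sy'.2.
    apply: (@le_trans _ _ (\int[mu]_(s in `[0, 1]) (2 * diffq (h_ n) y s ^+ 2 + 2 * y' s ^+ 2))).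
      apply: le_Rintegral; [by []|exact: (sq n).2| |].
        have := @integrableD _ _ _ mu _ m01 _ _ (integrableZl m01 2 i1) (integrableZl m01 2 i2).
        by apply: eq_integrable => // s _; rewrite /= EFinD !EFinM.
      by move=> s _; have := sqr_ge0 (diffq (h_ n) y s + y' s); nra.
    rewrite RintegralD; [|by []| |].
    - rewrite RintegralZl; [|by []|exact: i1].
      rewrite RintegralZl; [|by []|exact: i2].
      by have := diffq_L2 A py l2 (hn0 n); lra.
    - by have := integrableZl m01 2 i1; apply: eq_integrable => // s _; rewrite /= EFinM.
    - by have := integrableZl m01 2 i2; apply: eq_integrable => // s _; rewrite /= EFinM.
  by apply: (ae_imp (diffq_ae_cvg A hn0 h0)).
rewrite (_ : (fun n => _) = (fun n => \int[mu]_(s in `[0, 1]) (k s * diffq (h_ n) y s) -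
   \int[mu]_(s in `[0, 1]) (k s * y' s))).
  by move/subr_cvg0.
apply/funext => n; rewrite -RintegralB; [|by []|exact: sqintM|exact: sqintM].
by apply: eq_Rintegral => s _; rewrite mulrBr.
Qed.

(** Summation by parts over a period, where translation invariance leaves no boundary term. *)
Lemma periodic_by_parts y k h : continuous y -> (forall s, y (s + 1) = y s) ->
  locint k -> {ae mu, forall s, k (s + 1) = k s} ->
  \int[mu]_(s in `[0, 1]) (y s * diffq h k s) =
  - \int[mu]_(s in `[0, 1]) (k s * diffq (- h) y s).
Proof.
move=> cy py lk pk.
have cyh : continuous (fun s => y (s - h)).
  move=> s; apply: (continuous_comp (f := fun s : R => s - h)); last exact: cy.
  by apply: cvgB; [exact: cvg_id|exact: cvg_cst].
have l1 : locint (fun s => y (s - h) * k s) by exact: locint_cM.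
have l2 : locint (fun s => y s * k s) by exact: locint_cM.
have l3 : locint (fun s => y s * k (s + h)) by apply: locint_cM => //; exact: locint_shift.
have e1 : \int[mu]_(s in `[0, 1]) (y s * k (s + h)) = \int[mu]_(s in `[0, 1]) (y (s - h) * k s).
  rewrite -(@periodic_integral_shift R (fun s => y (s - h) * k s) h)//.
    by apply: eq_Rintegral => s _; rewrite addrK.
  by apply: (ae_imp pk) => s ->; rewrite addrAC py.
rewrite (@eq_Rintegral _ _ _ mu _ (fun s => h^-1 * (y s * k (s + h) - y s * k s))); last first.
  by move=> s _; rewrite /diffq; ring.
rewrite [X in _ = - X](@eq_Rintegral _ _ _ mu _ (fun s => h^-1 * (y s * k s - y (s - h) * k s))); last first.
  by move=> s _; rewrite /diffq invrN; ring.
rewrite RintegralZl; [|by []|exact: (locintB l3 l2)].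
rewrite RintegralZl; [|by []|exact: (locintB l2 l1)].
rewrite RintegralB; [|by []|exact: l3|exact: l2].
rewrite RintegralB; [|by []|exact: l2|exact: l1].
by rewrite e1; ring.
Qed.

End slice_lemmas.

(** * Sobolev functions on the cylinder, seen on lines *)

Section Sobolev.
Context {R : realType}.
Local Notation mu := (@lebesgue_measure R).
Local Notation mu2 := (@lebesgue_measure R \x @lebesgue_measure R)%E.
Implicit Types (v f g : R * R -> R).

Definition square (n : nat) : set (R * R) := `[- n%:R, n%:R] `*` `[- n%:R, n%:R].
Definition rect (a b : R) : set (R * R) := `[a, b] `*` `[0, 1].
(** Closed in [x_2], unlike [Omega]: the two differ by a null set, and the closed strip matches the
    segments over which lines are integrated. *)
Definition strip : set (R * R) := setT `*` `[0, 1].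

Lemma measurable_rectR (i j : interval R) :
  measurable ([set` i] `*` [set` j] : set (measurableTypeR R * measurableTypeR R)).
Proof. by apply: measurableX; exact: measurable_itvR. Qed.

Lemma measurable_stripR : measurable (strip : set (measurableTypeR R * measurableTypeR R)).
Proof. by apply: measurableX; [exact: measurableT|exact: measurable_itvR]. Qed.

Lemma bound_nat (x y z : R) : exists N : nat, [/\ `|x| <= N%:R, `|y| <= N%:R & `|z| <= N%:R].
Proof.
exists (Num.bound (`|x| + `|y| + `|z|)).
have := archi_boundP (addr_ge0 (addr_ge0 (normr_ge0 x) (normr_ge0 y)) (normr_ge0 z)).
move=> /ltW h; split; apply: le_trans h; have := normr_ge0 x; have := normr_ge0 y;
  have := normr_ge0 z; lra.
Qed.

Lemma sub_itv_nat (a b : R) (N : nat) : `|a| <= N%:R -> `|b| <= N%:R ->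
  `[a, b]%classic `<=` `[- N%:R, N%:R].
Proof.
move=> aN bN; apply: subset_itvScc; rewrite bnd_simp.
  by rewrite lerNl (le_trans _ aN)// -normrN ler_norm.
by rewrite (le_trans _ bN)// ler_norm.
Qed.

Definition box_integrable f := forall n, mu2.-integrable (square n) (EFin \o f).

Lemma slice_locint2 f : box_integrable f ->
  {ae mu, forall t, locint (fun s => f (t, s))}.
Proof.
move=> bf.
have H : {ae mu, forall s (n : nat), `[- n%:R, n%:R]%classic s ->
  mu.-integrable `[- n%:R, n%:R] (fun t => (f (s, t))%:E)}.
  by apply: ae_foralln => n; exact: (fubini_rect_ae1 (measurable_itvR _) (measurable_itvR _) (bf n)).
apply: (ae_imp H) => s hs c d.
have [N [sN cN dN]] := bound_nat s c d.
have hN : `[- N%:R, N%:R]%classic s by rewrite /= in_itv/= -ler_norml.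
by apply: integrableS (hs N hN) => //; exact: sub_itv_nat.
Qed.

Lemma rect_sub_square a b c d : exists n, [set` `[a, b]] `*` [set` `[c, d]] `<=` square n.
Proof.
have [n1 [h1 h2 _]] := bound_nat a b 0; have [n2 [h3 h4 _]] := bound_nat c d 0.
exists (n1 + n2)%N => z [/= z1 z2]; split => /=.
  by apply: sub_itv_nat z1; rewrite (le_trans h1, le_trans h2)// ler_nat leq_addr.
by apply: sub_itv_nat z2; rewrite (le_trans h3, le_trans h4)// ler_nat leq_addl.
Qed.

Lemma box_integrable_rect f a b c d : box_integrable f ->
  mu2.-integrable ([set` `[a, b]] `*` [set` `[c, d]]) (EFin \o f).
Proof.
move=> bf; have [n sub] := rect_sub_square a b c d.
by apply: integrableS (bf n) => //; exact: measurable_rectR.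
Qed.

Lemma measurable_slice1 f s : measurable_fun setT f -> measurable_fun setT (fun t => f (t, s)).
Proof. by move=> mf; apply: (measurableT_comp mf); exact: measurable_fun_pair. Qed.

Lemma measurable_slice2 f t : measurable_fun setT f -> measurable_fun setT (fun s => f (t, s)).
Proof. by move=> mf; apply: (measurableT_comp mf); exact: measurable_fun_pair. Qed.

Lemma measurable_shift2 f h : measurable_fun setT f ->
  measurable_fun setT (fun z : R * R => f (z.1, z.2 + h)).
Proof.
move=> mf; apply: (measurableT_comp mf); apply: measurable_fun_pair => //.
by apply: measurable_funD => //; exact: measurable_snd.
Qed.

Lemma measurable_eqset f g : measurable_fun setT f -> measurable_fun setT g ->
  measurable ((fun z => f z = g z) : set (measurableTypeR R * measurableTypeR R)).
Proof.
move=> mf mg.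
rewrite (_ : (fun z => _) = (fun z => f z - g z) @^-1` [set 0]).
  by rewrite -[X in measurable X]setTI; apply: (measurable_funB mf mg).
by apply/seteqP; split=> z /= h; [rewrite h subrr|apply/eqP; rewrite -subr_eq0 h].
Qed.

Lemma tonelliR1 (i j : interval R) f : measurable_fun setT f -> (forall z, 0 <= f z) ->
  (\int[mu2]_(z in [set` i] `*` [set` j]) (f z)%:E =
   \int[mu]_(t in [set` i]) \int[mu]_(s in [set` j]) (f (t, s))%:E)%E.
Proof.
move=> mf f0; apply: (tonelli_rect1 mu mu (f := EFin \o f)); [exact: measurable_itvR|
  exact: measurable_itvR|exact/measurable_EFinP|by move=> z; rewrite lee_fin].
Qed.

Lemma tonelliR2 (i j : interval R) f : measurable_fun setT f -> (forall z, 0 <= f z) ->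
  (\int[mu2]_(z in [set` i] `*` [set` j]) (f z)%:E =
   \int[mu]_(s in [set` j]) \int[mu]_(t in [set` i]) (f (t, s))%:E)%E.
Proof.
move=> mf f0; apply: (tonelli_rect2 mu mu (f := EFin \o f)); [exact: measurable_itvR|
  exact: measurable_itvR|exact/measurable_EFinP|by move=> z; rewrite lee_fin].
Qed.

Lemma sqint_shift2 f h a b : measurable_fun setT f -> box_integrable (fun z => f z ^+ 2) ->
  sqint mu2 (rect a b) (fun z => f (z.1, z.2 + h)).
Proof.
move=> mf bf; have mf2 : measurable_fun setT (fun z => f z ^+ 2) by exact: measurable_funX.
apply: sqint_lty; first exact: measurable_rectR.
  by apply: measurable_funTS; exact: measurable_shift2.
rewrite /rect (tonelliR1 _ _ (f := fun z => f (z.1, z.2 + h) ^+ 2)); last 2 first.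
- by apply: measurable_funX; exact: measurable_shift2.
- by move=> z; exact: sqr_ge0.
have -> : (\int[mu]_(t in `[a, b]) \int[mu]_(s in `[0%R, 1%R]) (f (t, (s + h)%R) ^+ 2)%:E =
  \int[mu2]_(z in `[a, b] `*` `[h, (1 + h)%R]) (f z ^+ 2)%:E)%E.
  rewrite (tonelliR1 _ _ mf2); last by move=> z; exact: sqr_ge0.
  apply: eq_integral => t _.
  rewrite -[RHS](@ge0_integral_shift _ h)//.
  - by congr (integral _ _ _); apply/seteqP; split=> s /=; rewrite !in_itv/= lerD2r -lerBlDr subrr.
  - apply/measurable_EFinP; apply: measurable_funTS; exact: (measurable_slice2 t mf2).
  - by move=> s _; rewrite lee_fin sqr_ge0.
apply: integrable_lty; first exact: measurable_rectR.
exact: box_integrable_rect.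
Qed.

(** Both representatives agree with [v] almost everywhere in the plane, but each is regular in its
    own direction only: [va] along rows, [vb] along columns. On an exceptional line they may differ
    from each other and from [v]. *)
Record Sob (v va vb v1 v2 : R * R -> R) : Prop := {
  sob_m : measurable_fun setT v;
  sob_m1 : measurable_fun setT v1;
  sob_m2 : measurable_fun setT v2;
  sob_sq : box_integrable (fun z => v z ^+ 2);
  sob_sq1 : box_integrable (fun z => v1 z ^+ 2);
  sob_sq2 : box_integrable (fun z => v2 z ^+ 2);
  sob_ma : measurable_fun setT va;
  sob_mb : measurable_fun setT vb;
  sob_ea : {ae mu2, forall z, v z = va z};
  sob_eb : {ae mu2, forall z, v z = vb z};
  sob_la : {ae mu, forall s, AC (fun t => va (t, s)) (fun t => v1 (t, s))};
  sob_lb : {ae mu, forall t, AC (fun s => vb (t, s)) (fun s => v2 (t, s))};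
  sob_per : forall t s, v (t, s + 1) = v (t, s);
  sob_fin : (\int[mu2]_(z in strip) (v1 z ^+ 2 + v2 z ^+ 2)%:E < +oo)%E
}.

Definition hline (v va v1 : R * R -> R) s :=
  AC (fun t => va (t, s)) (fun t => v1 (t, s)) /\ {ae mu, forall t, v (t, s) = va (t, s)}.

(** What holds on almost every column and is needed there, gathered so that a column can be selected
    once. *)
Definition vline (v va vb v1 v2 : R * R -> R) t :=
  [/\ AC (fun s => vb (t, s)) (fun s => v2 (t, s)),
      (forall s, vb (t, s + 1) = vb (t, s)),
      {ae mu, forall s, v (t, s) = vb (t, s) /\ va (t, s) = vb (t, s)},
      locint (fun s => v1 (t, s) ^+ 2) /\ locint (fun s => v2 (t, s) ^+ 2) &
      locint (fun s => v1 (t, s)) /\ {ae mu, forall s, v1 (t, s + 1) = v1 (t, s)}].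

Lemma locint_sqr (k : R -> R) : measurable_fun setT k -> locint (fun s => k s ^+ 2) -> locint k.
Proof.
move=> mk lk2 a b.
have l1 : locint (fun=> 1 : R) by apply: continuous_locint => x; exact: cvg_cst.
apply: (@integrable_le _ _ _ mu _ _ (fun s => 1 + k s ^+ 2)) => //.
- exact: measurable_funTS.
- move=> s _; have := sqr_ge0 (`|k s| - 1); have := real_normK (num_real (k s)).
  by have := normr_ge0 (k s); nra.
- exact: (locintD l1 lk2).
Qed.

Section Sob_lines.
Variables v va vb v1 v2 : R * R -> R.
Hypothesis S : Sob v va vb v1 v2.

Lemma Sob_hline : {ae mu, forall s, hline v va v1 s}.
Proof. by apply: (ae_imp2 (sob_la S) (ae_prod2 (sob_ea S))) => s. Qed.

Lemma Sob_vline : {ae mu, forall t, vline v va vb v1 v2 t}.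
Proof.
have e1 : {ae mu2, forall z, v z = vb z /\ va z = vb z}.
  by apply: (ae_imp2 (sob_ea S) (sob_eb S)) => z <- <-.
have per1 : {ae mu2, forall z, v1 (z.1, z.2 + 1) = v1 z}.
  apply: ae_prod2_conv.
    apply: (@measurable_eqset (fun z => v1 (z.1, z.2 + 1)) v1); [exact: measurable_shift2 (sob_m1 S)|exact: sob_m1 S].
  apply: (ae_imp2 Sob_hline (ae_shift 1 Sob_hline)) => s [A1 e] [A2 e'] /=.
  (* The rows [s] and [s + 1] carry continuous representatives of the same function, hence the same
     derivative; this is how the periodicity of [v] passes to [v1]. *)
  have E : (fun t => va (t, s)) =1 (fun t => va (t, s + 1)).
    apply: ae_eq_continuous; [exact: AC_continuous A1|exact: AC_continuous A2|].
    by apply: (ae_imp2 e e') => t <- <-; rewrite (sob_per S).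
  have := AC_cst_der0 (AC_sub A2 A1) _.
  move=> /(_ _)/ae_imp; apply; first by move=> t t'; rewrite -!E !subrr.
  by move=> t /eqP; rewrite subr_eq0 => /eqP.
have h1 := ae_prod1 e1; have h2 := ae_prod1 per1.
have h3 := slice_locint2 (sob_sq1 S); have h4 := slice_locint2 (sob_sq2 S).
have h12 : {ae mu, forall t, {ae mu, forall s, v (t, s) = vb (t, s) /\ va (t, s) = vb (t, s)} /\
   {ae mu, forall s, v1 (t, s + 1) = v1 (t, s)}}.
  by apply: (ae_imp2 h1 h2).
have h34 : {ae mu, forall t, locint (fun s => v1 (t, s) ^+ 2) /\ locint (fun s => v2 (t, s) ^+ 2)}.
  by apply: (ae_imp2 h3 h4).
apply: (ae_imp3 h12 h34 (sob_lb S)) => t [k1 k2] [k3 k4] A; split => //.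
- have c1 := AC_continuous A; have c2 := AC_continuous (AC_shift 1 A).
  apply: ae_eq_continuous => //.
  by apply: (ae_imp2 k1 (ae_shift 1 k1)) => s [<- _] [<- _]; rewrite (sob_per S).
- split => //; apply: locint_sqr => //; exact: measurable_slice2 (sob_m1 S).
Qed.

Lemma Sob_rect a b : [/\ sqint mu2 (rect a b) v, sqint mu2 (rect a b) v1 & sqint mu2 (rect a b) v2].
Proof.
by split; split; [exact: measurable_funTS (sob_m S)|exact: box_integrable_rect (sob_sq S)|
  exact: measurable_funTS (sob_m1 S)|exact: box_integrable_rect (sob_sq1 S)|
  exact: measurable_funTS (sob_m2 S)|exact: box_integrable_rect (sob_sq2 S)].
Qed.

End Sob_lines.

Section flux.
Variables u1 a1 b1 D11 D12 u2 a2 b2 D21 D22 : R * R -> R.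
Hypotheses (S1 : Sob u1 a1 b1 D11 D12) (S2 : Sob u2 a2 b2 D21 D22).
Hypothesis div0 : {ae mu2, forall z, D11 z + D22 z = 0}.
Variables (Phi1 Phi2 psi w w' : R * R -> R) (sg : R).
Hypotheses (C1 : C1with Phi1 psi w) (C2 : C1with Phi2 w' psi).
Hypothesis ww' : forall z, w' z = - sg * w z.
Hypotheses (ipsi : forall a b, sqint mu2 (rect a b) (fun z => psi (u1 z, u2 z)))
           (iw : forall a b, sqint mu2 (rect a b) (fun z => w (u1 z, u2 z))).

(** [F] is [d_1 Phi1(u)], integrated along rows to the boundary terms; [F2] is [d_2 Phi2(u)],
    integrated along columns to 0 by periodicity. In [F + F2] the divergence constraint cancels the
    terms in [psi]. The potentials are arbitrary, because coordinate functions in their place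
    control the means of [u1] and [u2]. *)
Lemma flux t0 t1 : t0 <= t1 ->
  vline u1 a1 b1 D11 D12 t0 -> vline u2 a2 b2 D21 D22 t0 ->
  vline u1 a1 b1 D11 D12 t1 -> vline u2 a2 b2 D21 D22 t1 ->
  \int[mu]_(s in `[0, 1]) Phi1 (b1 (t1, s), b2 (t1, s)) -
  \int[mu]_(s in `[0, 1]) Phi1 (b1 (t0, s), b2 (t0, s)) =
  \int[mu2]_(z in rect t0 t1) (w (u1 z, u2 z) * (D21 z - sg * D12 z)).
Proof.
move=> t01 v10 v20 v11 v21.
have mr := measurable_rectR `[t0, t1] `[0, 1].
have m01 := measurable_itvR (Interval (BLeft (0 : R)) (BRight 1)).
have mt := measurable_itvR (Interval (BLeft t0) (BRight t1)).
have [_ s11 s12] := Sob_rect S1 t0 t1; have [_ s21 s22] := Sob_rect S2 t0 t1.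
have ip := ipsi t0 t1; have iw0 := iw t0 t1.
pose F z := psi (u1 z, u2 z) * D11 z + w (u1 z, u2 z) * D21 z.
pose F2 z := w' (u1 z, u2 z) * D12 z + psi (u1 z, u2 z) * D22 z.
have iF : mu2.-integrable (rect t0 t1) (EFin \o F).
  have := integrableD mr (sqintM mr ip s11) (sqintM mr iw0 s21).
  by apply: eq_integrable => // z _ /=; rewrite EFinD.
have iF2 : mu2.-integrable (rect t0 t1) (EFin \o F2).
  have := integrableD mr (sqintM mr (sqintZ (- sg) mr iw0) s12) (sqintM mr ip s22).
  by apply: eq_integrable => // z _ /=; rewrite /F2 ww' EFinD.
have cPhi1 := C1with_continuous C1.
have cb (t : R) : vline u1 a1 b1 D11 D12 t -> vline u2 a2 b2 D21 D22 t ->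
    continuous (fun s => Phi1 (b1 (t, s), b2 (t, s))).
  move=> [A1 _ _ _ _] [A2 _ _ _ _] s.
  have cp := continuous_pair (AC_continuous A1) (AC_continuous A2).
  apply: (@continuous_comp _ _ _ (fun s => (b1 (t, s), b2 (t, s))) Phi1); last exact: cPhi1.
  exact: cp.
have cb0 := cb _ v10 v20; have cb1 := cb _ v11 v21.
have E1 : \int[mu2]_(z in rect t0 t1) F z = \int[mu]_(s in `[0, 1]) Phi1 (b1 (t1, s), b2 (t1, s)) -
  \int[mu]_(s in `[0, 1]) Phi1 (b1 (t0, s), b2 (t0, s)).
  rewrite (fubini_rect2 mt m01 iF) -RintegralB; [|by []|exact: (continuous_locint cb1)|exact: (continuous_locint cb0)].
  apply: ae_eq_Rintegral => //.
  - exact: (measurable_fine_fubini2 mt m01 iF).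
  - apply: measurable_funTS; apply: measurable_funB; exact: continuous_measurable_fun.
  - have [_ _ e10 _ _] := v10; have [_ _ e20 _ _] := v20; have [_ _ e11 _ _] := v11; have [_ _ e21 _ _] := v21.
    have e0 := ae_imp2 e10 e20 (fun s x y => conj x y).
    have e1 := ae_imp2 e11 e21 (fun s x y => conj x y).
    have hl := ae_imp2 (Sob_hline S1) (Sob_hline S2) (fun s x y => conj x y).
    apply: (ae_imp3 e0 e1 hl) => s [[_ <-] [_ <-]] [[_ <-] [_ <-]] [[A1 k1] [A2 k2]] _.
    have A := AC_chain2 C1 A1 A2; rewrite (proj2 A)//.
    apply: ae_eq_Rintegral => //.
    + apply: measurable_funTS; apply: (measurable_slice1 s (f := F)).
      have mu12 : measurable_fun setT (fun z => (u1 z, u2 z)).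
        by apply: measurable_fun_pair; [exact: sob_m S1|exact: sob_m S2].
      have [_ _ cpsi cw] := C1.
      apply: measurable_funD; apply: measurable_funM; [|exact: sob_m1 S1| |exact: sob_m1 S2];
        apply: (measurableT_comp _ mu12); exact: continuous_measurable2.
    + by apply: measurable_funTS; apply: locint_measurable; case: A.
    + by apply: (ae_imp2 k1 k2) => t e1' e2' _; rewrite /F /= e1' e2'.
have E2 : \int[mu2]_(z in rect t0 t1) F2 z = 0.
  rewrite (fubini_rect1 mt m01 iF2).
  transitivity (\int[mu]_(t in `[t0, t1]) (cst 0 : R -> R) t); last by rewrite Rintegral_itv_cst ?mul0r.
  apply: ae_eq_Rintegral => //; first exact: (measurable_fine_fubini1 mt m01 iF2).
  apply: (ae_imp2 (Sob_vline S1) (Sob_vline S2)) => t [A1 p1 k1 _ _] [A2 p2 k2 _ _] _ /=.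
  have A := AC_chain2 C2 A1 A2.
  transitivity (Phi2 (b1 (t, 1), b2 (t, 1)) - Phi2 (b1 (t, 0), b2 (t, 0))); last first.
    by have := p1 0; have := p2 0; rewrite !add0r => -> ->; rewrite subrr.
  rewrite (proj2 A)//; apply: ae_eq_Rintegral => //.
  + apply: measurable_funTS; apply: (measurable_slice2 t (f := F2)).
    have mu12 : measurable_fun setT (fun z => (u1 z, u2 z)).
      by apply: measurable_fun_pair; [exact: sob_m S1|exact: sob_m S2].
    have [_ _ cw' cpsi] := C2.
    apply: measurable_funD; apply: measurable_funM; [|exact: sob_m2 S1| |exact: sob_m2 S2];
      apply: (measurableT_comp _ mu12); exact: continuous_measurable2.
  + by apply: measurable_funTS; apply: locint_measurable; case: A.
  + by apply: (ae_imp2 k1 k2) => s [e1' _] [e2' _] _; rewrite /F2 /= e1' e2'.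
rewrite -E1 -[LHS]addr0 -E2 -RintegralD//.
have mF := measurable_int _ iF; have mF2 := measurable_int _ iF2.
apply: ae_eq_Rintegral => //.
- by apply: measurable_funD; apply/measurable_EFinP.
- apply: measurable_funM; first by have [] := iw0.
  by apply: measurable_funB; [have [] := s21|apply: measurable_funM => //; have [] := s12].
- apply: (ae_imp div0) => z dz _; rewrite /F /F2 ww'.
  have -> : D22 z = - D11 z by rewrite -[RHS]addr0 -dz addrA addNr add0r.
  ring.
Qed.

End flux.

Section det.
Variables f fa fb f1 f2 g ga gb g1 g2 : R * R -> R.
Hypotheses (Sf : Sob f fa fb f1 f2) (Sg : Sob g ga gb g1 g2).
Variables (eta eta' : R -> R) (C : R).
Hypotheses (deta : forall t, is_derive t (1 : R) eta (eta' t)) (ceta' : continuous eta')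
           (eta'C : forall t, `|eta' t| <= C).

Let ceta : continuous eta. Proof. exact: is_derive_continuous deta. Qed.

Let eta_lip x : `|eta x| <= `|eta 0| + C * `|x|.
Proof.
have [c [_ e]] := mean_value 0 x deta.
rewrite -[eta x](subrK (eta 0)) e subr0 addrC (le_trans (ler_normD _ _))// lerD2l normrM.
by rewrite ler_wpM2r.
Qed.

Let m01 := measurable_itvR (Interval (BLeft (0 : R)) (BRight 1)).

Let C0 : 0 <= C. Proof. exact: le_trans (normr_ge0 _) (eta'C 0). Qed.

Let sqint_eta a b : sqint mu2 (rect a b) (fun z => eta (f z)).
Proof.
have mr := measurable_rectR `[a, b] `[0, 1].
have [[mf if2] _ _] := Sob_rect Sf a b.
have me : measurable_fun (rect a b) (fun z => eta (f z)).
  by apply: (measurableT_comp _ mf); exact: continuous_measurable_fun.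
split => //.
have ic : mu2.-integrable (rect a b) (EFin \o (fun=> 2 * `|eta 0| ^+ 2)).
  apply: (box_integrable_rect (f := fun=> 2 * `|eta 0| ^+ 2)) => n.
  apply: measurable_bounded_integrable => //.
  - exact: measurable_rectR.
  - by rewrite /square /rect /= product_measure1E//= !lebesgue_measure_itv/=; case: ifP => _; rewrite ?mul0e// -EFinB -EFinM ltry.
  - exact: bounded_cst.
have i2 := integrableZl mr (2 * C ^+ 2) if2.
apply: (@integrable_le _ _ _ mu2 _ _ (fun z => 2 * `|eta 0| ^+ 2 + 2 * C ^+ 2 * f z ^+ 2)) => //.
- exact: measurable_funX.
- move=> z _; rewrite ger0_norm ?sqr_ge0// -real_normK ?num_real//.
  have e1 := eta_lip (f z); have n0 := normr_ge0 (eta (f z)).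
  have h : `|eta (f z)| ^+ 2 <= (`|eta 0| + C * `|f z|) ^+ 2.
    by rewrite lerXn2r// nnegrE// addr_ge0// mulr_ge0.
  apply: (le_trans h); rewrite -[f z ^+ 2]real_normK ?num_real//.
  by have := sqr_ge0 (`|eta 0| - C * `|f z|); nra.
- by have := integrableD mr ic i2; apply: eq_integrable => // z _ /=; rewrite EFinD.
Qed.

(** Formally [eta'(f) det = d_1(eta(f) d_2 g) - d_2(eta(f) d_1 g)]. Second derivatives of [g] are
    avoided by putting the difference quotient [G n] in place of [d_2 g]: the row integrals of
    [d_1(eta(f) G n)] are boundary terms, and on each column the difference quotient of [g1] is
    moved onto [eta(f)]. The limit is taken weakly on columns and by domination in [t]. *)
Lemma det_flux t0 t1 : t0 <= t1 ->
  vline f fa fb f1 f2 t0 -> vline g ga gb g1 g2 t0 ->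
  vline f fa fb f1 f2 t1 -> vline g ga gb g1 g2 t1 ->
  \int[mu2]_(z in rect t0 t1) (eta' (f z) * (f1 z * g2 z - f2 z * g1 z)) =
  \int[mu]_(s in `[0, 1]) (eta (fb (t1, s)) * g2 (t1, s)) -
  \int[mu]_(s in `[0, 1]) (eta (fb (t0, s)) * g2 (t0, s)).
Proof.
move=> t01 vf0 vg0 vf1 vg1.
have mr := measurable_rectR `[t0, t1] `[0, 1].
have mt := measurable_itvR (Interval (BLeft t0) (BRight t1)).
pose h_ n : R := n.+1%:R^-1.
have hn0 n : h_ n != 0 by rewrite invr_eq0 pnatr_eq0.
have h0 : h_ n @[n --> \oo] --> 0 by exact: cvg_harmonic.
have [sf sf1 sf2] := Sob_rect Sf t0 t1; have [sg sg1 sg2] := Sob_rect Sg t0 t1.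
have meta' : measurable_fun setT eta' by exact: continuous_measurable_fun.
have mef : measurable_fun (rect t0 t1) (fun z => eta' (f z)).
  by apply: (measurableT_comp meta'); have [] := sf.
have sef1 : sqint mu2 (rect t0 t1) (fun z => eta' (f z) * f1 z).
  by apply: sqint_boundedM => //.
have sef2 : sqint mu2 (rect t0 t1) (fun z => eta' (f z) * f2 z).
  by apply: sqint_boundedM => //.
have se := sqint_eta t0 t1.
pose G n z := (g (z.1, z.2 + h_ n) - g z) / h_ n.
pose G1 n z := (g1 (z.1, z.2 + h_ n) - g1 z) / h_ n.
have sG n : sqint mu2 (rect t0 t1) (G n).
  have := sqintZ (h_ n)^-1 mr (sqintB mr (sqint_shift2 (h_ n) t0 t1 (sob_m Sg) (sob_sq Sg)) sg).
  by rewrite (_ : G n = fun z => (h_ n)^-1 * (g (z.1, z.2 + h_ n) - g z))//; apply/funext => z; rewrite mulrC.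
have sG1 n : sqint mu2 (rect t0 t1) (G1 n).
  have := sqintZ (h_ n)^-1 mr (sqintB mr (sqint_shift2 (h_ n) t0 t1 (sob_m1 Sg) (sob_sq1 Sg)) sg1).
  by rewrite (_ : G1 n = fun z => (h_ n)^-1 * (g1 (z.1, z.2 + h_ n) - g1 z))//; apply/funext => z; rewrite mulrC.
(* [H n] is [d_1(eta(f) G n)], and [X n t] the integral of [eta(f) G n] over the column [t]. *)
pose H n z := (eta' (f z) * f1 z) * G n z + eta (f z) * G1 n z.
have iH n : mu2.-integrable (rect t0 t1) (EFin \o H n).
  have := integrableD mr (sqintM mr sef1 (sG n)) (sqintM mr se (sG1 n)).
  by apply: eq_integrable => // z _ /=; rewrite EFinD.
pose X n t := \int[mu]_(s in `[0, 1]) (eta (fb (t, s)) * diffq (h_ n) (fun s => gb (t, s)) s).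
have ceb (t : R) : vline f fa fb f1 f2 t -> continuous (fun s => eta (fb (t, s))).
  move=> [A _ _ _ _] s.
  by apply: (@continuous_comp _ _ _ (fun s => fb (t, s)) eta); [exact: (AC_continuous A)|exact: ceta].
have Xlim (t : R) : vline f fa fb f1 f2 t -> vline g ga gb g1 g2 t ->
    X n t @[n --> \oo] --> \int[mu]_(s in `[0, 1]) (eta (fb (t, s)) * g2 (t, s)).
  move=> vf [A p _ [_ l2] _]; apply: slice_limit => //.
  exact: sqint_continuous (ceb _ vf).
have cX n (t : R) : vline f fa fb f1 f2 t -> vline g ga gb g1 g2 t ->
    continuous (fun s => eta (fb (t, s)) * diffq (h_ n) (fun s => gb (t, s)) s).
  move=> vf [A _ _ _ _] s; apply: cvgM; first exact: (ceb _ vf).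
  by have cg := @AC_continuous_diffq R (fun s => gb (t, s)) (h_ n) (AC_continuous A); exact: (cg s).
have XE n : X n t1 - X n t0 = \int[mu2]_(z in rect t0 t1) H n z.
  have c0 := cX n _ vf0 vg0; have c1 := cX n _ vf1 vg1.
  rewrite (fubini_rect2 mt m01 (iH n)) /X -RintegralB; [|by []|exact: (continuous_locint c1)|exact: (continuous_locint c0)].
  apply: ae_eq_Rintegral => //.
  - apply: measurable_funTS; apply: measurable_funB; exact: continuous_measurable_fun.
  - exact: (measurable_fine_fubini2 mt m01 (iH n)).
  - have [_ _ ef0 _ _] := vf0; have [_ _ ef1 _ _] := vf1.
    have [_ _ eg0 _ _] := vg0; have [_ _ eg1 _ _] := vg1.
    have e0 := ae_imp3 ef0 eg0 (ae_shift (h_ n) eg0) (fun s x y z => conj x (conj y z)).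
    have e1 := ae_imp3 ef1 eg1 (ae_shift (h_ n) eg1) (fun s x y z => conj x (conj y z)).
    have hl := ae_imp3 (Sob_hline Sf) (Sob_hline Sg) (ae_shift (h_ n) (Sob_hline Sg))
      (fun s x y z => conj x (conj y z)).
    apply: (ae_imp3 e0 e1 hl) => s [[_ p1] [[_ p2] [_ p3]]] [[_ q1] [[_ q2] [_ q3]]].
    move=> [[A1 k1] [[A2 k2] [A3 k3]]] _.
    have AD : AC (fun t => (ga (t, s + h_ n) - ga (t, s)) / h_ n) (fun t => (g1 (t, s + h_ n) - g1 (t, s)) / h_ n).
      apply: AC_eq (AC_lin (h_ n)^-1 (AC_cst 0) (AC_sub A3 A2)) _ _ => t; by rewrite add0r mulrC.
    have A := AC_mul (AC_chain1 deta ceta' A1) AD.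
    rewrite /diffq -p1 -p2 -p3 -q1 -q2 -q3 (proj2 A)//.
    apply: ae_eq_Rintegral => //.
    + by apply: measurable_funTS; apply: locint_measurable; case: A.
    + have [/measurable_EFinP mH _] := integrableP _ _ _ (iH n).
      apply: measurable_funTS; apply: (measurable_slice1 s (f := H n)).
      have mG : measurable_fun setT (G n).
        by apply: measurable_funM => //; apply: measurable_funB; [exact: measurable_shift2 (sob_m Sg)|exact: sob_m Sg].
      have mG1 : measurable_fun setT (G1 n).
        by apply: measurable_funM => //; apply: measurable_funB; [exact: measurable_shift2 (sob_m1 Sg)|exact: sob_m1 Sg].
      have mff : measurable_fun setT f by exact: sob_m Sf.
      apply: measurable_funD; apply: measurable_funM => //.
        apply: measurable_funM; [exact: (measurableT_comp meta' mff)|exact: sob_m1 Sf].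
      by apply: (measurableT_comp _ mff); exact: continuous_measurable_fun.
    + by apply: (ae_imp3 k1 k2 k3) => t e1' e2' e3' _; rewrite /H /G /G1 /= e1' e2' e3'.
pose Mn n t := \int[mu]_(s in `[0, 1]) H n (t, s).
pose M0 t := \int[mu]_(s in `[0, 1]) (eta' (f (t, s)) * (f1 (t, s) * g2 (t, s) - f2 (t, s) * g1 (t, s))).
have iD : mu2.-integrable (rect t0 t1) (EFin \o (fun z => eta' (f z) * (f1 z * g2 z - f2 z * g1 z))).
  have := integrableB mr (sqintM mr sef1 sg2) (sqintM mr sef2 sg1).
  by apply: eq_integrable => // z _ /=; rewrite -EFinB; congr EFin; ring.
(* Its column integrals bound those of [H n] for every [n], since L2 norms of difference quotients
   are at most those of the derivatives. *)
pose dom z := (C ^+ 2 * f1 z ^+ 2 + g2 z ^+ 2) + (g1 z ^+ 2 + C ^+ 2 * f2 z ^+ 2).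
have idom : mu2.-integrable (rect t0 t1) (EFin \o dom).
  have [_ i1] := sf1; have [_ i2] := sf2; have [_ i3] := sg1; have [_ i4] := sg2.
  have := integrableD mr (integrableD mr (integrableZl mr (C ^+ 2) i1) i4)
     (integrableD mr i3 (integrableZl mr (C ^+ 2) i2)).
  by apply: eq_integrable => // z _ /=; rewrite /dom !EFinD !EFinM.
have slice : {ae mu, forall t, (Mn n t @[n --> \oo] --> M0 t) /\
    forall n, `|Mn n t| <= \int[mu]_(s in `[0, 1]) dom (t, s)}.
  apply: (ae_imp2 (Sob_vline Sf) (Sob_vline Sg)) => t vf vg.
  have [Af pf ef [l1f l2f] [l1 per1]] := vf; have [Ag pg eg [l1g l2g] [k1 perk1]] := vg.
  have ce := ceb _ vf.
  have Aef := AC_chain1 deta ceta' Af.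
  pose kk s := eta' (fb (t, s)) * f1 (t, s).
  have ceb' : continuous (fun s => eta' (fb (t, s))).
    by move=> s; apply: (@continuous_comp _ _ _ (fun s => fb (t, s)) eta'); [exact: (AC_continuous Af)|exact: ceta'].
  have skk : sqint mu `[0, 1] kk.
    apply: (sqint_boundedM (C := C)) => //.
      by apply: measurable_funTS; exact: continuous_measurable_fun.
    by split; [apply: measurable_funTS; exact: locint_measurable|exact: l1f].
  have sg1' : sqint mu `[0, 1] (fun s => g1 (t, s)).
    by split; [apply: measurable_funTS; exact: locint_measurable|exact: l1g].
  have sg2' : sqint mu `[0, 1] (fun s => g2 (t, s)).
    by split; [apply: measurable_funTS; apply: locint_measurable; case: Ag|exact: l2g].
  have sef2' : sqint mu `[0, 1] (fun s => eta' (fb (t, s)) * f2 (t, s)).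
    apply: (sqint_boundedM (C := C)) => //.
      by apply: measurable_funTS; exact: continuous_measurable_fun.
    by split; [apply: measurable_funTS; apply: locint_measurable; case: Af|exact: l2f].
  have lef2 : locint (fun s => (eta' (fb (t, s)) * f2 (t, s)) ^+ 2).
    apply: locint_eq (locint_cM (continuous_sqr ceb') l2f) _ => s; by rewrite exprMn.
  have pef s : eta (fb (t, s + 1)) = eta (fb (t, s)) by rewrite pf.
  have cdg n : continuous (diffq (h_ n) (fun s => gb (t, s))).
    exact: AC_continuous_diffq (AC_continuous Ag).
  have cdf n : continuous (diffq (- h_ n) (fun s => eta (fb (t, s)))).
    exact: AC_continuous_diffq ce.
  have sdg n := sqint_continuous 0 1 (cdg n).
  have sdf n := sqint_continuous 0 1 (cdf n).
  have ldk n : locint (fun s => eta (fb (t, s)) * diffq (h_ n) (fun s => g1 (t, s)) s).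
    apply: locint_cM => //; apply: locint_eq (locintZ (h_ n)^-1 (locintB (locint_shift (h_ n) k1) k1)) _ => s.
    by rewrite /diffq mulrC.
  (* Periodicity moves the difference quotient from [g1] to [eta(f)], with its step reversed. *)
  have MnE n : Mn n t = \int[mu]_(s in `[0, 1]) (kk s * diffq (h_ n) (fun s => gb (t, s)) s) -
     \int[mu]_(s in `[0, 1]) (g1 (t, s) * diffq (- h_ n) (fun s => eta (fb (t, s))) s).
    rewrite -(periodic_by_parts (h_ n) ce pef k1 perk1) -RintegralD; [|by []|exact: sqintM|exact: ldk].
    apply: ae_eq_Rintegral => //.
    - apply: measurable_funTS; apply: (measurable_slice2 t (f := H n)).
      have mG : measurable_fun setT (G n).
        by apply: measurable_funM => //; apply: measurable_funB; [exact: measurable_shift2 (sob_m Sg)|exact: sob_m Sg].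
      have mG1 : measurable_fun setT (G1 n).
        by apply: measurable_funM => //; apply: measurable_funB; [exact: measurable_shift2 (sob_m1 Sg)|exact: sob_m1 Sg].
      have mff : measurable_fun setT f by exact: sob_m Sf.
      apply: measurable_funD; apply: measurable_funM => //.
        apply: measurable_funM; [exact: (measurableT_comp meta' mff)|exact: sob_m1 Sf].
      by apply: (measurableT_comp _ mff); exact: continuous_measurable_fun.
    - apply: measurable_funD; last by apply: measurable_funTS; exact: locint_measurable (ldk n).
      by apply: measurable_funM; [have [] := skk|have [] := sdg n].
    - apply: (ae_imp3 ef eg (ae_shift (h_ n) eg)) => s [q1 _] [q2 _] [q3 _] _.
      by rewrite /H /kk /G /G1 /diffq /= q1 q2 q3.
  split.
    have -> : M0 t = \int[mu]_(s in `[0, 1]) (kk s * g2 (t, s)) -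
       \int[mu]_(s in `[0, 1]) (g1 (t, s) * (eta' (fb (t, s)) * f2 (t, s))).
      rewrite -RintegralB; [|by []|exact: sqintM|exact: sqintM].
      apply: ae_eq_Rintegral => //.
      - apply: measurable_funTS; apply: (measurable_slice2 t (f := fun z => eta' (f z) * (f1 z * g2 z - f2 z * g1 z))).
        apply: measurable_funM; first by apply: (measurableT_comp meta'); exact: sob_m Sf.
        by apply: measurable_funB; apply: measurable_funM; [exact: sob_m1 Sf|exact: sob_m2 Sg|exact: sob_m2 Sf|exact: sob_m1 Sg].
      - by apply: measurable_funB; apply: measurable_funM; [have [] := skk|have [] := sg2'|have [] := sg1'|have [] := sef2'].
      - by apply: (ae_imp ef) => s [q1 _] _; rewrite /kk /= q1; ring.
    under eq_fun do rewrite MnE.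
    apply: cvgB.
      by apply: slice_limit.
    apply: (slice_limit (h_ := fun n => - h_ n) sg1' Aef pef lef2).
      by move=> n; rewrite oppr_eq0.
    by rewrite -oppr0; exact: cvgN.
  move=> n; rewrite MnE; apply: (le_trans (ler_normB _ _)).
  have b1 := sqint_Rle m01 skk (sdg n); have b2 := sqint_Rle m01 sg1' (sdf n).
  apply: (le_trans (lerD b1 b2)).
  have c1 := diffq_L2 Ag pg l2g (hn0 n).
  have c2 : \int[mu]_(s in `[0, 1]) (diffq (- h_ n) (fun s => eta (fb (t, s))) s ^+ 2) <=
     \int[mu]_(s in `[0, 1]) ((eta' (fb (t, s)) * f2 (t, s)) ^+ 2).
    by apply: (diffq_L2 Aef pef lef2); rewrite oppr_eq0.
  have c3 : \int[mu]_(s in `[0, 1]) (kk s ^+ 2) <= \int[mu]_(s in `[0, 1]) (C ^+ 2 * f1 (t, s) ^+ 2).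
    apply: le_Rintegral; [by []|by have [] := skk|exact: (locintZ _ l1f)|].
    move=> s _; rewrite /kk exprMn ler_wpM2r ?sqr_ge0// -real_normK ?num_real//.
    by rewrite lerXn2r ?nnegrE.
  have c4 : \int[mu]_(s in `[0, 1]) ((eta' (fb (t, s)) * f2 (t, s)) ^+ 2) <= \int[mu]_(s in `[0, 1]) (C ^+ 2 * f2 (t, s) ^+ 2).
    apply: le_Rintegral; [by []|by have [] := sef2'|exact: (locintZ _ l2f)|].
    move=> s _; rewrite exprMn ler_wpM2r ?sqr_ge0// -real_normK ?num_real//.
    by rewrite lerXn2r ?nnegrE.
  rewrite /dom RintegralD; [|by []|exact: (locintD (locintZ _ l1f) l2g)|exact: (locintD l1g (locintZ _ l2f))].
  rewrite RintegralD; [|by []|exact: (locintZ _ l1f)|exact: l2g].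
  rewrite RintegralD; [|by []|exact: l1g|exact: (locintZ _ l2f)].
  lra.
have lim1 : \int[mu]_(t in `[t0, t1]) Mn n t @[n --> \oo] --> \int[mu]_(t in `[t0, t1]) M0 t.
  apply: (@Rintegral_dominated _ _ _ mu _ _ _ (fun t => \int[mu]_(s in `[0, 1]) dom (t, s))) => //.
  - by move=> n; exact: (measurable_fine_fubini1 mt m01 (iH n)).
  - exact: (measurable_fine_fubini1 mt m01 iD).
  - by apply: (ae_imp slice) => t [].
  - exact: (fubini_rect_int1 mt m01 idom).
  - by apply: (ae_imp slice) => t [_ h] n _.
have lim2 : \int[mu]_(t in `[t0, t1]) Mn n t @[n --> \oo] -->
    \int[mu]_(s in `[0, 1]) (eta (fb (t1, s)) * g2 (t1, s)) -
    \int[mu]_(s in `[0, 1]) (eta (fb (t0, s)) * g2 (t0, s)).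
  rewrite (_ : (fun n => _) = (fun n => X n t1 - X n t0)).
    by apply: cvgB; exact: Xlim.
  by apply/funext => n; rewrite XE (fubini_rect1 mt m01 (iH n)).
by rewrite (fubini_rect1 mt m01 iD); exact: (cvg_unique _ lim1 lim2).
Qed.

End det.

End Sobolev.

(** * From weak derivatives to lines, and integrals over slices *)

Section bridge.
Context {R : realType}.
Local Notation mu := (@lebesgue_measure R).
Local Notation mu2 := (@lebesgue_measure R \x @lebesgue_measure R)%E.
Implicit Types f g k : R * R -> R.

Lemma box_square (n : nat) : box (n%:R : R) = square n.
Proof.
by apply/seteqP; split=> z; rewrite /box /square /= !in_itv/= -!ler_norml.
Qed.

Lemma measurable_square n : measurable (@square R n : set (measurableTypeR R * measurableTypeR R)).
Proof. exact: measurable_rectR. Qed.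

Lemma box_integrable_sqr f : measurable_fun setT f -> box_integrable (fun z => f z ^+ 2) ->
  box_integrable f.
Proof.
move=> mf bf n.
have i1 : mu2.-integrable (square n) (EFin \o (fun=> 1 : R)).
  apply: measurable_bounded_integrable => //.
  - exact: measurable_square.
  - by rewrite /square /rect /= product_measure1E//= !lebesgue_measure_itv/=; case: ifP => _; rewrite ?mul0e// -EFinB -EFinM ltry.
  - exact: bounded_cst.
have i2 := @integrableD _ _ _ mu2 _ (measurable_square n) _ _ i1 (bf n).
apply: (@integrable_le _ _ _ mu2 _ _ (fun z => 1 + f z ^+ 2)) => //.
- exact: measurable_square.
- exact: measurable_funTS.
- move=> z _; have := sqr_ge0 (`|f z| - 1); have := real_normK (num_real (f z)).
  by have := normr_ge0 (f z); nra.
Qed.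

Lemma test2_tensor (b c : R -> R) : test1 b -> test1 c ->
  [/\ test2 (fun z : R * R => b z.1 * c z.2),
      pd1 (fun z : R * R => b z.1 * c z.2) = (fun z => derive1 b z.1 * c z.2) &
      pd2 (fun z : R * R => b z.1 * c z.2) = (fun z => b z.1 * derive1 c z.2)].
Proof.
move=> tb tc; have db := test1_is_derive tb; have dc := test1_is_derive tc.
have [_ cb cb' [M1 b0]] := tb; have [_ cc cc' [M2 c0]] := tc.
have e1 (x : R) (k : R) : is_derive x (1 : R) (fun t => b t * k) (derive1 b x * k).
  have d := is_deriveM (db x) (is_derive_cst k x (1 : R)); apply: (is_derive_eq d).
  by rewrite /GRing.scale/= mulr0 add0r mulrC.
have e2 (x : R) (k : R) : is_derive x (1 : R) (fun t => k * c t) (k * derive1 c x).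
  have d := is_deriveZ k (dc x); exact: d.
have p1 : pd1 (fun z : R * R => b z.1 * c z.2) = (fun z => derive1 b z.1 * c z.2).
  by apply/funext => z; have := @derive1_is_derive R (fun t => b t * c z.2) (fun t => derive1 b t * c z.2) _ (e1 z.1 (c z.2)).
have p2 : pd2 (fun z : R * R => b z.1 * c z.2) = (fun z => b z.1 * derive1 c z.2).
  by apply/funext => z; have := @derive1_is_derive R (fun t => b z.1 * c t) (fun t => b z.1 * derive1 c t) _ (e2 z.2 (b z.1)).
have cM (f1 f2 : R -> R) : continuous f1 -> continuous f2 ->
    continuous (fun z : R * R => f1 z.1 * f2 z.2).
  move=> k1 k2 z; apply: cvgM.
    by apply: (@continuous_comp _ _ _ fst f1); [exact: cvg_fst|exact: k1].
  by apply: (@continuous_comp _ _ _ snd f2); [exact: cvg_snd|exact: k2].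
split => //; split.
- split => z.
  + by have := e1 z.1 (c z.2); case.
  + by have := e2 z.2 (b z.1); case.
- exact: cM.
- by rewrite p1; exact: cM.
- by rewrite p2; exact: cM.
- exists (Num.max M1 M2) => z; rewrite !gt_max => -[] /andP[h1 h2].
    by rewrite b0 ?mul0r.
  by rewrite c0 ?mulr0.
Qed.

Lemma integrable_support f k (C : R) N : box_integrable f -> measurable_fun setT k ->
  (forall z, `|k z| <= C) -> (forall z, ~ square N z -> k z = 0) ->
  mu2.-integrable setT (EFin \o (fun z => f z * k z)).
Proof.
move=> bf mk kC k0.
have i1 : mu2.-integrable (square N) (EFin \o (fun z => k z * f z)).
  by apply: (integrable_boundedM (C := C)) => //; [exact: measurable_square|exact: measurable_funTS].
move: i1; rewrite integrable_mkcond; last exact: measurable_square.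
apply: eq_integrable => // z _; rewrite patchE; case: ifPn => [_|/negP zN] /=; first by rewrite mulrC.
by rewrite k0 ?mulr0// => zs; apply: zN; rewrite inE.
Qed.

Lemma test1_tensor_support (b c : R -> R) : test1 b -> test1 c ->
  exists N : nat, exists C : R, forall z : R * R,
   [/\ `|b z.1 * c z.2| <= C, `|derive1 b z.1 * c z.2| <= C, `|b z.1 * derive1 c z.2| <= C &
     ~ square N z -> [/\ b z.1 * c z.2 = 0, derive1 b z.1 * c z.2 = 0 & b z.1 * derive1 c z.2 = 0]].
Proof.
move=> tb tc; have [N1 [C1 h1]] := test1_bound tb; have [N2 [C2 h2]] := test1_bound tc.
exists (N1 + N2)%N, (C1 * C2) => z.
have [b1 b2 b3] := h1 z.1; have [c1 c2 c3] := h2 z.2.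
split; rewrite ?normrM ?ler_pM// => /not_andP[] /negP; rewrite /= in_itv/= -ler_norml -ltNge => h.
- have [|-> ->] := b3; last by rewrite !mul0r.
  by apply: le_lt_trans h; rewrite ler_nat leq_addr.
- have [|-> ->] := c3; last by rewrite !mulr0.
  by apply: le_lt_trans h; rewrite ler_nat leq_addl.
Qed.

Lemma measurable_tensor (b c : R -> R) : continuous b -> continuous c ->
  measurable_fun setT (fun z : R * R => b z.1 * c z.2).
Proof.
move=> cb cc; apply: measurable_funM.
  by apply: (measurableT_comp (continuous_measurable_fun cb)).
by apply: (measurableT_comp (continuous_measurable_fun cc)).
Qed.

Lemma wpd1_tensor f g : measurable_fun setT f -> measurable_fun setT g ->
  box_integrable f -> box_integrable g -> is_wpd1 f g ->
  forall b c : R -> R, test1 b -> test1 c ->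
  \int[mu2]_z ((f z * derive1 b z.1 + g z * b z.1) * c z.2) = 0.
Proof.
move=> mf mg bf bg fg b c tb tc.
have [t2 p1 _] := test2_tensor tb tc.
have [N [C h]] := test1_tensor_support tb tc.
have [_ cb cb' _] := tb; have [_ cc cc' _] := tc.
have i1 : mu2.-integrable setT (EFin \o (fun z => f z * (derive1 b z.1 * c z.2))).
  apply: (@integrable_support _ _ C N) => //; first exact: measurable_tensor.
    by move=> z; have [] := h z.
  by move=> z zN; have [_ _ _ /(_ zN)[]] := h z.
have i2 : mu2.-integrable setT (EFin \o (fun z => g z * (b z.1 * c z.2))).
  apply: (@integrable_support _ _ C N) => //; first exact: measurable_tensor.
    by move=> z; have [] := h z.
  by move=> z zN; have [_ _ _ /(_ zN)[]] := h z.
under eq_Rintegral do rewrite mulrDl -!mulrA.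
rewrite RintegralD//; rewrite /Rintegral.
have := fg _ t2; rewrite p1 /leb2 => ->.
by rewrite fineN addNr.
Qed.

Lemma measurable_swap f : measurable_fun setT f -> measurable_fun setT (fun z : R * R => f (z.2, z.1)).
Proof. by move=> mf; apply: (measurableT_comp mf); exact: measurable_fun_pair. Qed.

Lemma box_integrable_swap f : measurable_fun setT f -> box_integrable f ->
  box_integrable (fun z => f (z.2, z.1)).
Proof.
move=> mf bf n; have mf' := measurable_swap mf; apply/integrableP; split.
  by apply/measurable_EFinP; exact: measurable_funTS.
have /integrableP[_] := bf n.
rewrite (@tonelliR1 _ _ _ (fun z => `|f (z.2, z.1)|)); last 2 first.
- exact: measurableT_comp.
- by [].
by rewrite (@tonelliR2 _ _ _ (fun z => `|f z|))//; exact: measurableT_comp.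
Qed.

Lemma Rintegral_swap f N : measurable_fun setT f -> box_integrable f ->
  (forall z, ~ square N z -> f z = 0) -> \int[mu2]_z f (z.2, z.1) = \int[mu2]_z f z.
Proof.
move=> mf bf f0.
rewrite (@Rintegral_setT_support _ _ _ mu2 (square N) f)//.
rewrite (@Rintegral_setT_support _ _ _ mu2 (square N) (fun z => f (z.2, z.1))); last first.
  by move=> z zN; apply: f0 => -[h1 h2]; apply: zN.
rewrite (fubini_rect1 (measurable_itvR _) (measurable_itvR _) (box_integrable_swap mf bf N)).
by rewrite (fubini_rect2 (measurable_itvR _) (measurable_itvR _) (bf N)).
Qed.

Lemma wpd2_tensor f g : measurable_fun setT f -> measurable_fun setT g ->
  box_integrable f -> box_integrable g -> is_wpd2 f g ->
  forall b c : R -> R, test1 b -> test1 c ->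
  \int[mu2]_z ((f (z.2, z.1) * derive1 b z.1 + g (z.2, z.1) * b z.1) * c z.2) = 0.
Proof.
move=> mf mg bf bg fg b c tb tc.
have [t2 _ p2] := test2_tensor tc tb.
have [N [C h]] := test1_tensor_support tc tb.
have [_ cb cb' _] := tb; have [_ cc cc' _] := tc.
have i1 : mu2.-integrable setT (EFin \o (fun z => f z * (c z.1 * derive1 b z.2))).
  apply: (@integrable_support _ _ C N) => //; first exact: measurable_tensor.
    by move=> z; have [] := h z.
  by move=> z zN; have [_ _ _ /(_ zN)[]] := h z.
have i2 : mu2.-integrable setT (EFin \o (fun z => g z * (c z.1 * b z.2))).
  apply: (@integrable_support _ _ C N) => //; first exact: measurable_tensor.
    by move=> z; have [] := h z.
  by move=> z zN; have [_ _ _ /(_ zN)[]] := h z.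
pose F z := (f z * derive1 b z.2 + g z * b z.2) * c z.1.
have FE z : F z = f z * (c z.1 * derive1 b z.2) + g z * (c z.1 * b z.2) by rewrite /F; ring.
have iF : mu2.-integrable setT (EFin \o F).
  by have := integrableD measurableT i1 i2; apply: eq_integrable => // z _ /=; rewrite FE EFinD.
transitivity (\int[mu2]_z F (z.2, z.1)); first by [].
rewrite (@Rintegral_swap F N).
- rewrite (@eq_Rintegral _ _ _ mu2 _ (fun z => f z * (c z.1 * derive1 b z.2) + g z * (c z.1 * b z.2))); last by move=> z _; exact: FE.
  rewrite RintegralD//; rewrite /Rintegral.
  have := fg _ t2; rewrite p2 /leb2 => ->.
  by rewrite fineN addNr.
- by have /integrableP[/measurable_EFinP] := iF.
- by move=> n; apply: integrableS iF => //; exact: measurable_square.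
- by move=> z zN; have [_ _ _ /(_ zN)[e1 _ e3]] := h z; rewrite FE e1 e3 !mulr0 addr0.
Qed.

(** The representative along columns is obtained from [ACL] applied after exchanging the two
    coordinates. *)
Lemma H1loc_Sob v v1 v2 : (forall t s, v (t, s + 1) = v (t, s)) -> H1loc v v1 v2 ->
  (\int[mu2]_(z in strip) (v1 z ^+ 2 + v2 z ^+ 2)%:E < +oo)%E ->
  exists va vb, Sob v va vb v1 v2.
Proof.
move=> per [[mv lv] [m1 l1] [m2 l2] w1 w2] fin.
have bsq f : (forall M : R, (leb2 R).-integrable (box M) (fun x => (f x ^+ 2)%:E)) ->
    box_integrable (fun z => f z ^+ 2).
  by move=> h n; have := h n%:R; rewrite box_square.
have bv := bsq _ lv; have b1 := bsq _ l1; have b2 := bsq _ l2.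
have bv' := box_integrable_sqr mv bv; have b1' := box_integrable_sqr m1 b1.
have b2' := box_integrable_sqr m2 b2.
have [va [ma ea la]] := ACL mv m1 bv' b1' (wpd1_tensor mv m1 bv' b1' w1).
have [vb [mb eb lb]] := ACL (measurable_swap mv) (measurable_swap m2)
  (box_integrable_swap mv bv') (box_integrable_swap m2 b2') (wpd2_tensor mv m2 bv' b2' w2).
exists va, (fun z => vb (z.2, z.1)); split => //; first exact: measurable_swap.
apply: ae_prod1_conv; first exact: (measurable_eqset mv (measurable_swap mb)).
exact: (ae_prod2 eb).
Qed.

Lemma OmegaE : @Omega R = setT `*` [set` `[0, 1[].
Proof. by apply/seteqP; split=> z /=; rewrite in_itv/=; [move=> [-> ->]|move=> [_ /andP[]]]. Qed.

Lemma integral_Omega_strip f : measurable_fun setT f -> (forall z, 0 <= f z) ->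
  (\int[mu2]_(z in Omega R) (f z)%:E = \int[mu2]_(z in strip) (f z)%:E)%E.
Proof.
move=> mf f0; rewrite OmegaE /strip.
rewrite (tonelli_rect1 mu mu (f := EFin \o f)); [|exact: measurableT|exact: measurable_itvR|
  exact/measurable_EFinP|by move=> z; rewrite lee_fin].
rewrite (tonelli_rect1 mu mu (f := EFin \o f)); [|exact: measurableT|exact: measurable_itvR|
  exact/measurable_EFinP|by move=> z; rewrite lee_fin].
apply: eq_integral => t _; apply: integral_itv_bndo_bndc.
by apply/measurable_EFinP; apply: measurable_funTS; exact: measurable_slice2.
Qed.

Lemma strip_slices f : measurable_fun setT f -> (forall z, 0 <= f z) ->
  (\int[mu2]_(z in strip) (f z)%:E = \int[mu]_t \int[mu]_(s in `[0%R, 1%R]) (f (t, s))%:E)%E.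
Proof.
move=> mf f0; rewrite /strip.
by rewrite (tonelli_rect1 mu mu (f := EFin \o f)); [|exact: measurableT|exact: measurable_itvR|
  exact/measurable_EFinP|by move=> z; rewrite lee_fin].
Qed.

Lemma measurable_slice_integral f : measurable_fun setT f -> (forall z, 0 <= f z) ->
  measurable_fun setT (fun t => \int[mu]_(s in `[0%R, 1%R]) (f (t, s))%:E)%E.
Proof.
move=> mf f0.
have -> : (fun t => \int[mu]_(s in `[0%R, 1%R]) (f (t, s))%:E)%E =
  fubini_F mu ((EFin \o f) \_ (setT `*` `[0, 1])).
  apply/funext => t; rewrite /fubini_F [LHS]integral_mkcond; apply: eq_integral => s _.
  rewrite !patchE; congr (if _ then _ else _).
  by apply/idP/idP; rewrite !inE => //= -[].
apply: measurable_fun_fubini_tonelli_F => //.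
- have [h _] := measurable_restrictT (EFin \o f) (@measurable_stripR R); apply: h.
  by apply: measurable_funTS; exact/measurable_EFinP.
- by move=> z; rewrite patchE; case: ifP => // _; rewrite lee_fin.
Qed.

(** Otherwise almost every slice over [A] would carry more than [e], and the integral over the strip
    would be infinite. *)
Lemma exists_small_slice (A : set R) f (P : R -> Prop) (e : R) :
  measurable A -> mu A = +oo%E -> measurable_fun setT f -> (forall z, 0 <= f z) ->
  (\int[mu2]_(z in strip) (f z)%:E < +oo)%E -> {ae mu, forall t, P t} -> 0 < e ->
  exists t, [/\ A t, P t & (\int[mu]_(s in `[0%R, 1%R]) (f (t, s))%:E <= e%:E)%E].
Proof.
move=> mA Aoo mf f0 foo aP e0.
pose G t := (\int[mu]_(s in `[0%R, 1%R]) (f (t, s))%:E)%E.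
have mG : measurable_fun setT G by exact: measurable_slice_integral.
have G0 t : (0 <= G t)%E by apply: integral_ge0 => s _; rewrite lee_fin.
apply: contrapT => no.
have le : (\int[mu]_(t in A) e%:E <= \int[mu]_(t in A) G t)%E.
  apply: ae_ge0_le_integral => //.
  - by move=> t _; rewrite lee_fin ltW.
  - exact: measurable_funTS.
  - apply: (ae_imp aP) => t Pt At; rewrite leNgt; apply/negP => h.
    by apply: no; exists t; split => //; exact: ltW.
have le2 : (\int[mu]_(t in A) G t <= \int[mu]_t G t)%E.
  by apply: ge0_subset_integral => //.
move: foo; rewrite strip_slices// -/G => foo.
have := le_lt_trans (le_trans le le2) foo.
have -> : (\int[mu]_(t in A) e%:E = e%:E * +oo)%E by rewrite -Aoo; exact: integral_cst.
by rewrite mulry gtr0_sg// mul1e ltxx.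
Qed.

Lemma avg_vline v va vb v1 v2 t : vline v va vb v1 v2 t -> measurable_fun setT v ->
  avg v t = \int[mu]_(s in `[0, 1]) vb (t, s).
Proof.
move=> [A _ e _ _] mv; rewrite /avg /leb1.
have -> : [set s : R | 0 <= s /\ s < 1] = [set` `[0, 1[].
  by apply/seteqP; split=> s /=; rewrite in_itv/=; [move=> [-> ->]|move=> /andP[]].
rewrite integral_itv_bndo_bndc; last first.
  by apply/measurable_EFinP; apply: measurable_funTS; exact: measurable_slice2.
apply: (@ae_eq_Rintegral _ _ _ mu `[0, 1] (fun s => v (t, s)) (fun s => vb (t, s))) => //.
- by apply: measurable_funTS; exact: measurable_slice2.
- apply: measurable_funTS; apply: continuous_measurable_fun; exact: AC_continuous A.
- by apply: (ae_imp e) => s [].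
Qed.

End bridge.

(** * Good slices and the null Lagrangian *)

Section slices.
Context {R : realType}.
Local Notation mu := (@lebesgue_measure R).
Local Notation mu2 := (@lebesgue_measure R \x @lebesgue_measure R)%E.

Lemma Rintegral_le_cst (k : R -> R) (c : R) : mu.-integrable `[0, 1] (EFin \o k) ->
  (forall s, 0 <= s <= 1 -> k s <= c) -> \int[mu]_(s in `[0, 1]) k s <= c.
Proof.
move=> ik kc; have h := @Rintegral_itv_cst R 0 1 c ler01.
rewrite subr0 mulr1 in h; rewrite -{}h; apply: le_Rintegral => //.
by apply: continuous_locint => x; exact: cvg_cst.
Qed.

Lemma Rintegral_near_cst (k : R -> R) (c e : R) : mu.-integrable `[0, 1] (EFin \o k) ->
  (forall s, 0 <= s <= 1 -> `|k s - c| <= e) -> `|\int[mu]_(s in `[0, 1]) k s - c| <= e.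
Proof.
move=> ik kc; have m01 := measurable_itvR (Interval (BLeft (0 : R)) (BRight 1)).
have ic : mu.-integrable `[0, 1] (EFin \o (fun=> c)).
  by apply: (@continuous_locint R (fun=> c)) => x; exact: cvg_cst.
have h := @Rintegral_itv_cst R 0 1 c ler01; rewrite subr0 mulr1 in h; rewrite -{1}h -RintegralB//.
have iB : mu.-integrable `[0, 1] (EFin \o (fun s => k s - c)).
  by have := @integrableB _ _ _ mu _ m01 _ _ ik ic; apply: eq_integrable.
apply: (le_trans (le_normr_Rintegral m01 iB)).
apply: Rintegral_le_cst => //; exact: (integrable_norm iB).
Qed.

Lemma Rintegral_le_ereal (k : R -> R) (F : R -> R) (c : R) : mu.-integrable `[0, 1] (EFin \o k) ->
  measurable_fun (`[0, 1]%classic : set (measurableTypeR R)) F -> (forall s, 0 <= k s <= F s) ->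
  (\int[mu]_(s in `[0%R, 1%R]) (F s)%:E <= c%:E)%E -> \int[mu]_(s in `[0, 1]) k s <= c.
Proof.
move=> ik mF kF Fc; rewrite -lee_fin -integral_EFin_Rintegral//; apply: le_trans Fc.
apply: ge0_le_integral => //.
- by move=> s _; rewrite lee_fin; case/andP: (kF s).
- by case/integrableP: ik.
- exact/measurable_EFinP.
- by move=> s _; rewrite lee_fin; case/andP: (kF s).
Qed.

Lemma ge0_Rintegral_subset d (T : measurableType d) (m : {measure set T -> \bar R}) (A B : set T)
    (k : T -> R) : measurable A -> measurable B -> A `<=` B -> (forall x, 0 <= k x) ->
  m.-integrable B (EFin \o k) -> \int[m]_(x in A) k x <= \int[m]_(x in B) k x.
Proof.
move=> mA mB AB k0 ik; have ikA := integrableS mB mA AB ik.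
rewrite -lee_fin -!integral_EFin_Rintegral//.
apply: ge0_subset_integral => //; first by case/integrableP: ik.
by move=> x _; rewrite lee_fin.
Qed.

Lemma ge0_Rintegral_eq0 d (T : measurableType d) (m : {measure set T -> \bar R}) (A : set T)
    (k : T -> R) : measurable A -> (forall x, 0 <= k x) ->
  m.-integrable A (EFin \o k) -> \int[m]_(x in A) k x <= 0 -> {ae m, forall x, A x -> k x = 0}.
Proof.
move=> mA k0 ik le0.
have e0 : (\int[m]_(x in A) `|(EFin \o k) x| = 0)%E.
  have -> : (\int[m]_(x in A) `|(EFin \o k) x| = \int[m]_(x in A) (k x)%:E)%E.
    by apply: eq_integral => x _; rewrite /= ger0_norm.
  rewrite integral_EFin_Rintegral//; congr EFin; apply/eqP; rewrite eq_le le0 /=.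
  exact: Rintegral_ge0.
have [h _] := ae_eq_integral_abs m mA (measurable_int _ ik).
by apply: (ae_imp (h e0)) => x hx Ax; have [] := hx Ax.
Qed.

Lemma itv_ooy (M : R) : mu `]M, +oo[ = +oo%E.
Proof. by rewrite lebesgue_measure_itv/= ltry addye. Qed.

Lemma itv_Nyo (M : R) : mu `]-oo, M[ = +oo%E.
Proof. by rewrite lebesgue_measure_itv/= ltNyr addey. Qed.

Section setup.
Variables (a m p : R) (u1 a1 b1 D11 D12 u2 a2 b2 D21 D22 : R * R -> R).

Record Setup : Prop := {
  st1 : Sob u1 a1 b1 D11 D12;
  st2 : Sob u2 a2 b2 D21 D22;
  st_div : {ae mu2, forall z, D11 z + D22 z = 0};
  st_m1 : elim_minfty (avg u1) a;
  st_m2 : elim_minfty (avg u2) m;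
  st_p1 : elim_pinfty (avg u1) a;
  st_p2 : elim_pinfty (avg u2) p
}.

Hypothesis S : Setup.

(** A slice fit to be an end of the cylinder: both components are uniformly close to their limits,
    and so is to 0, in L2, the derivative [D22], the only one in the boundary terms of [det_flux]
    for [u1] and [u2]. *)
Definition good (t l e : R) :=
  [/\ vline u1 a1 b1 D11 D12 t, vline u2 a2 b2 D21 D22 t,
     \int[mu]_(s in `[0, 1]) (D22 (t, s) ^+ 2) <= e ^+ 2 &
     forall s, 0 <= s <= 1 -> `|b1 (t, s) - a| <= e /\ `|b2 (t, s) - l| <= e].

Let mD11 : measurable_fun setT D11. Proof. exact: sob_m1 (st1 S). Qed.
Let mD12 : measurable_fun setT D12. Proof. exact: sob_m2 (st1 S). Qed.
Let mD21 : measurable_fun setT D21. Proof. exact: sob_m1 (st2 S). Qed.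
Let mD22 : measurable_fun setT D22. Proof. exact: sob_m2 (st2 S). Qed.

Definition grad2 z := (D11 z ^+ 2 + D12 z ^+ 2) + (D21 z ^+ 2 + D22 z ^+ 2).

Lemma grad2_ge0 z : 0 <= grad2 z.
Proof. by rewrite /grad2 !addr_ge0 ?sqr_ge0. Qed.

Lemma measurable_grad2 : measurable_fun setT grad2.
Proof. by apply: measurable_funD; apply: measurable_funD; apply: measurable_funX. Qed.

Lemma grad2_integrable : mu2.-integrable strip (EFin \o grad2).
Proof.
apply: integrable_lty_ge0; [exact: measurable_stripR|exact: measurable_funTS measurable_grad2|
  by move=> z _; exact: grad2_ge0|].
rewrite /grad2; under eq_integral do rewrite EFinD.
rewrite ge0_integralD//=.
- exact: lte_add_pinfty (sob_fin (st1 S)) (sob_fin (st2 S)).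
- exact: measurable_stripR.
- by move=> z _; rewrite lee_fin addr_ge0 ?sqr_ge0.
- apply/measurable_EFinP; apply: measurable_funTS; apply: measurable_funD; exact: measurable_funX.
- by move=> z _; rewrite lee_fin addr_ge0 ?sqr_ge0.
- apply/measurable_EFinP; apply: measurable_funTS; apply: measurable_funD; exact: measurable_funX.
Qed.

(** Where the slice energy is at most [(e / 2)^2], values lie within [e / 2] of the mean, itself
    within [e / 2] of its limit. *)
Lemma good_ex (A : set R) (l e : R) : measurable A -> mu A = +oo%E -> 0 < e ->
  {ae mu, forall t, A t -> `|avg u1 t - a| < e / 2} ->
  {ae mu, forall t, A t -> `|avg u2 t - l| < e / 2} ->
  exists t, A t /\ good t l e.
Proof.
move=> mA Aoo e0 h1 h2.
have P := ae_imp2 (ae_imp2 h1 h2 (fun t x y => conj x y))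
  (ae_imp2 (Sob_vline (st1 S)) (Sob_vline (st2 S)) (fun t x y => conj x y)) (fun t x y => conj x y).
have e20 : 0 < (e / 2) ^+ 2 by rewrite exprn_gt0// divr_gt0.
have foo : (\int[mu2]_(z in strip) (grad2 z)%:E < +oo)%E.
  by apply: (integrable_lty (@measurable_stripR R) grad2_integrable).
have [t [At [[k1 k2] [v1 v2]] st]] := exists_small_slice mA Aoo measurable_grad2 grad2_ge0 foo P e20.
exists t; split => //; have {}k1 := k1 At; have {}k2 := k2 At.
have [A1 _ _ [_ l12] _] := v1; have [A2 _ _ [_ l22] _] := v2.
have mg : measurable_fun (`[0, 1]%classic : set (measurableTypeR R)) (fun s => grad2 (t, s)).
  by apply: measurable_funTS; exact: measurable_slice2 measurable_grad2.
have i12 : \int[mu]_(s in `[0, 1]) (D12 (t, s) ^+ 2) <= (e / 2) ^+ 2.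
  apply: (Rintegral_le_ereal (l12 0 1) mg _ st) => s; rewrite sqr_ge0 /grad2/=.
  have := sqr_ge0 (D11 (t, s)); have := sqr_ge0 (D21 (t, s)); have := sqr_ge0 (D22 (t, s)); lra.
have i22 : \int[mu]_(s in `[0, 1]) (D22 (t, s) ^+ 2) <= (e / 2) ^+ 2.
  apply: (Rintegral_le_ereal (l22 0 1) mg _ st) => s; rewrite sqr_ge0 /grad2/=.
  have := sqr_ge0 (D11 (t, s)); have := sqr_ge0 (D21 (t, s)); have := sqr_ge0 (D12 (t, s)); lra.
have E (y l' B : R) : `|B - l'| < e / 2 ->
    (y - B) ^+ 2 <= (e / 2) ^+ 2 -> `|y - l'| <= e.
  move=> q1; rewrite -[X in X <= _]real_normK ?num_real// ler_pXn2r ?nnegrE//; last by rewrite divr_ge0// ltW.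
  move=> q2; rewrite -[y](subrK B) -addrA; apply: (le_trans (ler_normD _ _)); lra.
split => //.
  by apply: (le_trans i22); rewrite lerXn2r ?nnegrE ?divr_ge0 ?ltW//; lra.
move=> s s01; rewrite (avg_vline v1 (sob_m (st1 S))) in k1; rewrite (avg_vline v2 (sob_m (st2 S))) in k2.
split.
  by apply: (E _ _ _ k1); exact: le_trans (AC_mean_sqr A1 l12 s01) i12.
by apply: (E _ _ _ k2); exact: le_trans (AC_mean_sqr A2 l22 s01) i22.
Qed.

Lemma good_pos (T e : R) : 0 < e -> exists t, T < t /\ good t p e.
Proof.
move=> e0; have e20 : 0 < e / 2 by rewrite divr_gt0.
have [M1 h1] := st_p1 S e20; have [M2 h2] := st_p2 S e20.
pose M := Num.max T (Num.max M1 M2).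
have h1' : {ae mu, forall t, `]M, +oo[%classic t -> `|avg u1 t - a| < e / 2}.
  by apply: (ae_imp h1) => t ht; rewrite /= in_itv/= andbT /M !gt_max => /and3P[_ + _]; exact: ht.
have h2' : {ae mu, forall t, `]M, +oo[%classic t -> `|avg u2 t - p| < e / 2}.
  by apply: (ae_imp h2) => t ht; rewrite /= in_itv/= andbT /M !gt_max => /and3P[_ _]; exact: ht.
have [t [tM gt]] := good_ex (measurable_itvR _) (itv_ooy M) e0 h1' h2'.
by exists t; split => //; move: tM; rewrite /= in_itv/= andbT /M gt_max => /andP[].
Qed.

Lemma good_neg (T e : R) : 0 < e -> exists t, t < T /\ good t m e.
Proof.
move=> e0; have e20 : 0 < e / 2 by rewrite divr_gt0.
have [M1 h1] := st_m1 S e20; have [M2 h2] := st_m2 S e20.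
pose M := Num.min T (Num.min M1 M2).
have h1' : {ae mu, forall t, `]-oo, M[%classic t -> `|avg u1 t - a| < e / 2}.
  by apply: (ae_imp h1) => t ht; rewrite /= in_itv/= /M !lt_min => /and3P[_ + _]; exact: ht.
have h2' : {ae mu, forall t, `]-oo, M[%classic t -> `|avg u2 t - m| < e / 2}.
  by apply: (ae_imp h2) => t ht; rewrite /= in_itv/= /M !lt_min => /and3P[_ _]; exact: ht.
have [t [tM gt]] := good_ex (measurable_itvR _) (itv_Nyo M) e0 h1' h2'.
by exists t; split => //; move: tM; rewrite /= in_itv/= /M lt_min => /andP[].
Qed.

Lemma vline_continuous (v va vb v1 v2 : R * R -> R) t : vline v va vb v1 v2 t -> continuous (fun s => vb (t, s)).
Proof. by move=> [A _ _ _ _]; exact: AC_continuous A. Qed.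

(** With [Phi1 = x_1], [Phi2 = x_2], [psi = 1] and [w = 0], the flux identity is the divergence
    constraint itself: the mean of [u1] is the same on all columns, and its limit is [a]. *)
Lemma avg_b1 t : vline u1 a1 b1 D11 D12 t -> vline u2 a2 b2 D21 D22 t ->
  \int[mu]_(s in `[0, 1]) b1 (t, s) = a.
Proof.
move=> v1 v2; have c1 := vline_continuous v1; have ic1 := continuous_locint c1.
have cc (c : R) : continuous (fun _ : R * R => c) by move=> x; exact: cvg_cst.
have C1 : C1with (fst : R * R -> R) (fun=> 1) (fun=> 0).
  split => //; move=> x /=; [exact: is_derive_id|exact: is_derive_cst].
have C2 : C1with (snd : R * R -> R) (fun=> 0) (fun=> 1).
  split => //; move=> x /=; [exact: is_derive_cst|exact: is_derive_id].
have sc (c : R) a' b' : sqint mu2 (rect a' b') (fun z => c).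
  split; first exact: measurable_cst.
  apply: measurable_bounded_integrable => //; [exact: measurable_rectR| |exact: bounded_cst].
  by rewrite /rect /= product_measure1E//= !lebesgue_measure_itv/= lte01; case: ifP => _; rewrite ?mul0e// -EFinB -?EFinB -EFinM ltry.
apply/eqP; rewrite -subr_eq0 -normr_le0; apply/ler_addgt0Pr => e e0; rewrite add0r.
have [t1 [tt1 [w1 w2 _ g]]] := good_pos t e0.
have := flux (st1 S) (st2 S) (st_div S) C1 C2 (sg := 0) (fun z => esym (mulr0 _)) (fun a' b' => sc 1 a' b') (fun a' b' => sc 0 a' b') (ltW tt1) v1 v2 w1 w2.
rewrite /=; under [X in _ = X]eq_Rintegral do rewrite mul0r.
rewrite /Rintegral [X in _ = fine X]integral0 -!/(Rintegral _ _ _) /= => /eqP; rewrite subr_eq0 => /eqP <-.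
apply: Rintegral_near_cst; first exact: (continuous_locint (vline_continuous w1)).
by move=> s /g [].
Qed.

Lemma ler_normD3_le (x y z j k : R) : `|x| <= j -> `|y| <= k -> `|x + y + z| <= `|z| + k + j.
Proof. by move=> q1 q2; apply: (le_trans (ler_normD _ _)); have := ler_normD x y; lra. Qed.

(** With [Phi1 = x_2], [w = 1] and [sg = 0], the flux identity writes the difference of two means of
    [u2] as an integral of [D21]. This bounds the means over a compact range of [t]; outside it the
    limits [m] and [p] do. *)
Lemma avg_b2 : exists K0 : R, 0 <= K0 /\
  {ae mu, forall t, `|\int[mu]_(s in `[0, 1]) b2 (t, s)| <= K0}.
Proof.
have cc (c : R) : continuous (fun _ : R * R => c) by move=> x; exact: cvg_cst.
have C1 : C1with (snd : R * R -> R) (fun=> 0) (fun=> 1).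
  split => //; move=> x /=; [exact: is_derive_cst|exact: is_derive_id].
have C2 : C1with (fun _ : R * R => 0 : R) (fun=> 0) (fun=> 0).
  by split => //; move=> x /=; exact: is_derive_cst.
have sc (c : R) a' b' : sqint mu2 (rect a' b') (fun z => c).
  split; first exact: measurable_cst.
  apply: measurable_bounded_integrable => //; [exact: measurable_rectR| |exact: bounded_cst].
  by rewrite /rect /= product_measure1E//= !lebesgue_measure_itv/= lte01; case: ifP => _; rewrite ?mul0e// -EFinB -?EFinB -EFinM ltry.
have [M1 h1] := st_p2 S ltr01; have [M2 h2] := st_m2 S ltr01.
have [t0 [t0M [v10 v20 _ g0]]] := good_neg (Num.min M1 M2) ltr01.
have mr := measurable_rectR `[t0, M1] `[0, 1].
pose J := \int[mu2]_(z in rect t0 M1) 1 ^+ 2 + \int[mu2]_(z in rect t0 M1) (D21 z ^+ 2).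
have J0 : 0 <= J by rewrite addr_ge0// Rintegral_ge0// => z _; rewrite sqr_ge0.
exists (`|m| + `|p| + 1 + J).
have n0 (x y : R) : `|x - y| < 1 -> `|x| <= `|y| + 1.
  move=> h; rewrite -[x](subrK y); apply: (le_trans (ler_normD _ _)); lra.
have J1 := normr_ge0 m; have J2 := normr_ge0 p; split; first by lra.
apply: (ae_imp3 h1 h2 (ae_imp2 (Sob_vline (st1 S)) (Sob_vline (st2 S)) (fun t x y => conj x y))).
move=> t k1 k2 [v1 v2]; rewrite (avg_vline v2 (sob_m (st2 S))) in k1 k2.
have [tM|tM] := ltP M1 t; first by have := n0 _ _ (k1 tM); lra.
have [tM'|tM'] := ltP t M2; first by have := n0 _ _ (k2 tM'); lra.
have t0t : t0 <= t by rewrite ltW// (lt_le_trans t0M)// ge_min tM' orbT.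
have ww (z : R * R) : 0 = - 0 * 1 :> R by rewrite oppr0 mul0r.
have := flux (st1 S) (st2 S) (st_div S) C1 C2 ww (fun a' b' => sc 0 a' b') (fun a' b' => sc 1 a' b') t0t v10 v20 v1 v2.
rewrite /=; set I := (X in _ = X) => fl.
have I_le : `|I| <= J.
  rewrite /I; under eq_Rintegral do rewrite mul0r subr0.
  have [_ sD _] := Sob_rect (st2 S) t0 t; have mr' := measurable_rectR `[t0, t] `[0, 1].
  apply: (le_trans (sqint_Rle mr' (sc 1 t0 t) sD)).
  have sub : rect t0 t `<=` rect t0 M1.
    move=> z [/= + z2]; rewrite in_itv/= => /andP[q1 q2]; split => //=.
    by rewrite in_itv/= q1 (le_trans q2).
  apply: lerD; apply: ge0_Rintegral_subset => //; try by move=> z; rewrite sqr_ge0.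
    by have [] := sc 1 t0 M1.
  by have [_ [_ +] _] := Sob_rect (st2 S) t0 M1.
have q : `|\int[mu]_(s in `[0, 1]) b2 (t0, s) - m| <= 1.
  apply: Rintegral_near_cst; first exact: (continuous_locint (vline_continuous v20)).
  by move=> s /g0[].
have -> : \int[mu]_(s in `[0, 1]) b2 (t, s) = I + (\int[mu]_(s in `[0, 1]) b2 (t0, s) - m) + m.
  by rewrite -fl; ring.
apply: (le_trans (@ler_normD3_le _ _ m _ _ I_le q)); rewrite !lerD2r lerDl; exact: normr_ge0.
Qed.

Lemma good_slice_D22 (eta : R -> R) (M t l e : R) : continuous eta ->
  (forall x, `|x - a| <= 1 -> `|eta x| <= M) -> 0 <= e <= 1 -> good t l e ->
  `|\int[mu]_(s in `[0, 1]) (eta (b1 (t, s)) * D22 (t, s))| <= M * e.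
Proof.
move=> ce eM /andP[e0 e1] [v1 v2 d22 g].
have M0 : 0 <= M by apply: le_trans (eM a _); rewrite ?subrr ?normr0.
have m01 := measurable_itvR (Interval (BLeft (0 : R)) (BRight 1)).
have cb := vline_continuous v1.
have ceb : continuous (fun s => eta (b1 (t, s))).
  by move=> s; apply: (@continuous_comp _ _ _ (fun s => b1 (t, s)) eta); [exact: cb|exact: ce].
have se := sqint_continuous 0 1 ceb.
have [A2 _ _ [_ l22] _] := v2.
have sd : sqint mu `[0, 1] (fun s => D22 (t, s)).
  by split; [apply: measurable_funTS; apply: locint_measurable; case: A2|exact: l22].
rewrite -(@ler_pXn2r _ 2) ?nnegrE ?mulr_ge0// real_normK ?num_real//.
apply: (le_trans (cauchy_schwarz_Rintegral m01 se sd)); rewrite exprMn; apply: ler_pM => //.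
- by apply: Rintegral_ge0 => s _; exact: sqr_ge0.
- by apply: Rintegral_ge0 => s _; exact: sqr_ge0.
- apply: Rintegral_le_cst; first exact: se.2.
  move=> s /g[g1 _]; rewrite -real_normK ?num_real// lerXn2r ?nnegrE//.
  by apply: eM; exact: le_trans e1.
Qed.

Lemma good_slice_Phi (Phi : R * R -> R) (l d : R) : continuous Phi -> 0 < d ->
  exists e, 0 < e /\ forall t e', e' <= e -> good t l e' ->
    `|\int[mu]_(s in `[0, 1]) Phi (b1 (t, s), b2 (t, s)) - Phi (a, l)| <= d.
Proof.
move=> cP d0; have [r r0 h] := continuous_ball2 (a, l) cP d0.
exists (r / 2); split; first by rewrite divr_gt0.
move=> t e' e'r [v1 v2 _ g]; apply: Rintegral_near_cst.
  apply: continuous_locint => s.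
  apply: (@continuous_comp _ _ _ (fun s => (b1 (t, s), b2 (t, s))) Phi); last exact: cP.
  exact: (continuous_pair (vline_continuous v1) (vline_continuous v2)).
move=> s /g[g1 g2]; rewrite distrC ltW//; apply: h => /=; move: g1 g2; rewrite !ler_distl; lra.
Qed.

(** The boundary terms of [det_flux] on good slices are at most [M * e'] each, one factor for
    [eta(u1)] and one for [D22]. *)
Lemma det_bulk (eta eta' : R -> R) (C d : R) :
  (forall t, is_derive t (1 : R) eta (eta' t)) -> continuous eta' ->
  (forall t, `|eta' t| <= C) -> 0 < d ->
  exists e, 0 < e /\ forall t0 t1 l0 l1 e', 0 <= e' <= e -> t0 <= t1 -> good t0 l0 e' -> good t1 l1 e' ->
  `|\int[mu2]_(z in rect t0 t1) (eta' (u1 z) * (D11 z * D22 z - D12 z * D21 z))| <= d.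
Proof.
move=> de ce' eC d0; have ce := is_derive_continuous de.
have C0 : 0 <= C by exact: le_trans (normr_ge0 _) (eC 0).
(* A bound for [eta] within distance 1 of [a], where [u1] lies on a good slice with [e' <= 1]. *)
pose M := `|eta a| + C.
have M0 : 0 <= M by rewrite addr_ge0.
have eM x : `|x - a| <= 1 -> `|eta x| <= M.
  move=> xa; have [c [_ E]] := mean_value a x de.
  rewrite -[eta x](subrK (eta a)) E addrC (le_trans (ler_normD _ _))// lerD2l normrM.
  by rewrite -[leRHS]mulr1 ler_pM.
exists (Num.min 1 (d / (2 * (M + 1)))); split.
  by rewrite lt_min ltr01 divr_gt0// mulr_gt0// ltr_wpDl.
move=> t0 t1 l0 l1 e' /andP[e'0]; rewrite le_min => /andP[e'1 e'd] t01 g0 g1.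
have [v10 v20 _ _] := g0; have [v11 v21 _ _] := g1.
rewrite (det_flux (st1 S) (st2 S) de ce' eC t01 v10 v20 v11 v21).
apply: (le_trans (ler_normB _ _)).
have h0 := good_slice_D22 ce eM _ g0; have h1 := good_slice_D22 ce eM _ g1.
rewrite e'0 e'1 in h0 h1; have {}h0 := h0 isT; have {}h1 := h1 isT.
have : M * e' <= d / 2.
  apply: (@le_trans _ _ ((M + 1) * (d / (2 * (M + 1))))).
    by apply: ler_pM => //; rewrite lerDl.
  have M1 : M + 1 != 0 by rewrite lt0r_neq0// ltr_wpDl.
  by rewrite le_eqVlt; apply/orP; left; apply/eqP; field.
by lra.
Qed.

End setup.
End slices.

(** * The case of equality *)

(** Three errors of size [d / 4]: the values of [Phi1] at the two ends and the integral of the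
    determinant. *)
Lemma defect_arith (R : realType) (d P M X Y Z V : R) : 0 < d -> P - d / 4 <= X -> Y <= M + d / 4 -> Z <= d / 4 ->
  V <= P - M -> V - (X - Y) + Z <= d.
Proof. lra. Qed.

Lemma defect_arithN (R : realType) (d P M X Y Z V : R) : 0 < d -> P - d / 4 <= X -> Y <= M + d / 4 -> - (d / 4) <= Z ->
  V <= P - M -> V - (X - Y) - Z <= d.
Proof. lra. Qed.

Section equality.
Context {R : realType}.
Local Notation mu := (@lebesgue_measure R).
Local Notation mu2 := (@lebesgue_measure R \x @lebesgue_measure R)%E.

Variables (a m p : R) (u1 a1 b1 D11 D12 u2 a2 b2 D21 D22 : R * R -> R).
Hypothesis S : Setup a m p u1 a1 b1 D11 D12 u2 a2 b2 D21 D22.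
Variables (Phi1 Phi2 psi w w' : R * R -> R) (sg : R).
Hypotheses (C1 : C1with Phi1 psi w) (C2 : C1with Phi2 w' psi).
Hypothesis ww' : forall z, w' z = - sg * w z.
Hypotheses (ipsi : forall a b, sqint mu2 (rect a b) (fun z => psi (u1 z, u2 z)))
           (iw : forall a b, sqint mu2 (rect a b) (fun z => w (u1 z, u2 z))).
Hypotheses (sg2 : sg ^+ 2 = 1) (sg1 : sg <= 1).
Hypothesis energy_le :
  (\int[mu2]_(z in strip) (grad2 D11 D12 D21 D22 z / 2 + w (u1 z, u2 z) ^+ 2 / 2)%:E <=
   (Phi1 (a, p) - Phi1 (a, m))%:E)%E.

(** For divergence 0 this is the excess of the energy density over
    [w(u) (D21 - sg D12) - sg det D]. *)
Let defect z := (D21 z - sg * D12 z - w (u1 z, u2 z)) ^+ 2 / 2 + (1 - sg) * D11 z ^+ 2.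
Let dens z := grad2 D11 D12 D21 D22 z / 2 + w (u1 z, u2 z) ^+ 2 / 2.

Let defect_ge0 z : 0 <= defect z.
Proof. by rewrite /defect addr_ge0// mulr_ge0 ?sqr_ge0 ?subr_ge0. Qed.

Let dens_ge0 z : 0 <= dens z.
Proof. by rewrite addr_ge0// mulr_ge0 ?sqr_ge0//; exact: grad2_ge0. Qed.

Let mw : measurable_fun setT (fun z => w (u1 z, u2 z)).
Proof.
have mu12 : measurable_fun setT (fun z => (u1 z, u2 z)).
  by apply: measurable_fun_pair; [exact: sob_m (st1 S)|exact: sob_m (st2 S)].
by have [_ _ _ cw] := C1; exact: (measurableT_comp (continuous_measurable2 cw) mu12).
Qed.

Let mdens : measurable_fun setT dens.
Proof.
apply: measurable_funD; apply: measurable_funM => //; first exact: (measurable_grad2 S).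
exact: measurable_funX.
Qed.

Let mD11 : measurable_fun setT D11. Proof. exact: sob_m1 (st1 S). Qed.
Let mD12 : measurable_fun setT D12. Proof. exact: sob_m2 (st1 S). Qed.
Let mD21 : measurable_fun setT D21. Proof. exact: sob_m1 (st2 S). Qed.

Let mdefect : measurable_fun setT defect.
Proof.
apply: measurable_funD.
  apply: measurable_funM => //; apply: measurable_funX; apply: measurable_funB => //.
  by apply: measurable_funB => //; exact: measurable_funM.
by apply: measurable_funM => //; exact: measurable_funX.
Qed.

Let integrable_dens A : measurable A -> A `<=` strip -> mu2.-integrable A (EFin \o dens).
Proof.
move=> mA As; apply: integrable_lty_ge0 => //; first exact: measurable_funTS.
apply: le_lt_trans (le_lt_trans energy_le (ltry _)).
apply: ge0_subset_integral => //; first exact: measurable_stripR.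
  by apply/measurable_EFinP; exact: measurable_funTS.
by move=> z _; rewrite lee_fin.
Qed.

Let rect_strip t0 t1 : rect t0 t1 `<=` (strip : set (R * R)).
Proof. by move=> z []. Qed.

Let defect_rect t0 t1 : t0 <= t1 ->
  vline u1 a1 b1 D11 D12 t0 -> vline u2 a2 b2 D21 D22 t0 ->
  vline u1 a1 b1 D11 D12 t1 -> vline u2 a2 b2 D21 D22 t1 ->
  mu2.-integrable (rect t0 t1) (EFin \o defect) /\
  \int[mu2]_(z in rect t0 t1) defect z = \int[mu2]_(z in rect t0 t1) dens z -
   (\int[mu]_(s in `[0, 1]) Phi1 (b1 (t1, s), b2 (t1, s)) -
    \int[mu]_(s in `[0, 1]) Phi1 (b1 (t0, s), b2 (t0, s))) +
   sg * \int[mu2]_(z in rect t0 t1) (1 * (D11 z * D22 z - D12 z * D21 z)).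
Proof.
move=> t01 v10 v20 v11 v21; have mr := measurable_rectR `[t0, t1] `[0, 1].
rewrite (flux (st1 S) (st2 S) (st_div S) C1 C2 ww' ipsi iw t01 v10 v20 v11 v21).
have [_ s11 s12] := Sob_rect (st1 S) t0 t1; have [_ s21 s22] := Sob_rect (st2 S) t0 t1.
have id := integrable_dens mr (@rect_strip t0 t1).
have s1 : sqint mu2 (rect t0 t1) (fun z => D21 z - sg * D12 z).
  by apply: sqintB => //; exact: sqintZ.
have iF := sqintM mr (iw t0 t1) s1.
have iD : mu2.-integrable (rect t0 t1) (EFin \o (fun z => 1 * (D11 z * D22 z - D12 z * D21 z))).
  have := integrableB mr (sqintM mr s11 s22) (sqintM mr s12 s21).
  by apply: eq_integrable => // z _ /=; rewrite mul1r.
have idef : mu2.-integrable (rect t0 t1) (EFin \o defect).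
  have s2 : sqint mu2 (rect t0 t1) (fun z => D21 z - sg * D12 z - w (u1 z, u2 z)) by exact: sqintB.
  have := integrableD mr (integrableZl mr 2^-1 s2.2) (integrableZl mr (1 - sg) s11.2).
  by apply: eq_integrable => // z _ /=; rewrite /defect EFinD EFinM muleC.
split => //.
have iDZ : mu2.-integrable (rect t0 t1) (EFin \o (fun z => sg * (1 * (D11 z * D22 z - D12 z * D21 z)))).
  by have := integrableZl mr sg iD; apply: eq_integrable => // z _ /=; rewrite EFinM.
have iB : mu2.-integrable (rect t0 t1) (EFin \o (fun z => dens z - w (u1 z, u2 z) * (D21 z - sg * D12 z))).
  by have := integrableB mr id iF; apply: eq_integrable => // z _ /=; rewrite EFinB.
rewrite -RintegralB// -RintegralZl// -RintegralD//.
have mE A (f : R * R -> R) : mu2.-integrable A (EFin \o f) -> measurable_fun A f.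
  by move=> /integrableP[/measurable_EFinP].
apply: ae_eq_Rintegral => //; first exact: measurable_funTS.
  by apply: measurable_funD; apply: mE.
apply: (ae_imp (st_div S)) => z dz _.
have -> : D22 z = - D11 z by rewrite -[RHS]addr0 -dz addrA addNr add0r.
rewrite /defect /dens /grad2.
have -> : D22 z = - D11 z by rewrite -[RHS]addr0 -dz addrA addNr add0r.
have -> : (D21 z - sg * D12 z - w (u1 z, u2 z)) ^+ 2 = D21 z ^+ 2 + sg ^+ 2 * D12 z ^+ 2 +
   w (u1 z, u2 z) ^+ 2 - 2 * sg * D12 z * D21 z - 2 * w (u1 z, u2 z) * (D21 z - sg * D12 z) by ring.
by rewrite sg2; field.
Qed.

(** Between sufficiently good slices the energy bound leaves at most [d] for the integral of
    [defect]. As [defect] is nonnegative, the same holds on any fixed rectangle in between, for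
    every [d > 0], so it vanishes there. *)
Lemma equality_case : {ae mu2, forall z, strip z ->
  D21 z - sg * D12 z = w (u1 z, u2 z) /\ (1 - sg) * D11 z ^+ 2 = 0}.
Proof.
have cPhi1 := C1with_continuous C1.
have key (n : nat) : {ae mu2, forall z, rect (- n%:R) n%:R z -> defect z = 0}.
  have mr := measurable_rectR `[- (n%:R : R), n%:R] `[0, 1].
  have small d : 0 < d -> mu2.-integrable (rect (- n%:R) n%:R) (EFin \o defect) /\
      \int[mu2]_(z in rect (- n%:R) n%:R) defect z <= d.
    move=> d0; have d40 : 0 < d / 4 by rewrite divr_gt0.
    have [e1 [e10 h1]] := @good_slice_Phi _ a u1 a1 b1 D11 D12 u2 a2 b2 D21 D22 _ p _ cPhi1 d40.
    have [e2 [e20 h2]] := @good_slice_Phi _ a u1 a1 b1 D11 D12 u2 a2 b2 D21 D22 _ m _ cPhi1 d40.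
    have c1 : continuous (fun _ : R => 1 : R) by move=> x; exact: cvg_cst.
    have b1' (t : R) : `|1 : R| <= 1 by rewrite normr1.
    have [e3 [e30 h3]] := det_bulk S (@is_derive_id _ _ ^~ (1 : R)) c1 b1' d40.
    pose e := Num.min e1 (Num.min e2 e3).
    have e0 : 0 < e by rewrite !lt_min e10 e20 e30.
    have [ee1 ee2 ee3] : [/\ e <= e1, e <= e2 & e <= e3] by rewrite /e !ge_min !lexx !orbT.
    have [t1 [nt1 g1]] := good_pos S n%:R e0; have [t0 [nt0 g0]] := good_neg S (- n%:R) e0.
    have t01 : t0 <= t1.
      by apply: (le_trans (ltW nt0)); apply: le_trans (ltW nt1); rewrite ge0_cp.
    have {}h1 := h1 _ _ ee1 g1; have {}h2 := h2 _ _ ee2 g0.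
    have e03 : 0 <= e <= e3 by rewrite ltW.
    have {}h3 := h3 _ _ _ _ _ e03 t01 g0 g1.
    have [v10 v20 _ _] := g0; have [v11 v21 _ _] := g1.
    have [idf E] := defect_rect t01 v10 v20 v11 v21.
    have sub : rect (- n%:R) n%:R `<=` rect t0 t1.
      move=> z [/= + z2]; rewrite in_itv/= => /andP[q1 q2]; split => //=.
      by rewrite in_itv/= (le_trans (ltW nt0))// (le_trans q2)// ltW.
    have mr' := measurable_rectR `[t0, t1] `[0, 1].
    split; first exact: integrableS idf.
    apply: (le_trans (ge0_Rintegral_subset mr mr' sub defect_ge0 idf)).
    have dle : \int[mu2]_(z in rect t0 t1) dens z <= Phi1 (a, p) - Phi1 (a, m).
      rewrite -lee_fin -integral_EFin_Rintegral//; last exact: integrable_dens.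
      apply: le_trans energy_le; apply: ge0_subset_integral => //; first exact: measurable_stripR.
        by apply/measurable_EFinP; exact: measurable_funTS.
      by move=> z _; rewrite lee_fin.
    rewrite E; move: h1 h2 h3 dle; set X := \int[mu]_(s in _) _; set Y := \int[mu]_(s in _) _.
    set Z := \int[mu2]_(z in _) _; set V := \int[mu2]_(z in _) _.
    rewrite !ler_distl ler_norml => /andP[q1 q2] /andP[q3 q4] /andP[q5 q6] q7.
    have : (sg == 1) || (sg == -1) by rewrite -eqf_sqr sg2 expr1n.
    by move=> /orP[]/eqP ->; rewrite ?mul1r ?mulN1r; [exact: (defect_arith d0 q1 q4 q6 q7)|exact: (defect_arithN d0 q1 q4 q5 q7)].
  have [idf _] := small 1 ltr01.
  apply: (ge0_Rintegral_eq0 mr defect_ge0 idf).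
  by apply/ler_addgt0Pr => d d0; rewrite add0r; have [] := small d d0.
have := ae_foralln key => K; apply: (ae_imp K) => z hz [_ zs].
have [N [h _ _]] := bound_nat z.1 0 0.
have : defect z = 0.
  by apply: (hz N); split => //=; rewrite in_itv/= -ler_norml.
have q2 : 0 <= (1 - sg) * D11 z ^+ 2 by rewrite mulr_ge0 ?sqr_ge0 ?subr_ge0.
rewrite /defect => /eqP; rewrite paddr_eq0//; last by rewrite mulr_ge0 ?sqr_ge0.
move=> /andP[].
by rewrite mulf_eq0 sqrf_eq0 invr_eq0 pnatr_eq0 orbF subr_eq0 => /eqP -> /eqP.
Qed.

End equality.

(** * Gagliardo-Nirenberg on the strip *)

Section strip_inequalities.
Context {R : realType}.
Local Notation mu := (@lebesgue_measure R).
Local Notation mu2 := (@lebesgue_measure R \x @lebesgue_measure R)%E.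

Lemma measurable_leset (f g : R * R -> R) : measurable_fun setT f -> measurable_fun setT g ->
  measurable ((fun z => f z <= g z) : set (measurableTypeR R * measurableTypeR R)).
Proof.
move=> mf mg.
rewrite (_ : (fun z => _) = (fun z => g z - f z) @^-1` `[0, +oo[).
  by rewrite -[X in measurable X]setTI; apply: (measurable_funB mg mf) => //; exact: measurable_itvR.
by apply/seteqP; split=> z /=; rewrite in_itv/= andbT subr_ge0.
Qed.

Variables v va vb v1 v2 : R * R -> R.
Hypothesis S : Sob v va vb v1 v2.
Variables phi phi' : R -> R.
Hypotheses (dphi : forall t, is_derive t (1 : R) phi (phi' t)) (cphi' : continuous phi').
Hypothesis zero2 : {ae mu, forall t, exists s, 0 <= s <= 1 /\ phi (vb (t, s)) = 0}.

Let F1 z := phi' (v z) * v1 z.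
Let F2 z := phi' (v z) * v2 z.

Let cphi : continuous phi. Proof. exact: is_derive_continuous dphi. Qed.
Let mphi : measurable_fun setT phi. Proof. exact: continuous_measurable_fun. Qed.
Let mphi' : measurable_fun setT phi'. Proof. exact: continuous_measurable_fun. Qed.

Let mphiv : measurable_fun setT (fun z => phi (v z)).
Proof. exact: (measurableT_comp mphi (sob_m S)). Qed.

Let mF1 : measurable_fun setT F1.
Proof. apply: measurable_funM; [exact: (measurableT_comp mphi' (sob_m S))|exact: sob_m1 S]. Qed.

Let mF2 : measurable_fun setT F2.
Proof. apply: measurable_funM; [exact: (measurableT_comp mphi' (sob_m S))|exact: sob_m2 S]. Qed.

Let m01 := measurable_itvR (Interval (BLeft (0 : R)) (BRight 1)).

(** On almost every column [phi(v)] has a zero, and over a unit segment its squared oscillation is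
    at most the integral of the squared derivative. *)
Lemma strip_poincare :
  (\int[mu2]_(z in strip) (phi (v z) ^+ 2)%:E <= \int[mu2]_(z in strip) (F2 z ^+ 2)%:E)%E.
Proof.
rewrite !strip_slices//; try by move=> z; exact: sqr_ge0.
- apply: ae_ge0_le_integral => //.
  + by move=> t _; apply: integral_ge0 => s _; rewrite lee_fin sqr_ge0.
  + by apply: (measurable_slice_integral (f := fun z => phi (v z) ^+ 2)); [exact: measurable_funX|move=> z; exact: sqr_ge0].
  + by move=> t _; apply: integral_ge0 => s _; rewrite lee_fin sqr_ge0.
  + by apply: (measurable_slice_integral (f := fun z => F2 z ^+ 2)); [exact: measurable_funX|move=> z; exact: sqr_ge0].
  + apply: (ae_imp2 (Sob_vline S) zero2) => t [A _ e [_ l2] _] [s0 [s01 p0]] _.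
    have Ap := AC_chain1 dphi cphi' A.
    have cb' : continuous (fun s => phi' (vb (t, s))).
      by move=> s; apply: (@continuous_comp _ _ _ (fun s => vb (t, s)) phi'); [exact: (AC_continuous A)|exact: cphi'].
    have lF : locint (fun s => (phi' (vb (t, s)) * v2 (t, s)) ^+ 2).
      apply: locint_eq (locint_cM (continuous_sqr cb') l2) _ => s; by rewrite exprMn.
    have E2 : (\int[mu]_(s in `[0%R, 1%R]) (F2 (t, s) ^+ 2)%:E =
        (\int[mu]_(s in `[0, 1]) ((phi' (vb (t, s)) * v2 (t, s)) ^+ 2))%:E)%E.
      rewrite -integral_EFin_Rintegral; [|by []|exact: lF].
      apply: ae_eq_integral => //.
      * apply/measurable_EFinP; apply: measurable_funX; apply: measurable_funTS; exact: measurable_slice2 mF2.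
      * by case/integrableP: (lF 0 1).
      * by apply: (ae_imp e) => s [e1 _] _; rewrite /F2 e1.
    rewrite E2; set J := Rintegral _ _ _.
    have h s : 0 <= s <= 1 -> phi (vb (t, s)) ^+ 2 <= J.
      by move=> hs; have := AC_osc_sqr Ap lF hs s01; rewrite /= p0 subr0.
    have J0 : 0 <= J by apply: Rintegral_ge0 => s _; exact: sqr_ge0.
    have -> : J%:E = (\int[mu]_(s in `[0%R, 1%R]) J%:E)%E.
      by rewrite integral_cst//= lebesgue_measure_itv/= lte_fin ltr01 -EFinB subr0 mule1.
    apply: ae_ge0_le_integral => //.
    * by move=> s _; rewrite lee_fin sqr_ge0.
    * apply/measurable_EFinP; apply: measurable_funX; apply: measurable_funTS; exact: (measurable_slice2 t mphiv).
    * by apply: (ae_imp e) => s [-> _]; rewrite /= in_itv/= => hs; rewrite lee_fin h.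
- exact: measurable_funX.
- exact: measurable_funX.
Qed.

Hypothesis zero1 : exists t0, {ae mu, forall s, 0 <= s <= 1 -> phi (va (t0, s)) = 0}.
Hypotheses (i1 : mu2.-integrable strip (EFin \o F1)) (i2 : mu2.-integrable strip (EFin \o F2)).

(** [|phi(v)|] at [(t, s)] is at most the row integral [P s] of [|F1|], because [phi] vanishes on
    the column [t0], and at most the column integral [Q t] of [|F2|], because it vanishes somewhere
    on each column. The integral of the product [P s * Q t] separates. *)
Lemma strip_gagliardo_nirenberg :
  (\int[mu2]_(z in strip) (phi (v z) ^+ 2)%:E <=
   (\int[mu2]_(z in strip) `|F1 z| * \int[mu2]_(z in strip) `|F2 z|)%:E)%E.
Proof.
have n1 : mu2.-integrable strip (EFin \o (fun z => `|F1 z|)) by exact: (integrable_norm i1).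
have n2 : mu2.-integrable strip (EFin \o (fun z => `|F2 z|)) by exact: (integrable_norm i2).
have mT := @measurableT _ (measurableTypeR R).
pose P s := \int[mu]_t `|F1 (t, s)|.
pose Q t := \int[mu]_(s in `[0, 1]) `|F2 (t, s)|.
have P0 s : 0 <= P s by apply: Rintegral_ge0.
have Q0 t : 0 <= Q t by apply: Rintegral_ge0.
have mP : measurable_fun setT P.
  apply: (measurable_Rintegral_param (K := fun x => `|F1 (x.2, x.1)|)).
  by apply: measurableT_comp => //; exact: measurable_swap mF1.
have P_int : mu.-integrable `[0, 1] (EFin \o P) by exact: (fubini_rect_int2 mT m01 n1).
have Q_int : mu.-integrable setT (EFin \o Q) by exact: (fubini_rect_int1 mT m01 n2).
have [t0 zt0] := zero1.
have hP : {ae mu, forall s, 0 <= s <= 1 -> forall t, `|phi (va (t, s))| <= P s}.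
  have hi := fubini_rect_ae2 mT m01 n1.
  apply: (ae_imp3 (Sob_hline S) zt0 hi) => s [A e] z0 is1 s01 t.
  have {}is1 : mu.-integrable setT (EFin \o (fun t => `|F1 (t, s)|)) by apply: is1; rewrite /= in_itv.
  have {}z0 := z0 s01; have Ap := AC_chain1 dphi cphi' A.
  have seg x y : `|\int[mu]_(t in `[x, y]) (phi' (va (t, s)) * v1 (t, s))| <= P s.
    have mxy := measurable_itvR (Interval (BLeft x) (BRight y)).
    apply: (le_trans (le_normr_Rintegral mxy (proj1 Ap x y))).
    have -> : \int[mu]_(t in `[x, y]) `|phi' (va (t, s)) * v1 (t, s)| = \int[mu]_(t in `[x, y]) `|F1 (t, s)|.
      apply: ae_eq_Rintegral => //.
      - apply: measurableT_comp => //; apply: measurable_funTS; apply: locint_measurable; by case: Ap.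
      - apply: measurableT_comp => //; apply: measurable_funTS; exact: measurable_slice1 mF1.
      - by apply: (ae_imp e) => r er _; rewrite /F1 er.
    by apply: ge0_Rintegral_subset => //.
  have [tt|tt] := leP t0 t.
    have := proj2 Ap _ _ tt; rewrite z0 subr0 => ->; exact: seg.
  have := proj2 Ap _ _ (ltW tt); rewrite z0 sub0r => /eqP; rewrite eqr_oppLR => /eqP ->.
  by rewrite normrN; exact: seg.
have hQ : {ae mu, forall t, forall s, 0 <= s <= 1 -> `|phi (vb (t, s))| <= Q t}.
  have hi := fubini_rect_ae1 mT m01 n2.
  apply: (ae_imp3 (Sob_vline S) zero2 hi) => t [A _ e _ _] [s0 [s01 p0]] is2 s hs.
  have {}is2 : mu.-integrable `[0, 1] (EFin \o (fun s => `|F2 (t, s)|)) by exact: is2.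
  have Ap := AC_chain1 dphi cphi' A.
  have seg x y : 0 <= x -> y <= 1 -> `|\int[mu]_(s in `[x, y]) (phi' (vb (t, s)) * v2 (t, s))| <= Q t.
    move=> x0 y1; have mxy := measurable_itvR (Interval (BLeft x) (BRight y)).
    apply: (le_trans (le_normr_Rintegral mxy (proj1 Ap x y))).
    have -> : \int[mu]_(s in `[x, y]) `|phi' (vb (t, s)) * v2 (t, s)| = \int[mu]_(s in `[x, y]) `|F2 (t, s)|.
      apply: ae_eq_Rintegral => //.
      - apply: measurableT_comp => //; apply: measurable_funTS; apply: locint_measurable; by case: Ap.
      - apply: measurableT_comp => //; apply: measurable_funTS; exact: measurable_slice2 mF2.
      - by apply: (ae_imp e) => r [er _] _; rewrite /F2 er.
    by apply: ge0_Rintegral_subset => //; apply: subset_itvScc; rewrite bnd_simp.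
  move: hs s01 => /andP[q1 q2] /andP[q3 q4].
  have [tt|tt] := leP s0 s.
    have := proj2 Ap _ _ tt; rewrite p0 subr0 => ->; exact: seg.
  have := proj2 Ap _ _ (ltW tt); rewrite p0 sub0r => /eqP; rewrite eqr_oppLR => /eqP ->.
  by rewrite normrN; exact: seg.
(* The row bound, known on almost every row, is transferred to almost every column through a
   measurable subset of the plane; an indicator encodes the restriction on [s]. *)
have hP2 : {ae mu, forall t, {ae mu, forall s, 0 <= s <= 1 -> `|phi (v (t, s))| <= P s}}.
  have mI : measurable_fun setT (fun z : R * R => \1_(`[0, 1]%classic : set (measurableTypeR R)) z.2 : R).
    by apply: (measurableT_comp (measurable_indic m01)).
  have mset : measurable ((fun z => \1_(`[0, 1]%classic : set (measurableTypeR R)) z.2 * `|phi (v z)| <= P z.2) : set (measurableTypeR R * measurableTypeR R)).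
    apply: measurable_leset.
      by apply: measurable_funM => //; exact: measurableT_comp.
    exact: (measurableT_comp mP measurable_snd).
  have : {ae mu2, forall z, \1_(`[0, 1]%classic : set (measurableTypeR R)) z.2 * `|phi (v z)| <= P z.2}.
    apply: (ae_prod2_conv mset); apply: (ae_imp2 hP (Sob_hline S)) => s h [_ e].
    apply: (ae_imp e) => t -> /=; rewrite indicE; case: (boolP (s \in _)) => [|_]; last by rewrite mul0r.
    by rewrite inE/= in_itv/= mul1r => hs; exact: h.
  move=> /ae_prod1 K; apply: (ae_imp K) => t ht; apply: (ae_imp ht) => s /= + hs.
  by rewrite indicE mem_set ?mul1r//= in_itv.
rewrite strip_slices//; first last.
- by move=> z; exact: sqr_ge0.
- exact: measurable_funX.
pose J1 := \int[mu]_(s in `[0, 1]) P s; pose J2 := \int[mu]_t Q t.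
have E1 : \int[mu2]_(z in strip) `|F1 z| = J1 by exact: (fubini_rect2 mT m01 n1).
have E2 : \int[mu2]_(z in strip) `|F2 z| = J2 by exact: (fubini_rect1 mT m01 n2).
rewrite E1 E2; have J10 : 0 <= J1 by apply: Rintegral_ge0.
apply: (@le_trans _ _ (\int[mu]_t (J1%:E * (Q t)%:E))%E).
  apply: ae_ge0_le_integral => //.
  - by move=> t _; apply: integral_ge0 => s _; rewrite lee_fin sqr_ge0.
  - by apply: (measurable_slice_integral (f := fun z => phi (v z) ^+ 2)); [exact: measurable_funX|move=> z; exact: sqr_ge0].
  - by move=> t _; rewrite -EFinM lee_fin mulr_ge0.
  - apply: measurable_funeM; by case/integrableP: Q_int.
  - apply: (ae_imp3 hP2 hQ (Sob_vline S)) => t k1 k2 [_ _ e _ _] _.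
    apply: (@le_trans _ _ (\int[mu]_(s in `[0%R, 1%R]) ((Q t)%:E * (P s)%:E))%E).
      apply: ae_ge0_le_integral => //.
      + by move=> s _; rewrite lee_fin sqr_ge0.
      + apply/measurable_EFinP; apply: measurable_funX; apply: measurable_funTS; exact: (measurable_slice2 t mphiv).
      + by move=> s _; rewrite -EFinM lee_fin mulr_ge0.
      + apply: measurable_funeM; apply/measurable_EFinP; exact: measurable_funTS.
      + apply: (ae_imp2 k1 e) => s k1s [es _]; rewrite /= in_itv/= => hs.
        rewrite -EFinM lee_fin -real_normK ?num_real// expr2 ler_pM//; last exact: k1s.
        by rewrite es; exact: k2.
    rewrite ge0_integralZl.
    + by rewrite muleC integral_EFin_Rintegral.
    + exact: m01.
    + by case/integrableP: P_int.
    + by move=> s _; rewrite lee_fin.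
    + by rewrite lee_fin.
rewrite ge0_integralZl.
- by rewrite integral_EFin_Rintegral// EFinM.
- by [].
- by case/integrableP: Q_int.
- by move=> s _; rewrite lee_fin.
- by rewrite lee_fin.
Qed.

End strip_inequalities.

(** * Decay of level sets *)

Section tails.
Context {R : realType}.
Local Notation mu := (@lebesgue_measure R).
Local Notation mu2 := (@lebesgue_measure R \x @lebesgue_measure R)%E.

Lemma is_derive_affine (f : R -> R) (k c t l : R) : is_derive (k * t + c) (1 : R) f l ->
  is_derive t (1 : R) (fun t => f (k * t + c)) (k * l).
Proof.
move=> df; have d1 : is_derive t (1 : R) (fun t : R => k * t + c) k.
  have d := is_deriveD (is_deriveZ k (is_derive_id t (1 : R))) (is_derive_cst c t (1 : R)).
  by apply: (is_derive_eq d); rewrite /GRing.scale/= mulr1 addr0.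
by rewrite mulrC; exact: (@is_derive1_comp _ f (fun t => k * t + c)).
Qed.

(* A C^1 step from 0 on (-oo, 0] to 1 on [1, +oo). *)
Definition step (x : R) := 2 * pos2 x - 4 * pos2 (x - 2^-1) + 2 * pos2 (x - 1).
Definition step' (x : R) := 4 * Num.max x 0 - 8 * Num.max (x - 2^-1) 0 + 4 * Num.max (x - 1) 0.

Lemma is_derive_pos2B (c x : R) : is_derive x (1 : R) (fun x => pos2 (x - c)) (2 * Num.max (x - c) 0).
Proof.
have := @is_derive_affine pos2 1 (- c) x _ (is_derive_pos2 _).
by rewrite !mul1r; under eq_fun do rewrite mul1r.
Qed.

Lemma is_derive_step x : is_derive x (1 : R) step (step' x).
Proof.
have d := is_deriveD (is_deriveB (is_deriveZ 2 (is_derive_pos2 x)) (is_deriveZ 4 (is_derive_pos2B 2^-1 x)))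
  (is_deriveZ 2 (is_derive_pos2B 1 x)).
by apply: (is_derive_eq d); rewrite /GRing.scale/= /step'; ring.
Qed.

Lemma continuous_posB (c : R) : continuous (fun x : R => Num.max (x - c) 0).
Proof.
move=> x; apply: (@continuous_comp _ _ _ (fun x => x - c) (fun x => Num.max x 0)); last exact: continuous_pos.
by apply: cvgB; [exact: cvg_id|exact: cvg_cst].
Qed.

Lemma continuous_step' : continuous step'.
Proof.
move=> x; apply: cvgD; [apply: cvgB|]; apply: cvgM; try exact: cvg_cst.
- exact: continuous_pos.
- exact: continuous_posB.
- exact: continuous_posB.
Qed.

Lemma step_le0 x : x <= 0 -> step x = 0.
Proof.
by move=> x0; rewrite /step /pos2 !max_r ?expr0n ?mulr0 ?subr0 ?addr0//; lra.
Qed.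

Lemma step_ge1 x : 1 <= x -> step x = 1.
Proof.
by move=> x0; rewrite /step /pos2 !max_l; try lra; field.
Qed.

Lemma step'_out x : x <= 0 \/ 1 <= x -> step' x = 0.
Proof.
by case=> x0; rewrite /step'; [rewrite !max_r; try lra|rewrite !max_l; try lra].
Qed.

Lemma step'_bound x : `|step' x| <= 2.
Proof.
rewrite /step' ler_norml.
have [h1|h1] := leP x 0; have [h2|h2] := leP (x - 2^-1) 0; have [h3|h3] := leP (x - 1) 0; lra.
Qed.

Variables v va vb v1 v2 : R * R -> R.
Hypothesis S : Sob v va vb v1 v2.
Variable K : R.
Hypothesis zK2 : {ae mu, forall t, exists s, 0 <= s <= 1 /\ vb (t, s) <= K}.
Hypothesis zK1 : exists t0, {ae mu, forall s, 0 <= s <= 1 -> va (t0, s) <= K}.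

Definition above (s : R) (z : R * R) : R := (s < v z)%R%:R.

Lemma measurable_above s : measurable_fun setT (above s).
Proof.
have -> : above s = \1_(v @^-1` `]s, +oo[).
  apply/funext => z; rewrite /above indicE; congr (nat_of_bool _)%:R.
  by apply/idP/idP => [h|]; rewrite inE/= in_itv/= andbT.
apply: measurable_indic; rewrite -[X in measurable X]setTI.
by apply: (sob_m S) => //; exact: measurable_itvR.
Qed.

Lemma above_sqr s z : above s z ^+ 2 = above s z.
Proof. by rewrite /above; case: (_ < _)%R; rewrite ?expr1n ?expr0n. Qed.

Lemma above_ge0 s z : 0 <= above s z. Proof. by rewrite /above ler0n. Qed.

Let mv1 : measurable_fun setT v1. Proof. exact: sob_m1 S. Qed.
Let mv2 : measurable_fun setT v2. Proof. exact: sob_m2 S. Qed.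
Let ms := @measurable_stripR R.
Let gr z := v1 z ^+ 2 + v2 z ^+ 2.

Let gr_ge0 z : 0 <= gr z. Proof. by rewrite addr_ge0 ?sqr_ge0. Qed.

Let mgr : measurable_fun setT gr.
Proof. by apply: measurable_funD; exact: measurable_funX. Qed.

Let igr : mu2.-integrable strip (EFin \o gr).
Proof.
apply: integrable_lty_ge0 => //; first exact: measurable_funTS.
exact: (sob_fin S).
Qed.

Let phi (s d : R) (x : R) := step (d^-1 * x + - (d^-1 * s)).
Let phi' (s d : R) (x : R) := d^-1 * step' (d^-1 * x + - (d^-1 * s)).

Let dphi s d t : is_derive t (1 : R) (phi s d) (phi' s d t).
Proof. exact: is_derive_affine (is_derive_step _). Qed.

Let cphi' s d : continuous (phi' s d).
Proof.
move=> x; apply: cvgM; first exact: cvg_cst.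
apply: (@continuous_comp _ _ _ (fun x => d^-1 * x + - (d^-1 * s)) step'); last exact: continuous_step'.
by apply: cvgD; [apply: cvgM; [exact: cvg_cst|exact: cvg_id]|exact: cvg_cst].
Qed.

Let argE (s d x : R) : d^-1 * x + - (d^-1 * s) = (x - s) / d.
Proof. by rewrite -mulrBr mulrC. Qed.

Let phi_le s d x : 0 < d -> x <= s -> phi s d x = 0.
Proof. by move=> d0 xs; rewrite /phi argE step_le0// pmulr_lle0 ?invr_gt0// subr_le0. Qed.

Let phi_ge s d x : 0 < d -> s + d <= x -> phi s d x = 1.
Proof. by move=> d0 xs; rewrite /phi argE step_ge1// ler_pdivlMr// mul1r lerBrDl. Qed.

Let phi'_bound s d x : 0 < d -> `|phi' s d x| <= (2 / d) * ((s < x)%R && (x <= s + d))%:R.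
Proof.
move=> d0; rewrite /phi' normrM gtr0_norm ?invr_gt0// argE mulrC.
have [xs|xs] := leP x s.
  by rewrite step'_out ?normr0 ?mul0r ?mulr0//; left; rewrite pmulr_lle0 ?invr_gt0// subr_le0.
have [xd|xd] := leP x (s + d); rewrite /= ?mulr1 ?mulr0.
  by rewrite ler_pM2r ?invr_gt0//; exact: step'_bound.
by rewrite step'_out ?normr0 ?mul0r//; right; rewrite ler_pdivlMr// mul1r lerBrDl ltW.
Qed.

(** The Poincare inequality for a step rising from 0 at [K] to 1 at [s]; its zeros on the columns
    are the points where [v] is at most [K]. *)
Lemma tail_integrable s : K < s -> mu2.-integrable strip (EFin \o above s).
Proof.
move=> Ks; pose d := s - K; have d0 : 0 < d by rewrite subr_gt0.
apply: integrable_lty_ge0 => //; first exact: measurable_funTS (measurable_above s).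
have z2 : {ae mu, forall t, exists s, 0 <= s <= 1 /\ phi K d (vb (t, s)) = 0}.
  by apply: (ae_imp zK2) => t [s' [h1 h2]]; exists s'; split => //; exact: phi_le.
have P := strip_poincare S (@dphi K d) (@cphi' K d) z2.
have mphiv : measurable_fun setT (fun z => phi K d (v z)).
  apply: (measurableT_comp _ (sob_m S)); apply: continuous_measurable_fun.
  exact: is_derive_continuous (@dphi K d).
have mphi'v : measurable_fun setT (fun z => phi' K d (v z)).
  by apply: (measurableT_comp _ (sob_m S)); exact: continuous_measurable_fun.
apply: (@le_lt_trans _ _ (\int[mu2]_(z in strip) (phi K d (v z) ^+ 2)%:E)%E).
  apply: ge0_le_integral => //.
  - by move=> z _; rewrite lee_fin above_ge0.
  - by apply/measurable_EFinP; exact: measurable_funTS (measurable_above s).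
  - by apply/measurable_EFinP; apply: measurable_funTS; exact: measurable_funX.
  - move=> z _; rewrite lee_fin /above; case: ltP => sz /=; last exact: sqr_ge0.
    by rewrite phi_ge// ?expr1n// /d addrC subrK ltW.
apply: (le_lt_trans P).
apply: (@le_lt_trans _ _ (\int[mu2]_(z in strip) (((2 / d) ^+ 2)%:E * (gr z)%:E))%E).
  apply: ge0_le_integral => //.
  - by move=> z _; rewrite lee_fin sqr_ge0.
  - by apply/measurable_EFinP; apply: measurable_funTS; apply: measurable_funX; exact: measurable_funM.
  - by apply: measurable_funeM; apply/measurable_EFinP; exact: measurable_funTS.
  - move=> z _; rewrite -EFinM lee_fin exprMn ler_pM ?sqr_ge0//.
      have hb : `|phi' K d (v z)| <= 2 / d.
        by apply: (le_trans (phi'_bound _ _ d0)); rewrite ler_piMr ?lern1 ?leq_b1// divr_ge0// ltW.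
      by rewrite -[leLHS]real_normK ?num_real// lerXn2r ?nnegrE//; exact: le_trans hb.
    by rewrite /gr lerDr sqr_ge0.
rewrite ge0_integralZl.
- by rewrite lte_mul_pinfty ?lee_fin ?sqr_ge0//; exact: integrable_lty igr.
- exact: ms.
- by apply/measurable_EFinP; exact: measurable_funTS.
- by move=> z _; rewrite lee_fin.
- by rewrite lee_fin sqr_ge0.
Qed.

Let tail s := \int[mu2]_(z in strip) above s z.

Let between s d z : R := ((s < v z)%R && (v z <= s + d))%:R.

Let mbetween s d : measurable_fun setT (between s d).
Proof.
have -> : between s d = (fun z => above s z * (1 - above (s + d) z)).
  apply/funext => z; rewrite /between /above [(v z <= _)%R]leNgt.
  by case: (s < v z)%R; case: (s + d < v z)%R; rewrite /= ?mul0r// mul1r ?subrr ?subr0.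
apply: measurable_funM; first exact: measurable_above.
by apply: measurable_funB => //; exact: measurable_above.
Qed.

Let ibetween s d : mu2.-integrable strip (EFin \o (fun z => between s d z * gr z)).
Proof.
have bnd z : strip z -> `|between s d z| <= 1.
  by move=> _; rewrite /between; case: (_ && _); rewrite ?normr0 ?normr1.
exact: (integrable_boundedM ms (measurable_funTS (mbetween s d)) bnd igr).
Qed.

(** The interpolation inequality for a step rising on the layer [s < v <= s + d] with slope at most
    [2 / d]. By Cauchy-Schwarz each squared factor is at most [(2 / d)^2 * tail s] times a part of
    the energy in the layer, and [J1 J2 <= (J1^2 + J2^2) / 2] adds the two parts. *)
Lemma tail_step s d : K < s -> 0 < d ->
  tail (s + d) <= (2 / d ^+ 2 * \int[mu2]_(z in strip) (between s d z * gr z)) * tail s.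
Proof.
move=> Ks d0.
have z2 : {ae mu, forall t, exists s', 0 <= s' <= 1 /\ phi s d (vb (t, s')) = 0}.
  apply: (ae_imp zK2) => t [s' [h1 h2]]; exists s'; split => //; apply: phi_le => //.
  exact: le_trans (ltW Ks).
have z1 : exists t0, {ae mu, forall s', 0 <= s' <= 1 -> phi s d (va (t0, s')) = 0}.
  have [t0 h] := zK1; exists t0; apply: (ae_imp h) => s' hs /hs h1; apply: phi_le => //.
  exact: le_trans (ltW Ks).
have mphi'v : measurable_fun setT (fun z => phi' s d (v z)).
  by apply: (measurableT_comp _ (sob_m S)); exact: continuous_measurable_fun.
have mphiv : measurable_fun setT (fun z => phi s d (v z)).
  apply: (measurableT_comp _ (sob_m S)); apply: continuous_measurable_fun.
  exact: is_derive_continuous (@dphi s d).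
have is_ := tail_integrable Ks.
pose f z : R := (2 / d) * above s z.
have sf : sqint mu2 strip f.
  split; first by apply: measurable_funTS; apply: measurable_funM => //; exact: measurable_above.
  have := integrableZl ms ((2 / d) ^+ 2) is_; apply: eq_integrable => // z _.
  by rewrite /f [(_ * above s z) ^+ 2]exprMn above_sqr EFinM.
have f2 : \int[mu2]_(z in strip) (f z ^+ 2) = (2 / d) ^+ 2 * tail s.
  rewrite -RintegralZl//; apply: eq_Rintegral => z _.
  by rewrite /f exprMn above_sqr.
pose g (vi : R * R -> R) z := between s d z * vi z.
have sg (vi : R * R -> R) : measurable_fun setT vi -> (forall z, vi z ^+ 2 <= gr z) ->
  sqint mu2 strip (g vi) /\ (fun z => g vi z ^+ 2) = (fun z => between s d z * vi z ^+ 2).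
  move=> mvi vig.
  have E : (fun z => g vi z ^+ 2) = (fun z => between s d z * vi z ^+ 2).
    by apply/funext => z; rewrite /g exprMn /between; case: (_ && _); rewrite ?expr1n ?expr0n.
  split => //; split; first by apply: measurable_funTS; exact: (measurable_funM (mbetween s d) mvi).
  suff : mu2.-integrable strip (EFin \o (fun z => between s d z * vi z ^+ 2)) by rewrite -E.
  apply: (@integrable_le _ _ _ mu2 _ _ gr) => //.
    by apply: measurable_funTS; exact: (measurable_funM (mbetween s d) (measurable_funX 2 mvi)).
  move=> z _; rewrite ger0_norm; last by rewrite mulr_ge0 ?sqr_ge0// /between ler0n.
  apply: le_trans (vig z); rewrite /between; case: (_ && _); rewrite ?mul1r// mul0r sqr_ge0//.
have le1 z : v1 z ^+ 2 <= gr z by rewrite /gr lerDl sqr_ge0.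
have le2 z : v2 z ^+ 2 <= gr z by rewrite /gr lerDr sqr_ge0.
have [sg1 E1] := sg _ mv1 le1; have [sg2 E2] := sg _ mv2 le2.
have Fle (vi : R * R -> R) z : `|phi' s d (v z) * vi z| <= f z * `|g vi z|.
  have -> : f z * `|g vi z| = f z * `|between s d z| * `|vi z| by rewrite /g normrM mulrA.
  rewrite normrM ler_wpM2r// /f.
  have /= h := @phi'_bound s d (v z) d0; apply: (le_trans h).
  have q : 0 <= 2 / d by rewrite divr_ge0// ltW.
  rewrite -[leRHS]mulrA (ler_wpM2l q)//.
  by rewrite /above /between normr_nat -natrM ler_nat; case: (s < _)%R; case: (_ <= _)%R.
have sn (vi : R * R -> R) : sqint mu2 strip (g vi) -> sqint mu2 strip (fun z => `|g vi z|).
  move=> [q1 q2]; split; first exact: measurableT_comp.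
  by move: q2; apply: eq_integrable => // z _; rewrite real_normK ?num_real.
have sn1 := sn _ sg1; have sn2 := sn _ sg2.
have iF (vi : R * R -> R) : measurable_fun setT vi -> sqint mu2 strip (fun z => `|g vi z|) ->
    mu2.-integrable strip (EFin \o (fun z => phi' s d (v z) * vi z)).
  move=> mvi sni; apply: (@integrable_le _ _ _ mu2 _ _ _ ms _ (fun z _ => Fle vi z)) => //.
    by apply: measurable_funTS; exact: measurable_funM.
  exact: sqintM.
have i1 := iF _ mv1 sn1; have i2 := iF _ mv2 sn2.
have GN := strip_gagliardo_nirenberg S (@dphi s d) (@cphi' s d) z2 z1 i1 i2.
move: GN; set J1 := Rintegral _ _ _; set J2 := Rintegral _ _ _ => GN.
have Jle (vi : R * R -> R) : measurable_fun setT vi -> sqint mu2 strip (g vi) -> sqint mu2 strip (fun z => `|g vi z|) ->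
   (\int[mu2]_(z in strip) `|phi' s d (v z) * vi z|) ^+ 2 <=
   (2 / d) ^+ 2 * tail s * \int[mu2]_(z in strip) (g vi z ^+ 2).
  move=> mvi sgi sni.
  rewrite -f2; apply: (@le_trans _ _ ((\int[mu2]_(z in strip) (f z * `|g vi z|)) ^+ 2)).
    rewrite lerXn2r ?nnegrE; first by [].
    - by apply: Rintegral_ge0.
    - apply: Rintegral_ge0 => z _; rewrite mulr_ge0// /f mulr_ge0 ?divr_ge0 ?above_ge0// ltW//.
    - apply: le_Rintegral => //; [exact: (integrable_norm (iF _ mvi sni))|exact: sqintM].
  apply: (le_trans (cauchy_schwarz_Rintegral ms sf sni)).
  by under [X in _ * X <= _]eq_Rintegral do rewrite real_normK ?num_real//.
have J1le := Jle _ mv1 sg1 sn1; have J2le := Jle _ mv2 sg2 sn2.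
rewrite -/J1 in J1le; rewrite -/J2 in J2le.
have Eg : \int[mu2]_(z in strip) (between s d z * gr z) =
    \int[mu2]_(z in strip) (g v1 z ^+ 2) + \int[mu2]_(z in strip) (g v2 z ^+ 2).
  rewrite -RintegralD//; [|exact: sg1.2|exact: sg2.2].
  apply: eq_Rintegral => z _; have := congr1 (@^~ z) E1; have := congr1 (@^~ z) E2.
  by rewrite /= => -> ->; rewrite /gr mulrDr.
have le : tail (s + d) <= J1 * J2.
  rewrite -lee_fin; apply: le_trans GN; rewrite /tail -integral_EFin_Rintegral//; last first.
    by apply: tail_integrable; rewrite (lt_trans Ks)// ltrDl.
  apply: ge0_le_integral => //.
  - by move=> z _; rewrite lee_fin above_ge0.
  - by apply/measurable_EFinP; exact: measurable_funTS (measurable_above _).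
  - by apply/measurable_EFinP; apply: measurable_funTS; exact: measurable_funX.
  - move=> z _; rewrite lee_fin /above; case: ltP => sz /=; last exact: sqr_ge0.
    by rewrite phi_ge ?expr1n// ltW.
apply: (le_trans le); rewrite Eg; move: J1le J2le; set A := Rintegral _ _ _; set B := Rintegral _ _ _.
have -> : 2 / d ^+ 2 * (A + B) * tail s = ((2 / d) ^+ 2 * tail s * A + (2 / d) ^+ 2 * tail s * B) / 2.
  by rewrite exprMn exprVn; field; rewrite lt0r_neq0.
move: (sqr_ge0 (J1 - J2)); move: (_ * A) (_ * B) => a b; nra.
Qed.

Lemma tail_prod s d n : K < s -> 0 < d -> tail (s + n%:R * d) <=
  (\prod_(i < n) (2 / d ^+ 2 * \int[mu2]_(z in strip) (between (s + i%:R * d) d z * gr z))) * tail s.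
Proof.
move=> Ks d0; elim: n => [|n IH]; first by rewrite big_ord0 mul1r mul0r addr0.
rewrite big_ord_recr /= -natr1 mulrDl mul1r addrA.
have Ks' : K < s + n%:R * d by rewrite (lt_le_trans Ks)// lerDl mulr_ge0// ltW.
apply: (le_trans (tail_step Ks' d0)); rewrite (mulrC (\prod_(i < n) _)) -[leRHS]mulrA ler_wpM2l//.
by rewrite mulr_ge0 ?divr_ge0 ?sqr_ge0//; apply: Rintegral_ge0 => z _; rewrite mulr_ge0// /between ler0n.
Qed.

(** The layers are disjoint; their indicators telescope. *)
Lemma sum_between s d n : 0 < d -> \sum_(i < n) \int[mu2]_(z in strip) (between (s + i%:R * d) d z * gr z) <=
  \int[mu2]_(z in strip) (above s z * gr z).
Proof.
move=> d0.
have ia : mu2.-integrable strip (EFin \o (fun z => above s z * gr z)).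
  have bnd z : strip z -> `|above s z| <= 1.
    by move=> _; rewrite /above; case: (_ < _)%R; rewrite ?normr0 ?normr1.
  exact: (integrable_boundedM ms (measurable_funTS (measurable_above s)) bnd igr).
have E : mu2.-integrable strip (EFin \o (fun z => \sum_(i < n) (between (s + i%:R * d) d z * gr z))) /\
   \sum_(i < n) \int[mu2]_(z in strip) (between (s + i%:R * d) d z * gr z) =
   \int[mu2]_(z in strip) (\sum_(i < n) (between (s + i%:R * d) d z * gr z)).
  elim: n => [|n [i1 IH]].
    split.
      have := integrable0 mu2 (strip : set (measurableTypeR R * measurableTypeR R)); apply: eq_integrable => // z _ /=.
      by rewrite big_ord0.
    by rewrite big_ord0; under eq_Rintegral do rewrite big_ord0; rewrite /Rintegral integral0.
  split.
    have := integrableD ms i1 (ibetween (s + n%:R * d) d); apply: eq_integrable => // z _ /=.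
    by rewrite big_ord_recr.
  rewrite big_ord_recr /= IH -RintegralD; [|exact: ms|exact: i1|exact: ibetween].
  apply: (@eq_Rintegral _ _ _ mu2) => z _.
  by rewrite big_ord_recr.
rewrite E.2; apply: le_Rintegral => //; first exact: E.1.
move=> z _; rewrite -mulr_suml ler_wpM2r//.
have H : \sum_(i < n) between (s + i%:R * d) d z <= above s z - above (s + n%:R * d) z.
  elim: n {E} => [|n IH]; first by rewrite big_ord0 mul0r addr0 subrr.
  rewrite big_ord_recr /= -natr1 mulrDl mul1r addrA.
  have -> : between (s + n%:R * d) d z = above (s + n%:R * d) z - above (s + n%:R * d + d) z.
    rewrite /between /above [(v z <= _)%R]leNgt.
    have [h1|h1] := ltP; have [h2|h2] := ltP; rewrite /= ?subrr ?subr0//.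
    by have := lt_le_trans h2 h1; rewrite gtrDl ltNge ltW.
  by lra.
by apply: (le_trans H); rewrite gerDl oppr_le0 above_ge0.
Qed.

End tails.

Lemma measurable_continuous_comp (R : realType) (f : R -> R) (v : R * R -> R) :
  continuous f -> measurable_fun setT v -> measurable_fun setT (fun z => f (v z)).
Proof. by move=> cf mv; exact: (measurableT_comp (continuous_measurable_fun cf) mv). Qed.

(** * Decay faster than any Gaussian and exponential integrability *)

Section gaussian_tails.
Context {R : realType}.
Local Notation mu := (@lebesgue_measure R).
Local Notation mu2 := (@lebesgue_measure R \x @lebesgue_measure R)%E.
Variables v va vb v1 v2 : R * R -> R.
Hypothesis S : Sob v va vb v1 v2.
Variable K : R.
Hypothesis zK2 : {ae mu, forall t, exists s, 0 <= s <= 1 /\ vb (t, s) <= K}.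
Hypothesis zK1 : exists t0, {ae mu, forall s, 0 <= s <= 1 -> va (t0, s) <= K}.

Let gr z := v1 z ^+ 2 + v2 z ^+ 2.
Let ms := @measurable_stripR R.

Let mgr : measurable_fun setT gr.
Proof. by apply: measurable_funD; apply: measurable_funX; [exact: sob_m1 S|exact: sob_m2 S]. Qed.

Let igr : mu2.-integrable strip (EFin \o gr).
Proof.
apply: integrable_lty_ge0 => //; first exact: measurable_funTS.
  by move=> z _; rewrite addr_ge0 ?sqr_ge0.
exact: (sob_fin S).
Qed.

Lemma energy_above_small (e : R) : 0 < e ->
  exists s, [/\ 0 <= s, K < s & \int[mu2]_(z in strip) (above v s z * gr z) <= e].
Proof.
move=> e0.
have lim : \int[mu2]_(z in strip) (above v n%:R z * gr z) @[n --> \oo] --> \int[mu2]_(z in strip) (cst 0 : R * R -> R) z.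
  apply: (@Rintegral_dominated _ _ _ mu2 _ _ _ gr) => //.
  - by move=> n; apply: measurable_funTS; apply: measurable_funM => //; exact: measurable_above S _.
  - apply: aeW => z _; apply: cvg_near_cst.
    exists (Num.bound (v z)) => // n /= hn; rewrite /above ltNge.
    have -> : v z <= n%:R.
      have [h|h] := leP 0 (v z); last by rewrite (le_trans (ltW h)).
      by rewrite (le_trans (ltW (archi_boundP h)))// ler_nat.
    by rewrite mul0r.
  - apply: aeW => z n _; rewrite normrM ger0_norm ?above_ge0// ger0_norm ?addr_ge0 ?sqr_ge0//.
    by rewrite ler_piMl ?addr_ge0 ?sqr_ge0// /above lern1 leq_b1.
rewrite [X in _ --> X]/Rintegral integral0 /= in lim.
move/cvgrPdist_le : lim => /(_ e e0)[N _ hN].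
pose M := (N + (Num.bound K).+1)%N; exists M%:R; split => //.
- have [h|h] := leP 0 K; last by rewrite (lt_le_trans h).
  by rewrite (lt_trans (archi_boundP h))// ltr_nat /M addnS ltnS leq_addl.
- by have := hN M (leq_addr _ _); rewrite sub0r normrN; apply: le_trans; exact: ler_norm.
Qed.

(** The range from [s1] to [s1 + N] is cut into [n = (j + 1) N^2] layers of width
    [d = 1 / ((j + 1) N)]. The factors of [tail_prod] add up to at most
    [(2 / d^2) / (4 (j + 1)) = n / 2], so by the inequality between arithmetic and geometric means
    their product is at most [2^-n]. The rate [j] is free because the energy above [s1] can be made
    as small as desired. *)
Lemma gaussian_tail (j : nat) : exists s1 C, [/\ 0 <= s1, K < s1, 0 <= C &
  forall N : nat, \int[mu2]_(z in strip) above v (s1 + N%:R) z <= C * 2^-1 ^+ (j.+1 * N ^ 2)].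
Proof.
have e0 : 0 < (4 * j.+1%:R : R)^-1 by rewrite invr_gt0 mulr_gt0.
have [s1 [s10 Ks1 small]] := energy_above_small e0.
exists s1, (\int[mu2]_(z in strip) above v s1 z).
have C0 : 0 <= \int[mu2]_(z in strip) above v s1 z by apply: Rintegral_ge0 => z _; exact: above_ge0.
(* For [N = 0] the bound is [C] itself; the width [d] below requires a nonzero [N]. *)
split => // -[|N]; first by rewrite addr0 exp0n// muln0 expr0 mulr1.
pose n := (j.+1 * N.+1 ^ 2)%N; pose d : R := (j.+1%:R * N.+1%:R)^-1.
have d0 : 0 < d by rewrite invr_gt0 mulr_gt0.
have n0 : (n%:R : R) != 0 by rewrite pnatr_eq0 /n muln_eq0 expn_eq0.
have hj : (j.+1%:R : R) != 0 by rewrite pnatr_eq0.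
have hN : (N.+1%:R : R) != 0 by rewrite pnatr_eq0.
have nd : n%:R * d = N.+1%:R.
  rewrite /n /d natrM natrX; move: (j.+1%:R : R) (N.+1%:R : R) hj hN => x y hx hy.
  by field; rewrite hx hy.
rewrite -nd; apply: (le_trans (tail_prod S zK2 zK1 n Ks1 d0)); rewrite mulrC ler_wpM2l//.
pose E (i : 'I_n) := 2 / d ^+ 2 * \int[mu2]_(z in strip) (((s1 + i%:R * d < v z)%R && (v z <= s1 + i%:R * d + d))%:R * gr z).
have E0 i : 0 <= E i.
  have q : 0 <= 2 / d ^+ 2 by rewrite divr_ge0 ?sqr_ge0.
  apply: mulr_ge0 => //; apply: Rintegral_ge0 => z _.
  by rewrite mulr_ge0 ?ler0n// addr_ge0 ?sqr_ge0.
have E0' : {in 'I_n, forall i, 0 <= E i} by [].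
have [AGM _] := leif_AGM E0'; rewrite card_ord in AGM.
apply: (@le_trans _ _ (\prod_(i in 'I_n) E i)); first by rewrite le_eqVlt; apply/orP; left; apply/eqP; apply: eq_bigl.
apply: (le_trans AGM); rewrite -/n lerXn2r ?nnegrE//.
  by rewrite divr_ge0// sumr_ge0.
have n0' : 0 < (n%:R : R) by rewrite lt0r n0 ler0n.
rewrite ler_pdivrMr//.
have -> : \sum_(i in 'I_n) E i = 2 / d ^+ 2 * \sum_(i < n) \int[mu2]_(z in strip) (((s1 + i%:R * d < v z)%R && (v z <= s1 + i%:R * d + d))%:R * gr z).
  by rewrite mulr_sumr; apply: eq_bigl.
have := sum_between S s1 n d0 => /le_trans/(_ small) h.
apply: (@le_trans _ _ (2 / d ^+ 2 * (4 * j.+1%:R)^-1)).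
  by rewrite ler_wpM2l// divr_ge0 ?sqr_ge0.
rewrite le_eqVlt; apply/orP; left; apply/eqP.
rewrite /d /n natrM natrX; move: (j.+1%:R : R) (N.+1%:R : R) hj hN => x y hx hy.
by field; rewrite hx hy.
Qed.

(** On the layer above [s1 + N] the exponent is at most [g (s1 + N + 1)^2 <= 2 g (s1 + 1)^2 + 2 g
    N^2]. With [exp(2 g) <= 2^j], multiplication by the tail of rate [j] leaves [2^(-N^2)], a
    summable bound. Where [v <= s1] the integrand is bounded, and the finite measure of [A] is
    used. *)
Lemma exp_sqr_pos_integrable (g : R) (A : set (R * R)) :
  measurable (A : set (measurableTypeR R * measurableTypeR R)) -> A `<=` strip ->
  (mu2 A < +oo)%E -> 0 <= g ->
  (\int[mu2]_(z in A) (expR (g * Num.max (v z) 0 ^+ 2))%:E < +oo)%E.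
Proof.
move=> mA As Aoo g0.
have [j hj] : exists j : nat, expR (2 * g) <= 2 ^+ j.
  exists (Num.bound (expR (2 * g))).
  apply: (le_trans (ltW (archi_boundP (expR_ge0 (2 * g))))).
  by rewrite -natrX ler_nat ltnW// ltn_expl.
have [s1 [C [s10 Ks1 C0 ht]]] := gaussian_tail j.
pose T N z := expR (g * (s1 + N%:R + 1) ^+ 2) * above v (s1 + N%:R) z.
have T0 N z : 0 <= T N z by rewrite mulr_ge0 ?expR_ge0 ?above_ge0.
have mT N : measurable_fun setT (T N) by apply: measurable_funM => //; exact: measurable_above S _.
pose c0 := expR (g * s1 ^+ 2); pose a0 := expR (2 * g * (s1 + 1) ^+ 2).
have TN N : (\int[mu2]_(z in A) (T N z)%:E <= (2 * a0 * C / (2 ^ N.+1)%:R)%:E)%E.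
  apply: (@le_trans _ _ (\int[mu2]_(z in strip) (T N z)%:E)%E).
    apply: ge0_subset_integral => //.
    - by apply/measurable_EFinP; exact: (measurable_funTS (mT N)).
    - by move=> z _; rewrite lee_fin.
  rewrite /T; under eq_integral do rewrite EFinM.
  have Ks : K < s1 + N%:R by rewrite (lt_le_trans Ks1)// lerDl.
  have ia := tail_integrable S zK2 Ks.
  rewrite ge0_integralZl; [|exact: ms|by case/integrableP: ia|by move=> z _; rewrite lee_fin above_ge0|by rewrite lee_fin expR_ge0].
  rewrite integral_EFin_Rintegral// -EFinM lee_fin.
  apply: (@le_trans _ _ ((a0 * 2 ^+ (j * N ^ 2)) * (C * 2^-1 ^+ (j.+1 * N ^ 2)))).
    apply: ler_pM; [exact: expR_ge0|by apply: Rintegral_ge0 => z _; exact: above_ge0| |exact: ht].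
    have -> : 2 ^+ (j * N ^ 2) = (2 ^+ j) ^+ (N ^ 2) :> R by rewrite exprM.
    apply: (@le_trans _ _ (a0 * expR (2 * g) ^+ (N ^ 2))).
      rewrite -expRM_natl /a0 -expRD ler_expR natrX.
      have h : 0 <= g * (s1 + 1 - N%:R) ^+ 2 by rewrite mulr_ge0 ?sqr_ge0.
      by move: h; move: (N%:R : R) => y h; nra.
    by rewrite ler_wpM2l ?expR_ge0// lerXn2r ?nnegrE ?expR_ge0// exprn_ge0.
  have -> : 2^-1 ^+ (j.+1 * N ^ 2) = (2 ^+ (j * N ^ 2))^-1 * 2^-1 ^+ (N ^ 2) :> R.
    by rewrite mulSn exprD mulrC exprVn.
  have n0 : (2 ^+ (j * N ^ 2) : R) != 0 by rewrite expf_neq0.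
  have -> : a0 * 2 ^+ (j * N ^ 2) * (C * ((2 ^+ (j * N ^ 2))^-1 * 2^-1 ^+ (N ^ 2))) = a0 * C * 2^-1 ^+ (N ^ 2).
    by move: (2^-1 ^+ (N ^ 2)) => y; field.
  have -> : 2 * a0 * C / (2 ^ N.+1)%:R = a0 * C * 2^-1 ^+ N.
    by rewrite natrX exprS exprVn; field; rewrite expf_neq0.
  have NN : (N <= N ^ 2)%N by rewrite -mulnn; case: (N) => // k; rewrite leq_pmull.
  by rewrite ler_wpM2l ?mulr_ge0 ?expR_ge0// ler_wiXn2l ?invr_ge0 ?invf_le1// ler1n.
apply: (@le_lt_trans _ _ (\int[mu2]_(z in A) (c0%:E + \sum_(N <oo) (T N z)%:E))%E).
  apply: ge0_le_integral => //.
  - apply/measurable_EFinP; apply: measurable_funTS.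
    apply: (measurable_continuous_comp (f := fun x : R => expR (g * Num.max x 0 ^+ 2))) (sob_m S).
    move=> x; apply: continuous_comp; last exact: continuous_expR.
    by have cs := continuous_sqr (@continuous_pos R); apply: cvgM; [exact: cvg_cst|exact: (cs x)].
  - apply: emeasurable_funD => //; apply: ge0_emeasurable_sum => // N *; rewrite ?lee_fin//.
    by apply/measurable_EFinP; exact: (measurable_funTS (mT N)).
  - move=> z Az.
    have S0 N : (0 <= (T N z)%:E)%E by rewrite lee_fin.
    have [vz|vz] := leP (v z) s1.
      apply: (@le_trans _ _ c0%:E); last by rewrite leeDl// nneseries_ge0.
      rewrite lee_fin /c0 ler_expR ler_wpM2l// lerXn2r ?nnegrE ?le_max ?lexx ?orbT//.
      by rewrite ge_max vz.
    have ex : exists n : nat, v z <= s1 + n%:R.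
      exists (Num.bound (v z - s1)); rewrite -lerBlDl ltW// archi_boundP// subr_ge0 ltW//.
    (* The layer of [z] is given by the least natural number that, added to [s1], bounds [v z]. *)
    case: (ex_minnP ex) => -[|N] hN minN; first by rewrite addr0 leNgt vz in hN.
    have hN' : s1 + N%:R < v z.
      by rewrite ltNge; apply/negP => /minN; rewrite ltnn.
    apply: (@le_trans _ _ (T N z)%:E).
      rewrite lee_fin /T /above hN' mulr1 ler_expR ler_wpM2l// lerXn2r ?nnegrE ?le_max ?lexx ?orbT//.
        by rewrite !addr_ge0.
      by rewrite ge_max -addrA natr1 hN !addr_ge0.
    apply: (@le_trans _ _ (\sum_(M <oo) (T M z)%:E)%E); last by rewrite leeDr// lee_fin expR_ge0.
    have := @nneseries_lim_ge R (fun M => (T M z)%:E) xpredT 0%N N.+1 (fun n _ _ => S0 n).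
    apply: le_trans; rewrite big_nat_recr//= leeDr// sume_ge0//.
rewrite ge0_integralD => //; last 2 first.
- by move=> z _; apply: nneseries_ge0 => N _ _; rewrite lee_fin.
- apply: ge0_emeasurable_sum => // N *; rewrite ?lee_fin//.
  by apply/measurable_EFinP; exact: (measurable_funTS (mT N)).
rewrite integral_cst// integral_nneseries => //; last 2 first.
- by move=> N; apply/measurable_EFinP; exact: (measurable_funTS (mT N)).
- by move=> N z _; rewrite lee_fin.
apply: lte_add_pinfty.
  by rewrite lte_mul_pinfty// lee_fin expR_ge0.
apply: (@le_lt_trans _ _ (2 * a0 * C)%:E); last by rewrite ltry.
have aC0 : 0 <= 2 * a0 * C by rewrite !mulr_ge0 ?expR_ge0.
(* The sum of [x / 2^(N + 1)] over [N] is at most [x]; this is why [TN] is stated with [N.+1]. *)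
apply: le_trans (epsilon_trick0 xpredT aC0).
apply: lee_nneseries => // N _ _; apply: integral_ge0 => z _; by rewrite lee_fin.
by move=> z _; rewrite lee_fin expR_ge0.
Qed.

End gaussian_tails.

(** * Integrability of functions of the minimizer *)

Section growth.
Context {R : realType}.
Local Notation mu := (@lebesgue_measure R).
Local Notation mu2 := (@lebesgue_measure R \x @lebesgue_measure R)%E.

Lemma Sob_opp (v va vb v1 v2 : R * R -> R) : Sob v va vb v1 v2 ->
  Sob (fun z => - v z) (fun z => - va z) (fun z => - vb z) (fun z => - v1 z) (fun z => - v2 z).
Proof.
move=> S; have mN (f : R * R -> R) : measurable_fun setT f -> measurable_fun setT (fun z => - f z).
  by move=> mf; exact: measurableT_comp.
have bN (f : R * R -> R) : box_integrable (fun z => f z ^+ 2) -> box_integrable (fun z => (- f z) ^+ 2).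
  by move=> bf n; move: (bf n); apply: eq_integrable => //; [exact: measurable_square|move=> z _ /=; rewrite sqrrN].
have AN (y h : R -> R) : AC y h -> AC (fun t => - y t) (fun t => - h t).
  by move=> A; apply: AC_eq (AC_sub (AC_cst 0) A) _ _ => t; rewrite sub0r.
split; [exact: mN (sob_m S)|exact: mN (sob_m1 S)|exact: mN (sob_m2 S)|exact: bN (sob_sq S)|
  exact: bN (sob_sq1 S)|exact: bN (sob_sq2 S)|exact: mN (sob_ma S)|exact: mN (sob_mb S)|..].
- by apply: (ae_imp (sob_ea S)) => z ->.
- by apply: (ae_imp (sob_eb S)) => z ->.
- by apply: (ae_imp (sob_la S)) => s; exact: AN.
- by apply: (ae_imp (sob_lb S)) => s; exact: AN.
- by move=> t s; rewrite (sob_per S).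
- by under eq_integral do rewrite !sqrrN; exact: (sob_fin S).
Qed.

(** The minimum over the segment is attained and is at most the mean. *)
Lemma mean_attained (y : R -> R) (K : R) : continuous y -> \int[mu]_(s in `[0, 1]) y s <= K ->
  exists s, 0 <= s <= 1 /\ y s <= K.
Proof.
move=> cy yK; have cy' : {within `[0, 1], continuous y} by exact: continuous_subspaceT.
have [c c01 hc] := EVT_min ler01 cy'; rewrite in_itv/= in c01.
exists c; split => //; apply: le_trans yK.
have h := @Rintegral_itv_cst R 0 1 (y c) ler01; rewrite subr0 mulr1 in h; rewrite -{}h.
apply: le_Rintegral => //.
- by apply: (@continuous_locint R (fun=> y c)) => x; exact: cvg_cst.
- exact: continuous_locint.
Qed.

Section setup.
Variables (a m p : R) (u1 a1 b1 D11 D12 u2 a2 b2 D21 D22 : R * R -> R).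
Hypothesis S : Setup a m p u1 a1 b1 D11 D12 u2 a2 b2 D21 D22.

Let v12 : {ae mu, forall t, vline u1 a1 b1 D11 D12 t /\ vline u2 a2 b2 D21 D22 t}.
Proof. exact: (ae_imp2 (Sob_vline (st1 S)) (Sob_vline (st2 S)) (fun t x y => conj x y)). Qed.

(** Supplies the zeros that the strip inequalities require for steps above [K], for both components
    and their opposites: the means are bounded, so every good column meets the level [K], and a good
    slice lies entirely below it. *)
Lemma slice_bounds : exists K : R,
  [/\ {ae mu, forall t, exists s, 0 <= s <= 1 /\ b1 (t, s) <= K},
      {ae mu, forall t, exists s, 0 <= s <= 1 /\ - b1 (t, s) <= K},
      {ae mu, forall t, exists s, 0 <= s <= 1 /\ b2 (t, s) <= K},
      {ae mu, forall t, exists s, 0 <= s <= 1 /\ - b2 (t, s) <= K} &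
      exists t0, {ae mu, forall s, 0 <= s <= 1 ->
        [/\ a1 (t0, s) <= K, - a1 (t0, s) <= K, a2 (t0, s) <= K & - a2 (t0, s) <= K]}].
Proof.
have [K0 [K00 hK0]] := avg_b2 S.
have [t0 [_ [w1 w2 _ g]]] := good_pos S 0 ltr01.
have ga := normr_ge0 a; have gp := normr_ge0 p.
have IN (y : R -> R) : continuous y -> \int[mu]_(s in `[0, 1]) (- y s) = - \int[mu]_(s in `[0, 1]) y s.
  move=> cy; rewrite -mulN1r -RintegralZl//; last exact: continuous_locint.
  by apply: eq_Rintegral => s _; rewrite mulN1r.
have cN (y : R -> R) : continuous y -> continuous (fun s => - y s).
  by move=> cy x; apply: cvgN; exact: cy.
exists (`|a| + `|p| + K0 + 1); split.
- apply: (ae_imp v12) => t [h1 h2]; apply: mean_attained; first exact: vline_continuous h1.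
  by rewrite (avg_b1 S h1 h2); have := ler_norm a; lra.
- apply: (ae_imp v12) => t [h1 h2]; apply: mean_attained; first exact/cN/(vline_continuous h1).
  rewrite IN; last exact: vline_continuous h1.
  by rewrite (avg_b1 S h1 h2); have := ler_norm (- a); rewrite normrN; lra.
- apply: (ae_imp2 v12 hK0) => t [h1 h2] h; apply: mean_attained; first exact: vline_continuous h2.
  by apply: (le_trans (ler_norm _)); apply: (le_trans h); lra.
- apply: (ae_imp2 v12 hK0) => t [h1 h2] h; apply: mean_attained; first exact/cN/(vline_continuous h2).
  rewrite IN; last exact: vline_continuous h2.
  by apply: (le_trans (ler_norm _)); rewrite normrN; apply: (le_trans h); lra.
- exists t0; have [_ _ e1 _ _] := w1; have [_ _ e2 _ _] := w2.
  apply: (ae_imp2 e1 e2) => s [_ ->] [_ ->] /g[]; rewrite !ler_distl.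
  have := ler_norm a; have := ler_norm p; have := ler_norm (- a); have := ler_norm (- p); rewrite !normrN.
  by move=> *; split; lra.
Qed.

(** The fourth power is the one that the maximum principle meets for the gradient of [w]; it also
    gives square integrability on rectangles. The sets [A] of finite measure may be unbounded, as
    the sets [u1 > k] are in general. *)
Definition tame (F : R * R -> R) := forall A : set (R * R),
  measurable (A : set (measurableTypeR R * measurableTypeR R)) -> A `<=` strip -> (mu2 A < +oo)%E ->
  mu2.-integrable A (EFin \o (fun z => F (u1 z, u2 z) ^+ 4)).

Lemma measurable_u12 (F : R * R -> R) : continuous F -> measurable_fun setT (fun z => F (u1 z, u2 z)).
Proof.
move=> cF; apply: (measurableT_comp (continuous_measurable2 cF)).
by apply: measurable_fun_pair; [exact: sob_m (st1 S)|exact: sob_m (st2 S)].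
Qed.

Lemma tame_bounded (F : R * R -> R) (K : R) : continuous F ->
  {ae mu2, forall z, `|u1 z| <= K /\ `|u2 z| <= K} -> tame F.
Proof.
move=> cF uK A mA As Aoo.
have mF := measurable_u12 cF.
have [M hM] : exists M : R, forall x : R * R, `|x.1| <= K /\ `|x.2| <= K -> `|F x| <= M.
  have cK : compact ([set` `[- K, K]] `*` [set` `[- K, K]] : set (R * R)).
    by apply: compact_setX; exact: segment_compact.
  have := continuous_compact (continuous_subspaceT cF) cK.
  move=> /compact_bounded[M [_ hM]]; exists (M + 1) => x [x1 x2]; apply: (hM (M + 1)); first by rewrite ltrDl.
  by exists x => //; split; rewrite /= in_itv/= -ler_norml.
apply/integrableP; split; first by apply/measurable_EFinP; apply: measurable_funTS; exact: measurable_funX.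
apply: (@le_lt_trans _ _ (\int[mu2]_(z in A) (M ^+ 4)%:E)%E); last first.
  rewrite integral_cst//; apply: lte_mul_pinfty => //; rewrite lee_fin.
  by rewrite (exprM M 2 2) sqr_ge0.
apply: ae_ge0_le_integral => //.
- by apply: measurableT_comp => //; apply/measurable_EFinP; apply: measurable_funTS; exact: measurable_funX.
- by move=> z _; rewrite lee_fin (exprM M 2 2) sqr_ge0.
- apply: (ae_imp uK) => z /(hM (u1 z, u2 z)) h _; rewrite /= lee_fin normrX lerXn2r ?nnegrE//.
  exact: le_trans h.
Qed.

Let exp_sqr_integrable (v va vb v1 v2 : R * R -> R) (K g : R) (A : set (R * R)) : Sob v va vb v1 v2 ->
  {ae mu, forall t, exists s, 0 <= s <= 1 /\ vb (t, s) <= K} ->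
  {ae mu, forall t, exists s, 0 <= s <= 1 /\ - vb (t, s) <= K} ->
  (exists t0, {ae mu, forall s, 0 <= s <= 1 -> va (t0, s) <= K /\ - va (t0, s) <= K}) ->
  measurable (A : set (measurableTypeR R * measurableTypeR R)) -> A `<=` strip -> (mu2 A < +oo)%E -> 0 <= g ->
  mu2.-integrable A (EFin \o (fun z => expR (g * v z ^+ 2))).
Proof.
move=> Sv z1 z2 [t0 z0] mA As Aoo g0.
have c (f : R -> R) : continuous f -> continuous (fun x => expR (g * f x ^+ 2)).
  move=> cf x; apply: continuous_comp; last exact: continuous_expR.
  by have cs := continuous_sqr cf; apply: cvgM; [exact: cvg_cst|exact: (cs x)].
have h1 : (\int[mu2]_(z in A) (expR (g * Num.max (v z) 0 ^+ 2))%:E < +oo)%E.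
  apply: (exp_sqr_pos_integrable Sv z1) => //; exists t0.
  by apply: (ae_imp z0) => s hs /hs[].
have h2 : (\int[mu2]_(z in A) (expR (g * Num.max (- v z) 0 ^+ 2))%:E < +oo)%E.
  apply: (exp_sqr_pos_integrable (Sob_opp Sv) z2) => //; exists t0.
  by apply: (ae_imp z0) => s hs /hs[].
have i1 : mu2.-integrable A (EFin \o (fun z => expR (g * Num.max (v z) 0 ^+ 2))).
  apply: integrable_lty_ge0 => //.
  apply: measurable_funTS; apply: (measurable_continuous_comp (c _ (@continuous_pos R))); exact: sob_m Sv.
have i2 : mu2.-integrable A (EFin \o (fun z => expR (g * Num.max (- v z) 0 ^+ 2))).
  apply: integrable_lty_ge0 => //.
  apply: measurable_funTS; apply: (measurable_continuous_comp (c _ (@continuous_pos R))); exact: sob_m (Sob_opp Sv).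
apply: (@integrable_le _ _ _ mu2 _ _ (fun z => expR (g * Num.max (v z) 0 ^+ 2) + expR (g * Num.max (- v z) 0 ^+ 2))) => //.
- apply: measurable_funTS; apply: (measurable_continuous_comp (f := fun x => expR (g * x ^+ 2))); last exact: sob_m Sv.
  by apply: c => x; exact: cvg_id.
- move=> z _; rewrite ger0_norm ?expR_ge0//; have [h|h] := leP 0 (v z).
    by rewrite lerDl expR_ge0.
  by rewrite [Num.max (- v z) 0]max_l ?sqrrN ?lerDr ?expR_ge0// oppr_ge0 ltW.
- by have := integrableD mA i1 i2; apply: eq_integrable => // z _; rewrite /= EFinD.
Qed.

(** The fourth power of [exp(beta (x^2 + y^2))] is the product of [exp(4 beta x^2)] and
    [exp(4 beta y^2)]. A product is at most the sum of the squares, which separates the two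
    components and produces [8 beta]. *)
Lemma tame_growth (F : R * R -> R) (C beta : R) : continuous F -> 0 <= beta ->
  (forall z, `|F z| <= C * expR (beta * sqn z)) -> tame F.
Proof.
move=> cF b0 hF A mA As Aoo.
have [K [z1 z1' z2 z2' [t0 z0]]] := slice_bounds.
have g0 : 0 <= 8 * beta by rewrite mulr_ge0.
have z01 : exists t0, {ae mu, forall s, 0 <= s <= 1 -> a1 (t0, s) <= K /\ - a1 (t0, s) <= K}.
  by exists t0; apply: (ae_imp z0) => s hs /hs[].
have z02 : exists t0, {ae mu, forall s, 0 <= s <= 1 -> a2 (t0, s) <= K /\ - a2 (t0, s) <= K}.
  by exists t0; apply: (ae_imp z0) => s hs /hs[].
have i1 := exp_sqr_integrable (st1 S) z1 z1' z01 mA As Aoo g0.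
have i2 := exp_sqr_integrable (st2 S) z2 z2' z02 mA As Aoo g0.
have C0 : 0 <= C.
  have := hF (0, 0); rewrite /sqn /= expr0n /= addr0 mulr0 expR0 mulr1; exact: le_trans.
apply: (@integrable_le _ _ _ mu2 _ _ (fun z => C ^+ 4 * (expR (8 * beta * u1 z ^+ 2) + expR (8 * beta * u2 z ^+ 2)))) => //.
- by apply: measurable_funTS; apply: measurable_funX; exact: measurable_u12.
- move=> z _; rewrite normrX; apply: (@le_trans _ _ ((C * expR (beta * sqn (u1 z, u2 z))) ^+ 4)).
    by rewrite lerXn2r ?nnegrE//; exact: le_trans (hF (u1 z, u2 z)).
  rewrite exprMn ler_wpM2l ?exprn_ge0// -expRM_natl /sqn /= !mulrDr expRD.
  set x := expR (4%:R * _); set y := expR (4%:R * _).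
  have -> : expR (8 * beta * u1 z ^+ 2) = x ^+ 2.
    by rewrite /x -expRM_natl; congr expR; ring.
  have -> : expR (8 * beta * u2 z ^+ 2) = y ^+ 2.
    by rewrite /y -expRM_natl; congr expR; ring.
  by have := sqr_ge0 (x - y); have := sqr_ge0 x; have := sqr_ge0 y; nra.
- have := integrableZl mA (C ^+ 4) (integrableD mA i1 i2).
  by apply: eq_integrable => // z _; rewrite /= EFinM EFinD.
Qed.

Lemma tame_sqint_rect (F : R * R -> R) : continuous F -> tame F ->
  forall t0 t1, sqint mu2 (rect t0 t1) (fun z => F (u1 z, u2 z)).
Proof.
move=> cF tF t0 t1; have mr := measurable_rectR `[t0, t1] `[0, 1].
have mF := measurable_u12 cF.
have Roo : (mu2 (rect t0 t1) < +oo)%E.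
  by rewrite /rect /= product_measure1E//= !lebesgue_measure_itv/= lte01; case: ifP => _; rewrite ?mul0e// -EFinB -?EFinB -EFinM ltry.
have i4 : mu2.-integrable (rect t0 t1) (EFin \o (fun z => F (u1 z, u2 z) ^+ 4)).
  by apply: tF => // z [].
have ic : mu2.-integrable (rect t0 t1) (EFin \o (fun=> 1 : R)).
  by apply: measurable_bounded_integrable => //; exact: bounded_cst.
split; first exact: measurable_funTS.
apply: (@integrable_le _ _ _ mu2 _ _ (fun z => 1 + F (u1 z, u2 z) ^+ 4)) => //.
- by apply: measurable_funTS; exact: measurable_funX.
- move=> z _; rewrite ger0_norm ?sqr_ge0// (exprM _ 2 2).
  by move: (_ ^+ 2) (sqr_ge0 (F (u1 z, u2 z))) => y y0; have := sqr_ge0 (y - 1); nra.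
- by have := integrableD mr ic i4; apply: eq_integrable => // z _; rewrite /= EFinD.
Qed.

End setup.
End growth.

(** * The maximum principle *)

Lemma invn_small (R : realType) (e : R) : 0 < e -> exists n : nat, n.+1%:R^-1 <= e.
Proof.
move=> e0; have ie0 : 0 <= e^-1 by rewrite invr_ge0 ltW.
exists (Num.bound e^-1); rewrite -[leRHS]invrK lef_pV2 ?posrE ?invr_gt0//.
by apply: (le_trans (ltW (archi_boundP ie0))); rewrite ler_nat.
Qed.

Section cutoff.
Context {R : realType}.
Variable k : R.

(** Zero up to [k], [(x - k)^2 / 2] up to [k + 1], then affine of slope 1: a [C^1] version of the
    positive part of [x - k], positive exactly above [k]. *)
Definition cut (x : R) := (pos2 (x - k) - pos2 (x - (k + 1))) / 2.
Definition cut' (x : R) := Num.max (x - k) 0 - Num.max (x - (k + 1)) 0.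
(** The primitive of [cut' ^+ 2] that vanishes up to [k], in closed form. *)
Definition cutsq (x : R) := ((x - k) * pos2 (x - k) - (x - (k + 1)) * pos2 (x - (k + 1))) / 3 - pos2 (x - (k + 1)).

Lemma is_derive_cut x : is_derive x (1 : R) cut (cut' x).
Proof.
have d := is_deriveZ 2^-1 (is_deriveB (is_derive_pos2B k x) (is_derive_pos2B (k + 1) x)).
have -> : cut = (fun x => 2^-1 * (pos2 (x - k) - pos2 (x - (k + 1)))) by apply/funext => y; rewrite mulrC.
by apply: (is_derive_eq d); rewrite /GRing.scale/= /cut'; field.
Qed.

Lemma is_derive_cube (c x : R) : is_derive x (1 : R) (fun x => (x - c) * pos2 (x - c)) (3 * pos2 (x - c)).
Proof.
have d1 : is_derive x (1 : R) (fun x : R => x - c) 1.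
  have d := is_deriveB (is_derive_id x (1 : R)) (is_derive_cst c x (1 : R)).
  by apply: (is_derive_eq d); rewrite subr0.
apply: (is_derive_eq (is_deriveM d1 (is_derive_pos2B c x))).
rewrite /GRing.scale/= /pos2; have [h|h] := leP (x - c) 0; rewrite ?mulr0 ?expr0n /= ?mulr0 ?mul0r ?addr0//; ring.
Qed.

Lemma is_derive_cutsq x : is_derive x (1 : R) cutsq (cut' x ^+ 2).
Proof.
have d := is_deriveB (is_deriveZ 3^-1 (is_deriveB (is_derive_cube k x) (is_derive_cube (k + 1) x)))
  (is_derive_pos2B (k + 1) x).
have -> : cutsq = (fun x => 3^-1 * ((x - k) * pos2 (x - k) - (x - (k + 1)) * pos2 (x - (k + 1))) - pos2 (x - (k + 1))).
  by apply/funext => y; rewrite /cutsq mulrC.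
apply: (is_derive_eq d); rewrite /GRing.scale/= /cut' /pos2.
have [h|h] := leP (x - k) 0; have [h'|h'] := leP (x - (k + 1)) 0; last by field.
- by field.
- by lra.
- by field.
Qed.

Lemma continuous_cut' : continuous cut'.
Proof. by move=> x; apply: cvgB; exact: continuous_posB. Qed.

Lemma continuous_cut : continuous cut.
Proof. exact: is_derive_continuous is_derive_cut. Qed.

Lemma cut'_bound x : 0 <= cut' x <= 1.
Proof.
rewrite /cut'; have [h|h] := leP (x - k) 0; have [h'|h'] := leP (x - (k + 1)) 0; lra.
Qed.

Lemma cut_ge0 x : 0 <= cut x.
Proof.
rewrite /cut /pos2; have [h|h] := leP (x - k) 0; have [h'|h'] := leP (x - (k + 1)) 0; nra.
Qed.

Lemma cut_le x : x <= k -> cut x = 0.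
Proof. by move=> xk; rewrite /cut /pos2 !max_r ?expr0n ?subrr ?mul0r//; lra. Qed.

Lemma cut_gt x : k < x -> 0 < cut x.
Proof.
move=> xk; rewrite /cut /pos2; have [h|h] := leP (x - k) 0; first by lra.
by have [h'|h'] := leP (x - (k + 1)) 0; nra.
Qed.

(** [cut'] is nonnegative and nondecreasing, so the integral of its square up to [x] is at most
    [cut' x] times the integral of [cut']. *)
Lemma cutsq_bound x : 0 <= cutsq x <= cut x * cut' x.
Proof.
rewrite /cutsq /cut /cut' /pos2.
have [h|h] := leP (x - k) 0; have [h'|h'] := leP (x - (k + 1)) 0.
- by rewrite !expr0n /= !mulr0 !subrr !mul0r subrr lexx.
- by lra.
- rewrite !expr0n /= !mulr0 !subr0; move: (x - k) h => y h.
  have h2 : 0 <= y * y ^+ 2 by rewrite mulr_ge0 ?sqr_ge0// ltW.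
  by apply/andP; split; nra.
- have -> : x - (k + 1) = (x - k) - 1 by ring.
  have : 1 < x - k by lra.
  move: (x - k) => y y1.
  have -> : (y * y ^+ 2 - (y - 1) * (y - 1) ^+ 2) / 3 - (y - 1) ^+ 2 = y - 2 / 3 by field.
  have -> : (y ^+ 2 - (y - 1) ^+ 2) / 2 * (y - (y - 1)) = y - 1 / 2 by field.
  by apply/andP; split; lra.
Qed.

End cutoff.

Section maximum_principle.
Context {R : realType}.
Local Notation mu := (@lebesgue_measure R).
Local Notation mu2 := (@lebesgue_measure R \x @lebesgue_measure R)%E.
Variables (a m p : R) (u1 a1 b1 D11 D12 u2 a2 b2 D21 D22 : R * R -> R).
Hypothesis S : Setup a m p u1 a1 b1 D11 D12 u2 a2 b2 D21 D22.
Variables (w w1 w2 : R * R -> R).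
Hypothesis C1 : C1with w w1 w2.
Hypotheses (tw1 : tame u1 u2 w1) (tw2 : tame u1 u2 w2).
Hypothesis iw : forall t0 t1, sqint mu2 (rect t0 t1) (fun z => w (u1 z, u2 z)).
Hypothesis eqw : {ae mu2, forall z, strip z -> D21 z - D12 z = w (u1 z, u2 z)}.

Let ms := @measurable_stripR R.
Let m01 := measurable_itvR (Interval (BLeft (0 : R)) (BRight 1)).
Let mu1 : measurable_fun setT u1. Proof. exact: sob_m (st1 S). Qed.
Let mD11 : measurable_fun setT D11. Proof. exact: sob_m1 (st1 S). Qed.
Let mD12 : measurable_fun setT D12. Proof. exact: sob_m2 (st1 S). Qed.
Let mD21 : measurable_fun setT D21. Proof. exact: sob_m1 (st2 S). Qed.
Let mD22 : measurable_fun setT D22. Proof. exact: sob_m2 (st2 S). Qed.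
Let cw1 : continuous w1. Proof. by have [_ _ + _] := C1. Qed.
Let cw2 : continuous w2. Proof. by have [_ _ _ +] := C1. Qed.
Let mw1 : measurable_fun setT (fun z => w1 (u1 z, u2 z)). Proof. exact: (measurable_u12 S). Qed.
Let mw2 : measurable_fun setT (fun z => w2 (u1 z, u2 z)). Proof. exact: (measurable_u12 S). Qed.

Let gr z := D11 z ^+ 2 + D12 z ^+ 2.
(** The indicator of [grad u1 <> 0]. The term [H2] to be estimated vanishes off this set, which
    meets every level set of [u1] in a null set. *)
Let nz z : R := (gr z != 0)%:R.
Let B z := w1 (u1 z, u2 z) ^+ 2 + w2 (u1 z, u2 z) ^+ 2.

Let gr_ge0 z : 0 <= gr z. Proof. by rewrite addr_ge0 ?sqr_ge0. Qed.
Let mgr : measurable_fun setT gr.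
Proof. by apply: measurable_funD; exact: measurable_funX. Qed.
Let B_ge0 z : 0 <= B z. Proof. by rewrite addr_ge0 ?sqr_ge0. Qed.
Let mB : measurable_fun setT B.
Proof. by apply: measurable_funD; exact: measurable_funX. Qed.

Let igr : mu2.-integrable strip (EFin \o gr).
Proof.
by apply: integrable_lty_ge0 => //; [exact: measurable_funTS|exact: (sob_fin (st1 S))].
Qed.

Let mnz : measurable_fun setT nz.
Proof.
have -> : nz = (fun z => 1 - \1_(fun z => gr z = 0) z).
  apply/funext => z; rewrite /nz indicE; case: eqP => h.
    by rewrite mem_set ?subrr.
  by rewrite memNset ?subr0.
apply: measurable_funB => //; apply: measurable_indic.
exact: (measurable_eqset mgr (measurable_cst _)).
Qed.

(** The mean of [u1] on good columns is [a < k], so each of them has a point where [u1] is at most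
    [a]; by [tail_integrable] the set [u1 > k] has finite measure in the strip, and tameness applies
    to it. *)
Let iB k : a < k -> mu2.-integrable strip (EFin \o (fun z => above u1 k z * (nz z * B z ^+ 2))).
Proof.
move=> ak.
have z2 : {ae mu, forall t, exists s, 0 <= s <= 1 /\ b1 (t, s) <= a}.
  apply: (ae_imp2 (Sob_vline (st1 S)) (Sob_vline (st2 S))) => t h1 h2.
  by apply: mean_attained; [exact: vline_continuous h1|rewrite (avg_b1 S h1 h2)].
have ia := tail_integrable (st1 S) z2 ak.
pose A := strip `&` (u1 @^-1` `]k, +oo[) : set (R * R).
have mA0 : measurable (u1 @^-1` `]k, +oo[ : set (measurableTypeR R * measurableTypeR R)).
  by rewrite -[X in measurable X]setTI; apply: mu1 => //; exact: measurable_itvR.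
have mA : measurable (A : set (measurableTypeR R * measurableTypeR R)) by exact: measurableI.
have Aoo : (mu2 A < +oo)%E.
  have := integrable_lty ms ia.
  have -> : (\int[mu2]_(x in strip) (EFin \o above u1 k) x = mu2 A)%E.
    rewrite /A setIC -integral_indic//; apply: eq_integral => z _; rewrite /above indicE /=.
    by congr ((nat_of_bool _)%:R%:E); apply/idP/idP => [h|]; rewrite inE/= in_itv/= andbT.
  by [].
have As : A `<=` strip by move=> z [].
have i1 := tw1 mA As Aoo; have i2 := tw2 mA As Aoo.
have iA : mu2.-integrable A (EFin \o (fun z => above u1 k z * (nz z * B z ^+ 2))).
  apply: (@integrable_le _ _ _ mu2 _ _ (fun z => 2 * w1 (u1 z, u2 z) ^+ 4 + 2 * w2 (u1 z, u2 z) ^+ 4)) => //.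
  - apply: measurable_funTS; apply: measurable_funM; first exact: (measurable_above (st1 S)).
    by apply: measurable_funM => //; exact: measurable_funX.
  - move=> z _; rewrite ger0_norm; last by rewrite !mulr_ge0 ?ler0n ?sqr_ge0.
    apply: (@le_trans _ _ (B z ^+ 2)).
      by rewrite mulrA ler_piMl ?sqr_ge0// /above /nz -natrM lern1 mulnb leq_b1.
    rewrite !(exprM _ 2 2) /B; move: (_ ^+ 2) (w2 _ ^+ 2) => x y.
    by have := sqr_ge0 (x - y); nra.
  - have := integrableD mA (integrableZl mA 2 i1) (integrableZl mA 2 i2).
    by apply: eq_integrable => // z _; rewrite /= EFinD !EFinM.
have e : {in strip, EFin \o (fun z => above u1 k z * (nz z * B z ^+ 2)) =1
    (EFin \o (fun z => above u1 k z * (nz z * B z ^+ 2))) \_ A}.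
  move=> z zs; rewrite patchE; case: ifPn => // /negP zA; rewrite /= /above.
  case: ltP => h; last by rewrite mul0r.
  by exfalso; apply: zA; rewrite /A inE; split; [rewrite inE in zs|rewrite /= in_itv/= h].
have : mu2.-integrable strip ((EFin \o (fun z => above u1 k z * (nz z * B z ^+ 2))) \_ A).
  by have := iA; rewrite (integrable_mkcond _ mA) => h; exact: integrableS h.
by apply: eq_integrable => // z zs; exact/esym/e.
Qed.

Section level.
Variable k : R.
Hypothesis ak : a < k.

Let phi := cut k.
Let phi' := cut' k.

Let mphi : measurable_fun setT (fun z => phi (u1 z)).
Proof. exact: measurable_continuous_comp (@continuous_cut R k) _. Qed.
Let mphi' : measurable_fun setT (fun z => phi' (u1 z)).
Proof. exact: measurable_continuous_comp (@continuous_cut' R k) _. Qed.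

Let phi'_sqr x : phi' x ^+ 2 <= 1.
Proof. by have /andP[h0 h1] := cut'_bound k x; rewrite exprn_ile1. Qed.

Let z2 : {ae mu, forall t, exists s, 0 <= s <= 1 /\ b1 (t, s) <= k}.
Proof.
apply: (ae_imp2 (Sob_vline (st1 S)) (Sob_vline (st2 S))) => t h1 h2.
by apply: mean_attained; [exact: vline_continuous h1|rewrite (avg_b1 S h1 h2) ltW].
Qed.

Let z1 : exists t0, {ae mu, forall s, 0 <= s <= 1 -> a1 (t0, s) <= k}.
Proof.
have ka : 0 < k - a by rewrite subr_gt0.
have [t0 [_ [v1 _ _ g]]] := good_pos S 0 ka; exists t0; have [_ _ e _ _] := v1.
by apply: (ae_imp e) => s [_ ->] /g[]; rewrite ler_distl => /andP[_ h] _; move: h; rewrite addrC subrK.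
Qed.

Let X z := phi' (u1 z) ^+ 2 * gr z.
Let mX : measurable_fun setT X.
Proof. by apply: measurable_funM => //; exact: measurable_funX. Qed.
Let X_ge0 z : 0 <= X z. Proof. by rewrite mulr_ge0 ?sqr_ge0. Qed.
Let iX : mu2.-integrable strip (EFin \o X).
Proof.
apply: (@integrable_le _ _ _ mu2 _ _ gr) => //; first exact: measurable_funTS.
by move=> z _; rewrite ger0_norm// ler_piMl.
Qed.
Let X0 := \int[mu2]_(z in strip) X z.

Let phi_sq : (\int[mu2]_(z in strip) (phi (u1 z) ^+ 2)%:E <= X0%:E)%E.
Proof.
have z2' : {ae mu, forall t, exists s, 0 <= s <= 1 /\ phi (b1 (t, s)) = 0}.
  by apply: (ae_imp z2) => t [s [h1 h2]]; exists s; split => //; exact: cut_le.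
apply: (le_trans (strip_poincare (st1 S) (@is_derive_cut R k) (@continuous_cut' R k) z2')).
rewrite /X0 -integral_EFin_Rintegral//; apply: ge0_le_integral => //.
- by move=> z _; rewrite lee_fin sqr_ge0.
- by apply/measurable_EFinP; apply: measurable_funTS; apply: measurable_funX; exact: measurable_funM.
- by apply/measurable_EFinP; exact: measurable_funTS.
- by move=> z _; rewrite lee_fin exprMn ler_wpM2l ?sqr_ge0// /gr lerDr sqr_ge0.
Qed.

Let sphi : sqint mu2 strip (fun z => phi (u1 z)).
Proof.
apply: sqint_lty => //; first exact: measurable_funTS.
exact: le_lt_trans phi_sq (ltry _).
Qed.

Let phi_sqR : \int[mu2]_(z in strip) (phi (u1 z) ^+ 2) <= X0.
Proof. by have := phi_sq; rewrite integral_EFin_Rintegral//; exact: sphi.2. Qed.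

(** The interpolation inequality for [phi ^ 2], with derivative [2 phi phi']. Cauchy-Schwarz bounds
    the squares of the two factors by [4 X0] times the two parts of [X0], so their product is at
    most [2 X0^2]. *)
Let phi4 : mu2.-integrable strip (EFin \o (fun z => phi (u1 z) ^+ 4)) /\
  \int[mu2]_(z in strip) (phi (u1 z) ^+ 4) <= 2 * X0 ^+ 2.
Proof.
pose F := fun x => phi x ^+ 2; pose F' := fun x => 2 * phi x * phi' x.
have dF x : is_derive x (1 : R) F (F' x).
  have dc := is_derive_cut k x; apply: (is_derive_eq (is_deriveM dc dc)).
  by rewrite /GRing.scale/= /F' /phi /phi'; ring.
have cF' : continuous F'.
  move=> x; apply: cvgM; last exact: continuous_cut'.
  by apply: cvgM; [exact: cvg_cst|exact: continuous_cut].
have z2' : {ae mu, forall t, exists s, 0 <= s <= 1 /\ F (b1 (t, s)) = 0}.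
  apply: (ae_imp z2) => t [s [h1 h2]]; exists s; split => //.
  by rewrite /F /phi cut_le// expr0n.
have z1' : exists t0, {ae mu, forall s, 0 <= s <= 1 -> F (a1 (t0, s)) = 0}.
  have [t0 h] := z1; exists t0; apply: (ae_imp h) => s hs /hs h1.
  by rewrite /F /phi cut_le// expr0n.
have sD (D : R * R -> R) : measurable_fun setT D -> (forall z, D z ^+ 2 <= gr z) ->
    sqint mu2 strip (fun z => phi' (u1 z) * D z) /\
    \int[mu2]_(z in strip) ((phi' (u1 z) * D z) ^+ 2) <= X0.
  move=> mD hD.
  have s : sqint mu2 strip (fun z => phi' (u1 z) * D z).
    split; first by apply: measurable_funTS; exact: measurable_funM.
    apply: (@integrable_le _ _ _ mu2 _ _ X) => //.
      by apply: measurable_funTS; apply: measurable_funX; exact: measurable_funM.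
    by move=> z _; rewrite ger0_norm ?sqr_ge0// exprMn ler_wpM2l ?sqr_ge0.
  split => //; apply: le_Rintegral => //; first exact: s.2.
  by move=> z _; rewrite exprMn ler_wpM2l ?sqr_ge0.
have g1 z : D11 z ^+ 2 <= gr z by rewrite /gr lerDl sqr_ge0.
have g2 z : D12 z ^+ 2 <= gr z by rewrite /gr lerDr sqr_ge0.
have [s1 le1] := sD _ mD11 g1; have [s2 le2] := sD _ mD12 g2.
have iF (D : R * R -> R) : sqint mu2 strip (fun z => phi' (u1 z) * D z) ->
    mu2.-integrable strip (EFin \o (fun z => F' (u1 z) * D z)).
  move=> sd; have := integrableZl ms 2 (sqintM ms sphi sd); apply: eq_integrable => // z _.
  by rewrite /= -EFinM /F'; congr EFin; ring.
have i1 := iF _ s1; have i2 := iF _ s2.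
have GN := strip_gagliardo_nirenberg (st1 S) dF cF' z2' z1' i1 i2.
have Jle (D : R * R -> R) : sqint mu2 strip (fun z => phi' (u1 z) * D z) ->
    \int[mu2]_(z in strip) ((phi' (u1 z) * D z) ^+ 2) <= X0 ->
   (\int[mu2]_(z in strip) `|F' (u1 z) * D z|) ^+ 2 <= 4 * X0 * \int[mu2]_(z in strip) ((phi' (u1 z) * D z) ^+ 2).
  move=> sd led.
  have sdn : sqint mu2 strip (fun z => `|phi' (u1 z) * D z|).
    have [q1 q2] := sd; split; first exact: measurableT_comp.
    by move: q2; apply: eq_integrable => // z _; rewrite real_normK ?num_real.
  have -> : \int[mu2]_(z in strip) `|F' (u1 z) * D z| = 2 * \int[mu2]_(z in strip) (phi (u1 z) * `|phi' (u1 z) * D z|).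
    rewrite -RintegralZl//; last exact: sqintM.
    apply: eq_Rintegral => z _.
    have -> : F' (u1 z) * D z = (2 * phi (u1 z)) * (phi' (u1 z) * D z) by rewrite /F'; ring.
    have p0 : 0 <= 2 * phi (u1 z) by rewrite mulr_ge0// cut_ge0.
    by rewrite normrM (ger0_norm p0); ring.
  rewrite exprMn; have -> : 2 ^+ 2 = 4 :> R by ring.
  rewrite -mulrA ler_wpM2l//; apply: (le_trans (cauchy_schwarz_Rintegral ms sphi sdn)).
  under [X in _ * X <= _]eq_Rintegral do rewrite real_normK ?num_real//.
  by rewrite ler_wpM2r//; apply: Rintegral_ge0 => z _; exact: sqr_ge0.
have J1 := Jle _ s1 le1; have J2 := Jle _ s2 le2.
have i4 : mu2.-integrable strip (EFin \o (fun z => phi (u1 z) ^+ 4)).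
  apply: integrable_lty_ge0 => //.
  - by apply: measurable_funTS; exact: measurable_funX.
  - by move=> z _; rewrite (exprM _ 2 2) sqr_ge0.
  - apply: le_lt_trans (ltry _); apply: le_trans GN.
    by under eq_integral do rewrite (exprM _ 2 2).
split => //; rewrite -lee_fin -integral_EFin_Rintegral//.
under eq_integral do rewrite (exprM _ 2 2).
apply: (le_trans GN); rewrite lee_fin.
have sumX : \int[mu2]_(z in strip) ((phi' (u1 z) * D11 z) ^+ 2) + \int[mu2]_(z in strip) ((phi' (u1 z) * D12 z) ^+ 2) = X0.
  rewrite -RintegralD//; [|exact: s1.2|exact: s2.2].
  by apply: eq_Rintegral => z _; rewrite /X /gr !exprMn mulrDr.
move: J1 J2 sumX; set j1 := Rintegral _ _ _; set A := Rintegral _ _ _.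
set j2 := Rintegral _ _ _; set C := Rintegral _ _ _ => q1 q2 q3.
have : 4 * X0 * A + 4 * X0 * C = 4 * X0 ^+ 2 by rewrite -mulrDr q3; ring.
by have := sqr_ge0 (j1 - j2); move: (4 * X0 * A) (4 * X0 * C) q1 q2 => x y; nra.
Qed.

Let eta := cutsq k.
Let eta' x := phi' x ^+ 2.

Let ceta' : continuous eta'. Proof. exact: continuous_sqr (@continuous_cut' R k). Qed.
Let ceta : continuous eta. Proof. exact: is_derive_continuous (@is_derive_cutsq R k). Qed.
Let eta'1 x : `|eta' x| <= 1. Proof. by rewrite ger0_norm ?sqr_ge0//; exact: phi'_sqr. Qed.

(** [H1 + H2] is [d_2 (eta(u1) w(u))] with [D22] replaced by [- D11], so its integral over almost
    every column is 0. *)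
Let H1 z := eta' (u1 z) * D12 z * w (u1 z, u2 z).
Let H2 z := eta (u1 z) * (w1 (u1 z, u2 z) * D12 z - w2 (u1 z, u2 z) * D11 z).
(** A bound for [|H2|]: half of [X], to be absorbed, and two terms whose balance is set by the
    parameter [th]. *)
Let G th z := 2^-1 * X z + (th / 2 * phi (u1 z) ^+ 4 + (8 * th)^-1 * (above u1 k z * (nz z * B z ^+ 2))).

Let mw : measurable_fun setT (fun z => w (u1 z, u2 z)).
Proof. exact: (measurable_u12 S (C1with_continuous C1)). Qed.
Let meta : measurable_fun setT (fun z => eta (u1 z)).
Proof. exact: measurable_continuous_comp ceta _. Qed.
Let meta' : measurable_fun setT (fun z => eta' (u1 z)).
Proof. exact: measurable_continuous_comp ceta' _. Qed.
Let mH1 : measurable_fun setT H1.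
Proof. by apply: measurable_funM => //; exact: measurable_funM. Qed.
Let mH2 : measurable_fun setT H2.
Proof. by apply: measurable_funM => //; apply: measurable_funB; exact: measurable_funM. Qed.

Let iG th : mu2.-integrable strip (EFin \o G th).
Proof.
have i1 := integrableZl ms 2^-1 iX; have i2 := integrableZl ms (th / 2) phi4.1.
have i3 := integrableZl ms (8 * th)^-1 (iB ak).
have := integrableD ms i1 (integrableD ms i2 i3).
by apply: eq_integrable => // z _; rewrite /= /G !EFinD !EFinM.
Qed.

Let G_ge0 th z : 0 < th -> 0 <= G th z.
Proof.
move=> th0; rewrite /G; apply: addr_ge0; first by rewrite mulr_ge0.
apply: addr_ge0.
  apply: mulr_ge0; first by rewrite divr_ge0// ltW.
  by rewrite (exprM _ 2 2); exact: sqr_ge0.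
by rewrite mulr_ge0 ?invr_ge0 ?mulr_ge0 ?above_ge0 ?ler0n ?sqr_ge0// ltW.
Qed.

(** Since [eta <= phi phi'], the factors are grouped as [phi' |grad u1|] and [phi |grad w(u)|].
    Young's inequality is used twice, the second time with weight [th] to separate [phi ^ 4] from
    [B ^ 2]. *)
Let H2_le th z : 0 < th -> `|H2 z| <= G th z.
Proof.
move=> th0; have G0 := G_ge0 z th0.
have [f0 f1] : 0 <= phi' (u1 z) /\ phi' (u1 z) <= 1 by apply/andP; exact: cut'_bound.
have p0 : 0 <= phi (u1 z) by exact: cut_ge0.
have [e0 e1] := andP (cutsq_bound k (u1 z)).
have [uk|uk] := leP (u1 z) k.
  rewrite /H2; have -> : eta (u1 z) = 0.
    by apply/eqP; rewrite eq_le e0 andbT; apply: (le_trans e1); rewrite cut_le// mul0r.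
  by rewrite mul0r normr0.
have [g0|g0] := eqVneq (gr z) 0.
  have : (D11 z == 0) && (D12 z == 0).
    by rewrite -[D11 z == 0]sqrf_eq0 -[D12 z == 0]sqrf_eq0 -paddr_eq0 ?sqr_ge0//; apply/eqP.
  by rewrite /H2 => /andP[/eqP -> /eqP ->]; rewrite !mulr0 subrr mulr0 normr0.
rewrite /H2 /G /X; have -> : above u1 k z = 1 by rewrite /above uk.
rewrite /nz g0 !mul1r normrM [`|eta _|]ger0_norm//.
apply: (@le_trans _ _ (phi (u1 z) * phi' (u1 z) * `|w1 (u1 z, u2 z) * D12 z - w2 (u1 z, u2 z) * D11 z|)).
  by rewrite ler_wpM2r.
apply: (@le_trans _ _ (2^-1 * (phi' (u1 z) ^+ 2 * gr z) + 2^-1 * (phi (u1 z) ^+ 2 * B z))).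
  rewrite -(ger0_norm (mulr_ge0 p0 f0)) -normrM /gr /B.
  move: (phi (u1 z)) (phi' (u1 z)) (w1 _) (w2 _) (D11 z) (D12 z) => x y w1' w2' d1 d2.
  rewrite ler_norml; apply/andP; split.
    have -> : - (2^-1 * (y ^+ 2 * (d1 ^+ 2 + d2 ^+ 2)) + 2^-1 * (x ^+ 2 * (w1' ^+ 2 + w2' ^+ 2))) =
      x * y * (w1' * d2 - w2' * d1) - 2^-1 * ((y * d2 + x * w1') ^+ 2 + (y * d1 - x * w2') ^+ 2) by field.
    by rewrite gerDl oppr_le0 mulr_ge0// addr_ge0 ?sqr_ge0.
  have -> : x * y * (w1' * d2 - w2' * d1) = 2^-1 * (y ^+ 2 * (d1 ^+ 2 + d2 ^+ 2)) + 2^-1 * (x ^+ 2 * (w1' ^+ 2 + w2' ^+ 2))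
      - 2^-1 * ((y * d2 - x * w1') ^+ 2 + (y * d1 + x * w2') ^+ 2) by field.
  by rewrite gerDl oppr_le0 mulr_ge0// addr_ge0 ?sqr_ge0.
rewrite lerD2l (exprM _ 2 2); move: (phi (u1 z) ^+ 2) (B z) => x y.
have -> : 2^-1 * (x * y) = th / 2 * x ^+ 2 + (8 * th)^-1 * y ^+ 2 - (8 * th)^-1 * (y - 2 * th * x) ^+ 2.
  by field; rewrite lt0r_neq0.
by rewrite gerDl oppr_le0 mulr_ge0 ?sqr_ge0// invr_ge0 mulr_ge0// ltW.
Qed.

Let iH2 t0 t1 : mu2.-integrable (rect t0 t1) (EFin \o H2).
Proof.
have mr := measurable_rectR `[t0, t1] `[0, 1].
apply: (@integrable_le _ _ _ mu2 _ _ (G 1)) => //; first exact: measurable_funTS.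
- by move=> z _; exact: H2_le.
- by apply: integrableS (iG 1) => // z [].
Qed.

Let iH1 t0 t1 : mu2.-integrable (rect t0 t1) (EFin \o H1).
Proof.
have mr := measurable_rectR `[t0, t1] `[0, 1].
have [_ _ s2] := Sob_rect (st1 S) t0 t1.
apply: sqintM => //; apply: (sqint_boundedM (C := 1)) => //.
exact: measurable_funTS.
Qed.

Let slice_zero : {ae mu, forall t, \int[mu]_(s in `[0, 1]) (H1 (t, s) + H2 (t, s)) = 0}.
Proof.
have dv := ae_prod1 (st_div S).
apply: (ae_imp3 (Sob_vline (st1 S)) (Sob_vline (st2 S)) dv) => t [A1 p1 e1 _ _] [A2 p2 e2 _ _] d.
have A := AC_mul (AC_chain1 (@is_derive_cutsq R k) ceta' A1) (AC_chain2 C1 A1 A2).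
transitivity (cutsq k (b1 (t, 1)) * w (b1 (t, 1), b2 (t, 1)) - cutsq k (b1 (t, 0)) * w (b1 (t, 0), b2 (t, 0))); last first.
  by have := p1 0; have := p2 0; rewrite !add0r => -> ->; rewrite subrr.
rewrite (proj2 A)//; apply: ae_eq_Rintegral => //.
- apply: measurable_funTS; apply: measurable_funD; [exact: (measurable_slice2 t mH1)|exact: (measurable_slice2 t mH2)].
- by apply: measurable_funTS; apply: locint_measurable; case: A.
- apply: (ae_imp3 e1 e2 d) => s [q1 _] [q2 _] q3 _; rewrite /H1 /H2 q1 q2.
  have -> : D22 (t, s) = - D11 (t, s) by rewrite -[RHS]addr0 -q3 addrA addNr add0r.
  by rewrite /eta /eta' /phi'; ring.
Qed.

Let rect_zero t0 t1 : \int[mu2]_(z in rect t0 t1) H1 z = - \int[mu2]_(z in rect t0 t1) H2 z.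
Proof.
have mr := measurable_rectR `[t0, t1] `[0, 1]; have mt := measurable_itvR (Interval (BLeft t0) (BRight t1)).
apply/eqP; rewrite -addr_eq0 -RintegralD//; apply/eqP.
have iD : mu2.-integrable (rect t0 t1) (EFin \o (fun z => H1 z + H2 z)).
  by have := integrableD mr (iH1 t0 t1) (iH2 t0 t1); apply: eq_integrable => // z _; rewrite /= EFinD.
rewrite (fubini_rect1 mt m01 iD).
transitivity (\int[mu]_(t in `[t0, t1]) (cst 0 : R -> R) t); last by rewrite /Rintegral integral0.
apply: ae_eq_Rintegral => //; first exact: (measurable_fine_fubini1 mt m01 iD).
by apply: (ae_imp slice_zero) => t ht _.
Qed.

(** Multiplying [D21 - D12 = w(u)] by [eta'(u1) D12] gives [X = - eta'(u1) det D - H1]. Between good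
    slices the determinant contributes almost nothing, and [- H1] has the same integral as [H2]. *)
Let X_le th : 0 < th -> X0 <= \int[mu2]_(z in strip) G th z.
Proof.
move=> th0; set RH := Rintegral _ _ _.
have key (n : nat) : \int[mu2]_(z in rect (- n%:R) n%:R) X z <= RH.
  apply/ler_addgt0Pr => d d0.
  have [e [e0 h]] := det_bulk S (@is_derive_cutsq R k) ceta' eta'1 d0.
  have [t1 [nt1 g1]] := good_pos S n%:R e0; have [t0 [nt0 g0]] := good_neg S (- n%:R) e0.
  have t01 : t0 <= t1 by apply: (le_trans (ltW nt0)); apply: le_trans (ltW nt1); rewrite ge0_cp.
  have ee : 0 <= e <= e by rewrite lexx ltW.
  have {}h := h _ _ _ _ _ ee t01 g0 g1.
  have sub : rect (- n%:R) n%:R `<=` rect t0 t1.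
    move=> z [/= + zz]; rewrite in_itv/= => /andP[q1 q2]; split => //=.
    by rewrite in_itv/= (le_trans (ltW nt0))// (le_trans q2)// ltW.
  have mr := measurable_rectR `[- (n%:R : R), n%:R] `[0, 1].
  have mr' := measurable_rectR `[t0, t1] `[0, 1].
  have rs : rect t0 t1 `<=` (strip : set (R * R)) by move=> z [].
  have iXr : mu2.-integrable (rect t0 t1) (EFin \o X) by exact: integrableS iX.
  apply: (le_trans (ge0_Rintegral_subset mr mr' sub X_ge0 iXr)).
  pose Dt z := eta' (u1 z) * (D11 z * D22 z - D12 z * D21 z).
  have iDt : mu2.-integrable (rect t0 t1) (EFin \o Dt).
    have [_ s11 s12] := Sob_rect (st1 S) t0 t1; have [_ s21 s22] := Sob_rect (st2 S) t0 t1.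
    apply: (integrable_boundedM (C := 1)) => //; first exact: measurable_funTS.
    by have := integrableB mr' (sqintM mr' s11 s22) (sqintM mr' s12 s21); apply: eq_integrable.
  have E : \int[mu2]_(z in rect t0 t1) X z = \int[mu2]_(z in rect t0 t1) (- Dt z - H1 z).
    apply: ae_eq_Rintegral => //.
    - exact: measurable_funTS.
    - apply: measurable_funTS; apply: measurable_funB => //; apply: measurableT_comp => //.
      by apply: measurable_funM => //; apply: measurable_funB; exact: measurable_funM.
    - apply: (ae_imp2 (st_div S) eqw) => z dz ez /rs zs; have {}ez := ez zs.
      have -> : - Dt z - H1 z = - (eta' (u1 z) * (D11 z * D22 z - D12 z * D21 z)) - eta' (u1 z) * D12 z * w (u1 z, u2 z) by [].
      have -> : D22 z = - D11 z by apply/eqP; rewrite -addr_eq0 addrC dz.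
      by rewrite -ez /X /gr /eta'; ring.
  have iNDt : mu2.-integrable (rect t0 t1) (EFin \o (fun z => - Dt z)).
    by have := integrableN iDt; apply: eq_integrable => // z _; rewrite /= EFinN.
  rewrite E RintegralB// rect_zero opprK.
  have -> : \int[mu2]_(z in rect t0 t1) - Dt z = - \int[mu2]_(z in rect t0 t1) Dt z.
    by rewrite -mulN1r -RintegralZl//; apply: eq_Rintegral => z _; rewrite mulN1r.
  rewrite addrC; apply: lerD; last by apply: le_trans h; rewrite -normrN; exact: ler_norm.
  apply: (@le_trans _ _ (\int[mu2]_(z in rect t0 t1) G th z)).
    apply: le_Rintegral => //; first exact: (integrableS ms mr' rs (iG th)).
    by move=> z _; apply: le_trans (H2_le z th0); exact: ler_norm.
  apply: ge0_Rintegral_subset => // z; apply: le_trans (H2_le z th0); exact: normr_ge0.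
pose I n z : R := \1_(rect (- n%:R) n%:R : set (measurableTypeR R * measurableTypeR R)) z.
have mr n := measurable_rectR `[- (n%:R : R), n%:R] `[0, 1].
have lim : \int[mu2]_(z in strip) (I n z * X z) @[n --> \oo] --> X0.
  apply: (@Rintegral_dominated _ _ _ mu2 _ _ _ X) => //.
  - move=> n; apply: measurable_funTS; apply: measurable_funM => //; exact: measurable_indic (mr n).
  - exact: measurable_funTS.
  - apply: aeW => z zs; apply: cvg_near_cst; have [N [h _ _]] := bound_nat z.1 0 0.
    exists N => // n /= Nn; rewrite /I indicE mem_set ?mul1r//; case: zs => _ z2s; split => //=.
    by rewrite in_itv/= -ler_norml (le_trans h)// ler_nat.
  - apply: aeW => z n _; rewrite normrM [`|X z|]ger0_norm// ler_piMl// /I indicE normr_nat lern1 leq_b1//.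
apply: (@ler_cvg_to _ _ _ _ _ _ _ _ lim (cvg_cst RH)); near=> n.
have -> : \int[mu2]_(z in strip) (I n z * X z) = \int[mu2]_(z in rect (- n%:R) n%:R) X z.
  rewrite [RHS](@Rintegral_mkcond _ _ _ mu2) [LHS](@Rintegral_mkcond _ _ _ mu2); apply: eq_Rintegral => z _.
  rewrite !patchE /I indicE; case: (boolP (z \in rect _ _)) => [|_]; last by rewrite mul0r if_same.
  by move=> zr; rewrite mul1r mem_set//; move: zr; rewrite inE => -[].
exact: key.
Unshelve. all: by end_near.
Qed.

(** Let [I] be the integral in the hypothesis. With [th = 1 / (8 X0)] the bound [X_le] implies
    [X0 <= X0 / 2 + X0 / 8 + X0 I], so [I < 3 / 8] excludes [X0 > 0]. Then [cut k (u1)] has zero L2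
    norm. *)
Lemma small_level : \int[mu2]_(z in strip) (above u1 k z * (nz z * B z ^+ 2)) < 3 / 8 ->
  {ae mu2, forall z, strip z -> u1 z <= k}.
Proof.
move=> small; have i4 := phi4.1; have le4 := phi4.2.
have GE th : \int[mu2]_(z in strip) G th z = 2^-1 * X0 + (th / 2 * \int[mu2]_(z in strip) (phi (u1 z) ^+ 4) +
    (8 * th)^-1 * \int[mu2]_(z in strip) (above u1 k z * (nz z * B z ^+ 2))).
  have i1 : mu2.-integrable strip (EFin \o (fun z => 2^-1 * X z)).
    by have := integrableZl ms 2^-1 iX; apply: eq_integrable => // z _; rewrite /= EFinM.
  have i2 : mu2.-integrable strip (EFin \o (fun z => th / 2 * phi (u1 z) ^+ 4)).
    by have := integrableZl ms (th / 2) i4; apply: eq_integrable => // z _; rewrite /= EFinM.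
  have i3 : mu2.-integrable strip (EFin \o (fun z => (8 * th)^-1 * (above u1 k z * (nz z * B z ^+ 2)))).
    by have := integrableZl ms (8 * th)^-1 (iB ak); apply: eq_integrable => // z _; rewrite /= EFinM.
  rewrite RintegralD//; last by have := integrableD ms i2 i3; apply: eq_integrable => // z _; rewrite /= EFinD.
  rewrite (RintegralD ms i2 i3) RintegralZl// RintegralZl// RintegralZl//.
  exact: iB.
have X00 : X0 <= 0.
  rewrite leNgt; apply/negP => X0p.
  have th0 : 0 < (8 * X0)^-1 by rewrite invr_gt0 mulr_gt0.
  have := X_le th0; rewrite GE; move: small le4.
  set P := Rintegral _ _ _; set Q := Rintegral _ _ _ => q1 q2.
  have -> : (8 * (8 * X0)^-1)^-1 = X0 by field; rewrite lt0r_neq0.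
  apply/negP; rewrite -ltNge.
  have h : (8 * X0)^-1 / 2 * Q <= X0 / 8.
    apply: (@le_trans _ _ ((8 * X0)^-1 / 2 * (2 * X0 ^+ 2))).
      by rewrite ler_wpM2l// divr_ge0// ltW.
    by rewrite le_eqVlt; apply/orP; left; apply/eqP; field; rewrite lt0r_neq0.
  by nra.
have z0 := ge0_Rintegral_eq0 ms (fun z => sqr_ge0 (phi (u1 z))) sphi.2 (le_trans phi_sqR X00).
apply: (ae_imp z0) => z hz zs; rewrite leNgt; apply/negP => /cut_gt h.
by have := hz zs => /eqP; rewrite sqrf_eq0 => /eqP h'; move: h; rewrite -/phi h' ltxx.
Qed.

End level.
Let level_null (M : R) : {ae mu2, forall z, u1 z = M -> gr z = 0}.
Proof.
have mimp (f g : R * R -> R) (c : R) : measurable_fun setT f -> measurable_fun setT g ->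
    measurable ((fun z => f z = c -> g z = 0) : set (measurableTypeR R * measurableTypeR R)).
  move=> mf mg; have m1 := measurable_eqset mf (measurable_cst c).
  have m2 := measurable_eqset mg (measurable_cst (0 : R)).
  rewrite (_ : (fun z => _) = ~` (fun z => f z = c) `|` (fun z => g z = 0)).
    by apply: measurableU => //; exact: measurableC.
  apply/seteqP; split => z /=; last by move=> [h1 /h1|].
  by move=> h; have [e|] := EM (f z = c); [right; exact: h|left].
have l1 : {ae mu2, forall z, u1 z = M -> D11 z = 0}.
  apply: (ae_prod2_conv (mimp _ _ M mu1 mD11)); apply: (ae_imp (Sob_hline (st1 S))) => s [A e].
  by apply: (ae_imp2 e (AC_level_set M A)) => t -> .
have l2 : {ae mu2, forall z, u1 z = M -> D12 z = 0}.
  apply: (ae_prod1_conv (mimp _ _ M mu1 mD12)); apply: (ae_imp (Sob_vline (st1 S))) => t [A _ e _ _].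
  by apply: (ae_imp2 e (AC_level_set M A)) => s [-> _].
by apply: (ae_imp2 l1 l2) => z h1 h2 uM; rewrite /gr h1// h2// expr0n addr0.
Qed.

(** If a level [k0 > a] is exceeded, so are levels [kn] that increase to the essential supremum of
    [u1], or to infinity. By [small_level] the integrals above [kn] stay at least [3 / 8]. They also
    tend to 0 by domination: where the gradient is nonzero, [u1] lies strictly below the
    supremum. *)
Lemma maximum_principle : {ae mu2, forall z, strip z -> u1 z <= a}.
Proof.
pose N k := {ae mu2, forall z, strip z -> u1 z <= k}.
have Nmono k l : k <= l -> N k -> N l.
  by move=> kl h; apply: (ae_imp h) => z hz /hz uk; exact: le_trans kl.
have [E0|] := pselect (forall k, a < k -> N k).
  have h : {ae mu2, forall z (n : nat), strip z -> u1 z <= a + n.+1%:R^-1}.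
    by apply: ae_foralln => n; apply: E0; rewrite ltrDl invr_gt0.
  apply: (ae_imp h) => z hz zs; apply/ler_addgt0Pr => e e0.
  have [n hn] := invn_small e0.
  by apply: (le_trans (hz n zs)); rewrite lerD2l.
move=> /existsNP[k0 /not_implyP[ak0 Nk0]]; exfalso.
have [kn [akn Nkn kn0 lim]] : exists kn : nat -> R, [/\ forall n, a < kn n, forall n, ~ N (kn n),
    forall n, k0 <= kn n &
    {ae mu2, forall z, strip z -> gr z != 0 -> \forall n \near \oo, u1 z <= kn n}].
  have [[U hU]|unb] := pselect (exists U, N U).
    pose A := [set k : R | k0 <= k /\ ~ N k].
    have A0 : A !=set0 by exists k0; split => //; exact: lexx.
    have AU : ubound A U.
      by move=> k [_ Nk]; rewrite leNgt; apply/negP => Uk; apply: Nk; apply: Nmono hU; exact: ltW.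
    have supA : has_sup A by split => //; exists U.
    pose M := sup A.
    have hU' : has_ubound A by exists U.
    have k0M : k0 <= M by apply: (ub_le_sup hU'); split => //; exact: lexx.
    have ltM k : k < M -> ~ N k.
      move=> kM Nk; have [k' [[k0k' Nk'] kk']] := sup_gt A0 kM.
      by apply: Nk'; apply: Nmono Nk; exact: ltW.
    have gtM k : M < k -> N k.
      move=> Mk; apply: contrapT => Nk; have : k <= M.
        by apply: (ub_le_sup hU'); split => //; exact: le_trans k0M (ltW Mk).
      by rewrite leNgt Mk.
    (* The sequence starts at [k0], and is constant if [M = k0], a case not excluded at this
       point. *)
    exists (fun n => M - (M - k0) / n.+1%:R).
    have le1 n : (M - k0) / n.+1%:R <= M - k0.
      by rewrite ler_pdivrMr// ler_peMr ?subr_ge0// ler1n.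
    have ge n : k0 <= M - (M - k0) / n.+1%:R by rewrite lerBrDr addrC -lerBrDr.
    split => //.
    - by move=> n; exact: lt_le_trans (ge n).
    - move=> n; have [k0M'|Mk0] := ltP k0 M.
        by apply: ltM; rewrite gtrDl oppr_lt0 divr_gt0// subr_gt0.
      have -> : M = k0 by apply/eqP; rewrite eq_le Mk0.
      by rewrite subrr mul0r subr0.
    - have leM : {ae mu2, forall z (n : nat), strip z -> u1 z <= M + n.+1%:R^-1}.
        by apply: ae_foralln => n; apply: gtM; rewrite ltrDl invr_gt0.
      apply: (ae_imp2 leM (level_null M)) => z h1 h2 zs g0.
      have uM : u1 z < M.
        rewrite lt_neqAle; apply/andP; split.
          by apply/eqP => /h2 g0'; rewrite g0' eqxx in g0.
        apply/ler_addgt0Pr => e e0.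
        have [n hn] := invn_small e0.
        by apply: (le_trans (h1 n zs)); rewrite lerD2l.
      have d0 : 0 < M - u1 z by rewrite subr_gt0.
      have x0 : 0 <= (M - k0) / (M - u1 z) by rewrite divr_ge0 ?subr_ge0// ltW.
      exists (Num.bound ((M - k0) / (M - u1 z))) => // n /= hn.
      rewrite lerBrDr -lerBrDl ler_pdivrMr// mulrC -ler_pdivrMr//.
      apply: (le_trans (ltW (archi_boundP x0))); rewrite ler_nat; exact: leq_trans hn _.
  exists (fun n => k0 + n%:R); split.
  - by move=> n; apply: (lt_le_trans ak0); rewrite lerDl.
  - by move=> n h; apply: unb; exists (k0 + n%:R).
  - by move=> n; rewrite lerDl.
  - apply: aeW => z _ _; exists (Num.bound `|u1 z - k0|) => // n /= hn.
    rewrite -lerBlDl (le_trans (ler_norm _))// (le_trans (ltW (archi_boundP (normr_ge0 _))))//.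
    by rewrite ler_nat.
have big n : 3 / 8 <= \int[mu2]_(z in strip) (above u1 (kn n) z * (nz z * B z ^+ 2)).
  by rewrite leNgt; apply/negP => h; apply: (Nkn n); exact: small_level h.
have cv : \int[mu2]_(z in strip) (above u1 (kn n) z * (nz z * B z ^+ 2)) @[n --> \oo] -->
    \int[mu2]_(z in strip) (cst 0 : R * R -> R) z.
  apply: (@Rintegral_dominated _ _ _ mu2 _ _ _ (fun z => above u1 k0 z * (nz z * B z ^+ 2))) => //.
  - move=> n; apply: measurable_funTS; apply: measurable_funM; first exact: (measurable_above (st1 S)).
    by apply: measurable_funM => //; exact: measurable_funX.
  - apply: (ae_imp lim) => z hz zs; rewrite /nz; have [g0|g0] := eqVneq (gr z) 0.
      by rewrite /= mul0r; under eq_fun do rewrite mulr0; exact: cvg_cst.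
    apply: cvg_near_cst; apply: filterS (hz zs g0) => n un.
    by rewrite /above ltNge un mul0r.
  - exact: iB.
  - apply: aeW => z n _; have q : 0 <= nz z * B z ^+ 2 by rewrite mulr_ge0 ?ler0n ?sqr_ge0.
    rewrite normrM (ger0_norm q) ler_wpM2r// ger0_norm ?above_ge0// /above ler_nat.
    have [h|h] := ltP (kn n) (u1 z); last by [].
    by rewrite (le_lt_trans (kn0 n) h).
rewrite [X in _ --> X]/Rintegral integral0 /= in cv.
have h : (3 / 8 : R) <= 0 by apply: (cvgr_to_ge cv); exact: nearW.
by move: h; rewrite leNgt divr_gt0.
Qed.

End maximum_principle.

(** * Potentials and growth *)

Section calculus.
Context {R : realType}.
Local Notation mu := (@lebesgue_measure R).
Local Notation mu2 := (@lebesgue_measure R \x @lebesgue_measure R)%E.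

Lemma is_derive_eps (f : R -> R) (t l : R) :
  (forall e, 0 < e -> exists2 d, 0 < d & forall h, `|h| < d -> `|f (t + h) - f t - l * h| <= e * `|h|) ->
  is_derive t (1 : R) f l.
Proof.
move=> fh.
have H : h^-1 *: (f (h *: 1 + t) - f t) @[h --> 0^'] --> l.
  apply/cvgrPdist_le => e e0; have [d d0 hd] := fh e e0; near=> h.
  have h0 : h != 0 by near: h; exact: nbhs_dnbhs_neq.
  rewrite /GRing.scale/= mulr1.
  have -> : l - h^-1 * (f (h + t) - f t) = - (h^-1 * (f (t + h) - f t - l * h)).
    by rewrite [h + t]addrC; field.
  rewrite normrN normrM normfV ler_pdivrMl ?normr_gt0// [leRHS]mulrC; apply: hd.
  by near: h; apply: dnbhs0_lt.
have dd : derivable f t 1 by apply/cvg_ex; exists l.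
by apply: DeriveDef => //; exact: cvg_lim H.
Unshelve. all: by end_near. Qed.

Lemma AC_derive (y k : R -> R) : AC y k -> continuous k -> forall t, is_derive t (1 : R) y (k t).
Proof.
move=> A ck t; apply: is_derive_eps => e e0.
have /cvgrPdist_lt/(_ e e0) := ck t; move=> /nbhs_ballP[d /= d0 hd]; exists d => // h hh.
have A2 : AC (fun x => y x - k t * x) (fun x => k x - k t).
  apply: AC_eq (AC_lin (- k t) A AC_id) _ _ => x; rewrite ?mulNr// mulr1//.
have near_t x : `|x - t| < d -> `|k x - k t| <= e.
  by move=> xt; rewrite distrC ltW//; apply: hd; rewrite /ball /= distrC.
have -> : y (t + h) - y t - k t * h = (y (t + h) - k t * (t + h)) - (y t - k t * t) by ring.
have [h0|h0] := leP 0 h.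
  have tth : t <= t + h by rewrite lerDl.
  rewrite (proj2 A2)//; apply: (le_trans (Rintegral_itv_le (proj1 A2) tth _)).
    by move=> x /andP[q1 q2]; apply: near_t; rewrite ger0_norm in hh => //; rewrite ger0_norm ?subr_ge0//; lra.
  by rewrite addrC addKr ger0_norm.
have tth : t + h <= t by rewrite gerDl ltW.
rewrite distrC (proj2 A2)//; apply: (le_trans (Rintegral_itv_le (proj1 A2) tth _)).
  by move=> x /andP[q1 q2]; apply: near_t; rewrite ltr0_norm in hh => //; rewrite ler0_norm ?subr_le0//; lra.
by rewrite ltr0_norm// opprD addNKr.
Qed.

Lemma continuous_slice1 (F : R * R -> R) s : continuous F -> continuous (fun t => F (t, s)).
Proof.
move=> cF t; apply: (@continuous_comp _ _ _ (fun t => (t, s)) F); last exact: cF.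
by apply: (continuous_pair (f := fun t : R => t) (g := fun=> s)) => x; [exact: cvg_id|exact: cvg_cst].
Qed.

Lemma continuous_slice2 (F : R * R -> R) t : continuous F -> continuous (fun s => F (t, s)).
Proof.
move=> cF s; apply: (@continuous_comp _ _ _ (fun s => (t, s)) F); last exact: cF.
by apply: (continuous_pair (f := fun=> t) (g := fun s : R => s)) => x; [exact: cvg_cst|exact: cvg_id].
Qed.

Lemma AC_line1 (F D : R * R -> R) s : (forall x : R * R, is_derive x.1 (1 : R) (fun t : R => F (t, x.2)) (D x)) ->
  continuous D -> AC (fun t => F (t, s)) (fun t => D (t, s)).
Proof.
by move=> dF cD; apply: (@AC_C1 R (fun t => F (t, s)) (fun t => D (t, s)) (fun t => dF (t, s))); exact: continuous_slice1.
Qed.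

Lemma AC_line2 (F D : R * R -> R) t : (forall x : R * R, is_derive x.2 (1 : R) (fun s : R => F (x.1, s)) (D x)) ->
  continuous D -> AC (fun s => F (t, s)) (fun s => D (t, s)).
Proof.
by move=> dF cD; apply: (@AC_C1 R (fun s => F (t, s)) (fun s => D (t, s)) (fun s => dF (t, s))); exact: continuous_slice2.
Qed.

Lemma continuous_integrable2 (F : R * R -> R) (a b c d : R) : continuous F ->
  mu2.-integrable ([set` `[a, b]] `*` [set` `[c, d]]) (EFin \o F).
Proof.
move=> cF; apply: measurable_bounded_integrable.
- exact: measurable_rectR.
- by rewrite /= product_measure1E//= !lebesgue_measure_itv/=; do 2 case: ifP => _; rewrite ?mul0e ?mule0// -EFinB -?EFinB -EFinM ltry.
- by apply: measurable_funTS; exact: continuous_measurable2.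
- have cK : compact ([set` `[a, b]] `*` [set` `[c, d]] : set (R * R)).
    by apply: compact_setX; exact: segment_compact.
  have := continuous_compact (continuous_subspaceT cF) cK.
  by move=> /compact_bounded[M [Mr hM]]; exists M; split => // N MN x xA; apply: (hM N MN); exists x.
Qed.

Lemma continuous_bounded_rect (F : R * R -> R) (a b c d : R) : continuous F ->
  exists M, forall x, a <= x.1 <= b -> c <= x.2 <= d -> `|F x| <= M.
Proof.
move=> cF; have cK : compact ([set` `[a, b]] `*` [set` `[c, d]] : set (R * R)).
  by apply: compact_setX; exact: segment_compact.
have := continuous_compact (continuous_subspaceT cF) cK.
move=> /compact_bounded[M [_ hM]]; exists (M + 1) => x x1 x2; apply: (hM (M + 1)); first by rewrite ltrDl.
by exists x => //; split; rewrite /= in_itv.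
Qed.

Section closed_form.
Variables P Q D : R * R -> R.
Hypotheses (cP : continuous P) (cQ : continuous Q) (cD : continuous D).
Hypothesis dP : forall x : R * R, is_derive x.2 1 (fun t : R => P (x.1, t)) (D x).
Hypothesis dQ : forall x : R * R, is_derive x.1 1 (fun t : R => Q (t, x.2)) (D x).

(** Both sides are the integral of [D] over the rectangle, computed in the two orders. *)
Let green a b c d : a <= b -> c <= d ->
  \int[mu]_(s in `[c, d]) (Q (b, s) - Q (a, s)) = \int[mu]_(t in `[a, b]) (P (t, d) - P (t, c)).
Proof.
move=> ab cd; have mab := measurable_itvR (Interval (BLeft a) (BRight b)).
have mcd := measurable_itvR (Interval (BLeft c) (BRight d)).
have iD := continuous_integrable2 a b c d cD.
transitivity (\int[mu2]_(z in [set` `[a, b]] `*` [set` `[c, d]]) D z).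
  rewrite (fubini_rect2 mab mcd iD); apply: eq_Rintegral => s _.
  by rewrite (proj2 (AC_line1 s dQ cD)).
rewrite (fubini_rect1 mab mcd iD); apply: eq_Rintegral => t _.
by rewrite (proj2 (AC_line2 t dP cD)).
Qed.

(** [P] is integrated along the axis and [Q] along the vertical through [x.1]. By [green],
    horizontal increments at height [x.2] are integrals of [P] at that height. *)
Lemma closed_form_primitive : exists Phi, C1with Phi P Q.
Proof.
pose Phi (x : R * R) := prim (fun s => Q (x.1, s)) x.2 + prim (fun t => P (t, 0)) x.1.
have cs1 (F : R * R -> R) s : continuous F -> locint (fun t => F (t, s)).
  by move=> cF; apply: continuous_locint; exact: continuous_slice1.
have cs2 (F : R * R -> R) t : continuous F -> locint (fun s => F (t, s)).
  by move=> cF; apply: continuous_locint; exact: continuous_slice2.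
exists Phi; split => // x.
- suff A : AC (fun t => Phi (t, x.2)) (fun t => P (t, x.2)).
    have := AC_derive A (@continuous_slice1 P x.2 cP) x.1.
    by rewrite -surjective_pairing.
  split; first exact: cs1.
  move=> a b ab; rewrite /Phi /=.
  have A0 := prim_AC (cs1 P 0 cP).
  have -> (p1 p2 p3 p4 : R) : p1 + p2 - (p3 + p4) = (p1 - p3) + (p2 - p4) by ring.
  rewrite (proj2 A0)//.
  have mab := measurable_itvR (Interval (BLeft a) (BRight b)).
  rewrite /prim; have [y0|y0] := leP 0 x.2.
    rewrite -RintegralB//; [|exact: cs2|exact: cs2].
    rewrite green// -RintegralD//; [|exact: (locintB (cs1 P x.2 cP) (cs1 P 0 cP))|exact: cs1].
    by apply: eq_Rintegral => t _; rewrite subrK.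
  rewrite -opprD -RintegralB//; [|exact: cs2|exact: cs2].
  rewrite (green ab (ltW y0)) addrC -RintegralB//; [|exact: cs1|exact: (locintB (cs1 P 0 cP) (cs1 P x.2 cP))].
  by apply: eq_Rintegral => t _; rewrite opprB addrC subrK.
- have A := prim_AC (cs2 Q x.1 cQ).
  have d := is_deriveD (AC_derive A (@continuous_slice2 Q x.1 cQ) x.2) (is_derive_cst (prim (fun t => P (t, 0)) x.1) x.2 (1 : R)).
  by rewrite addr0 -surjective_pairing in d.
Qed.

End closed_form.

Lemma is_derive_comp2 (F P Q : R * R -> R) (y1 y2 y1' y2' : R -> R) : C1with F P Q ->
  (forall t, is_derive t (1 : R) y1 (y1' t)) -> (forall t, is_derive t (1 : R) y2 (y2' t)) ->
  continuous y1' -> continuous y2' ->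
  forall t, is_derive t (1 : R) (fun t => F (y1 t, y2 t)) (P (y1 t, y2 t) * y1' t + Q (y1 t, y2 t) * y2' t).
Proof.
move=> C1 d1 d2 c1 c2; have [_ _ cP cQ] := C1.
apply: (AC_derive (AC_chain2 C1 (AC_C1 d1 c1) (AC_C1 d2 c2))).
have cy := continuous_pair (is_derive_continuous d1) (is_derive_continuous d2).
move=> t; apply: cvgD; apply: cvgM; [|exact: c1| |exact: c2].
- by apply: (@continuous_comp _ _ _ (fun t => (y1 t, y2 t)) P); [exact: cy|exact: cP].
- by apply: (@continuous_comp _ _ _ (fun t => (y1 t, y2 t)) Q); [exact: cy|exact: cQ].
Qed.

(** In polar coordinates, with [L] the full angle, this says that the integral of a closed form over
    a circle does not depend on the radius. *)
Lemma closed_loop (Phi P Q : R * R -> R) (L : R) : 0 <= L -> C1with Phi P Q ->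
  (forall r, P (r, L) = P (r, 0)) ->
  forall r r', \int[mu]_(s in `[0, L]) Q (r, s) = \int[mu]_(s in `[0, L]) Q (r', s).
Proof.
move=> L0 [d1 d2 cP cQ] per r r'.
have E t : \int[mu]_(s in `[0, L]) Q (t, s) = Phi (t, L) - Phi (t, 0).
  by rewrite (proj2 (AC_line2 t d2 cQ)).
rewrite !E.
have A := AC_sub (AC_line1 L d1 cP) (AC_line1 0 d1 cP).
by apply: (AC_der0_cst A); apply: aeW => t; rewrite per subrr.
Qed.

End calculus.

Lemma dist_lt_itv (R : realType) (x y r s : R) : `|x - y| <= r -> r < s -> y - s < x < y + s.
Proof. by move=> h rs; rewrite -ltr_distl; exact: le_lt_trans rs. Qed.

(** * A gradient bound for harmonic functions through Cauchy integrals *)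

Section conjugate_gradient.
Context {R : realType}.
Local Notation mu := (@lebesgue_measure R).
Variables (w psi w1 w2 w2' : R * R -> R).
Hypothesis Cw : C1with w w1 w2.
Hypothesis Cpsi : C1with psi w2' w1.
Hypothesis w2N : forall x, w2' x = - w2 x.
Variable z : R * R.

(** Logarithmic polar coordinates around [z]; they are conformal, and circles become vertical
    segments. *)
Let pt (x : R * R) : R * R := (z.1 + expR x.1 * cos x.2, z.2 + expR x.1 * sin x.2).

Let c_exp : continuous (fun x : R * R => expR x.1).
Proof. by move=> x; apply: (@continuous_comp _ _ _ fst expR); [exact: cvg_fst|exact: continuous_expR]. Qed.
Let c_cos : continuous (fun x : R * R => cos x.2).
Proof. by move=> x; apply: (@continuous_comp _ _ _ snd cos); [exact: cvg_snd|exact: continuous_cos]. Qed.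
Let c_sin : continuous (fun x : R * R => sin x.2).
Proof. by move=> x; apply: (@continuous_comp _ _ _ snd sin); [exact: cvg_snd|exact: continuous_sin]. Qed.

Let c_pt : continuous pt.
Proof.
move=> x; apply: (@cvg_pair _ _ _ _ (nbhs (pt x).1) (nbhs (pt x).2)).
  by apply: cvgD; [exact: cvg_cst|apply: cvgM; [exact: c_exp|exact: c_cos]].
by apply: cvgD; [exact: cvg_cst|apply: cvgM; [exact: c_exp|exact: c_sin]].
Qed.

Let c_comp (F : R * R -> R) : continuous F -> continuous (fun x => F (pt x)).
Proof. by move=> cF x; apply: (@continuous_comp _ _ _ pt F); [exact: c_pt|exact: cF]. Qed.

Let polar_r (F F1 F2 : R * R -> R) : C1with F F1 F2 -> forall x : R * R,
  is_derive x.1 (1 : R) (fun t => F (pt (t, x.2))) (expR x.1 * (F1 (pt x) * cos x.2 + F2 (pt x) * sin x.2)).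
Proof.
move=> CF x.
have d (c k : R) t : is_derive t (1 : R) (fun t => c + expR t * k) (expR t * k).
  have dd := is_deriveD (is_derive_cst c t (1 : R)) (is_deriveM (is_derive_expR t) (is_derive_cst k t (1 : R))).
  by apply: (is_derive_eq dd); rewrite /GRing.scale/= mulr0 !add0r mulrC.
have cd (k : R) : continuous (fun t : R => expR t * k).
  by move=> t; apply: cvgM; [exact: continuous_expR|exact: cvg_cst].
have dd := is_derive_comp2 CF (d z.1 (cos x.2)) (d z.2 (sin x.2)) (cd _) (cd _) x.1.
by apply: (is_derive_eq dd); rewrite /pt; ring.
Qed.

Let polar_t (F F1 F2 : R * R -> R) : C1with F F1 F2 -> forall x : R * R,
  is_derive x.2 (1 : R) (fun t => F (pt (x.1, t))) (expR x.1 * (- F1 (pt x) * sin x.2 + F2 (pt x) * cos x.2)).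
Proof.
move=> CF x.
have d1 (c k : R) t : is_derive t (1 : R) (fun t => c + k * cos t) (k * - sin t).
  have dd := is_deriveD (is_derive_cst c t (1 : R)) (is_deriveZ k (is_derive_cos t)).
  by apply: (is_derive_eq dd); rewrite add0r.
have d2 (c k : R) t : is_derive t (1 : R) (fun t => c + k * sin t) (k * cos t).
  have dd := is_deriveD (is_derive_cst c t (1 : R)) (is_deriveZ k (is_derive_sin t)).
  by apply: (is_derive_eq dd); rewrite add0r.
have cd1 (k : R) : continuous (fun t : R => k * - sin t).
  by move=> t; apply: cvgM; [exact: cvg_cst|apply: cvgN; exact: continuous_sin].
have cd2 (k : R) : continuous (fun t : R => k * cos t).
  by move=> t; apply: cvgM; [exact: cvg_cst|exact: continuous_cos].
have dd := is_derive_comp2 CF (d1 z.1 (expR x.1)) (d2 z.2 (expR x.1)) (cd1 _) (cd2 _) x.2.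
by apply: (is_derive_eq dd); rewrite /pt; ring.
Qed.

Let W x := w (pt x).
Let V x := psi (pt x).
Let cW : continuous W. Proof. exact: c_comp (C1with_continuous Cw). Qed.
Let cV : continuous V. Proof. exact: c_comp (C1with_continuous Cpsi). Qed.
Let pi2_ge0 : 0 <= pi *+ 2 :> R. Proof. by rewrite mulrn_wge0// pi_ge0. Qed.

(* The closed forms are the real parts of f(zeta) (zeta - z)^(-1-tau) d zeta in the
   coordinates zeta = z + exp(r + i t), for tau = 1 and tau = -1. *)
Let loop (tau : R) : tau ^+ 2 = 1 -> exists c, forall r,
  expR (- tau * r) * \int[mu]_(t in `[0, pi *+ 2]) (W (r, t) * cos t + tau * (V (r, t) * sin t)) = c.
Proof.
move=> tau2.
pose e (x : R * R) := expR (- tau * x.1).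
pose P x := e x * (V x * cos x.2 - tau * (W x * sin x.2)).
pose Q x := e x * (W x * cos x.2 + tau * (V x * sin x.2)).
pose Vt x := expR x.1 * (w2 (pt x) * sin x.2 + w1 (pt x) * cos x.2).
pose Wt x := expR x.1 * (- w1 (pt x) * sin x.2 + w2 (pt x) * cos x.2).
pose D x := e x * (Vt x * cos x.2 - V x * sin x.2 - tau * (Wt x * sin x.2 + W x * cos x.2)).
have [_ _ cw1 cw2] := Cw; have cw1p := c_comp cw1; have cw2p := c_comp cw2.
have ce : continuous e.
  move=> x; apply: (@continuous_comp _ _ _ (fun x : R * R => - tau * x.1) expR); last exact: continuous_expR.
  by apply: cvgM; [exact: cvg_cst|exact: cvg_fst].
have cVt : continuous Vt.
  move=> x; apply: cvgM; first exact: c_exp.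
  by apply: cvgD; apply: cvgM; [exact: cw2p|exact: c_sin|exact: cw1p|exact: c_cos].
have cWt : continuous Wt.
  move=> x; apply: cvgM; first exact: c_exp.
  by apply: cvgD; apply: cvgM; [apply: cvgN; exact: cw1p|exact: c_sin|exact: cw2p|exact: c_cos].
have cP : continuous P.
  move=> x; apply: cvgM; first exact: ce.
  apply: cvgB; [|apply: cvgM; first exact: cvg_cst]; apply: cvgM;
   [exact: cV|exact: c_cos|exact: cW|exact: c_sin].
have cQ : continuous Q.
  move=> x; apply: cvgM; first exact: ce.
  apply: cvgD; [|apply: cvgM; first exact: cvg_cst]; apply: cvgM;
   [exact: cW|exact: c_cos|exact: cV|exact: c_sin].
have cD : continuous D.
  move=> x; apply: cvgM; first exact: ce.
  apply: cvgB; [apply: cvgB|apply: cvgM; [exact: cvg_cst|apply: cvgD]]; apply: cvgM;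
   [exact: cVt|exact: c_cos|exact: cV|exact: c_sin|exact: cWt|exact: c_sin|exact: cW|exact: c_cos].
have dWr := polar_r Cw; have dWt := polar_t Cw; have dVr := polar_r Cpsi; have dVt := polar_t Cpsi.
have dP (x : R * R) : is_derive x.2 1 (fun t : R => P (x.1, t)) (D x).
  have d := is_deriveZ (e x) (is_deriveB (is_deriveM (dVt x) (is_derive_cos x.2))
     (is_deriveZ tau (is_deriveM (dWt x) (is_derive_sin x.2)))).
  apply: (is_derive_eq d); rewrite /GRing.scale/= /D /Vt /Wt /V /W -!surjective_pairing w2N; ring.
have dQ (x : R * R) : is_derive x.1 1 (fun t : R => Q (t, x.2)) (D x).
  have de : is_derive x.1 (1 : R) (fun t => expR (- tau * t)) (- tau * expR (- tau * x.1)).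
    have := @is_derive_affine R expR (- tau) 0 x.1 _ (is_derive_expR _); rewrite addr0.
    by under eq_fun do rewrite addr0.
  have d := is_deriveM de (is_deriveD (is_deriveM (dWr x) (is_derive_cst (cos x.2) x.1 (1 : R)))
     (is_deriveZ tau (is_deriveM (dVr x) (is_derive_cst (sin x.2) x.1 (1 : R))))).
  apply: (is_derive_eq d); rewrite /GRing.scale/= /D /Vt /Wt /V /W /e -!surjective_pairing w2N.
  rewrite (_ : (_ + _) x.1 = w (pt x) * cos x.2 + tau * (psi (pt x) * sin x.2))//.
  move: (w _) (psi _) (w1 _) (w2 _) (cos _) (sin _) (expR x.1) (expR _) => W' V' wa wb c s E E'.
  (* The mixed derivatives of the form agree because [tau ^+ 2 = 1]. *)
  have -> : E' * (E * (wb * s + wa * c) * c - V' * s - tau * (E * (- wa * s + wb * c) * s + W' * c)) =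
    E' * (E * (wb * s + wa * c) * c - tau ^+ 2 * V' * s - tau * (E * (- wa * s + wb * c) * s + W' * c)).
    by rewrite tau2 mul1r.
  ring.
have [Phi CPhi] := closed_form_primitive cP cQ cD dP dQ.
have per r : P (r, pi *+ 2) = P (r, 0).
  by rewrite /P /V /W /pt /e /= cos2pi sin2pi cos0 sin0.
have L := closed_loop pi2_ge0 CPhi per.
exists (\int[mu]_(s in `[0, pi *+ 2]) Q (0, s)) => r.
rewrite -(L r) -RintegralZl//.
apply: continuous_locint => t; apply: cvgD; [|apply: cvgM; first exact: cvg_cst]; apply: cvgM.
- exact: (@continuous_slice2 R W r cW).
- exact: continuous_cos.
- exact: (@continuous_slice2 R V r cV).
- exact: continuous_sin.
Qed.

Let iW r : mu.-integrable `[0, pi *+ 2] (EFin \o (fun t => W (r, t) * cos t)).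
Proof.
apply: continuous_locint => t; apply: cvgM; [exact: (@continuous_slice2 R W r cW)|exact: continuous_cos].
Qed.

Let iV r : mu.-integrable `[0, pi *+ 2] (EFin \o (fun t => V (r, t) * sin t)).
Proof.
apply: continuous_locint => t; apply: cvgM; [exact: (@continuous_slice2 R V r cV)|exact: continuous_sin].
Qed.

Let mpi := measurable_itvR (Interval (BLeft (0 : R)) (BRight (pi *+ 2))).

Let split_loop tau r : \int[mu]_(t in `[0, pi *+ 2]) (W (r, t) * cos t + tau * (V (r, t) * sin t)) =
  \int[mu]_(t in `[0, pi *+ 2]) (W (r, t) * cos t) + tau * \int[mu]_(t in `[0, pi *+ 2]) (V (r, t) * sin t).
Proof.
rewrite RintegralD//; first by rewrite RintegralZl.
by have := integrableZl mpi tau (iV r); apply: eq_integrable => // t _; rewrite /= EFinM.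
Qed.

Let norm_int_le (h : R -> R) (M : R) : continuous h -> (forall t, 0 <= t <= pi *+ 2 -> `|h t| <= M) ->
  `|\int[mu]_(t in `[0, pi *+ 2]) h t| <= M * (pi *+ 2).
Proof.
by move=> ch hM; apply: (le_trans (Rintegral_itv_le (continuous_locint ch) pi2_ge0 hM)); rewrite subr0.
Qed.

Let expR_small (e : R) : 0 < e -> exists r, r <= 0 /\ expR r <= e.
Proof.
move=> e0; have [n hn] := invn_small e0; exists (- n%:R); rewrite oppr_le0 ler0n; split => //.
apply: le_trans hn; rewrite expRN lef_pV2 ?posrE ?expR_gt0//.
by rewrite -natr1 addrC expR_ge1Dx.
Qed.

Let in_ball r x : r <= 0 -> forall t, [/\ `|(pt (r, t)).1 - z.1| <= expR r, `|(pt (r, t)).2 - z.2| <= expR r,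
  x = (pt (r, t)).1 - z.1 -> `|x| <= 1 & x = (pt (r, t)).2 - z.2 -> `|x| <= 1].
Proof.
move=> r0 t; have e0 := expR_ge0 r; have e1 : expR r <= 1 by rewrite -expR0 ler_expR.
have h1 : `|(pt (r, t)).1 - z.1| <= expR r.
  by rewrite /pt /= addrC addKr normrM ger0_norm// ler_piMr//; exact: cos_max.
have h2 : `|(pt (r, t)).2 - z.2| <= expR r.
  by rewrite /pt /= addrC addKr normrM ger0_norm// ler_piMr//; exact: sin_max.
by split => // ->; [exact: le_trans e1|exact: le_trans e1].
Qed.

(** The loop for [tau = -1] is Cauchy's theorem: its constant value tends to 0 with the radius. At
    radius 1 it expresses the term in [psi] through [w]. *)
Let cos_eq_sin : \int[mu]_(t in `[0, pi *+ 2]) (W (0, t) * cos t) = \int[mu]_(t in `[0, pi *+ 2]) (V (0, t) * sin t).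
Proof.
have N1 : (-1) ^+ 2 = 1 :> R by rewrite sqrrN expr1n.
have [c hc] := loop N1.
suff c0 : c = 0.
  have := hc 0; rewrite mulr0 expR0 mul1r split_loop mulN1r c0 => /eqP; rewrite subr_eq0 => /eqP //.
have [Mw hMw] := continuous_bounded_rect (z.1 - 1) (z.1 + 1) (z.2 - 1) (z.2 + 1) (C1with_continuous Cw).
have [Mp hMp] := continuous_bounded_rect (z.1 - 1) (z.1 + 1) (z.2 - 1) (z.2 + 1) (C1with_continuous Cpsi).
have bd r t : r <= 0 -> `|W (r, t)| <= Mw /\ `|V (r, t)| <= Mp.
  move=> r0; have [_ _ h1 h2] := @in_ball r ((pt (r, t)).1 - z.1) r0 t.
  have [_ _ _ h3] := @in_ball r ((pt (r, t)).2 - z.2) r0 t.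
  have := h1 erefl; have := h3 erefl; rewrite !ler_distl => q1 q2.
  by split; [apply: hMw|apply: hMp].
have Mw0 : 0 <= Mw by have [+ _] := bd 0 0 (lexx 0); exact: le_trans.
have Mp0 : 0 <= Mp by have [_ +] := bd 0 0 (lexx 0); exact: le_trans.
apply/eqP; rewrite -normr_le0; apply/ler_addgt0Pr => e e0; rewrite add0r.
pose M := (Mw + Mp) * (pi *+ 2) + 1.
have M0 : 0 < M by rewrite ltr_wpDl// mulr_ge0// addr_ge0.
have [r [r0 hr]] := expR_small (divr_gt0 e0 M0).
rewrite -(hc r) opprK mul1r normrM ger0_norm ?expR_ge0//.
apply: (@le_trans _ _ (e / M * M)); last by rewrite divfK ?lt0r_neq0.
apply: ler_pM; rewrite ?expR_ge0//.
apply: (@le_trans _ _ ((Mw + Mp) * (pi *+ 2))); last by rewrite lerDl.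
apply: norm_int_le.
  move=> t; apply: cvgD; [|apply: cvgM; first exact: cvg_cst]; apply: cvgM.
  - exact: (@continuous_slice2 R W r cW).
  - exact: continuous_cos.
  - exact: (@continuous_slice2 R V r cV).
  - exact: continuous_sin.
move=> t _; have [h1 h2] := bd r t r0; apply: (le_trans (ler_normD _ _)).
rewrite mulN1r normrN !normrM lerD//.
  by rewrite -[leRHS]mulr1 ler_pM//; exact: cos_max.
by rewrite -[leRHS]mulr1 ler_pM//; exact: sin_max.
Qed.

(** The loop for [tau = 1] is Cauchy's formula for the derivative. Its value is read off from the
    first order expansion at [z] on small circles; at radius 1, [cos_eq_sin] replaces the term in
    [psi] by a second copy of the term in [w]. Thus a bound on [w] alone controls its gradient. *)
Lemma gradient_mean : \int[mu]_(t in `[0, pi *+ 2]) (w (z.1 + cos t, z.2 + sin t) * cos t) = pi * w1 z.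
Proof.
have -> : \int[mu]_(t in `[0, pi *+ 2]) (w (z.1 + cos t, z.2 + sin t) * cos t) = \int[mu]_(t in `[0, pi *+ 2]) (W (0, t) * cos t).
  by apply: eq_Rintegral => t _; rewrite /W /pt /= expR0 !mul1r.
have [c hc] := loop (expr1n _ 2).
have E0 : 2 * \int[mu]_(t in `[0, pi *+ 2]) (W (0, t) * cos t) = c.
  have := hc 0; rewrite mulr0 expR0 mul1r split_loop mul1r -cos_eq_sin => <-; ring.
suff : c = pi *+ 2 * w1 z by rewrite -E0 mulr2n; lra.
have [_ _ cw1 cw2] := Cw.
apply/eqP; rewrite -subr_eq0 -normr_le0; apply/ler_addgt0Pr => e e0; rewrite add0r.
have p0 : 0 < pi *+ 2 :> R by rewrite mulrn_wgt0// pi_gt0.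
(* Four increments contribute at most [d * expR r] each, over an interval of length [pi *+ 2]. *)
pose d := e / (4 * (pi *+ 2)); have d0 : 0 < d by rewrite divr_gt0// mulr_gt0.
have [r1 r10 h1] := continuous_ball2 z cw1 d0; have [r2 r20 h2] := continuous_ball2 z cw2 d0.
pose rr := Num.min r1 r2; have rr0 : 0 < rr by rewrite lt_min r10.
have [r [r0 hr]] := expR_small (divr_gt0 rr0 (ltr0n _ 2 : 0 < 2)).
have er0 := expR_gt0 r.
have ert : expR r < rr by rewrite (le_lt_trans hr)// ltr_pdivrMr// ltr_pMr// ltr1n.
have [er1 er2] : expR r < r1 /\ expR r < r2 by move: ert; rewrite /rr lt_min => /andP.
have zero_cos : \int[mu]_(t in `[0, pi *+ 2]) cos t = 0.
  have A : AC (@sin R) cos := AC_C1 (@is_derive_sin R) (@continuous_cos R).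
  by rewrite -(proj2 A)// sin2pi sin0 subrr.
have zero_sin : \int[mu]_(t in `[0, pi *+ 2]) sin t = 0.
  have A : AC (fun t : R => - cos t) sin.
    apply: AC_C1; last exact: continuous_sin.
    by move=> t; have := is_deriveN (is_derive_cos t); rewrite opprK.
  by rewrite -(proj2 A)// cos2pi cos0 subrr.
have lc : mu.-integrable `[0, pi *+ 2] (EFin \o (@cos R)) by apply: continuous_locint; exact: continuous_cos.
have ls : mu.-integrable `[0, pi *+ 2] (EFin \o (@sin R)) by apply: continuous_locint; exact: continuous_sin.
pose err t := W (r, t) * cos t + 1 * (V (r, t) * sin t) - (w z * cos t + psi z * sin t + expR r * w1 z).
have cerr : continuous err.
  move=> t; apply: cvgB.
    apply: cvgD; [|apply: cvgM; first exact: cvg_cst]; apply: cvgM.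
    - exact: (@continuous_slice2 R W r cW).
    - exact: continuous_cos.
    - exact: (@continuous_slice2 R V r cV).
    - exact: continuous_sin.
  apply: cvgD; last exact: cvg_cst.
  by apply: cvgD; apply: cvgM; [exact: cvg_cst|exact: continuous_cos|exact: cvg_cst|exact: continuous_sin].
have errle t : `|err t| <= 4 * d * expR r.
  have [b1 b2 _ _] := @in_ball r 0 r0 t.
  have zz (y : R) s : 0 < s -> y - s < y < y + s.
    by move=> s0; apply: (@dist_lt_itv _ _ _ 0) => //; rewrite subrr normr0.
  have lo1 := dist_lt_itv b1 er1; have lo2 := dist_lt_itv b2 er1.
  have lo1' := dist_lt_itv b1 er2; have lo2' := dist_lt_itv b2 er2.
  have l1 := dist_lt_itv b1 ert; have l2 := dist_lt_itv b2 ert.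
  have mn (y q : R) : y - rr < q < y + rr -> y - r1 < q < y + r1 /\ y - r2 < q < y + r2.
    rewrite -!ltr_distl => hq; split; apply: (lt_le_trans hq); first by rewrite /rr ge_min lexx.
    by rewrite /rr ge_min lexx orbT.
  have [c1 [c2 [hc1 hc2 Ew]]] := C1with_incr Cw (zz z.1 rr rr0) l1 (zz z.2 rr rr0) l2.
  have [c3 [c4 [hc3 hc4 Ep]]] := C1with_incr Cpsi (zz z.1 rr rr0) l1 (zz z.2 rr rr0) l2.
  have g1 := h1 c1 (pt (r, t)).2 (mn _ _ hc1).1 lo2.
  have g2 := h2 z.1 c2 (zz z.1 r2 r20) (mn _ _ hc2).2.
  have g3 := h2 c3 (pt (r, t)).2 (mn _ _ hc3).2 lo2'.
  have g4 := h1 z.1 c4 (zz z.1 r1 r10) (mn _ _ hc4).1.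
  have e1 : (pt (r, t)).1 - z.1 = expR r * cos t by rewrite /pt /= addrC addKr.
  have e2 : (pt (r, t)).2 - z.2 = expR r * sin t by rewrite /pt /= addrC addKr.
  rewrite e1 e2 w2N in Ew Ep; rewrite -!surjective_pairing in Ew Ep.
  have cs := cos2Dsin2 t; have cm := cos_max t; have sm := sin_max t.
  have -> : err t = expR r * ((w1 (c1, (pt (r, t)).2) - w1 z) * (cos t * cos t) + (w2 (z.1, c2) - w2 z) * (sin t * cos t)
      + (w2 z - w2 (c3, (pt (r, t)).2)) * (cos t * sin t) + (w1 (z.1, c4) - w1 z) * (sin t * sin t)).
    rewrite /err /W /V.
    have -> : w (pt (r, t)) = w z + (w1 (c1, (pt (r, t)).2) * (expR r * cos t) + w2 (z.1, c2) * (expR r * sin t)).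
      by rewrite -Ew addrC subrK.
    have -> : psi (pt (r, t)) = psi z + (- w2 (c3, (pt (r, t)).2) * (expR r * cos t) + w1 (z.1, c4) * (expR r * sin t)).
      by rewrite -Ep addrC subrK.
    have -> : expR r * w1 z = expR r * w1 z * (cos t ^+ 2 + sin t ^+ 2) by rewrite cs mulr1.
    ring.
  rewrite normrM ger0_norm ?expR_ge0// mulrC ler_wpM2r ?expR_ge0//.
  have pr (x y q : R) : `|x| < d -> `|y| <= 1 -> `|q| <= 1 -> `|x * (y * q)| <= d.
    move=> xd y1 q1; rewrite !normrM -[leRHS]mulr1; apply: ler_pM => //; first exact: ltW.
    by rewrite -[leRHS]mulr1; exact: ler_pM.
  have -> : 4 * d = d + d + d + d by ring.
  apply: (le_trans (ler_normD _ _)); apply: lerD; last by apply: pr => //; rewrite distrC.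
  apply: (le_trans (ler_normD _ _)); apply: lerD; last by apply: pr.
  apply: (le_trans (ler_normD _ _)); apply: lerD; apply: pr => //; by rewrite distrC.
have ierr := norm_int_le cerr (fun t _ => errle t).
have Eerr : \int[mu]_(t in `[0, pi *+ 2]) err t =
   \int[mu]_(t in `[0, pi *+ 2]) (W (r, t) * cos t + 1 * (V (r, t) * sin t)) - expR r * (pi *+ 2 * w1 z).
  have ia : mu.-integrable `[0, pi *+ 2] (EFin \o (fun t => W (r, t) * cos t + 1 * (V (r, t) * sin t))).
    apply: continuous_locint => t; apply: cvgD; [|apply: cvgM; first exact: cvg_cst]; apply: cvgM.
    - exact: (@continuous_slice2 R W r cW).
    - exact: continuous_cos.
    - exact: (@continuous_slice2 R V r cV).
    - exact: continuous_sin.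
  have i1 : mu.-integrable `[0, pi *+ 2] (EFin \o (fun t => w z * cos t)).
    by have := integrableZl mpi (w z) lc; apply: eq_integrable => // t _; rewrite /= EFinM.
  have i2 : mu.-integrable `[0, pi *+ 2] (EFin \o (fun t => psi z * sin t)).
    by have := integrableZl mpi (psi z) ls; apply: eq_integrable => // t _; rewrite /= EFinM.
  have i3 : mu.-integrable `[0, pi *+ 2] (EFin \o (fun t : R => expR r * w1 z)).
    by apply: (@continuous_locint R (fun=> expR r * w1 z)) => x; exact: cvg_cst.
  have i12 : mu.-integrable `[0, pi *+ 2] (EFin \o (fun t => w z * cos t + psi z * sin t)).
    by have := @integrableD _ _ _ mu _ mpi _ _ i1 i2; apply: eq_integrable => // t _; rewrite /= EFinD.
  have ib : mu.-integrable `[0, pi *+ 2] (EFin \o (fun t => w z * cos t + psi z * sin t + expR r * w1 z)).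
    by have := @integrableD _ _ _ mu _ mpi _ _ i12 i3; apply: eq_integrable => // t _; rewrite /= EFinD.
  rewrite RintegralB// (RintegralD mpi i12 i3) (RintegralD mpi i1 i2) RintegralZl// RintegralZl//.
  rewrite zero_cos zero_sin !mulr0 !add0r Rintegral_itv_cst// subr0; ring.
rewrite Eerr in ierr.
have hcr := hc r; rewrite mulN1r expRN in hcr.
set I := Rintegral _ _ _ in hcr ierr.
have -> : c - pi *+ 2 * w1 z = (expR r)^-1 * (I - expR r * (pi *+ 2 * w1 z)).
  by rewrite -hcr mulrBr mulKf ?lt0r_neq0.
rewrite normrM ger0_norm ?invr_ge0 ?expR_ge0// ler_pdivrMl//.
apply: (le_trans ierr); rewrite /d le_eqVlt; apply/orP; left; apply/eqP.
move: p0; move: (pi *+ 2 : R) (expR r) => q y q0.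
by field; rewrite lt0r_neq0.
Qed.

Lemma gradient_bound (M : R) : (forall x : R * R, `|x.1 - z.1| <= 1 -> `|x.2 - z.2| <= 1 -> `|w x| <= M) ->
  `|w1 z| <= 2 * M.
Proof.
move=> hM; have p0 : 0 < pi :> R := pi_gt0 R.
have M0 : 0 <= M by apply: le_trans (hM z _ _); rewrite ?subrr ?normr0.
suff : `|pi * w1 z| <= M * (pi *+ 2).
  by rewrite normrM gtr0_norm// mulr2n => h; rewrite -(ler_pM2l p0); apply: (le_trans h); rewrite le_eqVlt; apply/orP; left; apply/eqP; ring.
rewrite -gradient_mean; apply: norm_int_le.
  move=> t; apply: cvgM; last exact: continuous_cos.
  have := @continuous_slice2 R W 0 cW t; rewrite /W /pt /=.
  by under eq_fun do rewrite expR0 !mul1r.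
move=> t _; rewrite normrM -[leRHS]mulr1 ler_pM//; last exact: cos_max.
by apply: hM => /=; rewrite addrC addKr; [exact: cos_max|exact: sin_max].
Qed.

End conjugate_gradient.

(** * Existence and growth of the potentials *)

Section potentials.
Context {R : realType}.

Lemma has_pd_is_derive1 (f : R * R -> R) : has_pd f -> forall x : R * R,
  is_derive x.1 (1 : R) (fun t : R => f (t, x.2)) (pd1 f x).
Proof. by move=> [h _] x; rewrite /pd1 derive1E; apply: DeriveDef => //; exact: h. Qed.

Lemma has_pd_is_derive2 (f : R * R -> R) : has_pd f -> forall x : R * R,
  is_derive x.2 (1 : R) (fun t : R => f (x.1, t)) (pd2 f x).
Proof. by move=> [_ h] x; rewrite /pd2 derive1E; apply: DeriveDef => //; exact: h. Qed.

Variables (w : R * R -> R) (sg : R).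
Hypothesis C2w : C2 w.
Hypothesis pde : forall x, pd1 (pd1 w) x + sg * pd2 (pd2 w) x = 0.

Lemma C2_C1with : C1with w (pd1 w) (pd2 w).
Proof.
have [h _ _ [_ c1 c2] _] := C2w.
by split => //; [exact: has_pd_is_derive1|exact: has_pd_is_derive2].
Qed.

Lemma potentials : exists psi Phi1 Phi2 : R * R -> R,
  [/\ C1with psi (fun x => - sg * pd2 w x) (pd1 w), C1with Phi1 psi w & C1with Phi2 (fun x => - sg * w x) psi].
Proof.
have [h h1 h2 [c c1 c2] [c11 _ _ c22]] := C2w.
have dZ (f : R * R -> R) : has_pd f -> forall x : R * R,
    is_derive x.2 (1 : R) (fun t : R => - sg * f (x.1, t)) (- sg * pd2 f x).
  by move=> hf x; exact: (is_deriveZ (- sg) (has_pd_is_derive2 hf x)).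
have cZ (f : R * R -> R) : continuous f -> continuous (fun x => - sg * f x).
  by move=> cf x; apply: cvgM; [exact: cvg_cst|exact: cf].
have dP (x : R * R) : is_derive x.2 (1 : R) (fun t : R => - sg * pd2 w (x.1, t)) (pd1 (pd1 w) x).
  by apply: (is_derive_eq (dZ _ h2 x)); have := pde x; lra.
have [psi Cpsi] := closed_form_primitive (cZ _ c2) c1 c11 dP (has_pd_is_derive1 h1).
have [dpsi1 dpsi2 _ _] := Cpsi; have cpsi := C1with_continuous Cpsi.
have [Phi1 CPhi1] := closed_form_primitive cpsi c c1 dpsi2 (has_pd_is_derive1 h).
have [Phi2 CPhi2] := closed_form_primitive (cZ _ c) cpsi (cZ _ c2) (dZ _ h) dpsi1.
by exists psi, Phi1, Phi2.
Qed.

Definition exp_growth (F : R * R -> R) := exists C b : R,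
  [/\ 0 <= C, 0 <= b & forall z, `|F z| <= C * expR (b * sqn z)].

Let sqn_near (z c : R * R) : `|c.1| <= `|z.1| + 1 -> `|c.2| <= `|z.2| + 1 -> sqn c <= 2 * sqn z + 4.
Proof.
move=> h1 h2; rewrite /sqn -[c.1 ^+ 2]real_normK ?num_real// -[c.2 ^+ 2]real_normK ?num_real//.
rewrite -[z.1 ^+ 2]real_normK ?num_real// -[z.2 ^+ 2]real_normK ?num_real//.
have := normr_ge0 c.1; have := normr_ge0 c.2.
move: `|c.1| `|c.2| `|z.1| `|z.2| h1 h2 => x1 x2 y1 y2 h1 h2 p1 p2.
have q1 : x1 ^+ 2 <= (y1 + 1) ^+ 2 by rewrite lerXn2r ?nnegrE// (le_trans _ h1).
have q2 : x2 ^+ 2 <= (y2 + 1) ^+ 2 by rewrite lerXn2r ?nnegrE// (le_trans _ h2).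
have := sqr_ge0 (y1 - 1); have := sqr_ge0 (y2 - 1); nra.
Qed.

Let growth_near (C b : R) (z c : R * R) : 0 <= C -> 0 <= b -> `|c.1| <= `|z.1| + 1 -> `|c.2| <= `|z.2| + 1 ->
  C * expR (b * sqn c) <= C * expR (4 * b) * expR (2 * b * sqn z).
Proof.
move=> C0 b0 h1 h2; rewrite -mulrA ler_wpM2l// -expRD ler_expR.
have := sqn_near h1 h2; move: (sqn c) (sqn z) => x y h; nra.
Qed.

Let sqn_ge0 (z : R * R) : 0 <= sqn z. Proof. by rewrite addr_ge0 ?sqr_ge0. Qed.

Let norm_near (x y : R) : `|x - y| <= 1 -> `|x| <= `|y| + 1.
Proof. by move=> h; rewrite -[x](subrK y) addrC (le_trans (ler_normD _ _))// lerD2l. Qed.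

(** Within unit distance in each coordinate, [|z|^2] becomes at most [2 |z|^2 + 4], which doubles
    the exponent and multiplies the constant. *)
Lemma conjugate_growth1 (f psi f1 f2 f2' : R * R -> R) : C1with f f1 f2 -> C1with psi f2' f1 ->
  (forall x, f2' x = - f2 x) -> exp_growth f -> exp_growth f1.
Proof.
move=> Cf Cpsi fN [C [b [C0 b0 hf]]]; exists (2 * C * expR (4 * b)), (2 * b).
split; [by rewrite !mulr_ge0 ?expR_ge0|by rewrite mulr_ge0|] => z.
rewrite -!mulrA; apply: (gradient_bound Cf Cpsi fN) => x h1 h2; apply: (le_trans (hf x)).
by rewrite !mulrA; apply: growth_near => //; exact: norm_near.
Qed.

Let swap_C1 (f f1 f2 : R * R -> R) : C1with f f1 f2 ->
  C1with (fun x => f (x.2, x.1)) (fun x => f2 (x.2, x.1)) (fun x => f1 (x.2, x.1)).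
Proof.
move=> [d1 d2 c1 c2]; have cs (g : R * R -> R) : continuous g -> continuous (fun x : R * R => g (x.2, x.1)).
  move=> cg x; apply: (@continuous_comp _ _ _ (fun x : R * R => (x.2, x.1)) g); last exact: cg.
  by apply: (@cvg_pair _ _ _ _ (nbhs x.2) (nbhs x.1)); [exact: cvg_snd|exact: cvg_fst].
by split; [move=> x; exact: (d2 (x.2, x.1))|move=> x; exact: (d1 (x.2, x.1))|exact: cs|exact: cs].
Qed.

(** Reflection in the diagonal exchanges the two partial derivatives; it reverses the orientation,
    so the conjugate changes sign. *)
Lemma conjugate_growth2 (f psi f1 f2 f2' : R * R -> R) : C1with f f1 f2 -> C1with psi f2' f1 ->
  (forall x, f2' x = - f2 x) -> exp_growth f -> exp_growth f2.
Proof.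
move=> Cf Cpsi fN gf.
have Cpsi' : C1with (fun x => - psi (x.2, x.1)) (fun x => - f1 (x.2, x.1)) (fun x => f2 (x.2, x.1)).
  have [d1 d2 c1 c2] := swap_C1 Cpsi; have [_ _ _ c3] := Cf.
  have [_ _ c2' _] := swap_C1 Cf.
  split => //.
  - by move=> x; exact: (is_deriveN (d1 x)).
  - by move=> x; apply: (is_derive_eq (is_deriveN (d2 x))); rewrite fN opprK.
  - by move=> x; apply: cvgN; exact: c1.
have gf' : exp_growth (fun x => f (x.2, x.1)).
  have [C [b [C0 b0 h]]] := gf; exists C, b; split => // z; apply: (le_trans (h _)).
  by rewrite /sqn /= addrC.
have [C [b [C0 b0 h]]] := conjugate_growth1 (swap_C1 Cf) Cpsi' (fun=> erefl) gf'.
exists C, b; split => // z; have := h (z.2, z.1); rewrite /= -surjective_pairing.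
by rewrite /sqn /= addrC.
Qed.

(** The extra 1 in the exponent absorbs the factors [|z1|] and [|z2|] of the increment from the
    origin. *)
Lemma C1_growth (f f1 f2 : R * R -> R) : C1with f f1 f2 -> exp_growth f1 -> exp_growth f2 -> exp_growth f.
Proof.
move=> Cf [A [a [A0 a0 h1]]] [B [b [B0 b0 h2]]].
exists (`|f (0, 0)| + A * expR (4 * a) + B * expR (4 * b)), (2 * a + 2 * b + 1).
split; [by rewrite !addr_ge0// mulr_ge0 ?expR_ge0|by rewrite !addr_ge0 ?mulr_ge0|] => -[z1 z2].
have lo (y : R) : - (`|y| + 1) < 0 < `|y| + 1 /\ - (`|y| + 1) < y < `|y| + 1.
  have := ler_norm y; have := ler_norm (- y); rewrite normrN; have := normr_ge0 y.
  by move=> q1 q2 q3; split; apply/andP; split; lra.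
have [c1 [c2 [hc1 hc2 E]]] := C1with_incr Cf (lo z1).1 (lo z1).2 (lo z2).1 (lo z2).2.
rewrite !subr0 in E.
have nc (c y : R) : - (`|y| + 1) < c < `|y| + 1 -> `|c| <= `|y| + 1.
  by move=> /andP[q1 q2]; rewrite ler_norml; apply/andP; split; exact: ltW.
set s := sqn (z1, z2); have s0 : 0 <= s := sqn_ge0 _.
have k1 : `|f1 (c1, z2)| <= A * expR (4 * a) * expR (2 * a * s).
  by apply: (le_trans (h1 _)); apply: growth_near => //=; [exact: nc|rewrite lerDl].
have k2 : `|f2 (0, c2)| <= B * expR (4 * b) * expR (2 * b * s).
  by apply: (le_trans (h2 _)); apply: growth_near => //=; [rewrite normr0 addr_ge0|exact: nc].
have n1 : `|z1| <= expR s.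
  apply: le_trans (expR_ge1Dx s); rewrite /s /sqn /=.
  have := sqr_ge0 (`|z1| - 1); rewrite -[z1 ^+ 2]real_normK ?num_real//; have := sqr_ge0 z2; have := normr_ge0 z1; nra.
have n2 : `|z2| <= expR s.
  apply: le_trans (expR_ge1Dx s); rewrite /s /sqn /=.
  have := sqr_ge0 (`|z2| - 1); rewrite -[z2 ^+ 2]real_normK ?num_real//; have := sqr_ge0 z1; have := normr_ge0 z2; nra.
have -> : f (z1, z2) = f (0, 0) + (f1 (c1, z2) * z1 + f2 (0, c2) * z2) by rewrite -E addrC subrK.
set Ex := expR ((2 * a + 2 * b + 1) * s).
have e1 : expR (2 * a * s) * expR s <= Ex.
  by rewrite /Ex -expRD ler_expR; have := mulr_ge0 b0 s0; lra.
have e2 : expR (2 * b * s) * expR s <= Ex.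
  by rewrite /Ex -expRD ler_expR; have := mulr_ge0 a0 s0; lra.
have qA : 0 <= A * expR (4 * a) by rewrite mulr_ge0 ?expR_ge0.
have qB : 0 <= B * expR (4 * b) by rewrite mulr_ge0 ?expR_ge0.
have e3 : 1 <= Ex.
  by rewrite /Ex -expR0 ler_expR mulr_ge0// !addr_ge0// mulr_ge0.
rewrite [leRHS]mulrDl [X in _ <= X + _]mulrDl -[leRHS]addrA; apply: (le_trans (ler_normD _ _)); apply: lerD; first by rewrite ler_peMr.
apply: (le_trans (ler_normD _ _)); apply: lerD; rewrite normrM.
  by apply: (le_trans (ler_pM (normr_ge0 _) (normr_ge0 _) k1 n1)); rewrite -[leLHS]mulrA (ler_wpM2l qA e1).
by apply: (le_trans (ler_pM (normr_ge0 _) (normr_ge0 _) k2 n2)); rewrite -[leLHS]mulrA (ler_wpM2l qB e2).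
Qed.

(** For [k = 1] and [k = -1], [psi - k f] is constant along the characteristic direction [(1, k)].
    Going from [z] along [(1, -1)] to the diagonal and then along [(1, 1)] to the origin expresses
    [psi z] through values of [f] and a constant; the intermediate point [(t, t)] is no farther from
    the origin than [z]. *)
Lemma wave_growth (f psi f1 f2 : R * R -> R) : C1with f f1 f2 -> C1with psi f2 f1 -> exp_growth f -> exp_growth psi.
Proof.
move=> Cf Cpsi [C [b [C0 b0 hf]]].
have along (k : R) (z : R * R) : k ^+ 2 = 1 -> (forall s, psi (z.1 + s, z.2 + k * s) - k * f (z.1 + s, z.2 + k * s) = psi z - k * f z).
  move=> k2 s.
  have A1 : AC (fun s => z.1 + s) (fun=> 1).
    by apply: AC_eq (AC_lin 1 (AC_cst z.1) AC_id) _ _ => t; rewrite ?mul1r ?add0r ?mulr1.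
  have A2 : AC (fun s => z.2 + k * s) (fun=> k).
    by apply: AC_eq (AC_lin k (AC_cst z.2) AC_id) _ _ => t; rewrite ?add0r ?mulr1.
  have A := AC_lin (- k) (AC_chain2 Cpsi A1 A2) (AC_chain2 Cf A1 A2).
  have := AC_der0_cst A _ s 0; rewrite mulr0 !addr0 -surjective_pairing !mulNr; apply.
  apply: aeW => t; set x := f1 _; set y := f2 _.
  have -> : y * 1 + x * k + - k * (x * 1 + y * k) = y * (1 - k ^+ 2) by ring.
  by rewrite k2 subrr mulr0.
exists (3 * C + `|psi (0, 0) - f (0, 0)|), b; split => //; first by rewrite addr_ge0// mulr_ge0.
move=> z; pose t := (z.1 + z.2) / 2.
have E1 := along (-1) z _ (t - z.1); rewrite sqrrN expr1n in E1; have {}E1 := E1 erefl.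
have E2 := along 1 (0, 0) (expr1n _ 2) t; rewrite /= !add0r !mul1r in E2.
have t1 : z.1 + (t - z.1) = t by ring.
have t2 : z.2 + (-1) * (t - z.1) = t by rewrite /t; field.
rewrite t1 t2 in E1.
have -> : psi z = 2 * f (t, t) - f z + (psi (0, 0) - f (0, 0)).
  by rewrite -E2; move: E1; rewrite !mulN1r !opprK => E1; rewrite -[psi z](addrK (f z)) -E1; ring.
have s0 := sqn_ge0 z.
have e1 : 1 <= expR (b * sqn z) by rewrite -expR0 ler_expR mulr_ge0.
have ft : `|f (t, t)| <= C * expR (b * sqn z).
  apply: (le_trans (hf _)); rewrite ler_wpM2l// ler_expR ler_wpM2l// /sqn /t /=.
  by have := sqr_ge0 (z.1 - z.2); nra.
have T := le_trans (ler_normD (2 * f (t, t) - f z) (psi (0, 0) - f (0, 0))) (lerD (ler_normB _ _) (lexx _)).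
apply: (le_trans T); rewrite normrM (ger0_norm (ler0n _ 2)).
have := hf z; have := ler_peMr (normr_ge0 (psi (0, 0) - f (0, 0))) e1.
move: ft; move: (`|psi (0, 0) - f (0, 0)|) (expR _) (`|f z|) (`|f (t, t)|) => K E F G.
move=> q1 q2 q3; have -> : (3 * C + K) * E = 3 * (C * E) + K * E by ring.
lra.
Qed.

End potentials.

(** * Heteroclinic orbits *)

Section autonomous.
Context {R : realType}.
Local Notation mu := (@lebesgue_measure R).

(** The solution is the inverse of a primitive of [1 / k]. The upper bound on [k] makes this
    primitive unbounded at both ends, so the solution exists for all times. *)
Lemma autonomous_solution (k : R -> R) (M : R) : continuous k -> (forall x, 0 < k x <= M) ->
  exists x : R -> R, [/\ forall t, is_derive t (1 : R) x (k (x t)), x t @[t --> +oo] --> +oo &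
    x t @[t --> -oo] --> -oo].
Proof.
move=> ck kM.
have k0 x : 0 < k x by have /andP[] := kM x.
have M0 : 0 < M by have /andP[q1 q2] := kM 0; exact: lt_le_trans q1 q2.
have cV : continuous (fun x => (k x)^-1).
  by move=> x; apply: cvgV; [exact/lt0r_neq0|exact: ck].
have [T aT] := AC_prim (continuous_locint cV).
have dT := AC_derive aT cV.
have incr a b : a <= b -> M^-1 * (b - a) <= T b - T a.
  move=> ab; rewrite aT.2// -Rintegral_itv_cst//; apply: le_Rintegral => //.
  - by apply: continuous_locint => x; exact: cvg_cst.
  - exact: aT.1.
  - by move=> x _; rewrite lef_pV2 ?posrE//; have /andP[] := kM x.
have cT := AC_continuous aT.
have mono a b : T a < T b -> a < b.
  rewrite ltNge => h; rewrite ltNge; apply: contra h => ba; rewrite -subr_ge0.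
  by apply: le_trans (incr _ _ ba); rewrite mulr_ge0 ?subr_ge0// invr_ge0 ltW.
have inj : injective T.
  move=> a b e; case: (ltgtP a b) => // h; have := incr _ _ (ltW h);
    by rewrite e subrr leNgt mulr_gt0 ?subr_gt0// invr_gt0.
have sur v : exists x, T x = v.
  set r := M * `|v - T 0|; have r0 : 0 <= r by rewrite mulr_ge0// ltW.
  have r1 := incr 0 r r0; have r2 := incr (- r) 0; rewrite oppr_le0 in r2.
  have {}r2 := r2 r0; rewrite subr0 in r1; rewrite sub0r opprK in r2.
  rewrite /r mulKf ?lt0r_neq0// in r1 r2; rewrite -/r in r1 r2.
  have n1 := ler_norm (v - T 0); have n2 := ler_norm (T 0 - v); rewrite distrC in n2.
  have rr : - r <= r by rewrite (le_trans _ r0)// oppr_le0.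
  have vr : minr (T (- r)) (T r) <= v <= maxr (T (- r)) (T r).
    by apply/andP; split; [rewrite ge_min|rewrite le_max]; apply/orP; [left|right]; lra.
  by have [c _ cv] := IVT rr (continuous_subspaceT cT) vr; exists c.
have [x Tx] := choice sur.
have xT : cancel T x by move=> s; apply: inj; rewrite Tx.
exists x; split.
- move=> t; have n1 : {near x t, cancel T x} by near=> z; exact: xT.
  have n2 : {near x t, continuous T} by near=> z; exact: cT.
  have := is_derive_inverse n1 n2 (dT (x t)) (invr_neq0 (lt0r_neq0 (k0 _))).
  by rewrite Tx invrK.
- apply/cvgryPge => A; near=> t; apply/ltW/mono; rewrite Tx; near: t; apply: nbhs_pinfty_gt; exact: num_real.
- apply/cvgrNyPle => A; near=> t; apply/ltW/mono; rewrite Tx; near: t; apply: nbhs_ninfty_lt; exact: num_real.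
Unshelve. all: by end_near. Qed.

Definition logistic (x : R) : R := (1 + expR (- x))^-1.

Lemma logistic_itv x : 0 < logistic x < 1.
Proof.
have e := expR_gt0 (- x); rewrite /logistic invr_gt0 addr_gt0//= invf_lt1 ?addr_gt0//.
by rewrite ltrDl.
Qed.

Lemma is_derive_logistic (x : R) : is_derive x (1 : R) logistic (logistic x * (1 - logistic x)).
Proof.
have n0 : 1 + expR (- x) != 0 by rewrite lt0r_neq0// addr_gt0// expR_gt0.
have dE : is_derive x (1 : R) (fun x => 1 + expR (- x)) (- expR (- x)).
  have d := is_derive1_comp (is_derive_expR (- x)) (is_deriveN (is_derive_id x (1 : R))).
  by apply: (is_derive_eq (is_deriveD (is_derive_cst (1 : R) x (1 : R)) d)); rewrite add0r mulrN1.
have d : is_derive x (1 : R) logistic _ := @is_deriveV R (fun x => 1 + expR (- x)) x _ (1 : R) n0 dE.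
by apply: (is_derive_eq d); rewrite /logistic /GRing.scale/=; field.
Qed.

Lemma logistic_sym x : logistic (- x) = 1 - logistic x.
Proof.
have e := expR_gt0 x; rewrite /logistic opprK expRN.
have n1 : 1 + expR x != 0 by rewrite lt0r_neq0// addr_gt0.
by field; rewrite !lt0r_neq0 ?addr_gt0.
Qed.

Lemma logistic_pinfty : logistic x @[x --> +oo] --> (1 : R).
Proof.
rewrite -[X in _ --> X]invr1; apply: cvgV; first exact: oner_neq0.
rewrite -[X in _ --> X]addr0; apply: cvgD; [exact: cvg_cst|exact: cvgr_expR].
Qed.

Lemma logistic_ninfty : logistic x @[x --> -oo] --> (0 : R).
Proof.
have h : (1 - logistic x) @[x --> +oo] --> (1 - 1 : R).
  by apply: cvgB; [exact: cvg_cst|exact: logistic_pinfty].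
rewrite subrr in h; apply/cvgNy_compNP; apply: cvg_trans h.
by apply: near_eq_cvg; near=> x; rewrite /= logistic_sym.
Unshelve. all: by end_near. Qed.

(** The substitution [y = m + (p - m) logistic(x)] opens the segment to the whole line and gives
    [x' = k(x)] with [k] positive. Here [k] is bounded because [r] is Lipschitz on [[0, 1]] and
    vanishes at both ends, whence [r(s) <= 2 L s (1 - s)]. *)
Lemma heteroclinic (f f' : R -> R) (m p : R) :
  (forall t, is_derive t (1 : R) f (f' t)) -> continuous f' -> f m = 0 -> f p = 0 ->
  (forall t, 0 < t < 1 -> 0 < (p - m) * f (m + t * (p - m))) ->
  exists y : R -> R, [/\ forall t, is_derive t (1 : R) y (f (y t)), y t @[t --> +oo] --> p &
    y t @[t --> -oo] --> m].
Proof.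
move=> df cf' fm fp fpos; set q := p - m.
have mq : m + q = p by rewrite /q addrC subrK.
have q0 : q != 0.
  apply/eqP => e; have := fpos 2^-1; rewrite -/q e mul0r ltxx => h; suff: false by []; apply: h.
  by apply/andP; split; lra.
have Af := AC_C1 df cf'; have cf := AC_continuous Af.
have A1 : AC (fun s => m + s * q) (fun=> q).
  by apply: AC_eq (AC_lin q (AC_cst m) AC_id) _ _ => t; rewrite ?add0r ?mulr1// mulrC.
have Ar := AC_lin q (AC_cst 0) (AC_chain1 df cf' A1).
pose r s := q * f (m + s * q).
have {}Ar : AC r (fun s => q * (f' (m + s * q) * q)).
  by apply: AC_eq Ar _ _ => t; rewrite /r add0r.
have cr := AC_continuous Ar.
have cd : continuous (fun s : R => q * (f' (m + s * q) * q)).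
  have c1 : continuous (fun s : R => f' (m + s * q)).
    by move=> s; apply: (@continuous_comp R R R (fun s : R => m + s * q) f'); [exact: (AC_continuous A1)|exact: cf'].
  move=> s; apply: cvgM; first exact: cvg_cst.
  by apply: cvgM; [exact: c1|exact: cvg_cst].
have [L [L0 hL]] := continuous_bounded_itv 0 1 cd.
have r0 : r 0 = 0 by rewrite /r mul0r addr0 fm mulr0.
have r1 : r 1 = 0 by rewrite /r mul1r mq fp mulr0.
have lip a b : 0 <= a -> a <= b -> b <= 1 -> `|r b - r a| <= L * (b - a).
  move=> a0 ab b1; rewrite Ar.2//; apply: Rintegral_itv_le => //; first exact: Ar.1.
  by move=> x /andP[xa xb]; apply: hL; rewrite (le_trans a0)//= (le_trans xb).
have rp s : 0 < s < 1 -> 0 < r s by move=> hs; exact: fpos.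
pose k x := r (logistic x) / (q ^+ 2 * (logistic x * (1 - logistic x))).
have den x : 0 < q ^+ 2 * (logistic x * (1 - logistic x)).
  have /andP[s0 s1] := logistic_itv x.
  by apply: mulr_gt0; [rewrite exprn_even_gt0|rewrite mulr_gt0// subr_gt0].
have cl : continuous logistic.
  by move=> x; apply: is_derive_continuous; exact: is_derive_logistic.
have ck : continuous k.
  move=> x; apply: cvgM; first by apply: (@continuous_comp _ _ _ logistic r); [exact: cl|exact: cr].
  apply: cvgV; first exact: lt0r_neq0.
  apply: cvgM; first exact: cvg_cst.
  by apply: cvgM; [exact: cl|apply: cvgB; [exact: cvg_cst|exact: cl]].
have kb x : 0 < k x <= 2 * L / q ^+ 2.
  have /andP[s0 s1] := logistic_itv x; have rs := rp _ (logistic_itv x).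
  rewrite /k divr_gt0//= ler_pdivrMr//.
  have -> : 2 * L / q ^+ 2 * (q ^+ 2 * (logistic x * (1 - logistic x))) = 2 * L * (logistic x * (1 - logistic x)) by field.
  have l1 := lip 0 (logistic x) (lexx _) (ltW s0) (ltW s1).
  have l2 := lip (logistic x) 1 (ltW s0) (ltW s1) (lexx _).
  rewrite r0 subr0 subr0 in l1; rewrite r1 sub0r normrN in l2; rewrite gtr0_norm// in l1 l2.
  move: l1 l2 s0 s1 L0; move: (logistic x) (r _) => s e; clear; nra.
have [x [dx xp xm]] := autonomous_solution ck kb.
exists (fun t => m + q * logistic (x t)); split.
- move=> t.
  have d := is_derive1_comp (is_derive_logistic (x t)) (dx t).
  have d2 := is_deriveD (is_derive_cst m t (1 : R)) (is_deriveZ q d).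
  have d3 : is_derive t (1 : R) (fun t => m + q * logistic (x t)) _ := d2.
  apply: (is_derive_eq d3).
  rewrite add0r /GRing.scale/= /k /r [q * logistic (x t)]mulrC; have /andP[s0 s1] := logistic_itv (x t).
  have alg (b c v e : R) : b != 0 -> c != 0 -> v != 0 -> b * (c * v * (b * e / (b ^+ 2 * (c * v)))) = e.
    by move=> b0 c0 v0; field; rewrite b0 c0 v0.
  by apply: alg => //; [exact: lt0r_neq0|rewrite subr_eq0 gt_eqF].
- rewrite -[X in _ --> X]/(p); rewrite -mq -[q in m + q]mulr1.
  apply: cvgD; first exact: cvg_cst.
  have h : logistic (x t) @[t --> +oo] --> (1 : R) := cvg_comp _ _ xp logistic_pinfty.
  by apply: cvgM; [exact: cvg_cst|exact: h].
- suff : m + q * logistic (x t) @[t --> -oo] --> m + q * 0 by rewrite mulr0 addr0.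
  apply: cvgD; first exact: cvg_cst.
  have h : logistic (x t) @[t --> -oo] --> (0 : R) := cvg_comp _ _ xm logistic_ninfty.
  by apply: cvgM; [exact: cvg_cst|exact: h].
Qed.

End autonomous.

(** * Uniqueness of the orbit up to translation *)

Section uniqueness.
Context {R : realType}.

Lemma limits_bounded (y : R -> R) (m p : R) : continuous y -> y t @[t --> +oo] --> p -> y t @[t --> -oo] --> m ->
  exists2 K, 0 <= K & forall t, `|y t| <= K.
Proof.
move=> cy yp ym.
have /cvgrPdist_lt/(_ 1 ltr01)[N1 [_ h1]] := yp.
have /cvgrPdist_lt/(_ 1 ltr01)[N2 [_ h2]] := ym.
have [K [K0 hK]] := continuous_bounded_itv N2 N1 cy.
exists (K + `|m| + `|p| + 1); first by rewrite !addr_ge0.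
have := normr_ge0 m; have := normr_ge0 p => q1 q2 t.
have [tN|tN] := ltP N1 t.
  have := h1 _ tN; rewrite distrC => h; have := ler_normD (y t - p) p; rewrite subrK; lra.
have [tM|tM] := ltP t N2.
  have := h2 _ tM; rewrite distrC => h; have := ler_normD (y t - m) m; rewrite subrK; lra.
by have := hK t; rewrite tN tM => /(_ isT); lra.
Qed.

Lemma limits_midpoint (y : R -> R) (m p : R) : continuous y -> y t @[t --> +oo] --> p -> y t @[t --> -oo] --> m ->
  m != p -> exists t, y t = (m + p) / 2.
Proof.
move=> cy yp ym mp; have e0 : 0 < `|m - p| / 2 by rewrite divr_gt0// normr_gt0 subr_eq0.
have /cvgrPdist_lt/(_ _ e0)[N1 [_ h1]] := yp.
have /cvgrPdist_lt/(_ _ e0)[N2 [_ h2]] := ym.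
pose b := Num.max N1 N2 + 1; pose c := Num.min N1 N2 - 1.
have Nb : N1 < b by rewrite (le_lt_trans (y := Num.max N1 N2)) ?le_max ?lexx// ltrDl.
have cN : c < N2 by rewrite (lt_le_trans (y := Num.min N1 N2)) ?ge_min ?lexx ?orbT// gtrDl oppr_lt0.
have cb : c <= b.
  rewrite (le_trans (ltW cN))// (le_trans (y := Num.max N1 N2)) ?le_max ?lexx ?orbT//.
  by rewrite lerDl.
have q1 := h1 _ Nb; have q2 := h2 _ cN.
have v : minr (y c) (y b) <= (m + p) / 2 <= maxr (y c) (y b).
  rewrite ge_min le_max.
  move: q1 q2; rewrite !ltr_norml => /andP[q1 q3] /andP[q2 q4].
  have [mp'|mp'] := lerP m p.
    by move: q1 q2 q3 q4; rewrite ler0_norm ?subr_le0// => *; apply/andP; split; apply/orP; [left|right]; lra.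
  by move: q1 q2 q3 q4; rewrite gtr0_norm ?subr_gt0// => *; apply/andP; split; apply/orP; [right|left]; lra.
by have [t _ yt] := IVT cb (continuous_subspaceT cy) v; exists t.
Qed.

(** The function [(y - z)^2 exp(-2 L s)] has nonpositive derivative and starts at 0. *)
Lemma gronwall0 (f : R -> R) (L : R) (y z : R -> R) :
  (forall t, is_derive t (1 : R) y (f (y t))) -> (forall t, is_derive t (1 : R) z (f (z t))) ->
  (forall t, `|f (y t) - f (z t)| <= L * `|y t - z t|) -> y 0 = z 0 ->
  forall t, 0 <= t -> y t = z t.
Proof.
move=> dy dz lip e0 t t0.
pose G s := (y s - z s) * (y s - z s) * expR (- (2 * L) * s).
have dG s : is_derive s (1 : R) G
    ((2 * (y s - z s) * (f (y s) - f (z s)) - 2 * L * (y s - z s) ^+ 2) * expR (- (2 * L) * s)).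
  have d1 := is_derive1_comp (is_derive_expR (- (2 * L) * s)) (is_deriveZ (- (2 * L)) (is_derive_id s (1 : R))).
  have d2 := is_deriveB (dy s) (dz s).
  have d3 : is_derive s (1 : R) G _ := is_deriveM (is_deriveM d2 d2) d1.
  apply: (is_derive_eq d3); rewrite /GRing.scale/= !fctE; ring.
have [c [_ E]] := mean_value 0 t dG.
have G0 : G 0 = 0 by rewrite /G e0 subrr !mul0r.
have le0 : G t <= 0.
  move: E; rewrite G0 !subr0 => ->; apply: mulr_le0_ge0 => //.
  apply: mulr_le0_ge0; last exact: expR_ge0.
  have := ler_wpM2l (normr_ge0 (y c - z c)) (lip c); have := ler_norm ((y c - z c) * (f (y c) - f (z c))); rewrite normrM.
  rewrite -[(y c - z c) ^+ 2]real_normK ?num_real//.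
  rewrite -[2 * (y c - z c) * _]mulrA.
  move: (`|y c - z c|) (`|f (y c) - f (z c)|) ((y c - z c) * _) => u v x; lra.
have : G t = 0 by apply/le_anti; rewrite le0 /G -expr2 mulr_ge0 ?sqr_ge0 ?expR_ge0.
by move/eqP; rewrite /G -expr2 mulf_eq0 (gt_eqF (expR_gt0 _)) orbF sqrf_eq0 subr_eq0 => /eqP.
Qed.

(** Both orbits pass through the midpoint of the segment. They are compared from there forwards, and
    backwards by reversing time, with a Lipschitz constant taken on a bounded range containing both
    orbits. *)
Lemma autonomous_unique (f f' : R -> R) (m p : R) (y z : R -> R) :
  (forall t, is_derive t (1 : R) f (f' t)) -> continuous f' -> m != p ->
  (forall t, is_derive t (1 : R) y (f (y t))) -> (forall t, is_derive t (1 : R) z (f (z t))) ->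
  y t @[t --> +oo] --> p -> y t @[t --> -oo] --> m ->
  z t @[t --> +oo] --> p -> z t @[t --> -oo] --> m ->
  exists tau, forall t, z t = y (t + tau).
Proof.
move=> df cf' mp dy dz yp ym zp zm.
have cont (x : R -> R) : (forall t, is_derive t (1 : R) x (f (x t))) -> continuous x.
  by move=> dx t; apply: is_derive_continuous; exact: (dx t).
have [K1 K10 hy] := limits_bounded (cont _ dy) yp ym.
have [K2 K20 hz] := limits_bounded (cont _ dz) zp zm.
have [L [L0 hL]] := continuous_bounded_itv (- (K1 + K2)) (K1 + K2) cf'.
have Af := AC_C1 df cf'.
have lip0 u v : u <= v -> `|u| <= K1 + K2 -> `|v| <= K1 + K2 -> `|f v - f u| <= L * (v - u).
  move=> uv hu hv; move: hu hv; rewrite !(ler_norml _ (K1 + K2)) => /andP[u1 u2] /andP[v1 v2].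
  rewrite Af.2//; apply: Rintegral_itv_le => //; first exact: Af.1.
  by move=> x /andP[x1 x2]; apply: hL; rewrite (le_trans u1)//= (le_trans x2).
have lip u v : `|u| <= K1 + K2 -> `|v| <= K1 + K2 -> `|f u - f v| <= L * `|u - v|.
  move=> hu hv; have [uv|vu] := leP v u.
    by rewrite (ger0_norm (x := u - v)) ?subr_ge0//; exact: lip0.
  by rewrite distrC (distrC u) (gtr0_norm (x := v - u)) ?subr_gt0//; apply: lip0 => //; exact: ltW.
have by1 t : `|y t| <= K1 + K2 by rewrite (le_trans (hy t))// lerDl.
have bz1 t : `|z t| <= K1 + K2 by rewrite (le_trans (hz t))// lerDr.
have [t1 y1] := limits_midpoint (cont _ dy) yp ym mp.
have [t2 z2] := limits_midpoint (cont _ dz) zp zm mp.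
have shift (x : R -> R) c : (forall t, is_derive t (1 : R) x (f (x t))) ->
    forall t, is_derive t (1 : R) (fun t => x (c + t)) (f (x (c + t))).
  move=> dx t; have dc := is_deriveD (is_derive_cst c t (1 : R)) (is_derive_id t (1 : R)).
  by apply: (is_derive_eq (is_derive1_comp (dx (c + t)) dc)); rewrite add0r mulr1.
have rev (x : R -> R) c : (forall t, is_derive t (1 : R) x (f (x t))) ->
    forall t, is_derive t (1 : R) (fun t => x (c - t)) ((fun u => - f u) (x (c - t))).
  move=> dx t; have dc : is_derive t (1 : R) (fun t => c - t) (0 - 1) := is_deriveB (is_derive_cst c t (1 : R)) (is_derive_id t (1 : R)).
  have d : is_derive t (1 : R) (fun t => x (c - t)) _ := @is_derive1_comp _ x (fun t => c - t) t _ _ (dx (c - t)) dc.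
  by apply: (is_derive_eq d); rewrite sub0r mulrN1.
have fwd := @gronwall0 f L _ _ (shift _ t1 dy) (shift _ t2 dz).
have bwd := @gronwall0 (fun u => - f u) L _ _ (rev _ t1 dy) (rev _ t2 dz).
exists (t1 - t2) => t; have [tt|tt] := leP t2 t.
  have := fwd _ _ (t - t2); rewrite !addr0 y1 z2 subr_ge0 => h.
  have -> : t + (t1 - t2) = t1 + (t - t2) by ring.
  rewrite h//; last by move=> s; exact: lip.
  by congr z; ring.
have := bwd _ _ (t2 - t); rewrite !subr0 y1 z2 subr_ge0 => h.
have -> : t + (t1 - t2) = t1 - (t2 - t) by ring.
rewrite h ?ltW//; last by move=> s; rewrite -opprD normrN; exact: lip.
by congr z; ring.
Qed.

End uniqueness.

(** * The one-dimensional problem *)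

Section one_dimensional.
Context {R : realType}.
Local Notation mu := (@lebesgue_measure R).

Lemma integral_exhaust (K : R -> R) (c : \bar R) : measurable_fun setT K -> (forall t, 0 <= K t) ->
  (forall n : nat, (\int[mu]_(t in `[(- n%:R)%R, n%:R]) (K t)%:E <= c)%E) -> (\int[mu]_t (K t)%:E <= c)%E.
Proof.
move=> mK K0 Kc.
pose g (n : nat) := ((EFin \o K) \_ `[(- n%:R)%R, n%:R%R]%classic)%E.
have mI n : measurable (`[- n%:R, n%:R]%classic : set (measurableTypeR R)) by exact: measurable_itvR.
have g0 n t : setT t -> (0 <= g n t)%E by rewrite /g patchE; case: ifP => // _; rewrite lee_fin.
have mg n : measurable_fun setT (g n).
  by apply/(measurable_restrictT _ (mI n)); apply: measurable_funTS; exact/measurable_EFinP.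
have nd t : setT t -> nondecreasing_seq (g^~ t).
  move=> _ n k nk; rewrite /g !patchE; case: ifPn => // tn; last by case: ifP => // _; rewrite lee_fin.
  rewrite ifT//; move: tn; rewrite !inE /= !in_itv/= -!ler_norml => tn.
  by rewrite (le_trans tn)// ler_nat.
have -> : (\int[mu]_t (K t)%:E = \int[mu]_t limn (g^~ t))%E.
  apply: eq_integral => t _; apply/esym/lim_near_cst => //; near=> n.
  rewrite /g patchE ifT// inE /= in_itv/= -ler_norml; near: n.
  exact: nbhs_infty_ger.
rewrite (monotone_convergence mu measurableT mg g0 nd); apply: lime_le.
  by apply: ereal_nondecreasing_is_cvgn => n k nk; apply: (@ge0_le_integral _ _ _ mu setT measurableT (g n) (g k)); [exact: g0|exact: mg|exact: mg|move=> t _; exact: nd].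
by apply: nearW => n; rewrite /g -integral_mkcond.
Unshelve. all: by end_near. Qed.

(** Otherwise the fundamental lemma would make the constant 1 vanish almost everywhere. *)
Lemma test1_nonzero_mean : exists2 b : R -> R, test1 b & \int[mu]_t b t != 0.
Proof.
apply: contrapT => h; have l1 : locint (fun=> 1 : R) by apply: continuous_locint => x; exact: cvg_cst.
have H : {ae mu, forall t : R, (1 : R) = 0}.
  apply: (fundamental_lemma l1) => b tb; under eq_Rintegral do rewrite mul1r.
  by apply/eqP; rewrite -[_ == _]negbK; apply/negP => nz; apply: h; exists b.
have [N [mN N0 sN]] := H.
have : (mu N = +oo)%E.
  apply/eqP; rewrite -leye_eq -(itv_ooy (0 : R)); apply: le_measure; rewrite ?inE//.
  by move=> t _; apply: sN => /= e; have := oner_neq0 R; rewrite e eqxx.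
by rewrite N0.
Qed.

(** A test function minus the right multiple of [b0] has zero mean, hence is the derivative of a
    test function; this brings the claim back to the fundamental lemma for [Q - c]. *)
Lemma du_bois_reymond (Q : R -> R) : locint Q -> (forall b, test1 b -> \int[mu]_t (Q t * derive1 b t) = 0) ->
  exists c, {ae mu, forall t, Q t = c}.
Proof.
move=> lQ h; have [b0 t0 nz] := test1_nonzero_mean.
have [N0 [C0 hb0]] := test1_bound t0; have [_ cb0 _ _] := t0.
exists (\int[mu]_t (Q t * b0 t) / \int[mu]_t b0 t); set c := _ / _.
have lc : locint (fun=> c) by apply: continuous_locint => x; exact: cvg_cst.
have {}nz : {ae mu, forall t, Q t - c = 0}; last by apply: (ae_imp nz) => t /eqP; rewrite subr_eq0 => /eqP.
apply: (fundamental_lemma (locintB lQ lc)) => b tb.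
have [Nb [Cb hb]] := test1_bound tb; have [_ cb _ _] := tb.
pose N : R := (N0 + Nb).+1%:R; have NN : 0 <= N := ler0n _ _.
have out (t : R) : t <= - N \/ N <= t -> b0 t = 0 /\ b t = 0.
  move=> tN; have ht : N <= `|t|.
    by case: tN => h'; [rewrite -normrN (le_trans _ (ler_norm _))// lerNr|rewrite (le_trans h')// ler_norm].
  have [_ _ /(_ _)[|-> _]] := hb0 t; first by apply: lt_le_trans ht; rewrite ltr_nat ltnS leq_addr.
  have [_ _ /(_ _)[|-> _]//] := hb t; by apply: lt_le_trans ht; rewrite ltr_nat ltnS leq_addl.
have fin (f : R -> R) : (forall t : R, t <= - N \/ N <= t -> f t = 0) -> \int[mu]_t f t = \int[mu]_(t in `[- N, N]) f t.
  exact: Rintegral_setT_itv.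
set I0 := \int[mu]_t b0 t in nz c lc *; pose kap := (\int[mu]_t b t) / I0.
have l0 := continuous_locint cb0; have l1 := continuous_locint cb.
pose k t := b t - kap * b0 t.
have ck : continuous k.
  by move=> t; apply: cvgB; [exact: cb|apply: cvgM; [exact: cvg_cst|exact: cb0]].
have k0 (t : R) : t <= - N \/ N <= t -> k t = 0 by move=> /out[e1 e2]; rewrite /k e1 e2 mulr0 subr0.
have ik : \int[mu]_(t in `[- N, N]) k t = 0.
  rewrite RintegralB; [|by []|exact: l1|exact: (locintZ _ l0)].
  rewrite RintegralZl; [|by []|exact: l0].
  rewrite -!fin; [|by move=> t /out[]|by move=> t /out[]].
  by rewrite -/I0 /kap divfK// subrr.
have [a ta ka] := test1_prim ck NN k0 ik.
have q0 := locint_cM cb0 lQ; have q1 := locint_cM cb lQ.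
have := h _ ta; rewrite ka fin; last by move=> t /k0 ->; rewrite mulr0.
have -> : \int[mu]_(t in `[- N, N]) (Q t * k t) =
    \int[mu]_(t in `[- N, N]) (b t * Q t) - kap * \int[mu]_(t in `[- N, N]) (b0 t * Q t).
  rewrite -RintegralZl; [|by []|exact: q0].
  rewrite -RintegralB; [|by []|exact: q1|exact: (locintZ _ q0)].
  by apply: eq_Rintegral => t _; rewrite /k; ring.
move=> E; rewrite fin; last by move=> t /out[_ ->]; rewrite mulr0.
have -> : \int[mu]_(t in `[- N, N]) ((Q t - c) * b t) =
    \int[mu]_(t in `[- N, N]) (b t * Q t) - c * \int[mu]_(t in `[- N, N]) b t.
  rewrite -RintegralZl; [|by []|exact: l1].
  rewrite -RintegralB; [|by []|exact: q1|exact: (locintZ _ l1)].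
  by apply: eq_Rintegral => t _; ring.
rewrite -[RHS]E /c /kap !fin; [|by move=> t /out[_ ->]|by move=> t /out[-> _]; rewrite mulr0].
have -> : \int[mu]_(t in `[- N, N]) (Q t * b0 t) = \int[mu]_(t in `[- N, N]) (b0 t * Q t).
  by apply: eq_Rintegral => t _; rewrite mulrC.
by congr (_ - _); rewrite mulrAC [RHS]mulrAC; congr (_ / _); rewrite mulrC.
Qed.

Lemma locL2_1_locint (f : R -> R) : locL2_1 f -> locint (fun t => f t ^+ 2).
Proof.
move=> [mf h] a b; have mI := measurable_itvR (Interval (BLeft a) (BRight b)).
have hM := h (`|a| + `|b|).
apply: integrableS hM => //.
  have -> : [set t | `|t| <= `|a| + `|b|] = `[- (`|a| + `|b|), `|a| + `|b|]%classic.
    by apply/seteqP; split => t /=; rewrite in_itv/= ler_norml.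
  exact: measurable_itvR.
move=> t /=; rewrite in_itv/= => /andP[t1 t2].
rewrite ler_norml; apply/andP; split.
  by apply: le_trans t1; rewrite lerNl (le_trans (ler_norm _))// normrN lerDl.
by rewrite (le_trans t2)// (le_trans (ler_norm _))// lerDr.
Qed.

Lemma is_wd_AC (y h : R -> R) : locL2_1 y -> locL2_1 h -> is_wd y h ->
  exists y1, AC y1 h /\ {ae mu, forall t, y t = y1 t}.
Proof.
move=> Ly Lh wd.
have ly := locint_sqr Ly.1 (locL2_1_locint Ly); have lh := locint_sqr Lh.1 (locL2_1_locint Lh).
have AP := prim_AC lh; set P := prim h in AP.
have lP := continuous_locint (AC_continuous AP).
have [c hc] : exists c, {ae mu, forall t, y t - P t = c}.
  apply: (du_bois_reymond (locintB ly lP)) => b tb.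
  have [Nb [Cb hb]] := test1_bound tb; have [db cb cb' _] := tb.
  pose N : R := Nb.+1%:R; have NN : 0 <= N := ler0n _ _.
  have out (t : R) : t <= - N \/ N <= t -> b t = 0 /\ derive1 b t = 0.
    move=> tN; have ht : N <= `|t|.
      by case: tN => h'; [rewrite -normrN (le_trans _ (ler_norm _))// lerNr|rewrite (le_trans h')// ler_norm].
    by have [_ _ /(_ _)[|-> ->]] := hb t; first by apply: lt_le_trans ht; rewrite ltr_nat.
  have fin (f : R -> R) : (forall t : R, t <= - N \/ N <= t -> f t = 0) -> \int[mu]_t f t = \int[mu]_(t in `[- N, N]) f t.
    exact: Rintegral_setT_itv.
  have Ab : AC b (derive1 b).
    by apply: AC_C1 => //; exact: test1_is_derive.
  have A := AC_mul AP Ab.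
  have e : \int[mu]_(t in `[- N, N]) (h t * b t + P t * derive1 b t) = 0.
    have NN2 : - N <= N by rewrite (le_trans _ NN)// oppr_le0.
    rewrite -A.2//.
    by rewrite (out N (or_intror (lexx _))).1 (out (- N) (or_introl (lexx _))).1 !mulr0 subrr.
  have l1 : locint (fun t => h t * b t) by apply: locint_eq (locint_cM cb lh) _ => t; rewrite mulrC.
  have l2 : locint (fun t => P t * derive1 b t) by apply: locint_eq (locint_cM cb' lP) _ => t; rewrite mulrC.
  have l3 : locint (fun t => y t * derive1 b t) by apply: locint_eq (locint_cM cb' ly) _ => t; rewrite mulrC.
  rewrite RintegralD// in e.
  have w : \int[mu]_t (y t * derive1 b t) = - \int[mu]_t (h t * b t).
    by have := wd _ tb; rewrite /Rintegral /leb1 => ->; rewrite fineN.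
  rewrite !fin in w; [|by move=> t /out[-> _]; rewrite mulr0|by move=> t /out[_ ->]; rewrite mulr0].
  rewrite fin; last by move=> t /out[_ ->]; rewrite mulr0.
  under eq_Rintegral do rewrite mulrBl.
  by rewrite RintegralB// w -opprD e oppr0.
exists (fun t => P t + c); split; last by apply: (ae_imp hc) => t <-; rewrite addrC subrK.
by apply: AC_eq (AC_lin 1 AP (AC_cst c)) _ _ => t; rewrite mul1r ?addr0.
Qed.

End one_dimensional.

Section energy1.
Context {R : realType}.
Local Notation mu := (@lebesgue_measure R).
Variables (f Phi : R -> R) (m p : R).
Hypotheses (dPhi : forall t, is_derive t (1 : R) Phi (f t)) (cf : continuous f).

Section curve.
Variables (y h : R -> R).
Hypotheses (A : AC y h) (yp : y t @[t --> +oo] --> p) (ym : y t @[t --> -oo] --> m).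

Let K t := h t ^+ 2 / 2 + f (y t) ^+ 2 / 2.
Let G t := (h t - f (y t)) ^+ 2 / 2.

Let K0 t : 0 <= K t.
Proof. by rewrite addr_ge0// divr_ge0// sqr_ge0. Qed.

Let G0 t : 0 <= G t.
Proof. by rewrite divr_ge0// sqr_ge0. Qed.

Let cfy : continuous (fun t => f (y t)).
Proof. by move=> t; apply: (@continuous_comp R R R y f); [exact: (AC_continuous A)|exact: cf]. Qed.

Let mK : measurable_fun setT K.
Proof.
have mh := locint_measurable A.1; have mfy := continuous_measurable_fun cfy.
by apply: measurable_funD; apply: measurable_funM => //; exact: measurable_funX.
Qed.

Let finK : (\int[mu]_t (K t)%:E < +oo)%E -> mu.-integrable setT (EFin \o K).
Proof. exact: integrable_lty_ge0. Qed.

(** [K - G] equals [f(y) h], the derivative of [Phi(y)]. *)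
Let gap N : 0 <= N -> mu.-integrable setT (EFin \o K) -> mu.-integrable `[- N, N] (EFin \o G) /\
  \int[mu]_(t in `[- N, N]) G t = \int[mu]_(t in `[- N, N]) K t - (Phi (y N) - Phi (y (- N))).
Proof.
move=> N0 iK; have NN : - N <= N by rewrite (le_trans _ N0)// oppr_le0.
have lK : locint K by move=> a b; apply: integrableS iK => //; exact: measurable_itvR.
have AP := AC_chain1 dPhi cf A; have l1 := AP.1.
rewrite AP.2// -RintegralB//; split; last by apply: eq_Rintegral => t _; rewrite /G /K; field.
by apply: locint_eq (locintB lK l1) _ _ _ => t; rewrite /G /K; field.
Qed.

Let cvgPhi : (Phi (y N) - Phi (y (- N))) @[N --> +oo] --> Phi p - Phi m.
Proof.
have cP : continuous Phi by exact: is_derive_continuous dPhi.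
apply: cvgB; first exact: (cvg_comp _ _ yp (cP p)).
have h1 : y (- N) @[N --> +oo] --> m by have /cvgNy_compNP := ym.
exact: (cvg_comp _ _ h1 (cP m)).
Qed.

Lemma energy1_ge : ((Phi p - Phi m)%:E <= \int[mu]_t (K t)%:E)%E.
Proof.
have [Ky|/finK iK] := leP +oo%E (\int[mu]_t (K t)%:E)%E; first by rewrite (le_trans _ Ky)// leey.
rewrite integral_EFin_Rintegral// lee_fin; apply: (cvgr_to_le cvgPhi).
near=> N; have N0 : 0 <= N by near: N; apply: nbhs_pinfty_ge; exact: num_real.
have [iG E] := gap N0 iK.
have := @ge0_Rintegral_subset _ _ _ mu `[- N, N] setT K (measurable_itvR _) measurableT (@subsetT _ _) K0 iK.
have : 0 <= \int[mu]_(t in `[- N, N]) G t by apply: Rintegral_ge0 => t _; exact: G0.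
by rewrite E; lra.
Unshelve. all: by end_near. Qed.

Lemma energy1_equality : (\int[mu]_t (K t)%:E <= (Phi p - Phi m)%:E)%E -> {ae mu, forall t, h t = f (y t)}.
Proof.
move=> le; have iK : mu.-integrable setT (EFin \o K) by apply: finK; exact: le_lt_trans le (ltry _).
rewrite integral_EFin_Rintegral// lee_fin in le.
have H : {ae mu, forall t (n : nat), `[- n%:R, n%:R]%classic t -> G t = 0}.
  apply: ae_foralln => n; have [iG _] := gap (ler0n _ n) iK.
  apply: (@ge0_Rintegral_eq0 _ _ _ mu _ G (measurable_itvR _) G0 iG).
  have cv : (Phi p - Phi m - (Phi (y N) - Phi (y (- N)))) @[N --> +oo] --> (Phi p - Phi m - (Phi p - Phi m)).
    by apply: cvgB; [exact: cvg_cst|exact: cvgPhi].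
  rewrite subrr in cv; apply: (cvgr_to_ge cv).
  near=> N; have nN : n%:R <= N by near: N; apply: nbhs_pinfty_ge; exact: num_real.
  have N0 : 0 <= N := le_trans (ler0n _ n) nN.
  have [iGN E] := gap N0 iK.
  have s1 := @ge0_Rintegral_subset _ _ _ mu `[- N, N] setT K (measurable_itvR _) measurableT (@subsetT _ _) K0 iK.
  have ss : `[- n%:R, n%:R]%classic `<=` `[- N, N]%classic.
    by apply: subset_itvScc; rewrite bnd_simp// lerN2.
  have s2 := @ge0_Rintegral_subset _ _ _ mu `[- n%:R, n%:R] `[- N, N] G (measurable_itvR _) (measurable_itvR _) ss G0 iGN.
  rewrite E in s2; apply: (le_trans s2); exact: lerB (le_trans s1 le) (lexx _).
apply: (ae_imp H) => t Ht.
have := Ht (Num.bound `|t|); rewrite /= in_itv/= -ler_norml => /(_ (ltW (archi_boundP (normr_ge0 t)))).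
by rewrite /G => /eqP; rewrite mulf_eq0 sqrf_eq0 invr_eq0 pnatr_eq0 orbF subr_eq0 => /eqP.
Unshelve. all: by end_near. Qed.

End curve.

(** Along a solution [f(y)^2] is the derivative of [Phi(y)], which is therefore nondecreasing, with
    limits [Phi m] and [Phi p]. *)
Lemma solution_energy (y : R -> R) : (forall t, is_derive t (1 : R) y (f (y t))) ->
  y t @[t --> +oo] --> p -> y t @[t --> -oo] --> m ->
  (\int[mu]_t (f (y t) ^+ 2)%:E = (Phi p - Phi m)%:E)%E.
Proof.
move=> dy yp ym; have cy : continuous y by apply: (is_derive_continuous (f' := fun t => f (y t))) => t; exact: dy.
have cfy : continuous (fun t => f (y t)).
  by move=> t; apply: (@continuous_comp R R R y f); [exact: cy|exact: cf].
have A : AC y (fun t => f (y t)) by exact: AC_C1.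
have AP := AC_chain1 dPhi cf A.
apply/le_anti/andP; split; last first.
  apply: (le_trans (energy1_ge A yp ym)); rewrite le_eqVlt; apply/orP; left; apply/eqP.
  by apply: eq_integral => t _; congr EFin; field.
have csq := continuous_sqr cfy; have lsq := continuous_locint csq.
apply: integral_exhaust => [|t|n]; [exact: continuous_measurable_fun|exact: sqr_ge0|].
have nn : - n%:R <= n%:R :> R by rewrite (le_trans _ (ler0n _ n))// oppr_le0.
rewrite (integral_EFin_Rintegral (measurable_itvR _) (lsq _ _)).
rewrite lee_fin.
have -> : \int[mu]_(t in `[- n%:R, n%:R]) f (y t) ^+ 2 = Phi (y n%:R) - Phi (y (- n%:R)).
  by rewrite AP.2//; apply: eq_Rintegral => t _; rewrite expr2.
have mono a b : a <= b -> Phi (y a) <= Phi (y b).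
  by move=> ab; rewrite -subr_ge0 AP.2//; apply: Rintegral_ge0 => t _; rewrite -expr2 sqr_ge0.
have cP : continuous Phi by exact: is_derive_continuous dPhi.
apply: lerB.
  apply: (cvgr_to_ge (cvg_comp _ _ yp (cP p))).
  near=> t; apply: mono; near: t; apply: nbhs_pinfty_ge; exact: num_real.
apply: (cvgr_to_le (cvg_comp _ _ ym (cP m))).
near=> t; apply: mono; near: t; apply: nbhs_ninfty_le; exact: num_real.
Unshelve. all: by end_near. Qed.

End energy1.

(** * Essential limits and weak derivatives on the line *)

Section limits.
Context {R : realType}.
Local Notation mu := (@lebesgue_measure R).

Lemma ae_itv_exists (P : R -> Prop) (a b : R) : a < b -> {ae mu, forall t, P t} -> exists2 t, a < t < b & P t.
Proof.
move=> ab [N [mN N0 sN]]; apply: contrapT => h.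
have mab : measurable (`]a, b[%classic : set (measurableTypeR R)) by exact: measurable_itvR.
have : (mu `]a, b[ <= mu N)%E.
  apply: (@le_measure _ _ _ mu); rewrite ?inE//.
  by move=> t; rewrite /= in_itv/= => tab; apply: sN => /= Pt; apply: h; exists t.
by rewrite N0 lebesgue_measure_itv/= lte_fin ab -EFinB lee_fin subr_le0 leNgt ab.
Qed.

(** Each point has arbitrarily close neighbours outside the null set, and continuity carries the
    bound back from them. *)
Lemma elim_pinfty_cvg (z y : R -> R) (l : R) : continuous y -> {ae mu, forall t, z t = y t} ->
  elim_pinfty z l -> y t @[t --> +oo] --> l.
Proof.
move=> cy zy zl; apply/cvgrPdist_lt => e e0; have e2 : 0 < e / 2 by rewrite divr_gt0.
have [M hM] := zl _ e2; exists M; split; first exact: num_real.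
move=> t Mt; have /cvgrPdist_lt/(_ _ e2)/nbhs_ballP[d /= d0 hd] := cy t.
have td : t < t + d by rewrite ltrDl.
have [s /andP[ts sd] hs] := ae_itv_exists td (ae_imp2 zy hM (fun s q h => conj q h)).
have := hd s; rewrite /ball /= distrC ger0_norm ?subr_ge0 ?(ltW ts)// => /(_ _); rewrite ltrBlDl => /(_ sd) h1.
have [_ /(_ (lt_trans Mt ts))] := hs; rewrite hs.1 => h2.
by have := ler_distD (y s) (y t) l; rewrite distrC; lra.
Qed.

Lemma elim_minfty_cvg (z y : R -> R) (l : R) : continuous y -> {ae mu, forall t, z t = y t} ->
  elim_minfty z l -> y t @[t --> -oo] --> l.
Proof.
move=> cy zy zl; apply/cvgrPdist_lt => e e0; have e2 : 0 < e / 2 by rewrite divr_gt0.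
have [M hM] := zl _ e2; exists M; split; first exact: num_real.
move=> t Mt; have /cvgrPdist_lt/(_ _ e2)/nbhs_ballP[d /= d0 hd] := cy t.
have td : t - d < t by rewrite gtrDl oppr_lt0.
have [s /andP[ts sd] hs] := ae_itv_exists td (ae_imp2 zy hM (fun s q h => conj q h)).
have := hd s; rewrite /ball /= ger0_norm ?subr_ge0 ?(ltW sd)// => /(_ _); rewrite ltrBlDl -ltrBlDr => /(_ ts) h1.
have [_ /(_ (lt_trans sd Mt))] := hs; rewrite hs.1 => h2.
by have := ler_distD (y s) (y t) l; rewrite distrC; lra.
Qed.

Lemma cvg_elim_pinfty (y : R -> R) (l : R) : y t @[t --> +oo] --> l -> elim_pinfty y l.
Proof.
move=> /cvgrPdist_lt h e e0; have [M [_ hM]] := h e e0.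
by exists M; apply: aeW => t Mt; rewrite distrC; exact: hM.
Qed.

Lemma cvg_elim_minfty (y : R -> R) (l : R) : y t @[t --> -oo] --> l -> elim_minfty y l.
Proof.
move=> /cvgrPdist_lt h e e0; have [M [_ hM]] := h e e0.
by exists M; apply: aeW => t Mt; rewrite distrC; exact: hM.
Qed.

Lemma derive1_support (g : R -> R) (M : R) : (forall t, M < `|t| -> g t = 0) -> forall t, M < `|t| -> derive1 g t = 0.
Proof.
move=> h t Mt; rewrite derive1E.
have -> : 'D_1 g t = 'D_1 (cst 0 : R -> R) t.
  apply: near_eq_derive; near=> x; apply: h.
  near: x; apply: (@cvgr_norm_gt _ _ _ _ _ id t) => //; exact: cvg_id.
exact: derive_cst.
Unshelve. all: by end_near. Qed.

Lemma integral_support d (T : measurableType d) (nu : {measure set T -> \bar R}) (A : set T) (f : T -> R) :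
  measurable A -> (forall x, ~ A x -> f x = 0) -> nu.-integrable A (EFin \o f) ->
  (\int[nu]_x (f x)%:E = (\int[nu]_(x in A) f x)%:E)%E.
Proof.
move=> mA f0 iA; rewrite -integral_EFin_Rintegral// [RHS]integral_mkcond.
apply: eq_integral => x _; rewrite patchE; case: ifPn => // /negP; rewrite inE => nA.
by rewrite f0.
Qed.

Lemma AC_is_wd (y h : R -> R) : AC y h -> is_wd y h.
Proof.
move=> A b tb; have [Nb [Cb hb]] := test1_bound tb; have [db cb cb' _] := tb.
pose N : R := Nb.+1%:R; have N0 : 0 <= N := ler0n _ _.
have NN : - N <= N by rewrite (le_trans _ N0)// oppr_le0.
have out (t : R) : N <= `|t| -> b t = 0 /\ derive1 b t = 0.
  by move=> ht; have [_ _ /(_ _)[|-> ->]] := hb t; first by apply: lt_le_trans ht; rewrite ltr_nat.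
have Ab : AC b (derive1 b) by apply: AC_C1 => //; exact: test1_is_derive.
have AM := AC_mul A Ab.
have l1 : locint (fun t => h t * b t) by apply: locint_eq (locint_cM cb A.1) _ => t; rewrite mulrC.
have l2 : locint (fun t => y t * derive1 b t) by exact: (locint_cM (AC_continuous A) Ab.1).
have mI := measurable_itvR (Interval (BLeft (- N)) (BRight N)).
have no (t : R) : ~ `[- N, N]%classic t -> N <= `|t|.
  by rewrite /= in_itv/= -ler_norml => /negP; rewrite -ltNge => /ltW.
rewrite /leb1 (@integral_support _ _ mu `[- N, N] (fun t => y t * derive1 b t) mI _ (l2 _ _)); last first.
  by move=> t /no/out[_ ->]; rewrite mulr0.
rewrite (@integral_support _ _ mu `[- N, N] (fun t => h t * b t) mI _ (l1 _ _)); last first.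
  by move=> t /no/out[-> _]; rewrite mulr0.
rewrite -EFinN; congr EFin; apply/eqP; rewrite -addr_eq0 addrC -RintegralD//.
rewrite -AM.2// (out N _).1 ?ger0_norm// (out (- N) _).1 ?normrN ?ger0_norm//.
by rewrite !mulr0 subrr.
Qed.

End limits.

(** * Functions of the first variable as competitors on the cylinder *)

Section tensor.
Context {R : realType}.
Local Notation mu := (@lebesgue_measure R).
Local Notation mu2 := (@lebesgue_measure R \x @lebesgue_measure R)%E.

Lemma locL2_2_continuous (F : R * R -> R) : continuous F -> locL2_2 F.
Proof.
move=> cF; split; first exact: continuous_measurable2.
move=> M; have -> : box M = [set` `[- M, M]] `*` [set` `[- M, M]].
  by apply/seteqP; split=> z; rewrite /box /= !in_itv/= -!ler_norml.
have c2 : continuous (fun x => F x ^+ 2).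
  by move=> x; apply: (@continuous_comp _ _ _ F (fun z => z ^+ 2)); [exact: cF|exact: exprn_continuous].
exact: continuous_integrable2.
Qed.

Section product.
Variables (y h : R -> R) (phi : R * R -> R).
Hypotheses (A : AC y h) (ch : continuous h) (tphi : test2 phi).

Let support : exists2 N : R, 0 <= N & forall x : R * R, N <= `|x.1| \/ N <= `|x.2| ->
  [/\ phi x = 0, pd1 phi x = 0 & pd2 phi x = 0].
Proof.
have [_ _ _ _ [M hM]] := tphi; exists (`|M| + 1); first by rewrite addr_ge0.
have MN : M < `|M| + 1 by rewrite (le_lt_trans (ler_norm M))// ltrDl.
move=> [t s] /= ts; have ts' : M < `|t| \/ M < `|s|.
  by case: ts => q; [left|right]; exact: lt_le_trans q.
split; first exact: hM.
- rewrite /pd1 /=; case: ts' => q.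
    by apply: (derive1_support _ q) => x Mx; apply: hM; left.
  have -> : (fun t0 => phi (t0, s)) = cst 0 by apply/funext => x; apply: hM; right.
  by rewrite derive1_cst.
- rewrite /pd2 /=; case: ts' => q; last by apply: (derive1_support _ q) => x Mx; apply: hM; right.
  have -> : (fun s0 => phi (t, s0)) = cst 0 by apply/funext => x; apply: hM; left.
  by rewrite derive1_cst.
Qed.

Let c1 (k : R -> R) : continuous k -> continuous (fun x : R * R => k x.1).
Proof. by move=> ck x; apply: (@continuous_comp _ _ _ fst k); [exact: cvg_fst|exact: ck]. Qed.

Lemma is_wpd1_product : (\int[mu2]_x (y x.1 * pd1 phi x)%:E = - \int[mu2]_x (h x.1 * phi x)%:E)%E.
Proof.
have [hp cp cp1 cp2 _] := tphi; have [N N0 hN] := support.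
have cy := AC_continuous A.
have NN : - N <= N by rewrite (le_trans _ N0)// oppr_le0.
have Nn : N <= `|- N| by rewrite normrN ler_norm.
pose B := [set` `[- N, N]] `*` [set` `[- N, N]] : set (R * R).
have mB : measurable (B : set (measurableTypeR R * measurableTypeR R)) by exact: measurable_rectR.
have no (x : R * R) : ~ B x -> N <= `|x.1| \/ N <= `|x.2|.
  by move=> /not_andP[]; rewrite /= in_itv/= -ler_norml => /negP; rewrite -ltNge => /ltW q; [left|right].
have k1 : continuous (fun x : R * R => y x.1 * pd1 phi x).
  by have c := c1 cy => x; apply: cvgM; [exact: c|exact: cp1].
have k2 : continuous (fun x : R * R => h x.1 * phi x).
  by have c := c1 ch => x; apply: cvgM; [exact: c|exact: cp].
have i1 := continuous_integrable2 (- N) N (- N) N k1.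
have i2 := continuous_integrable2 (- N) N (- N) N k2.
rewrite !(@integral_support R _ _ mu2 B)//; [|by move=> x /no/hN[-> _ _]; rewrite mulr0|by move=> x /no/hN[_ -> _]; rewrite mulr0].
rewrite -EFinN; congr EFin; apply/eqP; rewrite -addr_eq0 addrC -RintegralD//.
have i12 : mu2.-integrable B (EFin \o (fun x : R * R => h x.1 * phi x + y x.1 * pd1 phi x)).
  have := integrableD mB i2 i1; by apply: eq_integrable => // z _ /=; rewrite EFinD.
rewrite (fubini_rect2 (measurable_itvR _) (measurable_itvR _) i12).
rewrite (@eq_Rintegral _ _ _ mu _ (fun=> 0)); first by rewrite Rintegral_itv_cst// mul0r.
move=> s _; have dphi := AC_line1 s (has_pd_is_derive1 hp) cp1.
rewrite -(AC_mul A dphi).2//.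
have [-> _ _] := hN (N, s) (or_introl (ler_norm _)).
have [-> _ _] := hN (- N, s) (or_introl Nn).
by rewrite !mulr0 subrr.
Qed.

Lemma is_wpd2_product : (\int[mu2]_x (y x.1 * pd2 phi x)%:E = 0)%E.
Proof.
have [hp cp cp1 cp2 _] := tphi; have [N N0 hN] := support.
have cy := AC_continuous A.
have NN : - N <= N by rewrite (le_trans _ N0)// oppr_le0.
have Nn : N <= `|- N| by rewrite normrN ler_norm.
pose B := [set` `[- N, N]] `*` [set` `[- N, N]] : set (R * R).
have mB : measurable (B : set (measurableTypeR R * measurableTypeR R)) by exact: measurable_rectR.
have no (x : R * R) : ~ B x -> N <= `|x.1| \/ N <= `|x.2|.
  by move=> /not_andP[]; rewrite /= in_itv/= -ler_norml => /negP; rewrite -ltNge => /ltW q; [left|right].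
have k1 : continuous (fun x : R * R => y x.1 * pd2 phi x).
  by have c := c1 cy => x; apply: cvgM; [exact: c|exact: cp2].
have i1 := continuous_integrable2 (- N) N (- N) N k1.
rewrite (@integral_support R _ _ mu2 B)//; last by move=> x /no/hN[_ _ ->]; rewrite mulr0.
congr EFin; rewrite (fubini_rect1 (measurable_itvR _) (measurable_itvR _) i1).
rewrite (@eq_Rintegral _ _ _ mu _ (fun=> 0)); first by rewrite Rintegral_itv_cst// mul0r.
move=> t _; have dphi := AC_line2 t (has_pd_is_derive2 hp) cp2.
rewrite /= RintegralZl//; last exact: dphi.1.
rewrite -dphi.2//.
have [-> _ _] := hN (t, N) (or_intror (ler_norm _)).
have [-> _ _] := hN (t, - N) (or_intror Nn).
by rewrite subrr mulr0.
Qed.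

End product.

Lemma H1loc_product (y h : R -> R) : AC y h -> continuous h ->
  H1loc (fun x => y x.1) (fun x => h x.1) (fun=> 0).
Proof.
move=> A ch; have cy := AC_continuous A.
have c1 (k : R -> R) : continuous k -> continuous (fun x : R * R => k x.1).
  by move=> ck x; apply: (@continuous_comp _ _ _ fst k); [exact: cvg_fst|exact: ck].
split; [exact: locL2_2_continuous (c1 _ cy)|exact: locL2_2_continuous (c1 _ ch)|by apply: locL2_2_continuous => x; exact: cvg_cst|..].
- by move=> phi tphi; exact: is_wpd1_product.
- move=> phi tphi; rewrite (is_wpd2_product A)//.
  by under eq_integral do rewrite mul0r; rewrite integral0 oppe0.
Qed.

Lemma integral_Omega_product (k : R -> R) : measurable_fun setT k -> (forall t, 0 <= k t) ->
  (\int[mu2]_(x in Omega R) (k x.1)%:E = \int[mu]_t (k t)%:E)%E.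
Proof.
move=> mk k0; have mk2 : measurable_fun setT (fun x : R * R => k x.1) by apply: (measurableT_comp mk).
rewrite integral_Omega_strip// strip_slices//; apply: eq_integral => t _ /=.
by rewrite integral_cst//= lebesgue_measure_itv/= lte_fin ltr01 sube0 mule1.
Qed.

Lemma avg_product (k : R -> R) : avg (fun x => k x.1) = k.
Proof.
apply/funext => t; rewrite /avg /=.
have -> : [set s : R | 0 <= s /\ s < 1] = `[0, 1[%classic.
  by apply/seteqP; split => s /=; rewrite in_itv/= => /andP.
by rewrite integral_cst//= lebesgue_measure_itv/= lte_fin ltr01 sube0 mule1.
Qed.

End tensor.

(** * Minimizers of the one-dimensional problem *)

Section minimizers.
Context {R : realType}.
Local Notation mu := (@lebesgue_measure R).
Local Notation mu2 := (@lebesgue_measure R \x @lebesgue_measure R)%E.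
Variables (w Phi1 psi : R * R -> R) (w1 w2 : R * R -> R) (a m p : R).
Hypotheses (Cw : C1with w w1 w2) (CPhi : C1with Phi1 psi w).

Let f (s : R) := w (a, s).
Let Phi (s : R) := Phi1 (a, s).
Let dPhi s : is_derive s (1 : R) Phi (f s).
Proof. by have [_ d _ _] := CPhi; exact: (d (a, s)). Qed.
Let df s : is_derive s (1 : R) f (w2 (a, s)).
Proof. by have [_ d _ _] := Cw; exact: (d (a, s)). Qed.
Let cf' : continuous (fun s => w2 (a, s)).
Proof. by have [_ _ _ c] := Cw; exact: continuous_slice2. Qed.
Let cf : continuous f.
Proof. exact: is_derive_continuous df. Qed.

Definition heteroclinic_orbit (y : R -> R) := [/\ forall t, is_derive t (1 : R) y (w (a, y t)),
  y t @[t --> +oo] --> p & y t @[t --> -oo] --> m].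

Lemma admissible1_AC gam h : admissible1 a m p gam h -> exists y, [/\ AC y h, {ae mu, forall t, (gam t).2 = y t},
  y t @[t --> +oo] --> p & y t @[t --> -oo] --> m].
Proof.
move=> [_ [Ly Lh] wd _ [gm gp]]; have [y [A e]] := is_wd_AC Ly Lh wd.
have cy := AC_continuous A; exists y; split => //.
  exact: elim_pinfty_cvg cy e gp.
exact: elim_minfty_cvg cy e gm.
Qed.

Lemma energy1_AC gam h y : admissible1 a m p gam h -> AC y h -> {ae mu, forall t, (gam t).2 = y t} ->
  (energy1 (Wof w) gam h = \int[mu]_t (h t ^+ 2 / 2 + f (y t) ^+ 2 / 2)%:E)%E.
Proof.
move=> [ga [[mg _] [mh _]] _ _ _] A e; have cw := C1with_continuous Cw.
have gE t : gam t = (a, (gam t).2) by rewrite [LHS]surjective_pairing ga.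
have mf2 (k : R -> R) : measurable_fun setT k -> measurable_fun setT (fun t => (h t ^+ 2 / 2 + f (k t) ^+ 2 / 2)%:E).
  move=> mk; apply/measurable_EFinP; have mfk := measurableT_comp (continuous_measurable_fun cf) mk.
  by apply: measurable_funD; apply: measurable_funM => //; exact: measurable_funX.
rewrite /energy1 /leb1; apply: ae_eq_integral => //.
- have -> : (fun t => (h t ^+ 2 / 2 + Wof w (gam t))%:E) = (fun t => (h t ^+ 2 / 2 + f (gam t).2 ^+ 2 / 2)%:E).
    by apply/funext => t; rewrite gE.
  exact: mf2.
- by apply: mf2; apply: continuous_measurable_fun; exact: AC_continuous A.
- by apply: (ae_imp e) => t <- _; rewrite /f -gE.
Qed.

Lemma orbit_continuous y : heteroclinic_orbit y -> continuous y /\ continuous (fun t => w (a, y t)).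
Proof.
move=> [dy _ _]; have cy : continuous y by apply: (is_derive_continuous (f' := fun t => w (a, y t))) => t; exact: dy.
by split => // t; apply: (@continuous_comp R R R y f); [exact: cy|exact: cf].
Qed.

Lemma orbit_AC y : heteroclinic_orbit y -> AC y (fun t => w (a, y t)).
Proof. by move=> Hy; have [dy _ _] := Hy; have [_ c] := orbit_continuous Hy; exact: AC_C1. Qed.

Lemma orbit_energy y : heteroclinic_orbit y ->
  (\int[mu]_t (w (a, y t) ^+ 2)%:E = (Phi1 (a, p) - Phi1 (a, m))%:E)%E.
Proof. by move=> [dy yp ym]; exact: (solution_energy dPhi cf dy yp ym). Qed.

Lemma orbit_admissible1 y : heteroclinic_orbit y -> admissible1 a m p (fun t => (a, y t)) (fun t => w (a, y t)).
Proof.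
move=> Hy; have [dy yp ym] := Hy; have [cy ch] := orbit_continuous Hy.
have L (k : R -> R) : continuous k -> locL2_1 k.
  move=> ck; split; first exact: continuous_measurable_fun.
  move=> M; have -> : [set t | `|t| <= M] = `[- M, M]%classic.
    by apply/seteqP; split => t /=; rewrite in_itv/= ler_norml.
  exact: (continuous_locint (continuous_sqr ck)).
split => //.
- by split; exact: L.
- exact: AC_is_wd (orbit_AC Hy).
- by rewrite /leb1 orbit_energy// ltry.
- by split; [exact: cvg_elim_minfty|exact: cvg_elim_pinfty].
Qed.

Lemma orbit_energy1 y : heteroclinic_orbit y ->
  energy1 (Wof w) (fun t => (a, y t)) (fun t => w (a, y t)) = (Phi1 (a, p) - Phi1 (a, m))%:E.
Proof.
move=> Hy; rewrite -(orbit_energy Hy); by apply: eq_integral => t _; congr EFin; rewrite /Wof; field.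
Qed.

Lemma orbit_minimizer1 y : heteroclinic_orbit y -> minimizer1 (Wof w) a m p (fun t => (a, y t)).
Proof.
move=> Hy; exists (fun t => w (a, y t)); split; first exact: orbit_admissible1.
move=> gam h ad; rewrite orbit_energy1//; have [z [A e zp zm]] := admissible1_AC ad.
by rewrite (energy1_AC ad A e); exact: (energy1_ge dPhi cf A zp zm).
Qed.

(** The derivative agrees almost everywhere with the continuous function [w(a, y)], so [y] solves
    the equation classically. *)
Lemma AC_orbit y h : AC y h -> {ae mu, forall t, h t = w (a, y t)} -> y t @[t --> +oo] --> p ->
  y t @[t --> -oo] --> m -> heteroclinic_orbit y.
Proof.
move=> A e yp ym; split => //; have cy := AC_continuous A.
have ch : continuous (fun t => f (y t)).
  by move=> t; apply: (@continuous_comp R R R y f); [exact: cy|exact: cf].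
exact: AC_derive (AC_ext A (fun=> erefl) (continuous_measurable_fun ch) e) ch.
Qed.

(** Comparison with the orbit forces equality in the lower energy bound, so [gam] solves the same
    equation. *)
Lemma minimizer1_unique y gam : m != p -> heteroclinic_orbit y -> minimizer1 (Wof w) a m p gam ->
  exists tau : R, {ae mu, forall t, gam t = (a, y (t + tau))}.
Proof.
move=> mp Hy [h [ad le]]; have [z [A e zp zm]] := admissible1_AC ad.
have := le _ _ (orbit_admissible1 Hy); rewrite orbit_energy1// (energy1_AC ad A e) => le1.
have [dz _ _] := AC_orbit A (energy1_equality dPhi cf A zp zm le1) zp zm.
have [dy yp ym] := Hy.
have [tau ztau] := autonomous_unique df cf' mp dy dz yp ym zp zm.
exists tau; apply: (ae_imp e) => t et; rewrite [gam t]surjective_pairing et ztau.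
by have [-> _ _ _ _] := ad.
Qed.

Lemma orbit_competitor y : heteroclinic_orbit y -> exists v Dv, admissible2 a m p v Dv /\
  energy2 (Wof w) v Dv = (Phi1 (a, p) - Phi1 (a, m))%:E.
Proof.
move=> Hy; have [dy yp ym] := Hy; have [cy ch] := orbit_continuous Hy; have A := orbit_AC Hy.
exists (fun x => (a, y x.1)), (fun x => ((0, 0), (w (a, y x.1), 0))).
have gE (x : R * R) : gradsq (fun x => ((0, 0), (w (a, y x.1), 0))) x = w (a, y x.1) ^+ 2.
  by rewrite /gradsq /sqn /= expr0n/= !addr0 add0r.
have msq : measurable_fun setT (fun t => w (a, y t) ^+ 2).
  by apply: measurable_funX; exact: continuous_measurable_fun.
split; first split.
- by [].
- split; last exact: (H1loc_product A ch).
  by apply: (H1loc_product (AC_cst a)) => x; exact: cvg_cst.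
- under eq_integral do rewrite gE.
  by rewrite (integral_Omega_product msq) ?orbit_energy ?ltry// => t; exact: sqr_ge0.
- by apply: aeW => x; rewrite addr0.
- have := avg_product (fun=> a); have := avg_product y => /= -> ->.
  split; [|exact: cvg_elim_minfty| |exact: cvg_elim_pinfty];
    by [apply: cvg_elim_minfty; exact: cvg_cst|apply: cvg_elim_pinfty; exact: cvg_cst].
rewrite /energy2 -(orbit_energy Hy) -integral_Omega_product//; last by move=> t; exact: sqr_ge0.
by apply: eq_integral => x _; rewrite gE /Wof; congr EFin; field.
Qed.

End minimizers.

(** * Rigidity *)

Section periodic_ae.
Context {R : realType}.
Local Notation mu := (@lebesgue_measure R).
Local Notation mu2 := (@lebesgue_measure R \x @lebesgue_measure R)%E.

(** Integer translates of the closed strip cover the plane; translations are by natural numbers in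
    either direction, hence the two signs of the integer part. *)
Lemma ae_strip_plane (v : R * R -> R) (c : R) : measurable_fun setT v -> (forall t s, v (t, s + 1) = v (t, s)) ->
  {ae mu2, forall z, strip z -> v z = c} -> {ae mu2, forall z, v z = c}.
Proof.
move=> mv per e; apply: ae_prod1_conv; first by apply: measurable_eqset => //; exact: measurable_cst.
apply: (ae_imp (ae_prod1 e)) => t et.
have pern (n : nat) (s : R) : v (t, s + n%:R) = v (t, s).
  by elim: n s => [|n IH] s; [rewrite addr0|rewrite -addn1 natrD addrA per IH].
have pos : {ae mu, forall s (n : nat), strip (t, s + n%:R) -> v (t, s) = c}.
  by apply: ae_foralln => n; apply: (ae_imp (ae_shift n%:R et)) => s h1 /h1; rewrite pern.
have neg : {ae mu, forall s (n : nat), strip (t, s - n%:R) -> v (t, s) = c}.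
  apply: ae_foralln => n; apply: (ae_imp (ae_shift (- n%:R) et)) => s h1 /h1.
  by rewrite -(pern n (s - n%:R)) subrK.
apply: (ae_imp2 pos neg) => s h1 h2.
have fl := floor_itv (s : R).
have inT (x : R) : 0 <= x <= 1 -> strip (t, x) by move=> hx; split => //=; rewrite in_itv.
have /andP[f0 f1] := fl; rewrite intrD1 in f1.
case E : (Num.floor s) f0 f1 => [n|n] f0 f1.
  have g0 : n%:R <= s := f0; have g1 : s < n%:R + 1 := f1.
  by apply: (h2 n); apply: inT; rewrite subr_ge0 g0/= lerBlDl ltW.
rewrite NegzE mulrNz in f0 f1; have g0 : - n.+1%:R <= s := f0; have g1 : s < - n.+1%:R + 1 := f1.
by apply: (h1 n.+1); apply: inT; rewrite -lerBlDr sub0r g0/= -lerBrDr [1 - _]addrC ltW.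
Qed.

End periodic_ae.

Section rigidity.
Context {R : realType}.
Local Notation mu := (@lebesgue_measure R).
Local Notation mu2 := (@lebesgue_measure R \x @lebesgue_measure R)%E.
Variables (a m p : R) (u1 a1 b1 D11 D12 u2 a2 b2 D21 D22 : R * R -> R).
Hypothesis S : Setup a m p u1 a1 b1 D11 D12 u2 a2 b2 D21 D22.

Let S1 := st1 S.
Let S2 := st2 S.
Let strip_itv t (s : R) : 0 <= s <= 1 -> strip (t, s).
Proof. by move=> hs; split => //=; rewrite in_itv. Qed.

(** On a column [a - u1] has zero mean. The maximum with 0 makes the integrand nonnegative at every
    point, the bound [u1 <= a] being known almost everywhere only. *)
Lemma constant_from_above : {ae mu2, forall z, strip z -> u1 z <= a} -> {ae mu2, forall z, u1 z = a}.
Proof.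
move=> le; have mu1 := sob_m S1; apply: ae_strip_plane => //; first exact: sob_per S1.
have me : measurable ((fun z => strip z -> u1 z = a) : set (measurableTypeR R * measurableTypeR R)).
  have -> : (fun z => strip z -> u1 z = a) = (~` strip) `|` (fun z => u1 z = a).
    apply/seteqP; split => z; last by case.
    by move=> h; have [sz|nz] := pselect (strip z); [right; exact: h|left].
  apply: measurableU; first by apply: measurableC; exact: measurable_stripR.
  by apply: measurable_eqset => //; exact: measurable_cst.
apply: (ae_prod1_conv me).
apply: (ae_imp3 (Sob_vline S1) (Sob_vline S2) (ae_prod1 le)) => t v1 v2 lt.
have [A _ e _ _] := v1; have cb := AC_continuous A.
have ca : continuous (fun s => a - b1 (t, s)).
  by move=> s; apply: cvgB; [exact: cvg_cst|exact: cb].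
have cm : continuous (fun s => Num.max (a - b1 (t, s)) 0) by move=> s; apply: (@continuous_comp R R R (fun s => a - b1 (t, s)) (fun x => Num.max x 0)); [exact: ca|exact: continuous_pos].
have la := continuous_locint ca; have lm := continuous_locint cm.
have lc : locint (fun=> a) by apply: continuous_locint => x; exact: cvg_cst.
have m01 := measurable_itvR (Interval (BLeft (0 : R)) (BRight 1)).
have E : \int[mu]_(s in `[0, 1]) Num.max (a - b1 (t, s)) 0 = 0.
  rewrite (@ae_eq_Rintegral _ _ _ mu _ _ (fun s => a - b1 (t, s)))//.
  - rewrite RintegralB; [|exact: m01|exact: lc|exact: (continuous_locint cb)].
    by rewrite Rintegral_itv_cst ?ler01// subr0 mulr1 (avg_b1 S v1 v2) subrr.
  - by apply: measurable_funTS; exact: continuous_measurable_fun.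
  - by apply: measurable_funTS; exact: continuous_measurable_fun.
  - apply: (ae_imp2 e lt) => s [es _] ls; rewrite /= in_itv/= => s01.
    by rewrite max_l// subr_ge0 -es; apply: ls; exact: strip_itv.
have z0 := @ge0_Rintegral_eq0 _ _ _ mu `[0, 1] (fun s => Num.max (a - b1 (t, s)) 0) m01 _ (lm _ _).
have pos0 s : 0 <= Num.max (a - b1 (t, s)) 0 by rewrite le_max lexx orbT.
rewrite E lexx in z0; have {}z0 := z0 pos0 isT.
apply: (ae_imp3 e lt z0) => s [es _] ls zs st; have s01 : `[0, 1]%classic s by case: st.
apply/le_anti; rewrite ls//= es -subr_le0 -(zs s01) le_max lexx//.
Qed.

(** Almost every row in the strip is constant, and good slices give on it values within
    [1 / (n + 1)] of [a] for every [n]. *)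
Lemma constant_from_derivative : {ae mu2, forall z, strip z -> D11 z = 0} -> {ae mu2, forall z, u1 z = a}.
Proof.
move=> D0; have mu1 := sob_m S1; apply: ae_strip_plane => //; first exact: sob_per S1.
have me : measurable ((fun z => strip z -> u1 z = a) : set (measurableTypeR R * measurableTypeR R)).
  have -> : (fun z => strip z -> u1 z = a) = (~` strip) `|` (fun z => u1 z = a).
    apply/seteqP; split => z; last by case.
    by move=> h; have [sz|nz] := pselect (strip z); [right; exact: h|left].
  apply: measurableU; first by apply: measurableC; exact: measurable_stripR.
  by apply: measurable_eqset => //; exact: measurable_cst.
apply: (ae_prod2_conv me).
have slices : {ae mu, forall s (n : nat), 0 <= s <= 1 -> exists t, `|a1 (t, s) - a| <= n.+1%:R^-1}.
  apply: ae_foralln => n; have n0 : 0 < n.+1%:R^-1 :> R by rewrite invr_gt0.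
  have [t [_ [[A _ e _ _] _ _ hb]]] := good_pos S 0 n0.
  by apply: (ae_imp e) => s [_ e2] s01; exists t; rewrite e2; have [] := hb s s01.
apply: (ae_imp3 (Sob_hline S1) (ae_prod2 D0) slices) => s [A e] D0s hs.
have [s01|ns] := boolP (0 <= s <= 1); last first.
  by apply: aeW => t [_]; rewrite /= in_itv/= => h; rewrite h in ns.
have cst t t' : a1 (t, s) = a1 (t', s).
  by apply: (AC_der0_cst A); apply: (ae_imp D0s) => x; apply; exact: strip_itv.
apply: (ae_imp e) => t -> _; apply/eqP; rewrite -subr_eq0 -normr_le0; apply/ler_addgt0Pr => e0 e00.
have [n hn] := invn_small e00; have [t' ht] := hs n s01.
by rewrite add0r (cst t t') (le_trans ht)// ltW.
Qed.

Hypothesis u1a : {ae mu2, forall z, u1 z = a}.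

Let cca : continuous (fun _ : R => a).
Proof. by move=> x; exact: cvg_cst. Qed.

Lemma constant_D11 : {ae mu2, forall z, D11 z = 0}.
Proof.
have m1 := sob_m1 S1; apply: ae_prod2_conv; first by apply: measurable_eqset => //; exact: measurable_cst.
apply: (ae_imp2 (Sob_hline S1) (ae_prod2 u1a)) => s [A e] ua.
have h : (fun t => a1 (t, s)) =1 (fun=> a).
  apply: (ae_eq_continuous (AC_continuous A) cca).
  by apply: (ae_imp2 e ua) => t <-.
by apply: (AC_cst_der0 A) => t t'; rewrite !h.
Qed.

Lemma constant_D12 : {ae mu2, forall z, D12 z = 0}.
Proof.
have m2 := sob_m2 S1; apply: ae_prod1_conv; first by apply: measurable_eqset => //; exact: measurable_cst.
apply: (ae_imp2 (Sob_vline S1) (ae_prod1 u1a)) => t [A _ e _ _] ua.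
have h : (fun s => b1 (t, s)) =1 (fun=> a).
  apply: (ae_eq_continuous (AC_continuous A) cca).
  by apply: (ae_imp2 e ua) => s [<- _].
by apply: (AC_cst_der0 A) => s s'; rewrite !h.
Qed.

(** As [D22 = - D11 = 0], [u2] is constant on columns, and any typical row represents it. One such
    row in []0, 1[] is selected; its continuous representative is the profile. *)
Lemma one_dimensional_profile (w : R * R -> R) (sg : R) : continuous w ->
  {ae mu2, forall z, strip z -> D21 z - sg * D12 z = w (u1 z, u2 z)} ->
  exists y h, [/\ AC y h, {ae mu, forall t, h t = w (a, y t)}, {ae mu2, forall z, u2 z = y z.1},
    y t @[t --> +oo] --> p & y t @[t --> -oo] --> m].
Proof.
move=> cw eqw.
have D220 : {ae mu2, forall z, D22 z = 0}.
  by apply: (ae_imp2 (st_div S) constant_D11) => z + e; rewrite e add0r.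
have col : {ae mu, forall t, vline u2 a2 b2 D21 D22 t /\ forall s, b2 (t, s) = b2 (t, 0)}.
  apply: (ae_imp2 (Sob_vline S2) (ae_prod1 D220)) => t v D0; split => // s.
  by have [A _ _ _ _] := v; exact: (AC_der0_cst A D0).
have mb0 : measurable_fun setT (fun z : R * R => b2 (z.1, 0)).
  by apply: (measurableT_comp (sob_mb S2)); apply: measurable_fun_pair => //; exact: measurable_fst.
have mu2' := sob_m S2.
have E : {ae mu2, forall z, u2 z = b2 (z.1, 0)}.
  apply: ae_prod1_conv; first exact: measurable_eqset.
  apply: (ae_imp col) => t [[_ _ e _ _] bc].
  by apply: (ae_imp e) => s [-> _]; exact: bc.
have ae1 : {ae mu2, forall z, strip z -> D21 z = w (a, u2 z)}.
  by apply: (ae_imp3 eqw u1a constant_D12) => z + e1 e2 sz; rewrite e1 e2 mulr0 subr0; exact.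
have [s s01 [[A e] Es ws]] : exists2 s, 0 < s < 1 & [/\ hline u2 a2 D21 s,
    {ae mu, forall t, u2 (t, s) = b2 (t, 0)} & {ae mu, forall t, strip (t, s) -> D21 (t, s) = w (a, u2 (t, s))}].
  apply: (ae_itv_exists ltr01).
  by apply: (ae_imp3 (Sob_hline S2) (ae_prod2 E) (ae_prod2 ae1)) => s h1 h2 h3; split.
have st t : strip (t, s) by apply: strip_itv; have /andP[q1 q2] := s01; rewrite !ltW.
pose y t := a2 (t, s); have cy : continuous y by exact: (AC_continuous A).
have by0 : {ae mu, forall t, b2 (t, 0) = y t} by apply: (ae_imp2 e Es) => t e1 <-.
have my : measurable_fun setT (fun z : R * R => y z.1).
  by apply: (measurableT_comp (continuous_measurable_fun cy)).
have avgy : {ae mu, forall t, avg u2 t = y t}.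
  apply: (ae_imp2 col by0) => t [v bc] <-; rewrite (avg_vline v mu2').
  by under eq_Rintegral do rewrite bc; rewrite Rintegral_itv_cst ?ler01// subr0 mulr1.
exists y, (fun t => D21 (t, s)); split => //.
- by apply: (ae_imp2 e ws) => t; rewrite /y => <-; apply; exact: st.
- apply: ae_prod1_conv; first exact: measurable_eqset.
  apply: (ae_imp2 (ae_prod1 E) by0) => t Et bt.
  by apply: (ae_imp Et) => s' ->.
- exact: elim_pinfty_cvg cy avgy (st_p2 S).
- exact: elim_minfty_cvg cy avgy (st_m2 S).
Qed.

End rigidity.

(** * From the minimizer to its one-dimensional form *)

Section assembly.
Context {R : realType}.
Local Notation mu := (@lebesgue_measure R).
Local Notation mu2 := (@lebesgue_measure R \x @lebesgue_measure R)%E.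

Lemma admissible2_Setup (a m p : R) (u : R * R -> R * R) D : admissible2 a m p u D ->
  exists a1 b1 a2 b2, Setup a m p (fun x => (u x).1) a1 b1 (fun x => (D x).1.1) (fun x => (D x).1.2)
    (fun x => (u x).2) a2 b2 (fun x => (D x).2.1) (fun x => (D x).2.2).
Proof.
move=> [per [H1 H2] fin dv [l1 l2 l3 l4]].
have [_ [m11 _] [m12 _] _ _] := H1; have [_ [m21 _] [m22 _] _ _] := H2.
have mg : measurable_fun setT (gradsq D).
  by apply: measurable_funD; apply: measurable_funD; apply: measurable_funX.
have g0 z : 0 <= gradsq D z by rewrite /gradsq /sqn !addr_ge0// sqr_ge0.
rewrite /leb2 integral_Omega_strip// in fin.
have sub (d : (R * R -> (R * R) * (R * R)) -> R * R -> R * R) :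
    measurable_fun setT (fun x => (d D x).1) -> measurable_fun setT (fun x => (d D x).2) ->
    (forall x, sqn (d D x) <= gradsq D x) ->
    (\int[mu2]_(z in strip) ((d D z).1 ^+ 2 + (d D z).2 ^+ 2)%:E < +oo)%E.
  move=> h1 h2 le; apply: le_lt_trans fin; apply: ge0_le_integral => //.
  - exact: measurable_stripR.
  - by move=> z _; rewrite lee_fin addr_ge0// sqr_ge0.
  - apply: measurable_funTS; apply/measurable_EFinP.
    by apply: measurable_funD; apply: measurable_funX.
  - by apply: measurable_funTS; exact/measurable_EFinP.
  - by move=> z _; rewrite lee_fin; exact: le.
have f1 := sub (fun D x => (D x).1) m11 m12 (fun x => ltac:(by rewrite /gradsq lerDl /sqn addr_ge0// sqr_ge0)).
have f2 := sub (fun D x => (D x).2) m21 m22 (fun x => ltac:(by rewrite /gradsq lerDr /sqn addr_ge0// sqr_ge0)).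
have per1 t s : (u (t, s + 1)).1 = (u (t, s)).1 by rewrite -(per (t, s)).
have per2 t s : (u (t, s + 1)).2 = (u (t, s)).2 by rewrite -(per (t, s)).
have [a1 [b1 S1]] := H1loc_Sob per1 H1 f1; have [a2 [b2 S2]] := H1loc_Sob per2 H2 f2.
by exists a1, b1, a2, b2; split.
Qed.

(** From [|w| <= 1 + w^2] and [w^2 = 2 W]. *)
Lemma Wof_exp_growth (w : R * R -> R) (C beta : R) : 0 < C -> 0 < beta ->
  (forall z, Wof w z <= C * expR (beta * sqn z)) -> exp_growth w.
Proof.
move=> C0 b0 h; exists (1 + 2 * C), beta; split; [by rewrite addr_ge0// mulr_ge0// ltW|exact: ltW|] => z.
have e1 : 1 <= expR (beta * sqn z).
  by rewrite -expR0 ler_expR; apply: mulr_ge0; [exact: ltW|rewrite /sqn addr_ge0// sqr_ge0].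
have := h z; have := sqr_ge0 (`|w z| - 1); rewrite /Wof -[w z ^+ 2]real_normK ?num_real//.
move: e1; move: `|w z| (expR _) => x E; nra.
Qed.

Variables (w : R * R -> R) (a m p : R) (u : R * R -> R * R) (sg : R).
Hypotheses (C2w : C2 w) (pde : forall x, pd1 (pd1 w) x + sg * pd2 (pd2 w) x = 0) (sg1 : sg = 1 \/ sg = -1).
Hypotheses (wm : w (a, m) = 0) (wp : w (a, p) = 0).
Hypothesis wpos : forall t, 0 < t < 1 -> 0 < (p - m) * w (a, m + t * (p - m)).
Hypothesis minu : global_minimizer (Wof w) a m p u.
Hypothesis growth : (exists K : R, {ae leb2 R, forall x, `|(u x).1| <= K /\ `|(u x).2| <= K}) \/
   (exists C beta : R, [/\ 0 < C, 0 < beta & forall z : R * R, Wof w z <= C * expR (beta * sqn z)]).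

(** The sign of [w] is taken relative to [p - m], so that the flow of [y' = w(a, y)] leads from [m]
    to [p] whatever the order of the end points. *)
Lemma global_minimizer_one_dimensional : exists g : R -> R * R,
  [/\ minimizer1 (Wof w) a m p g,
      (forall gam, minimizer1 (Wof w) a m p gam -> exists tau : R, {ae leb1 R, forall t, gam t = g (t + tau)}) &
      {ae leb2 R, forall x, u x = g x.1}].
Proof.
have mp : m != p.
  have h2 : 0 < (2^-1 : R) < 1 by rewrite invr_gt0 ltr0n invf_lt1 ?ltr1n.
  by apply/eqP => e; have := wpos h2; rewrite e subrr mul0r ltxx.
have [psi [Phi1 [Phi2 [Cpsi CPhi1 CPhi2]]]] := potentials C2w pde.
have Cw := C2_C1with C2w; have cw := C1with_continuous Cw; have cpsi := C1with_continuous Cpsi.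
have [_ _ cw1 cw2] := Cw.
have [D [ad le]] := minu; have [a1 [b1 [a2 [b2 S]]]] := admissible2_Setup ad.
have [y0 Hy0] : exists y, heteroclinic_orbit w a m p y.
  have df (s : R) : is_derive s (1 : R) (fun s => w (a, s)) (pd2 w (a, s)) by have [_ d _ _] := Cw; exact: (d (a, s)).
  have [y [dy yp ym]] := heteroclinic df (continuous_slice2 cw2) wm wp wpos.
  by exists y; split.
have [v [Dv [adv ev]]] := orbit_competitor Cw CPhi1 Hy0.
have := le _ _ adv; rewrite ev => energy_le.
have mW : measurable_fun setT (fun z => w (u z)).
  have := measurable_u12 S cw; by under eq_fun do rewrite -surjective_pairing.
rewrite /energy2 /leb2 integral_Omega_strip in energy_le; last 2 first.
- apply: measurable_funD; apply: measurable_funM => //; last exact: measurable_funX.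
  by have := measurable_grad2 S.
- by move=> z; rewrite /gradsq /sqn /Wof addr_ge0 ?divr_ge0 ?addr_ge0 ?sqr_ge0.
(* The gradient of [w] enters in the harmonic case alone, through the maximum principle; in the wave
   case [psi] is controlled along characteristics. *)
have tames : tame (fun x => (u x).1) (fun x => (u x).2) w /\ tame (fun x => (u x).1) (fun x => (u x).2) psi /\
    (sg = 1 -> tame (fun x => (u x).1) (fun x => (u x).2) (pd1 w) /\ tame (fun x => (u x).1) (fun x => (u x).2) (pd2 w)).
  case: growth => [[K uK]|[C [beta [C0 beta0 hW]]]].
    by split; [|split] => [||_]; [| |split]; apply: (tame_bounded S (K := K)).
  have gw := Wof_exp_growth C0 beta0 hW.
  have tg F : continuous F -> exp_growth F -> tame (fun x => (u x).1) (fun x => (u x).2) F.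
    by move=> cF [A [b [A0 bb0 hF]]]; exact: (tame_growth S cF bb0 hF).
  split; first exact: tg.
  case: sg1 => e; rewrite e in Cpsi *.
    have N (x : R * R) : - 1 * pd2 w x = - pd2 w x by rewrite mulN1r.
    have g1 := conjugate_growth1 Cw Cpsi N gw; have g2 := conjugate_growth2 Cw Cpsi N gw.
    have g3 : exp_growth (fun x => - 1 * pd2 w x).
      by have [A [b [A0 bb0 hF]]] := g2; exists A, b; split => // z; rewrite N normrN.
    split; first by apply: tg => //; exact: C1_growth Cpsi g3 g1.
    by move=> _; split; exact: tg.
  split; last by move=> /eqP; rewrite -subr_eq0 -opprD oppr_eq0 (_ : 1 + 1 = 2%:R)// pnatr_eq0.
  apply: (tg _ cpsi); apply: (@wave_growth R w psi (pd1 w) (pd2 w) Cw _ gw).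
  have -> : pd2 w = (fun x => - -1 * pd2 w x) by apply/funext => x; rewrite opprK mul1r.
  exact: Cpsi.
have [tw [tpsi t12]] := tames.
have sq2 : sg ^+ 2 = 1 by case: sg1 => ->; rewrite ?sqrrN expr1n.
have sle : sg <= 1 by case: sg1 => -> //; lra.
have eqc := equality_case S CPhi1 CPhi2 (fun=> erefl) (tame_sqint_rect S cpsi tpsi) (tame_sqint_rect S cw tw) sq2 sle.
have {}eqc : {ae mu2, forall z, strip z -> (D z).2.1 - sg * (D z).1.2 = w ((u z).1, (u z).2) /\ (1 - sg) * (D z).1.1 ^+ 2 = 0}.
  apply: eqc; under eq_integral do rewrite -surjective_pairing; exact: energy_le.
have u1a : {ae mu2, forall z, (u z).1 = a}.
  case: sg1 => e.
    have [t1 t2] := t12 e; apply: (constant_from_above S).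
    apply: (maximum_principle S Cw t1 t2 (tame_sqint_rect S cw tw)).
    by apply: (ae_imp eqc) => z h sz; have [+ _] := h sz; rewrite e mul1r.
  apply: (constant_from_derivative S); apply: (ae_imp eqc) => z h sz; have [_] := h sz.
  by move/eqP; rewrite e opprK mulf_eq0 sqrf_eq0 (_ : 1 + 1 = 2%:R)// pnatr_eq0 => /eqP.
have eq1 : {ae mu2, forall z, strip z -> (D z).2.1 - sg * (D z).1.2 = w ((u z).1, (u z).2)}.
  by apply: (ae_imp eqc) => z h sz; have [] := h sz.
have [y [h [A hy u2y yp ym]]] := one_dimensional_profile S u1a cw eq1.
have Hy := AC_orbit Cw A hy yp ym.
exists (fun t => (a, y t)); split; first exact: (orbit_minimizer1 Cw CPhi1 Hy).
- by move=> gam mg; exact: (minimizer1_unique Cw CPhi1 mp Hy mg).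
- by apply: (ae_imp2 u1a u2y) => x <- <-; exact: surjective_pairing.
Qed.

End assembly.

Section opposite.
Context {R : realType}.

Lemma pd1N (f : R * R -> R) : has_pd f -> pd1 (fun x => - f x) = (fun x => - pd1 f x).
Proof.
move=> hf; apply/funext => x; have d := is_deriveN (has_pd_is_derive1 hf x).
by rewrite {1}/pd1 derive1E; have [_ ->] := d.
Qed.

Lemma pd2N (f : R * R -> R) : has_pd f -> pd2 (fun x => - f x) = (fun x => - pd2 f x).
Proof.
move=> hf; apply/funext => x; have d := is_deriveN (has_pd_is_derive2 hf x).
by rewrite {1}/pd2 derive1E; have [_ ->] := d.
Qed.

Lemma has_pdN (f : R * R -> R) : has_pd f -> has_pd (fun x => - f x).
Proof.
move=> hf; split => x.
  by have [] := is_deriveN (has_pd_is_derive1 hf x).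
by have [] := is_deriveN (has_pd_is_derive2 hf x).
Qed.

Lemma C2N (w : R * R -> R) : C2 w -> C2 (fun x => - w x).
Proof.
move=> [h h1 h2 [c c1 c2] [c11 c12 c21 c22]].
have cN (f : R * R -> R) : continuous f -> continuous (fun x => - f x).
  by move=> cf x; apply: cvgN; exact: cf.
split.
- exact: has_pdN h.
- rewrite (pd1N h); exact: has_pdN h1.
- rewrite (pd2N h); exact: has_pdN h2.
- by rewrite (pd1N h) (pd2N h); split; exact: cN.
- by rewrite (pd1N h) (pd2N h) (pd1N h1) (pd2N h1) (pd1N h2) (pd2N h2); split; exact: cN.
Qed.

End opposite.

Unset Implicit Arguments.

Theorem theorem2p6 (R : realType) (w : R * R -> R) (a m p : R)
    (u : R * R -> R * R) :
  C2 w ->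
  ((forall x, pd1 (pd1 w) x + pd2 (pd2 w) x = 0) \/
   (forall x, pd1 (pd1 w) x - pd2 (pd2 w) x = 0)) ->
  Wof w (a, m) = 0 -> Wof w (a, p) = 0 ->
  (forall t : R, 0 < t < 1 -> 0 < w (a, m + t * (p - m))) ->
  global_minimizer (Wof w) a m p u ->
  ((exists K : R, {ae leb2 R, forall x, `|(u x).1| <= K /\ `|(u x).2| <= K}) \/
   (exists C beta : R, [/\ 0 < C, 0 < beta &
      forall z : R * R, Wof w z <= C * expR (beta * sqn z)])) ->
  exists g : R -> R * R,
    [/\ minimizer1 (Wof w) a m p g,
        (forall gam, minimizer1 (Wof w) a m p gam ->
           exists tau : R, {ae leb1 R, forall t, gam t = g (t + tau)}) &
        {ae leb2 R, forall x, u x = g x.1}].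
Proof.
move=> C2w pde wm wp wpos minu growth.
have W0 z : Wof w z = 0 -> w z = 0.
  by move=> /eqP; rewrite /Wof mulf_eq0 sqrf_eq0 invr_eq0 pnatr_eq0 orbF => /eqP.
have [sg sg1 pdesg] : exists2 sg : R, sg = 1 \/ sg = -1 & forall x, pd1 (pd1 w) x + sg * pd2 (pd2 w) x = 0.
  case: pde => h; [exists 1; first by left|exists (-1); first by right] => x.
    by rewrite mul1r.
  by rewrite mulN1r.
(* If [p < m] the result is applied to [- w], which has the same [W]. The case [p = m] cannot occur,
   since [w] would then both vanish and be positive at [(a, m)]. *)
have [pm|mp] := ltP p m; last first.
  apply: (global_minimizer_one_dimensional C2w pdesg sg1 (W0 _ wm) (W0 _ wp)) => // t t01.
  rewrite mulr_gt0 ?wpos// subr_gt0 lt_neqAle mp andbT; apply/eqP => e.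
  by have := wpos _ t01; rewrite -e subrr mulr0 addr0 (W0 _ wm) ltxx.
have WN : Wof (fun x => - w x) = Wof w by apply/funext => z; rewrite /Wof sqrrN.
have [h h1 h2 _ _] := C2w.
rewrite -WN in minu growth *.
have pdeN x : pd1 (pd1 (fun x => - w x)) x + sg * pd2 (pd2 (fun x => - w x)) x = 0.
  by rewrite (pd1N h) (pd2N h) (pd1N h1) (pd2N h2) mulrN -opprD pdesg oppr0.
have wmN : - w (a, m) = 0 by rewrite (W0 _ wm) oppr0.
have wpN : - w (a, p) = 0 by rewrite (W0 _ wp) oppr0.
have wposN t : 0 < t < 1 -> 0 < (p - m) * - w (a, m + t * (p - m)).
  by move=> t01; rewrite mulrN -mulNr mulr_gt0 ?wpos// opprB subr_gt0.
exact: (@global_minimizer_one_dimensional R (fun x => - w x) a m p u sg (C2N C2w) pdeN sg1 wmN wpN wposN minu growth).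
Qed.
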